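(* Suppose the running cost $f$ is concave (case (II) of the context) and $0<\sigma_1\le\sigma_2$. Let $\theta(y)=c-\frac1\rho\frac{f(y)}{y}$ for $y\in(0,1]$, let $u(x,i;y)$ be the value function of the associated optimal stopping problem, let $x_1^*(y),x_2^*(y)$ be the thresholds defined in the context, and set $W(x,y,i):=y\,u(x,i;y)-\frac1\rho f(y)$ for $y\in(0,1]$ and $W(x,0,i):=\lim_{y\downarrow 0}W(x,y,i)=0$. For $y\in(0,1]$ let $$\tau^*=\inf\{t\ge0:\ X_t\ge x^*_{\varepsilon_t}(y)\},\qquad \nu^{\star}_t:=\begin{cases}0,&t\le\tau^*,\\ y,&t>\tau^*.\end{cases}$$ Then the admissible control $\nu^\star$ is optimal for the singular control problem $V(x,y,i)=\sup_{\nu\in\mathcal{A}_y}\mathcal{J}_{x,y,i}(\nu)$, i.e. $V(x,y,i)=\mathcal{J}_{x,y,i}(\nu^\star)$ for all $(x,y,i)\in\mathbb{R}\times(0,1]\times\{1,2\}$, and $W\equiv V$ on $\mathcal{O}$.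
   Context: Let $(\Omega,\mathcal{F},\mathbb{P})$ be a complete probability space carrying a one-dimensional Brownian motion $W$ (not to be confused with the function $W(x,y,i)$) and an independent continuous-time Markov chain $\varepsilon$ with state space $\{1,2\}$ and generator $\begin{pmatrix}-\lambda_1&\lambda_1\\ \lambda_2&-\lambda_2\end{pmatrix}$, $\lambda_1,\lambda_2>0$; $\mathbb{F}$ is the augmented filtration generated by the Brownian motion and $\varepsilon$. With $\sigma_1,\sigma_2>0$, the price is $dX_t=\sigma_{\varepsilon_t}dW_t$, $X_0=x\in\mathbb{R}$. Let $\rho>0$, $c>0$ be constants and $\mathcal{O}:=\mathbb{R}\times[0,1]\times\{1,2\}$. $\mathbb{E}_{(x,i)}$ and $\mathbb{E}_{(x,y,i)}$ denote expectations given $X_0=x,\varepsilon_0=i$ (and $Y_0=y$). Running cost, case (II): $f:\mathbb{R}\to\mathbb{R}_+$ is increasing, continuous on $[0,1]$, $f(0)=0$, and $f$ is concave on $[0,1]$ and continuously differentiable on $(0,1]$. Control problem: for $y\in[0,1]$, $\mathcal{A}_y$ is the set of processes $\nu:\Omega\times\mathbb{R}_+\to\mathbb{R}_+$ that are nondecreasing, left-continuous, $\mathbb{F}$-adapted, with $\nu_0=0$ and $y-\nu_t\ge0$ for all $t\ge0$ a.s. Set $Y^\nu_t=y-\nu_t$ and $$\mathcal{J}_{x,y,i}(\nu)=\mathbb{E}_{(x,y,i)}\Big[\int_0^\infty e^{-\rho t}(X_t-c)\,d\nu_t-\int_0^\infty e^{-\rho t}f(Y^\nu_t)\,dt\Big],$$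 where $\int_0^t\cdots d\nu_s$ means the Stieltjes integral over $[0,t)$ (so that a jump of $\nu$ at time $0$, i.e. $\nu_{0+}>0$, is counted). $V(x,y,i)=\sup_{\nu\in\mathcal{A}_y}\mathcal{J}_{x,y,i}(\nu)$. Stopping problem: $u(x,i;y)=\sup_{\tau\ge0}\mathbb{E}_{(x,i)}[e^{-\rho\tau}(X_\tau-\theta(y))]$, supremum over all $\mathbb{P}_{(x,i)}$-a.s. finite $\mathbb{F}$-stopping times. Thresholds: let $\Phi_i(\alpha)=-\frac12\sigma_i^2\alpha^2+\rho+\lambda_i$, let $0<\alpha_3<\alpha_4$ be the two positive roots of $\Phi_1(\alpha)\Phi_2(\alpha)=\lambda_1\lambda_2$, $\alpha_5=\sqrt{2(\rho+\lambda_2)/\sigma_2^2}$, and $a_1=-\frac{\alpha_4\Phi_1(\alpha_3)-\alpha_3\Phi_1(\alpha_4)}{\lambda_1(\alpha_4-\alpha_3)}+\frac{\lambda_2}{\rho+\lambda_2}$, $a_2=\frac{\Phi_1(\alpha_3)-\Phi_1(\alpha_4)}{\lambda_1(\alpha_4-\alpha_3)}$, $a_3=\frac{\alpha_3\alpha_4[\Phi_1(\alpha_4)-\Phi_1(\alpha_3)]}{\lambda_1(\alpha_4-\alpha_3)}$, $a_4=\frac{\alpha_3\Phi_1(\alpha_3)-\alpha_4\Phi_1(\alpha_4)}{\lambda_1(\alpha_4-\alpha_3)}+\frac{\lambda_2}{\rho+\lambda_2}$. If $\sigma_1<\sigma_2$, let $(z_1^*,z_2^* )$ be the unique solution in $(0,\infty)\times(0,\hat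 z_2)$ of $$\Big(a_1+\tfrac{\rho}{\rho+\lambda_2}\cosh(\alpha_5v)\Big)u-\tfrac{\rho}{\rho+\lambda_2}\Big[\tfrac1{\alpha_5}\sinh(\alpha_5v)-v\cosh(\alpha_5v)\Big]+a_2=0,$$ $$\Big(a_3-\tfrac{\rho\alpha_5}{\rho+\lambda_2}\sinh(\alpha_5v)\Big)u-\tfrac{\rho}{\rho+\lambda_2}\big[v\alpha_5\sinh(\alpha_5v)-\cosh(\alpha_5v)\big]+a_4=0$$ in the unknowns $(u,v)$, where $\hat z_2$ is the unique positive zero of $v\mapsto a_1+\frac{\rho}{\rho+\lambda_2}\cosh(\alpha_5v)$; put $x_1^*(y)=z_1^*+\theta(y)$, $x_2^*(y)=z_2^*+x_1^*(y)$. If $\sigma_1=\sigma_2=\sigma$, put $x_1^*(y)=x_2^*(y)=\frac{\sigma}{\sqrt{2\rho}}+\theta(y)$. *)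

(* Defs.v *)
From HB Require Import structures.
From mathcomp Require Import all_boot all_order all_algebra.
From mathcomp Require Import all_classical all_reals all_analysis.
Set Implicit Arguments.
Unset Strict Implicit.
Unset Printing Implicit Defensive.
Import Order.TTheory GRing.Theory Num.Theory.
Import numFieldNormedType.Exports.
Local Open Scope classical_set_scope.
Local Open Scope ring_scope.

(* Time is the half-line of nonnegative reals: processes are functions
   [R -> Omega -> R] whose values at negative times never matter.
   The state space {1,2} of the chain is ['I_2], with 1 = reg1 and 2 = reg2. *)
Definition reg1 : 'I_2 := ord0.
Definition reg2 : 'I_2 := ord_max.

Section ProbabilityModel.
Context {R : realType} {d : measure_display} {Omega : measurableType d}.
Variable P : probability Omega R.
Implicit Types (B Z H : R -> Omega -> R) (eps : R -> Omega -> 'I_2).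

Definition events_of B (D : set R) : set (set Omega) :=
  [set A | exists2 t, D t & exists2 U, measurable U & A = B t @^-1` U].

Definition chain_events_of eps (D : set R) : set (set Omega) :=
  [set A | exists2 t, D t & exists j, A = [set w | eps t w = j]].

Definition independent_classes (G1 G2 : set (set Omega)) : Prop :=
  forall A1 A2, G1 A1 -> G2 A2 -> P (A1 `&` A2) = (P A1 * P A2)%E.

(* [normal_prob m s] takes the standard deviation [s]. *)
Definition brownian_motion B : Prop :=
  [/\ forall t : R, 0 <= t -> measurable_fun setT (B t),
      {ae P, forall w, B 0 w = 0},
      {ae P, forall w, {within `[0, +oo[, continuous (fun t : R => B t w)}},
      forall s t : R, 0 <= s < t -> forall U : set R, measurable U ->
        P [set w | U (B t w - B s w)] = normal_prob 0 (Num.sqrt (t - s)) U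
    & forall s t : R, 0 <= s < t ->
        independent_classes <<s events_of B `[0, s] >>
          [set A | exists2 U : set R, measurable U &
                   A = [set w | U (B t w - B s w)]]].

Definition generator (lambda : 'I_2 -> R) : 'M[R]_2 :=
  \matrix_(i, j) (if i == j then - lambda i else lambda i).

Definition expmx (A : 'M[R]_2) (i j : 'I_2) : R :=
  lim (series (fun k : nat => (A ^+ k) i j / k`!%:R) @ \oo).

Definition markov_chain eps (Q : 'M[R]_2) : Prop :=
  [/\ forall (t : R) j, 0 <= t -> measurable [set w | eps t w = j],
      {ae P, forall w, forall t : R, 0 <= t ->
         \forall s \near t^'+, eps s w = eps t w},
      {ae P, forall w, forall t : R, 0 < t ->
         exists j, \forall s \near t^'-, eps s w = j}
    & forall (s t : R) i j A, 0 <= s <= t -> <<s chain_events_of eps `[0, s] >> A ->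
        P (A `&` [set w | eps s w = i] `&` [set w | eps t w = j]) =
        (P (A `&` [set w | eps s w = i]) * (expmx ((t - s) *: Q) i j)%:E)%E].

Definition independent_processes B eps : Prop :=
  independent_classes <<s events_of B `[0, +oo[ >>
                      <<s chain_events_of eps `[0, +oo[ >>.

Definition augmented_filtration B eps (t : R) : set (set Omega) :=
  <<s events_of B `[0, t] `|` chain_events_of eps `[0, t]
      `|` [set N | P.-negligible N] >>.

Variable F : R -> set (set Omega).

Definition adapted Z : Prop :=
  forall t : R, 0 <= t -> forall U, measurable U -> F t (Z t @^-1` U).

(* The process s |-> \sum_(k < n) xi_k 1_(]t_k, t_(k+1)])(s). *)
Record simple_process := SimpleProcess {
  sp_size : nat;
  sp_time : nat -> R;
  sp_coef : nat -> Omega -> R;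
  sp_time_ge0 : 0 <= sp_time 0;
  sp_time_nd : forall k, sp_time k <= sp_time k.+1;
  sp_coef_adapted : forall k, (k < sp_size)%N ->
    forall U, measurable U -> F (sp_time k) (sp_coef k @^-1` U);
  sp_coef_bounded : exists M, forall k w, (k < sp_size)%N ->
    `|sp_coef k w| <= M }.

Definition simple_value (S : simple_process) (s : R) (w : Omega) : R :=
  \sum_(k < sp_size S) sp_coef S k w *
    \1_(`]sp_time S k, sp_time S k.+1]%classic : set R) s.

Definition simple_integral B (S : simple_process) (t : R) (w : Omega) : R :=
  \sum_(k < sp_size S) sp_coef S k w *
    (B (Num.min t (sp_time S k.+1)) w - B (Num.min t (sp_time S k)) w).

(* Z is the Ito integral of H against B: the continuous adapted process whose
   value at T is the L^2 limit of the integrals of simple processes that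
   converge to H in L^2(Omega x [0, T]). *)
Definition is_ito_integral B H Z : Prop :=
  [/\ adapted Z,
      {ae P, forall w, {within `[0, +oo[, continuous (fun t : R => Z t w)}}
    & forall T : R, 0 <= T -> exists S : nat -> simple_process,
        (\int[P]_w \int[lebesgue_measure]_(s in `[0%R, T])
           ((simple_value (S n) s w - H s w) ^+ 2)%:E)%E
           @[n --> \oo] --> 0%E /\
        (\int[P]_w ((simple_integral B (S n) T w - Z T w) ^+ 2)%:E)%E
           @[n --> \oo] --> 0%E].

(* dX_t = sigma_(eps_t) dB_t, X_0 = x *)
Definition price_process B eps (sigma : 'I_2 -> R) (x : R) X : Prop :=
  is_ito_integral B (fun t w => sigma (eps t w)) (fun t w => X t w - x).

Definition cond_expectation (A : set Omega) (Z : Omega -> \bar R) : \bar R :=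
  ((\int[P]_(w in A) Z w) * ((fine (P A))^-1)%:E)%E.

Definition start eps (i : 'I_2) : set Omega := [set w | eps 0 w = i].

End ProbabilityModel.

Section Controls.
Context {R : realType} {d : measure_display} {Omega : measurableType d}.

Record control := Control {
  ctl :> R -> Omega -> R;
  ctl_zero : forall w, ctl 0 w = 0;
  ctl_nd : forall w s t, 0 <= s -> s <= t -> ctl s w <= ctl t w;
  ctl_lc : forall w t, 0 < t -> ctl s w @[s --> t^'-] --> ctl t w }.

(* The right-continuous version t |-> nu_(t+) of a path, equal to nu_0 = 0 at
   negative times. Its Lebesgue-Stieltjes measure is the one that gives
   [a, b[ the mass nu_b - nu_a; in particular {0} has mass nu_(0+). *)
Definition ctl_right (nu : control) (w : Omega) (t : R) : R :=
  inf [set nu s w | s in [set s | 0 <= s /\ t < s]].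

Lemma ctl_ge0 (nu : control) w s : 0 <= s -> 0 <= nu s w.
Proof. by move=> s0; rewrite -(ctl_zero nu w); exact: ctl_nd. Qed.

Lemma ctl_right_lb (nu : control) w t :
  lbound [set nu s w | s in [set s | 0 <= s /\ t < s]] 0.
Proof. by move=> _ [s [s0 _] <-]; exact: ctl_ge0. Qed.

Lemma ctl_right_neq0 (nu : control) w t :
  [set nu s w | s in [set s | 0 <= s /\ t < s]] !=set0.
Proof.
exists (nu (`|t| + 1) w), (`|t| + 1) => //; split; first by rewrite addr_ge0.
by rewrite (le_lt_trans (ler_norm t))// ltrDl.
Qed.

Lemma ctl_right_le (nu : control) w t s :
  0 <= s -> t < s -> ctl_right nu w t <= nu s w.
Proof.
move=> s0 ts; apply: ge_inf; last by exists s.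
by exists 0; exact: ctl_right_lb.
Qed.

Lemma ctl_right_nd (nu : control) w : nondecreasing (ctl_right nu w).
Proof.
move=> s t st; apply: lb_le_inf; first exact: ctl_right_neq0.
by move=> _ [r [r0 tr] <-]; apply: ctl_right_le => //; exact: le_lt_trans tr.
Qed.

Lemma ctl_right_rc (nu : control) w : right_continuous (ctl_right nu w).
Proof.
move=> t; apply/cvgrPdist_le => e e0.
have [|_ [s [s0 ts] <-] se] := @inf_adherent _ _ _ e0
    (_ : has_inf [set nu s w | s in [set s | 0 <= s /\ t < s]]).
  by split; [exact: ctl_right_neq0|exists 0; exact: ctl_right_lb].
near=> r.
have tr : t < r by near: r; exact: nbhs_right_gt.
have rs : r < s by near: r; exact: nbhs_right_lt.
rewrite distrC ger0_norm ?subr_ge0; last exact/ctl_right_nd/ltW.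
rewrite lerBlDl (le_trans _ (ltW se))//.
exact: ctl_right_le.
Unshelve. all: by end_near. Qed.

HB.instance Definition _ (nu : control) (w : Omega) :=
  isCumulative.Build R _ R (ctl_right nu w)
    (@ctl_right_nd nu w) (@ctl_right_rc nu w).

Definition stieltjes_integral (nu : control) (w : Omega) (h : R -> R) : \bar R :=
  (\int[lebesgue_stieltjes_measure (ctl_right nu w)]_(t in `[0%R, +oo[)
     (h t)%:E)%E.

Definition jump_path (y : R) (tau : Omega -> \bar R) (t : R) (w : Omega) : R :=
  if (t%:E <= tau w)%E then 0 else y.

Lemma jump_path_zero y tau : (forall w, 0 <= tau w)%E ->
  forall w, jump_path y tau 0 w = 0.
Proof. by move=> tau0 w; rewrite /jump_path tau0. Qed.

Lemma jump_path_nd y tau : 0 <= y ->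
  forall w s t, 0 <= s -> s <= t -> jump_path y tau s w <= jump_path y tau t w.
Proof.
move=> y0 w s t _ st; rewrite /jump_path.
have [ttau|_] := leP t%:E (tau w); last by case: ifP.
by rewrite ifT//; apply: le_trans ttau; rewrite lee_fin.
Qed.

Lemma jump_path_lc y tau w t : 0 < t ->
  jump_path y tau s w @[s --> t^'-] --> jump_path y tau t w.
Proof.
move=> t0; apply: cvg_near_cst; rewrite /jump_path.
have [ttau|] := leP t%:E (tau w).
  near=> s; rewrite ifT//; apply: le_trans ttau.
  by rewrite lee_fin ltW//; near: s; exact: nbhs_left_lt.
case: (tau w) => [r| |]//=.
  rewrite lte_fin => rt; near=> s; rewrite lee_fin leNgt.
  by rewrite (_ : r < s)//; near: s; exact: nbhs_left_gt.
by move=> _; near=> s.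
Unshelve. all: by end_near. Qed.

Definition jump_control y tau (y0 : 0 <= y) (tau0 : forall w, (0 <= tau w)%E) :=
  Control (jump_path_zero y tau0) (jump_path_nd tau y0)
          (fun w t => @jump_path_lc y tau w t).

End Controls.
Arguments control R {d} Omega.

Section Problems.
Context {R : realType} {d : measure_display} {Omega : measurableType d}.
Variables (P : probability Omega R) (F : R -> set (set Omega)).
Variables (eps : R -> Omega -> 'I_2) (X : R -> R -> Omega -> R).
Variables (rho c : R) (f : R -> R).

Definition admissible (y : R) : set (control R Omega) :=
  [set nu | adapted F nu /\ {ae P, forall w, forall t : R, 0 <= t -> 0 <= y - nu t w}].

Definition payoff (x y : R) (i : 'I_2) (nu : control R Omega) : \bar R :=
  cond_expectation P (start eps i) (fun w =>
    (stieltjes_integral nu w (fun t => expR (- (rho * t)) * (X x t w - c))%R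
     - \int[lebesgue_measure]_(t in `[0%R, +oo[)
         (expR (- (rho * t)) * f (y - nu t w))%:E)%E).

Definition control_value (x y : R) (i : 'I_2) : \bar R :=
  ereal_sup [set payoff x y i nu | nu in admissible y].

Definition stopping_time (tau : Omega -> \bar R) : Prop :=
  (forall w, 0 <= tau w)%E /\
  forall t : R, 0 <= t -> F t [set w | (tau w <= t%:E)%E].

Definition finite_stopping_time (i : 'I_2) (tau : Omega -> \bar R) : Prop :=
  stopping_time tau /\
  {ae P, forall w, start eps i w -> (tau w < +oo)%E}.

Definition theta (y : R) : R := c - rho^-1 * (f y / y).

Definition stopping_value (x : R) (i : 'I_2) (y : R) : \bar R :=
  ereal_sup [set cond_expectation P (start eps i)
      (fun w => (expR (- (rho * fine (tau w))) *
                 (X x (fine (tau w)) w - theta y))%:E)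
    | tau in finite_stopping_time i].

Definition candidate_pos (x y : R) (i : 'I_2) : \bar R :=
  (y%:E * stopping_value x i y - (rho^-1 * f y)%:E)%E.

Definition candidate (x y : R) (i : 'I_2) : \bar R :=
  if y == 0 then lim (candidate_pos x z i @[z --> 0^'+])
  else candidate_pos x y i.

Definition hitting_time (b : 'I_2 -> R) (x : R) (w : Omega) : \bar R :=
  ereal_inf [set t%:E | t in [set t | 0 <= t /\ b (eps t w) <= X x t w]].

Lemma hitting_time_ge0 b x w : (0 <= hitting_time b x w)%E.
Proof. by apply: le_ereal_inf_tmp => _ [t [t0 _] <-]; rewrite lee_fin. Qed.

Definition hitting_control (y : R) (y0 : 0 <= y) (b : 'I_2 -> R) (x : R) :
    control R Omega :=
  jump_control y0 (hitting_time_ge0 b x).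

End Problems.

Section RunningCost.
Context {R : realType}.

Definition concave_on (D : set R) (f : R -> R) : Prop :=
  forall a b t, D a -> D b -> 0 <= t <= 1 ->
    t * f a + (1 - t) * f b <= f (t * a + (1 - t) * b).

(* At an end point of D that belongs to D the derivative is one-sided. *)
Definition continuously_differentiable_on (D : set R) (f : R -> R) : Prop :=
  exists2 df : R -> R, {within D, continuous df} &
    forall z, D z ->
      (f r - f z) / (r - z) @[r --> within (D `\ z) (nbhs z)] --> df z.

(* [f] is monotone in the wide sense: a nonnegative function on R that vanishes
   at 0 cannot be strictly increasing on the negative half-line. *)
Definition concave_running_cost (f : R -> R) : Prop :=
  [/\ (forall z, 0 <= f z) /\ nondecreasing f,
      {within `[0, 1], continuous f},
      f 0 = 0,
      concave_on `[0, 1] f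
    & continuously_differentiable_on `]0, 1] f].

End RunningCost.

Section Thresholds.
Context {R : realType}.
Variables (sigma lambda : 'I_2 -> R) (rho : R).

Definition cosh (v : R) : R := (expR v + expR (- v)) / 2.
Definition sinh (v : R) : R := (expR v - expR (- v)) / 2.

Definition Phi (i : 'I_2) (a : R) : R :=
  - (2^-1 * sigma i ^+ 2 * a ^+ 2) + rho + lambda i.

Definition alpha5 : R :=
  Num.sqrt (2 * (rho + lambda reg2) / sigma reg2 ^+ 2).

Section Coefficients.
Variables (alpha3 alpha4 : R).

Definition coef1 : R :=
  - ((alpha4 * Phi reg1 alpha3 - alpha3 * Phi reg1 alpha4) /
     (lambda reg1 * (alpha4 - alpha3)))
  + lambda reg2 / (rho + lambda reg2).

Definition coef2 : R :=
  (Phi reg1 alpha3 - Phi reg1 alpha4) / (lambda reg1 * (alpha4 - alpha3)).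

Definition coef3 : R :=
  alpha3 * alpha4 * (Phi reg1 alpha4 - Phi reg1 alpha3) /
  (lambda reg1 * (alpha4 - alpha3)).

Definition coef4 : R :=
  (alpha3 * Phi reg1 alpha3 - alpha4 * Phi reg1 alpha4) /
  (lambda reg1 * (alpha4 - alpha3))
  + lambda reg2 / (rho + lambda reg2).

Definition boundary_eq1 (u v : R) : Prop :=
  (coef1 + rho / (rho + lambda reg2) * cosh (alpha5 * v)) * u
  - rho / (rho + lambda reg2) *
      (alpha5^-1 * sinh (alpha5 * v) - v * cosh (alpha5 * v))
  + coef2 = 0.

Definition boundary_eq2 (u v : R) : Prop :=
  (coef3 - rho * alpha5 / (rho + lambda reg2) * sinh (alpha5 * v)) * u
  - rho / (rho + lambda reg2) *
      (v * alpha5 * sinh (alpha5 * v) - cosh (alpha5 * v))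
  + coef4 = 0.

Definition is_zhat2 (v : R) : Prop :=
  0 < v /\ coef1 + rho / (rho + lambda reg2) * cosh (alpha5 * v) = 0.

End Coefficients.

Definition is_root (a : R) : Prop :=
  Phi reg1 a * Phi reg2 a = lambda reg1 * lambda reg2.

Definition free_boundary_solution (z1 z2 : R) : Prop :=
  exists alpha3 alpha4 zhat2 : R,
    [/\ [/\ 0 < alpha3, alpha3 < alpha4, is_root alpha3 & is_root alpha4],
        is_zhat2 alpha3 alpha4 zhat2,
        0 < z1 /\ 0 < z2 < zhat2,
        boundary_eq1 alpha3 alpha4 z1 z2
      & boundary_eq2 alpha3 alpha4 z1 z2].

(* [th] stands for theta(y); [z1] and [z2] only matter if sigma1 < sigma2. *)
Definition threshold (z1 z2 th : R) (i : 'I_2) : R :=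
  if sigma reg1 < sigma reg2 then
    if i == reg1 then z1 + th else z2 + (z1 + th)
  else sigma reg1 / Num.sqrt (2 * rho) + th.

End Thresholds.

(* Main.v *)
(* Put [a = f y / y], so that [c = theta y + a / rho]. Concavity gives
   [f z >= a z] on [[0, y]], and integrating by parts turns the running cost
   [a (y - nu)] into [f y / rho] minus [a / rho] times the discounted Stieltjes
   integral of [nu]. Hence the payoff of a control [nu] is at most the integral
   of [exp (- rho t) (X_t - theta y)^+] against [d nu_t] minus [f y / rho], with
   equality for one jump of size [y] at a time where [X >= theta y]; what
   remains is the stopping problem for [X - theta y]. Its value function [v]
   solves a variational inequality in closed form.

   That [exp (- rho t) v(eps_t, X_t - theta y)] is a supermartingale, and a
   martingale up to the hitting time, is obtained without Ito's formula. Over a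
   step of length [h] the increment of [X] differs from
   [sigma(eps_t) (B_(t + h) - B_t)] by [O(h^(3/2))] in [L^1], because the chain
   has to jump for them to differ; and the one-step expectation of [v] under
   the frozen coefficient follows from a Taylor expansion against the Gaussian
   increment and the transition probabilities of the chain, again up to
   [O(h^(3/2))]. The errors accumulated over a bounded horizon vanish with [h],
   and so they do over the horizon [m] for the mesh [m^(-4)]. *)
Require Import Defs.
From HB Require Import structures.
From mathcomp Require Import all_boot all_order all_algebra.
From mathcomp Require Import all_classical all_reals all_analysis.
From mathcomp Require Import measurable_realfun ring lra.
Set Implicit Arguments.
Unset Strict Implicit.
Unset Printing Implicit Defensive.
Import Order.TTheory GRing.Theory Num.Theory.
Import numFieldNormedType.Exports.
Local Open Scope classical_set_scope.
Local Open Scope ring_scope.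

(** * The verification inequality *)

Section Calculus.
Context {R : realType}.
Implicit Types (f g df k : R -> R) (a b x y z L K : R).

(** The closed form need not be twice differentiable at the stopping boundaries, so second
    derivatives enter only through slope bounds, which glue across a kink. The upper Taylor bound
    holds everywhere; the lower one is available only at a distance e below the boundary, with a
    constant that grows like 1/e. Hence the lower estimate of the value first raises the cost by
    [del], which keeps the process [del] below the boundary until it is hit, and lets [del] tend to
    0 last. Controls and stopping rules are treated alike, as nonincreasing adapted weights on a
    time grid: summation by parts compares the collected reward with the initial value, and no
    optional stopping is invoked. Integrals are suprema over simple minorants, hence monotone
    without measurability, so path integrals are compared with measurable bounds and need not
    themselves be shown measurable in the sample point. In the limit, the role of uniform
    integrability is played by a truncation together with the squared Brownian increments, whose
    discounted sum is bounded in mean. *)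

Lemma mvt_is_derive f df a b : a <= b ->
  (forall x, a <= x <= b -> is_derive x 1 f (df x)) ->
  exists2 c, a <= c <= b & f b - f a = df c * (b - a).
Proof.
move=> ab fdf.
have [] := @MVT_segment R f df a b ab.
- move=> x; rewrite in_itv/= => /andP[ax xb]; apply: fdf.
  by rewrite !ltW.
- apply: derivable_within_continuous => x; rewrite in_itv/= => xab.
  by have [] := fdf _ xab.
by move=> c; rewrite in_itv/= => cab e; exists c.
Qed.

Lemma is_derive_near_eq f g x d : (\forall y \near x, f y = g y) ->
  is_derive x 1 f d -> is_derive x 1 g d.
Proof.
move=> fg fd; apply: DeriveDef.
  by apply: near_eq_derivable fg _; rewrite ?oner_eq0//; case: fd.
by rewrite -(near_eq_derive _ fg)//; case: fd.
Qed.

(** Each branch is required to have derivative [d] only on its own side, so at [x = a] both are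
    available and the difference quotient, whichever branch it takes, converges to the same [d]. *)
Lemma is_derive_glue f g a x d :
  f a = g a ->
  (x <= a -> is_derive x 1 f d) -> (a <= x -> is_derive x 1 g d) ->
  is_derive x 1 (fun y => if y <= a then f y else g y) d.
Proof.
move=> fga fd gd; have [xa|ax|xa] := ltgtP x a.
- apply: is_derive_near_eq (fd (ltW xa)); near=> y.
  by rewrite ifT// ltW//; near: y; exact: lt_nbhsl.
- apply: is_derive_near_eq (gd (ltW ax)); near=> y.
  by rewrite ifF//; apply/negbTE; rewrite -ltNge; near: y; exact: (cvgr_gt x).
have {}fd : is_derive x 1 f d by apply: fd; rewrite xa.
have {}gd : is_derive x 1 g d by apply: gd; rewrite xa.
suff H : h^-1 *: ((if h *: 1 + x <= a then f (h *: 1 + x) else g (h *: 1 + x))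
     - f x) @[h --> 0^'] --> d.
  have {}H : h^-1 *: (((fun y => if y <= a then f y else g y) \o shift x) (h *: 1)
      - (if x <= a then f x else g x)) @[h --> 0^'] --> d.
    by rewrite {2}xa lexx; exact: H.
  apply: DeriveDef; last exact: cvg_lim H.
  by apply/cvg_ex; exists d; exact: H.
case: fd => [cf /= ef]; case: gd => [cg /= eg].
have {}cf : h^-1 *: (f (h *: 1 + x) - f x) @[h --> 0^'] --> d by rewrite -ef; exact: cf.
have {}cg : h^-1 *: (g (h *: 1 + x) - g x) @[h --> 0^'] --> d by rewrite -eg; exact: cg.
have fgx : f x = g x by rewrite xa.
apply/cvgrPdist_lt => e e0.
move/cvgrPdist_lt : cf => /(_ e e0) cf; move/cvgrPdist_lt : cg => /(_ e e0) cg.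
near=> h; case: ifP => _; first by near: h.
by rewrite fgx; near: h.
Unshelve. all: by end_near. Qed.

Lemma derive_ge0_nd f df a b : (forall x, a <= x <= b -> is_derive x 1 f (df x)) ->
  (forall x, a <= x <= b -> 0 <= df x) -> a <= b -> f a <= f b.
Proof.
move=> fdf df0 ab; have [c cab e] := mvt_is_derive ab fdf.
by rewrite -subr_ge0 e mulr_ge0 ?df0// subr_ge0.
Qed.

(** Substitute for the second-order bound [df' <= K * k] that stays meaningful where [df] has a
    corner: the quadratic term absorbs the Lipschitz variation of [k] between the two points. *)
Definition slope_le (k df : R -> R) (K L : R) (D : R -> Prop) :=
  forall x y, D x -> D y -> x <= y ->
    df y - df x <= K * (k x * (y - x) + L * (y - x) ^+ 2).

Lemma slope_le_smooth k df ddf K L (D : R -> Prop) : 0 <= K ->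
  (forall x y z, D x -> D z -> x <= y <= z -> D y) ->
  (forall x, D x -> is_derive x 1 df (ddf x)) ->
  (forall x, D x -> ddf x = K * k x) ->
  (forall x y, x <= y -> k y <= k x + L * (y - x)) -> 0 <= L ->
  slope_le k df K L D.
Proof.
move=> K0 cD dD ddfE kL L0 x y Dx Dy xy.
have [||c cxy ->] := @mvt_is_derive df ddf x y => //.
  by move=> z zxy; apply: dD; exact: cD zxy.
have Dc : D c by exact: cD cxy.
rewrite ddfE// -mulrA ler_wpM2l//.
have /andP[xc cy] := cxy.
have := kL x c xc.
move=> kc; apply: (@le_trans _ _ ((k x + L * (c - x)) * (y - x))).
  by rewrite ler_wpM2r// subr_ge0.
rewrite mulrDl lerD2l -mulrA ler_wpM2l// expr2 ler_wpM2r ?subr_ge0//.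
by rewrite lerD2r.
Qed.

(** Second derivatives at [a] never have to match: passing from [k a] to [k x] costs [L * p * q],
    and [p ^+ 2 + p * q + q ^+ 2] is at most [(p + q) ^+ 2]. *)
Lemma slope_le_glue k df K L (D : R -> Prop) a : 0 <= K -> 0 <= L -> D a ->
  (forall x y, x <= y -> k y <= k x + L * (y - x)) ->
  slope_le k df K L (fun x => D x /\ x <= a) ->
  slope_le k df K L (fun x => D x /\ a <= x) ->
  slope_le k df K L D.
Proof.
move=> K0 L0 Da kL sl sr x y Dx Dy xy.
have [ya|/ltW ay] := leP y a; first by apply: sl => //; split=> //; exact: le_trans ya.
have [ax|/ltW xa] := leP a x; first by apply: sr => //; split=> //; exact: le_trans xy.
have h1 := sl x a (conj Dx xa) (conj Da (lexx _)) xa.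
have h2 := sr a y (conj Da (lexx _)) (conj Dy ay) ay.
have h3 := kL x a xa.
rewrite -(subrKA (df a)).
apply: (le_trans (lerD h2 h1)); rewrite -mulrDr ler_wpM2l//.
set p := a - x in h3 *; set q := y - a.
have p0 : 0 <= p by rewrite subr_ge0.
have q0 : 0 <= q by rewrite subr_ge0.
have -> : y - x = p + q by rewrite /p /q; ring.
have : k a * q <= (k x + L * p) * q by rewrite ler_wpM2r.
have : 0 <= L * p * q by rewrite !mulr_ge0.
nra.
Qed.

(* The two halves of the estimate integrate the slope bound forwards and
   backwards from [x]. *)
Lemma taylor_le f df k K L (D : R -> Prop) : 0 <= K -> 0 <= L ->
  (forall x y z, D x -> D z -> x <= y <= z -> D y) ->
  (forall x, is_derive x 1 f (df x)) ->
  (forall x y, x <= y -> k x <= k y + L * (y - x)) ->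
  slope_le k df K L D ->
  forall x z, D x -> D (x + z) -> f (x + z) <= f x + df x * z + K / 2 * k x * z ^+ 2
                           + K * L * `|z| ^+ 3.
Proof.
move=> K0 L0 cD fdf kL sl x z Dx Dxz.
pose g u := f (x + u) - df x * u - K / 2 * k x * u ^+ 2.
have gd (u : R) : is_derive u 1 g (df (x + u) - df x - K * k x * u).
  rewrite /g.
  have -> : (fun u => f (x + u) - df x * u - K / 2 * k x * u ^+ 2) =
     (f \o (cst x + id)) - (df x \*: (id : R -> R)) - (K / 2 * k x) \*: ((id : R -> R) ^+ 2).
    by apply/funext => v /=; rewrite !fctE.
  apply: is_derive_eq; rewrite /= add0r !fctE /=.
  by rewrite /GRing.scale/=; field.
have [z0|/ltW z0] := leP 0 z.
- rewrite ger0_norm//.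
  pose h u := K * L * u ^+ 3 - g u.
  have hd (u : R) : is_derive u 1 h (3 * K * L * u ^+ 2 - (df (x + u) - df x - K * k x * u)).
    rewrite /h.
    have -> : (fun u => K * L * u ^+ 3 - g u) = (K * L) \*: ((id : R -> R) ^+ 3) - g.
      by apply/funext => v /=; rewrite !fctE.
    apply: is_derive_eq; rewrite /= ?fctE /=.
    by rewrite /GRing.scale/=; ring.
  have : h 0 <= h z.
    apply: (derive_ge0_nd (fun u _ => hd u)) => // u /andP[u0 uz].
    have Du : D (x + u) by apply: cD Dx Dxz _; rewrite lerDl u0 lerD2l.
    have /(_ Dx Du) := @sl x (x + u); rewrite lerDl => /(_ u0).
    rewrite addrAC subrr add0r => sxu.
    have : 0 <= K * L * u ^+ 2 by rewrite mulr_ge0 ?sqr_ge0// mulr_ge0.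
    nra.
  rewrite /h /g !addr0 !mulr0 !expr0n/=; nra.
- rewrite ler0_norm//.
  pose h u := - (K * L * u ^+ 3) - g u.
  have hd (u : R) : is_derive u 1 h (- (3 * K * L * u ^+ 2) - (df (x + u) - df x - K * k x * u)).
    rewrite /h.
    have -> : (fun u => - (K * L * u ^+ 3) - g u) = (- (K * L)) \*: ((id : R -> R) ^+ 3) - g.
      apply/funext => v; rewrite !fctE /GRing.scale/= /GRing.scale/=.
      by ring.
    apply: is_derive_eq; rewrite /= ?fctE /=.
    by rewrite /GRing.scale/=; ring.
  have : - h z <= - h 0.
    have hNd (u : R) : is_derive u 1 (- h) (- (- (3 * K * L * u ^+ 2) - (df (x + u) - df x - K * k x * u))).
      exact: is_deriveN.
    apply: (@derive_ge0_nd (- h) _ z 0 (fun u _ => hNd u)) => // u /andP[zu u0].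
    have Du : D (x + u) by apply: cD Dxz Dx _; rewrite gerDl u0 lerD2l zu.
    have /(_ Du Dx) := @sl (x + u) x; rewrite gerDl => /(_ u0).
    have := kL (x + u) x; rewrite gerDl => /(_ u0).
    have -> : x - (x + u) = - u by ring.
    move=> kx sxu.
    have : 0 <= K * L * u ^+ 2 by rewrite mulr_ge0 ?sqr_ge0// mulr_ge0.
    have : K * (k (x + u) * - u) <= K * ((k x + L * - u) * - u).
      by rewrite ler_wpM2l// ler_wpM2r// oppr_ge0.
    nra.
  rewrite /h /g !addr0 !mulr0 !expr0n/=; nra.
Qed.

Lemma slope_le_eq k df dg K L (D : R -> Prop) : (forall x, D x -> df x = dg x) ->
  slope_le k df K L D -> slope_le k dg K L D.
Proof. by move=> e sl x y Dx Dy xy; rewrite -!e//; exact: sl. Qed.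

Lemma slope_leS k df K L (D D' : R -> Prop) : (forall x, D x -> D' x) ->
  slope_le k df K L D' -> slope_le k df K L D.
Proof. by move=> DD' sl x y Dx Dy xy; apply: sl => //; exact: DD'. Qed.

(** Used in the stopping regions, where the slope of the value is constant. *)
Lemma slope_le_cst k df K L (D : R -> Prop) d : 0 <= K -> 0 <= L ->
  (forall x, D x -> 0 <= k x) -> (forall x, D x -> df x = d) ->
  slope_le k df K L D.
Proof.
move=> K0 L0 k0 dfd x y Dx Dy xy; rewrite !dfd// subrr mulr_ge0//.
by rewrite addr_ge0// mulr_ge0 ?sqr_ge0 ?k0// subr_ge0.
Qed.

End Calculus.

Definition other (i : 'I_2) : 'I_2 := if i == reg1 then reg2 else reg1.

Lemma regP (i : 'I_2) : i = reg1 \/ i = reg2.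
Proof. by case: i => -[|[|//]] p; [left|right]; apply/val_inj. Qed.

Lemma reg2_neq1 : (reg2 == reg1) = false. Proof. by []. Qed.

Section Verification.
Context {R : realType}.
Variables (sigma lambda : 'I_2 -> R) (rho : R).
Hypotheses (sigma_gt0 : forall i, 0 < sigma i) (lambda_gt0 : forall i, 0 < lambda i).
Hypothesis rho_gt0 : 0 < rho.
Implicit Types (b : 'I_2 -> R) (w s : 'I_2 -> R -> R).

(* [half sigma_i^2 w_i''] in the continuation region of regime [i]. *)
Definition kgen w (i : 'I_2) (x : R) : R :=
  (rho + lambda i) * w i x - lambda i * w (other i) x.

(* [w] solves the variational inequality of the stopping problem with reward
   [x]; the generator is tested through two-sided Taylor bounds, so that no
   second derivative is needed at the free boundary. *)
Record verification b w s : Prop := Verification {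
  vf_b : forall i, 0 < b i;
  vf_ge0 : forall i x, 0 <= w i x;
  vf_ge : forall i x, x <= w i x;
  vf_eq : forall i x, b i <= x -> w i x = x;
  vf_nd : forall i x y, x <= y -> w i x <= w i y;
  vf_lip : forall i x y, x <= y -> w i y - w i x <= y - x;
  vf_kgen : forall i x, 0 <= kgen w i x;
  vf_upper : exists2 C, 0 <= C & forall i x z,
    w i (x + z) <= w i x + s i x * z + (sigma i ^+ 2)^-1 * kgen w i x * z ^+ 2
                   + C * `|z| ^+ 3;
  vf_lower : forall e, 0 < e -> exists2 C, 0 <= C & forall i x z, x <= b i - e ->
    w i x + s i x * z + (sigma i ^+ 2)^-1 * kgen w i x * z ^+ 2
      - C * `|z| ^+ 3 <= w i (x + z) }.

(** Both increments of [w] lie between 0 and [y - x], so the increment of [kgen] lies between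
    [- lambda i * (y - x)] and [(rho + lambda i) * (y - x)]. *)
Lemma kgen_lip w :
  (forall i x y, x <= y -> w i x <= w i y) ->
  (forall i x y, x <= y -> w i y - w i x <= y - x) ->
  forall i x y, x <= y ->
  kgen w i y <= kgen w i x + (rho + lambda i) * (y - x) /\
  kgen w i x <= kgen w i y + (rho + lambda i) * (y - x).
Proof.
move=> nd lip i x y xy; rewrite /kgen.
have := nd i x y xy; have := nd (other i) x y xy.
have := lip i x y xy; have := lip (other i) x y xy.
have := lambda_gt0 i.
set a := w i x; set a' := w i y; set c := w _ x; set c' := w _ y => l0 h1 h2 h3 h4.
have h5 : 0 <= lambda i * (c' - c) by rewrite mulr_ge0 ?subr_ge0// ltW.
have h6 : lambda i * (c' - c) <= lambda i * (y - x) by rewrite ler_wpM2l// ltW.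
have h7 : 0 <= (rho + lambda i) * (a' - a).
  by rewrite mulr_ge0 ?subr_ge0// addr_ge0// ltW.
have h8 : (rho + lambda i) * (a' - a) <= (rho + lambda i) * (y - x).
  by rewrite ler_wpM2l// addr_ge0// ltW.
have h9 : 0 <= rho * (y - x) by rewrite mulr_ge0 ?subr_ge0// ltW.
split; nra.
Qed.

(** Reduces the verification record to slope bounds. The bound for [- s] is asked only below [b i]:
    above it [s] is constant, and the inequality would fail wherever [kgen] is positive. *)
Lemma verification_of_slopes b w s :
  (forall i, 0 < b i) ->
  (forall i (x : R), is_derive x 1 (w i) (s i x)) ->
  (forall i x, 0 <= s i x) ->
  (forall i x y, x <= y -> s i x <= s i y) ->
  (forall i x, b i <= x -> s i x = 1) ->
  (forall i, w i (b i) = b i) ->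
  (forall i x, 0 <= w i x) ->
  (forall i x, 0 <= kgen w i x) ->
  (forall i, slope_le (kgen w i) (s i) (2 * (sigma i ^+ 2)^-1) (rho + lambda i)
     (fun=> True)) ->
  (forall i, slope_le (fun x => - kgen w i x) (fun x => - s i x)
     (2 * (sigma i ^+ 2)^-1) (rho + lambda i) (fun x => x <= b i)) ->
  verification b w s.
Proof.
move=> b0 wd s0 snd s1 wb w0 kg su sl.
have sle1 i x : s i x <= 1.
  rewrite -(s1 i (Num.max x (b i))) ?le_max ?lexx ?orbT//.
  by apply: snd; rewrite le_max lexx.
have wnd i x y : x <= y -> w i x <= w i y.
  by move=> xy; apply: (derive_ge0_nd (fun z _ => wd i z)) => // z _; exact: s0.
have wlip i x y : x <= y -> w i y - w i x <= y - x.
  move=> xy; have [c _ ->] := mvt_is_derive xy (fun z _ => wd i z).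
  by rewrite ler_piMl// subr_ge0.
have weq i x : b i <= x -> w i x = x.
  move=> bx; have [c /andP[bc _] e] := mvt_is_derive bx (fun z _ => wd i z).
  by move: e; rewrite s1// mul1r wb => /addIr.
have K0 i : 0 <= 2 * (sigma i ^+ 2)^-1 by rewrite mulr_ge0// invr_ge0 sqr_ge0.
have L0 i : 0 <= rho + lambda i by rewrite addr_ge0// ltW.
have KE i : 2 * (sigma i ^+ 2)^-1 / 2 = (sigma i ^+ 2)^-1.
  by rewrite mulrAC divff// mul1r.
have kL := kgen_lip wnd wlip.
split => //.
- move=> i x; have [xb|/ltW bx] := leP x (b i); last by rewrite weq.
  by have := wlip i _ _ xb; rewrite wb; lra.
- pose C i := 2 * (sigma i ^+ 2)^-1 * (rho + lambda i).
  have C0 i : 0 <= C i by rewrite mulr_ge0.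
  exists (C reg1 + C reg2); first by rewrite addr_ge0.
  move=> i x z; rewrite -KE.
  apply: (le_trans (@taylor_le _ (w i) (s i) (kgen w i) _ (rho + lambda i)
    (fun=> True) (K0 i) (L0 i) _ (wd i) _ (su i) x z I I)) => //.
    by move=> u v uv; have [] := kL i u v uv.
  rewrite lerD2l ler_wpM2r ?exprn_ge0// -/(C i).
  by case: (regP i) => ->; rewrite ?lerDl ?lerDr.
- move=> e e0.
  (* The second summand serves increments that cross the boundary: there [z >= e], so
     [z ^+ 2 <= z ^+ 3 / e]. *)
  pose C i := 2 * (sigma i ^+ 2)^-1 * (rho + lambda i)
    + (sigma i ^+ 2)^-1 * ((rho + lambda i) * b i) / e.
  have C0 i : 0 <= C i.
    by rewrite addr_ge0// ?mulr_ge0// ?invr_ge0 ?sqr_ge0// ltW.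
  exists (C reg1 + C reg2); first by rewrite addr_ge0.
  move=> i x z xb.
  have xbi : x <= b i by rewrite (le_trans xb)// lerBlDr lerDl ltW.
  suff H : w i x + s i x * z + (sigma i ^+ 2)^-1 * kgen w i x * z ^+ 2
      - C i * `|z| ^+ 3 <= w i (x + z).
    apply: le_trans H; rewrite lerD2l lerN2 ler_wpM2r ?exprn_ge0//.
    by case: (regP i) => ->; rewrite ?lerDl ?lerDr.
  have [xzb|bxz] := leP (x + z) (b i).
    have nwd (u : R) : is_derive u 1 (- (w i)) (- s i u) by exact: is_deriveN.
    have := @taylor_le _ (- w i) (fun u => - s i u) (fun u => - kgen w i u) _ (rho + lambda i)
      (fun x => x <= b i) (K0 i) (L0 i) _ nwd _ (sl i) x z xbi xzb.
    rewrite KE => H; have {}H : - w i (x + z) <= - w i x + - s i x * z + (sigma i ^+ 2)^-1 *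
       - kgen w i x * z ^+ 2 +  2 / sigma i ^+ 2 * (rho + lambda i) * `|z| ^+ 3.
      apply: H.
        by move=> u v t _ tb /andP[_ vt]; exact: le_trans tb.
      by move=> u v uv; have [] := kL i u v uv; lra.
    have : 0 <= (sigma i ^+ 2)^-1 * ((rho + lambda i) * b i) / e * `|z| ^+ 3.
      by rewrite !mulr_ge0// ?invr_ge0 ?sqr_ge0// ?exprn_ge0// ltW.
    rewrite /C; nra.
  have ez : e <= z by lra.
  have z0 : 0 <= z by rewrite (le_trans (ltW e0)).
  have xxz : x <= x + z by rewrite lerDl.
  rewrite ger0_norm//.
  (* Past the boundary the slope bound is lost, but monotonicity of [s] still gives the tangent-line
     bound; the quadratic term is then paid for by the cubic one. *)
  have h1 : w i x + s i x * z <= w i (x + z).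
    have [c /andP[xc _] e'] := mvt_is_derive xxz (fun z _ => wd i z).
    rewrite -lerBrDl e' addrAC subrr add0r ler_wpM2r// snd//.
  have h2 : kgen w i x <= (rho + lambda i) * b i.
    rewrite /kgen lerBlDr (@le_trans _ _ ((rho + lambda i) * b i))//.
      by rewrite ler_wpM2l// -wb wnd.
    by rewrite lerDl mulr_ge0// ltW.
  have h3 : (sigma i ^+ 2)^-1 * kgen w i x * z ^+ 2 <=
            (sigma i ^+ 2)^-1 * ((rho + lambda i) * b i) / e * z ^+ 3.
    rewrite (exprS z 2) [leRHS]mulrA; apply: ler_wpM2r; first exact: sqr_ge0.
    rewrite -!mulrA ler_wpM2l ?invr_ge0 ?sqr_ge0//.
    apply: (le_trans h2); rewrite ler_wpM2l// ler_peMr ?(ltW (b0 i))//.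
    by rewrite mulrC ler_pdivlMr// mul1r.
  have h4 : 0 <= 2 * (sigma i ^+ 2)^-1 * (rho + lambda i) * z ^+ 3.
    by rewrite mulr_ge0 ?exprn_ge0// mulr_ge0.
  rewrite /C; nra.
Qed.

End Verification.

(** * Closed-form solutions *)

Section Hyperbolic.
Context {R : realType}.
Implicit Types (a p q x t : R).

Lemma is_derive_expR_affine (a b x : R) :
  is_derive x 1 (fun y => expR (a * (y - b))) (a * expR (a * (x - b))).
Proof.
have -> : (fun y => expR (a * (y - b))) = expR \o (a \*: (id - cst b)).
  by apply/funext => y.
apply: is_derive_eq; rewrite /GRing.scale/= /GRing.scale/= ?fctE; ring.
Qed.

Lemma coshN t : cosh (- t) = cosh t.
Proof. by rewrite /cosh opprK addrC. Qed.

Lemma sinhN t : sinh (- t) = - sinh t.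
Proof. by rewrite /sinh opprK; ring. Qed.

Lemma cosh0 : cosh (0 : R) = 1.
Proof. by rewrite /cosh oppr0 expR0; field. Qed.

Lemma sinh0 : sinh (0 : R) = 0.
Proof. by rewrite /sinh oppr0 expR0; field. Qed.

Lemma is_derive_cosh_affine (a b x : R) :
  is_derive x 1 (fun y => cosh (a * (y - b))) (a * sinh (a * (x - b))).
Proof.
have -> : (fun y => cosh (a * (y - b))) =
    2^-1 \*: ((fun y => expR (a * (y - b))) + (fun y => expR (- a * (y - b)))).
  by apply/funext => y; rewrite /cosh -mulNr mulrC.
have d1 := is_derive_expR_affine a b x; have d2 := is_derive_expR_affine (- a) b x.
by apply: is_derive_eq; rewrite /sinh /GRing.scale/= mulNr mulNr; field.
Qed.

Lemma is_derive_sinh_affine (a b x : R) :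
  is_derive x 1 (fun y => sinh (a * (y - b))) (a * cosh (a * (x - b))).
Proof.
have -> : (fun y => sinh (a * (y - b))) =
    2^-1 \*: ((fun y => expR (a * (y - b))) - (fun y => expR (- a * (y - b)))).
  by apply/funext => y; rewrite /sinh -mulNr mulrC.
have d1 := is_derive_expR_affine a b x; have d2 := is_derive_expR_affine (- a) b x.
by apply: is_derive_eq; rewrite /cosh /GRing.scale/= mulNr mulNr; field.
Qed.

Lemma sinh_ge0 t : 0 <= t -> 0 <= sinh t.
Proof.
move=> t0; rewrite /sinh divr_ge0// subr_ge0 ler_expR.
by rewrite (le_trans _ t0)// oppr_le0.
Qed.

(** The derivative of [t * cosh t - sinh t] is [t * sinh t]. The inequality makes the middle piece
    of the regime 2 value convex. *)
Lemma sinh_le_cosh t : 0 <= t -> sinh t <= t * cosh t.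
Proof.
move=> t0; rewrite -subr_ge0.
pose g (y : R) := y * cosh (1 * (y - 0)) - sinh (1 * (y - 0)).
have gd (y : R) : is_derive y 1 g (y * sinh y).
  rewrite /g.
  have -> : (fun y => y * cosh (1 * (y - 0)) - sinh (1 * (y - 0))) =
    id * (fun y : R => cosh (1 * (y - 0))) - (fun y : R => sinh (1 * (y - 0))) by [].
  have d1 := is_derive_cosh_affine 1 0 y; have d2 := is_derive_sinh_affine 1 0 y.
  apply: is_derive_eq; rewrite /GRing.scale/= subr0 !mul1r; ring.
have : g 0 <= g t.
  apply: (derive_ge0_nd (fun u _ => gd u)) => // u /andP[u0 _].
  by rewrite mulr_ge0// sinh_ge0.
by rewrite /g subr0 !mul1r mul0r sinh0 !subr0.
Qed.

End Hyperbolic.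

(** * The value function built from a free-boundary solution *)

Section TwoRegimes.
Context {R : realType}.
Variables (sigma lambda : 'I_2 -> R) (rho : R).
Hypotheses (sigma_gt0 : forall i, 0 < sigma i) (lambda_gt0 : forall i, 0 < lambda i).
Hypothesis rho_gt0 : 0 < rho.
Variables (a3 a4 z1 z2 : R).
Hypotheses (a3_gt0 : 0 < a3) (a34 : a3 < a4).
Hypotheses (root3 : is_root sigma lambda rho a3) (root4 : is_root sigma lambda rho a4).
Hypotheses (z1_gt0 : 0 < z1) (z2_gt0 : 0 < z2).
Hypotheses (eq1 : boundary_eq1 sigma lambda rho a3 a4 z1 z2)
           (eq2 : boundary_eq2 sigma lambda rho a3 a4 z1 z2).

Let s1 := sigma reg1. Let s2 := sigma reg2.
Let l1 := lambda reg1. Let l2 := lambda reg2.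
Let x2 := z2 + z1.
Let a5 := alpha5 sigma lambda rho.

Let s1_gt0 : 0 < s1. Proof. exact: sigma_gt0. Qed.
Let s2_gt0 : 0 < s2. Proof. exact: sigma_gt0. Qed.
Let l1_gt0 : 0 < l1. Proof. exact: lambda_gt0. Qed.
Let l2_gt0 : 0 < l2. Proof. exact: lambda_gt0. Qed.
Let a4_gt0 : 0 < a4. Proof. exact: lt_trans a34. Qed.
Let z1x2 : z1 < x2. Proof. by rewrite /x2 ltrDr. Qed.

Let a5_gt0 : 0 < a5.
Proof. by rewrite sqrtr_gt0 divr_gt0 ?exprn_gt0// mulr_gt0// addr_gt0. Qed.

Let a5sq : s2 ^+ 2 * a5 ^+ 2 = 2 * (rho + l2).
Proof.
rewrite sqr_sqrtr; last by rewrite ltW// divr_gt0 ?exprn_gt0// mulr_gt0// addr_gt0.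
by rewrite mulrC divfK// gt_eqF// exprn_gt0.
Qed.

(* ratio of the two components of the solution with exponent [a] *)
Let kap a := Phi sigma lambda rho reg1 a / l1.

Let PhiE a : Phi sigma lambda rho reg1 a = l1 * kap a.
Proof. by rewrite mulrC divfK ?gt_eqF. Qed.

Let kap1 a : l1 * kap a = rho + l1 - 2^-1 * s1 ^+ 2 * a ^+ 2.
Proof. by rewrite mulrC divfK ?gt_eqF// /Phi -/s1 -/l1; ring. Qed.

Let kap2 a : is_root sigma lambda rho a ->
  kap a * (rho + l2 - 2^-1 * s2 ^+ 2 * a ^+ 2) = l2.
Proof.
rewrite /is_root -/l1 -/l2 => r.
have -> : rho + l2 - 2^-1 * s2 ^+ 2 * a ^+ 2 = Phi sigma lambda rho reg2 a.
  by rewrite /Phi -/s2 -/l2; ring.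
by rewrite /kap mulrAC r mulrAC divff ?mul1r// gt_eqF.
Qed.

Let kap_lt : kap a4 < kap a3.
Proof.
rewrite -(ltr_pM2l l1_gt0) !kap1 ltrD2l ltrN2 ltr_pM2l; last first.
  by rewrite mulr_gt0// exprn_gt0.
by rewrite ltrXn2r// ?nnegrE// ltW.
Qed.

(** Subtracting the two root equations determines the product: it is minus sigma_1^2 lambda_2 over
    sigma_2^2 lambda_1. With [kap_lt] this settles both signs, on which [Ac_ge0] rests. *)
Let kap_neg : kap a3 * kap a4 < 0.
Proof.
have r3 := kap2 root3; have r4 := kap2 root4.
have k3 := kap1 a3; have k4 := kap1 a4.
set u := 2^-1 * s1 ^+ 2; set v := 2^-1 * s2 ^+ 2.
rewrite -/u in k3 k4; rewrite -/v in r3 r4.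
have u0 : 0 < u by rewrite mulr_gt0// exprn_gt0.
have v0 : 0 < v by rewrite mulr_gt0// exprn_gt0.
have d : a4 ^+ 2 - a3 ^+ 2 != 0.
  by rewrite subr_eq0 gt_eqF// ltrXn2r// ?nnegrE// ltW.
suff E : l1 * (v * (kap a3 * kap a4)) = - (u * l2).
  rewrite -(pmulr_rlt0 _ v0) -(pmulr_rlt0 _ l1_gt0) E oppr_lt0.
  exact: mulr_gt0.
apply: (mulIf d).
move: r3 r4 k3 k4; set x := a3 ^+ 2; set y := a4 ^+ 2; set p := kap a3; set q := kap a4.
move=> r3 r4 k3 k4.
have ed : l1 * (p - q) = u * (y - x) by rewrite mulrBr k3 k4; ring.
have h : p * q * (v * (y - x)) = - (l2 * (p - q)).
  have -> : l2 * (p - q) = p * (q * (rho + l2 - v * y)) - q * (p * (rho + l2 - v * x)).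
    by rewrite r3 r4; ring.
  by ring.
have -> : l1 * (v * (p * q)) * (y - x) = l1 * (p * q * (v * (y - x))) by ring.
by rewrite h mulrN mulrCA ed; ring.
Qed.

Let kap3_gt0 : 0 < kap a3.
Proof.
rewrite ltNge; apply/negP => k3.
have : 0 <= kap a3 * kap a4 by rewrite mulr_le0// ltW// (lt_le_trans kap_lt).
by rewrite leNgt kap_neg.
Qed.

Let kap4_lt0 : kap a4 < 0.
Proof. by move: kap_neg; rewrite pmulr_rlt0. Qed.

(** Only positive exponents occur, since the value has to stay bounded at minus infinity; centring
    at [z1] makes the fit conditions there linear in the coefficients. *)
Let ex2 p q x := p * expR (a3 * (x - z1)) + q * expR (a4 * (x - z1)).

Let ex2_derive p q (x : R) : is_derive x 1 (ex2 p q) (ex2 (a3 * p) (a4 * q) x).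
Proof.
have d1 := is_derive_expR_affine a3 z1 x; have d2 := is_derive_expR_affine a4 z1 x.
have -> : ex2 p q = (p \*: (fun y => expR (a3 * (y - z1)))) +
  (q \*: (fun y => expR (a4 * (y - z1)))) by [].
by apply: is_derive_eq; rewrite /ex2 /GRing.scale/=; ring.
Qed.

Let ex2_z1 p q : ex2 p q z1 = p + q.
Proof. by rewrite /ex2 subrr !mulr0 expR0 !mulr1. Qed.

(** Left of [z1] the smaller exponent dominates, so only its coefficient and the value at [z1] have
    to be nonnegative. *)
Let ex2_ge0 p q x : 0 <= p -> 0 <= p + q -> x <= z1 -> 0 <= ex2 p q x.
Proof.
move=> p0 pq xz; rewrite /ex2.
set e3 := expR _; set e4 := expR _.
have e34 : e4 <= e3.
  by rewrite ler_expR -subr_ge0 -mulrBl mulr_le0// subr_le0// ltW.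
have e40 : 0 < e4 by exact: expR_gt0.
have : p * e4 <= p * e3 by rewrite ler_wpM2l.
have : 0 <= (p + q) * e4 by rewrite mulr_ge0// ltW.
nra.
Qed.

(** Carries that criterion from a derivative to its antiderivative, because [a3 < a4] gives
    [a3 * p + a4 * q <= a4 * (p + q)]. Convexity at [z1] thus yields monotonicity and positivity. *)
Let coef_down p q : 0 <= a3 * p -> 0 <= a3 * p + a4 * q -> 0 <= p /\ 0 <= p + q.
Proof.
rewrite pmulr_rge0// => p0 h; split => //.
have [q0|q0] := leP 0 q; first exact: addr_ge0.
rewrite -(pmulr_rge0 _ a4_gt0) mulrDr (le_trans h)// lerD2r.
by rewrite ler_wpM2r// ltW.
Qed.

(** The solution of [Ac + Bc = z1] and [a3 * Ac + a4 * Bc = 1]: value matching and smooth fit of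
    regime 1 at [z1]. *)
Let Ac := (a4 * z1 - 1) / (a4 - a3).
Let Bc := (1 - a3 * z1) / (a4 - a3).
Let E1 := ex2 Ac Bc.
Let E2 := ex2 (kap a3 * Ac) (kap a4 * Bc).
Let dE1 := ex2 (a3 * Ac) (a4 * Bc).
Let dE2 := ex2 (a3 * (kap a3 * Ac)) (a4 * (kap a4 * Bc)).
Let ddE1 := ex2 (a3 * (a3 * Ac)) (a4 * (a4 * Bc)).
Let ddE2 := ex2 (a3 * (a3 * (kap a3 * Ac))) (a4 * (a4 * (kap a4 * Bc))).

Let a43 : a4 - a3 != 0. Proof. by rewrite subr_eq0 gt_eqF. Qed.

Let E1_z1 : Ac + Bc = z1. Proof. by rewrite /Ac /Bc; field. Qed.
Let dE1_z1 : a3 * Ac + a4 * Bc = 1. Proof. by rewrite /Ac /Bc; field. Qed.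

Let ddE1E x : 2^-1 * s1 ^+ 2 * ddE1 x = (rho + l1) * E1 x - l1 * E2 x.
Proof.
have k3 := kap1 a3; have k4 := kap1 a4.
have -> : l1 * E2 x = ex2 (l1 * kap a3 * Ac) (l1 * kap a4 * Bc) x.
  by rewrite /E2 /ex2; ring.
by rewrite k3 k4 /ddE1 /E1 /ex2; ring.
Qed.

Let ddE2E x : 2^-1 * s2 ^+ 2 * ddE2 x = (rho + l2) * E2 x - l2 * E1 x.
Proof.
have -> : l2 * E1 x = ex2 (kap a3 * (rho + l2 - 2^-1 * s2 ^+ 2 * a3 ^+ 2) * Ac)
  (kap a4 * (rho + l2 - 2^-1 * s2 ^+ 2 * a4 ^+ 2) * Bc) x.
  by rewrite (kap2 root3) (kap2 root4) /E1 /ex2; ring.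
by rewrite /ddE2 /E2 /ex2; ring.
Qed.

Let r := rho / (rho + l2).
Let rl2_gt0 : 0 < rho + l2. Proof. exact: addr_gt0. Qed.
Let r_gt0 : 0 < r. Proof. exact: divr_gt0. Qed.
Let rE : l2 / (rho + l2) = 1 - r.
Proof. by rewrite /r; field; rewrite gt_eqF. Qed.

(** Regime 2 between the boundaries, where regime 1 already has value [x]: the solution of
    [half s2^2 M'' = (rho + l2) M - l2 x] with [M x2 = x2] and slope 1 there; [(1 - r) * x] is a
    particular solution. *)
Let M x := (1 - r) * x + r * (x2 * cosh (a5 * (x - x2)) + a5^-1 * sinh (a5 * (x - x2))).
Let dM x := (1 - r) + r * (x2 * a5 * sinh (a5 * (x - x2)) + cosh (a5 * (x - x2))).
Let ddM x := r * a5 * (x2 * a5 * cosh (a5 * (x - x2)) + sinh (a5 * (x - x2))).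

Let M_derive (x : R) : is_derive x 1 M (dM x).
Proof.
have d1 := is_derive_cosh_affine a5 x2 x; have d2 := is_derive_sinh_affine a5 x2 x.
have -> : M = ((1 - r) \*: (id : R -> R)) + r \*: (x2 \*: (fun x : R => cosh (a5 * (x - x2))) +
   a5^-1 \*: (fun x : R => sinh (a5 * (x - x2)))) by [].
apply: is_derive_eq; rewrite /dM /GRing.scale/=; field; rewrite gt_eqF//.
Qed.

Let dM_derive (x : R) : is_derive x 1 dM (ddM x).
Proof.
have d1 := is_derive_cosh_affine a5 x2 x; have d2 := is_derive_sinh_affine a5 x2 x.
have -> : dM = (cst (1 - r)) + r \*: ((x2 * a5) \*: (fun x : R => sinh (a5 * (x - x2))) +
   (fun x : R => cosh (a5 * (x - x2)))) by [].
by apply: is_derive_eq; rewrite /ddM /GRing.scale/=; ring.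
Qed.

Let ddME x : 2^-1 * s2 ^+ 2 * ddM x = (rho + l2) * M x - l2 * x.
Proof.
have -> : l2 * x = (rho + l2) * ((1 - r) * x).
  by rewrite -rE mulrA (mulrC _ (_ / _)) divfK ?gt_eqF.
rewrite /M mulrDr addrAC subrr add0r.
have -> : rho + l2 = 2^-1 * (s2 ^+ 2 * a5 ^+ 2).
  by rewrite a5sq mulrA mulVf// mul1r.
by rewrite /ddM; field; rewrite gt_eqF.
Qed.

(** This is what [boundary_eq1] expresses at [u = z1], [v = z2]: value matching of regime 2 at [z1].
    In the same way [boundary_eq2] is smooth fit there. *)
Let M_z1 : E2 z1 = M z1.
Proof.
have e : (- ((a4 * (l1 * kap a3) - a3 * (l1 * kap a4)) / (l1 * (a4 - a3)))
    + l2 / (rho + l2) + r * cosh (a5 * z2)) * z1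
    - r * (a5^-1 * sinh (a5 * z2) - z2 * cosh (a5 * z2))
    + (l1 * kap a3 - l1 * kap a4) / (l1 * (a4 - a3)) = 0.
  have h := eq1; rewrite /boundary_eq1 /Defs.coef1 /coef2 !PhiE in h.
  exact: h.
rewrite rE in e.
rewrite /E2 ex2_z1 /M (_ : a5 * (z1 - x2) = - (a5 * z2)); last by rewrite /x2; ring.
rewrite coshN sinhN; apply/eqP; rewrite -subr_eq0; apply/eqP.
rewrite -[RHS]oppr0 -e /Ac /Bc /x2.
by field; rewrite ?a43 ?gt_eqF.
Qed.

Let dM_z1 : dE2 z1 = dM z1.
Proof.
have e : (a3 * a4 * (l1 * kap a4 - l1 * kap a3) / (l1 * (a4 - a3))
    - r * a5 * sinh (a5 * z2)) * z1
    - r * (z2 * a5 * sinh (a5 * z2) - cosh (a5 * z2))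
    + ((a3 * (l1 * kap a3) - a4 * (l1 * kap a4)) / (l1 * (a4 - a3))
       + l2 / (rho + l2)) = 0.
  by have := eq2; rewrite /boundary_eq2 /coef3 /coef4 !PhiE (mulrAC rho); exact.
rewrite rE in e.
rewrite /dE2 ex2_z1 /dM (_ : a5 * (z1 - x2) = - (a5 * z2)); last by rewrite /x2; ring.
rewrite coshN sinhN; apply/eqP; rewrite -subr_eq0; apply/eqP.
rewrite -[RHS]oppr0 -e /Ac /Bc /x2.
by field; rewrite ?a43 ?gt_eqF.
Qed.

Let M_x2 : M x2 = x2.
Proof. by rewrite /M subrr mulr0 cosh0 sinh0; ring. Qed.

Let dM_x2 : dM x2 = 1.
Proof. by rewrite /dM subrr mulr0 cosh0 sinh0; ring. Qed.

(** With [t = a5 * (x2 - x)] the claim is [sinh t <= x2 * a5 * cosh t]; since [x] is positive,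
    [t <= x2 * a5]. *)
Let ddM_ge0 x : z1 <= x <= x2 -> 0 <= ddM x.
Proof.
move=> /andP[zx xx]; rewrite /ddM.
have t0 : 0 <= a5 * (x2 - x) by rewrite mulr_ge0 ?subr_ge0// ltW.
have -> : a5 * (x - x2) = - (a5 * (x2 - x)) by ring.
rewrite coshN sinhN; apply: mulr_ge0; first by rewrite mulr_ge0 ?ltW.
rewrite subr_ge0 (le_trans (sinh_le_cosh t0))// ler_wpM2r//.
  by rewrite /cosh divr_ge0// addr_ge0// expR_ge0.
rewrite mulrC ler_wpM2r ?(ltW a5_gt0)// lerBlDr lerDl.
by rewrite (le_trans _ zx)// ltW.
Qed.

Let dM_nd x y : z1 <= x -> x <= y -> y <= x2 -> dM x <= dM y.
Proof.
move=> zx xy yx; apply: (derive_ge0_nd (fun u _ => dM_derive u)) => // u /andP[xu uy].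
by apply: ddM_ge0; rewrite (le_trans zx)// (le_trans uy).
Qed.

Let M_ge x : z1 <= x <= x2 -> x <= M x.
Proof.
move=> /andP[zx xx].
have [c /andP[xc cx] e] := mvt_is_derive xx (fun u _ => M_derive u).
have := @dM_nd c x2 (le_trans zx xc) cx (lexx _); rewrite dM_x2 => d1.
have : dM c * (x2 - x) <= 1 * (x2 - x) by rewrite ler_wpM2r// subr_ge0.
by rewrite -e M_x2 mul1r; lra.
Qed.

(** Convexity of [M] carries slope 1 at [x2] down to slope at most 1 at [z1], where smooth fit hands
    it to [E2]. *)
Let dE2_le1 : a3 * (kap a3 * Ac) + a4 * (kap a4 * Bc) <= 1.
Proof. by rewrite -ex2_z1 -/dE2 dM_z1 -dM_x2 dM_nd// ltW. Qed.

Let E2_ge : z1 <= kap a3 * Ac + kap a4 * Bc.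
Proof. by rewrite -ex2_z1 -/E2 M_z1 M_ge// lexx ltW. Qed.

(* Differentiating the equation of regime 1 once more:
   [half s1^2 w1''' = (rho + l1) w1' - l1 w2' >= rho] at [z1]. *)
Let ddE1_z1 : 0 <= a3 * (a3 * Ac) + a4 * (a4 * Bc).
Proof.
have k3 := kap1 a3; have k4 := kap1 a4.
have h : 0 < a3 ^+ 2 * (a3 * Ac) + a4 ^+ 2 * (a4 * Bc).
  have s0 : 0 < 2^-1 * s1 ^+ 2 by rewrite mulr_gt0// exprn_gt0.
  rewrite -(pmulr_rgt0 _ s0).
  have -> : 2^-1 * s1 ^+ 2 * (a3 ^+ 2 * (a3 * Ac) + a4 ^+ 2 * (a4 * Bc)) =
    (rho + l1) * (a3 * Ac + a4 * Bc) - (l1 * kap a3 * (a3 * Ac) + l1 * kap a4 * (a4 * Bc)).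
    by rewrite k3 k4; ring.
  have -> : l1 * kap a3 * (a3 * Ac) + l1 * kap a4 * (a4 * Bc) =
    l1 * (a3 * (kap a3 * Ac) + a4 * (kap a4 * Bc)) by ring.
  rewrite dE1_z1.
  have : l1 * (a3 * (kap a3 * Ac) + a4 * (kap a4 * Bc)) <= l1 * 1.
    by rewrite ler_wpM2l// ltW.
  by rewrite !mulr1 => h; rewrite subr_gt0 (le_lt_trans h)// ltrDr.
move: h dE1_z1; move: (a3 * Ac) (a4 * Bc) => a b h ab.
have [b0|b0] := leP 0 b.
  have : a3 * b <= a4 * b by rewrite ler_wpM2r// ltW.
  have : a3 * (a + b) = a3 by rewrite ab mulr1.
  move=> e1 e2; rewrite (le_trans (ltW a3_gt0))// -[leLHS]e1 mulrDr lerD2l.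
  exact: e2.
rewrite -(pmulr_rge0 _ a3_gt0) (le_trans (ltW h))// mulrDr !mulrA -!expr2 lerD2l.
by rewrite expr2 ler_nM2r// ler_wpM2r// ltW.
Qed.

(** The equation of regime 2 at [z1] reads [half s2^2 w2'' = (rho + l2) w2 - l2 z1], and [w2 >= z1]
    there. *)
Let ddE2_z1 : 0 <= a3 * (a3 * (kap a3 * Ac)) + a4 * (a4 * (kap a4 * Bc)).
Proof.
have s0 : 0 < 2^-1 * s2 ^+ 2 by rewrite mulr_gt0// exprn_gt0.
rewrite -(pmulr_rge0 _ s0) -ex2_z1 -/ddE2 ddE2E /E1 /E2 !ex2_z1 E1_z1.
have : (rho + l2) * z1 <= (rho + l2) * (kap a3 * Ac + kap a4 * Bc).
  by rewrite ler_wpM2l// ltW.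
have : 0 <= rho * z1 by rewrite mulr_ge0// ltW.
lra.
Qed.

(** If [Ac] were negative, convexity of regime 1 at [z1] would force [Bc > 0]; as
    [kap a3 > 0 > kap a4], both coefficients of regime 2 would be negative, against its convexity at
    [z1]. *)
Let Ac_ge0 : 0 <= Ac.
Proof.
rewrite leNgt; apply/negP => A0.
have B0 : 0 < Bc.
  rewrite ltNge; apply/negP => B0; have := ddE1_z1.
  have : a3 * (a3 * Ac) < 0 by rewrite pmulr_rlt0// pmulr_rlt0.
  have : a4 * (a4 * Bc) <= 0 by rewrite pmulr_rle0// pmulr_rle0.
  lra.
have := ddE2_z1.
have : a3 * (a3 * (kap a3 * Ac)) < 0.
  by rewrite pmulr_rlt0// pmulr_rlt0// pmulr_rlt0.
have : a4 * (a4 * (kap a4 * Bc)) < 0.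
  by rewrite pmulr_rlt0// pmulr_rlt0// nmulr_rlt0.
lra.
Qed.

Let a3_ge0 := ltW a3_gt0.
Let k3A_ge0 : 0 <= kap a3 * Ac. Proof. by apply: mulr_ge0 => //; exact: ltW. Qed.

Let pos1 : [/\ 0 <= Ac + Bc, 0 <= a3 * Ac + a4 * Bc &
  0 <= a3 * (a3 * Ac) + a4 * (a4 * Bc)].
Proof.
have [h1 h2] := coef_down (mulr_ge0 a3_ge0 (mulr_ge0 a3_ge0 Ac_ge0)) ddE1_z1.
by have [_ h3] := coef_down h1 h2; split => //; exact: ddE1_z1.
Qed.

Let pos2 : [/\ 0 <= kap a3 * Ac + kap a4 * Bc,
  0 <= a3 * (kap a3 * Ac) + a4 * (kap a4 * Bc) &
  0 <= a3 * (a3 * (kap a3 * Ac)) + a4 * (a4 * (kap a4 * Bc))].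
Proof.
have [h1 h2] := coef_down (mulr_ge0 a3_ge0 (mulr_ge0 a3_ge0 k3A_ge0)) ddE2_z1.
by have [_ h3] := coef_down h1 h2.
Qed.

Let E1_ge0 x : x <= z1 -> 0 <= E1 x.
Proof. by move=> xz; have [h _ _] := pos1; exact: ex2_ge0. Qed.

Let dE1_ge0 x : x <= z1 -> 0 <= dE1 x.
Proof.
by move=> xz; have [_ h _] := pos1; apply: ex2_ge0 => //; apply: mulr_ge0.
Qed.

Let ddE1_ge0 x : x <= z1 -> 0 <= ddE1 x.
Proof.
move=> xz; have [_ _ h] := pos1; apply: ex2_ge0 => //; apply: mulr_ge0 => //.
exact: mulr_ge0.
Qed.

Let E2_ge0 x : x <= z1 -> 0 <= E2 x.
Proof. by move=> xz; have [h _ _] := pos2; exact: ex2_ge0. Qed.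

Let dE2_ge0 x : x <= z1 -> 0 <= dE2 x.
Proof.
by move=> xz; have [_ h _] := pos2; apply: ex2_ge0 => //; apply: mulr_ge0.
Qed.

Let ddE2_ge0 x : x <= z1 -> 0 <= ddE2 x.
Proof.
move=> xz; have [_ _ h] := pos2; apply: ex2_ge0 => //; apply: mulr_ge0 => //.
exact: mulr_ge0.
Qed.

Let w i x := if i == reg1 then if x <= z1 then E1 x else x
  else if x <= z1 then E2 x else if x <= x2 then M x else x.
Let s i x := if i == reg1 then if x <= z1 then dE1 x else 1
  else if x <= z1 then dE2 x else if x <= x2 then dM x else 1.
Let b (i : 'I_2) := if i == reg1 then z1 else x2.

Let wd i (x : R) : is_derive x 1 (w i) (s i x).
Proof.
rewrite /w /s; case: (regP i) => ->; rewrite ?eqxx ?reg2_neq1.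
  apply: (@is_derive_glue _ E1 id).
  - by rewrite /E1 ex2_z1 E1_z1.
  - by move=> ->; exact: ex2_derive.
  - move=> zx; case: ifPn => [xz|_]; last exact: is_derive_id.
    have -> : x = z1 by apply/eqP; rewrite eq_le xz.
    by rewrite /dE1 ex2_z1 dE1_z1; exact: is_derive_id.
apply: (@is_derive_glue _ E2 (fun x => if x <= x2 then M x else x)).
- by rewrite (ltW z1x2) M_z1.
- by move=> ->; exact: ex2_derive.
move=> zx.
have -> : (if x <= z1 then dE2 x else if x <= x2 then dM x else 1) =
    (if x <= x2 then dM x else 1).
  case: ifPn => // xz; have -> : x = z1 by apply/eqP; rewrite eq_le xz.
  by rewrite (ltW z1x2) dM_z1.
apply: (@is_derive_glue _ M id).
- by rewrite M_x2.
- by move=> ->; exact: M_derive.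
- move=> xx; case: ifPn => [xx'|_]; last exact: is_derive_id.
  have -> : x = x2 by apply/eqP; rewrite eq_le xx'.
  by rewrite dM_x2; exact: is_derive_id.
Qed.

Let sE1 x : x <= z1 -> s reg1 x = dE1 x. Proof. by move=> xz; rewrite /s eqxx xz. Qed.
Let sE1' x : z1 <= x -> s reg1 x = 1.
Proof.
move=> zx; rewrite /s eqxx; case: ifPn => // xz.
have -> : x = z1 by apply/eqP; rewrite eq_le xz.
by rewrite /dE1 ex2_z1 dE1_z1.
Qed.
Let sE2 x : x <= z1 -> s reg2 x = dE2 x.
Proof. by move=> xz; rewrite /s reg2_neq1 xz. Qed.
Let sE2' x : z1 <= x <= x2 -> s reg2 x = dM x.
Proof.
move=> /andP[zx xx]; rewrite /s reg2_neq1 xx; case: ifPn => // xz.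
have -> : x = z1 by apply/eqP; rewrite eq_le xz.
by rewrite dM_z1.
Qed.
Let sE2'' x : x2 <= x -> s reg2 x = 1.
Proof.
move=> xx; rewrite /s reg2_neq1 ifF; last first.
  by apply/negbTE; rewrite -ltNge (lt_le_trans z1x2).
case: ifPn => // xx'; have -> : x = x2 by apply/eqP; rewrite eq_le xx'.
exact: dM_x2.
Qed.

Let wE1' x : z1 <= x -> w reg1 x = x.
Proof.
move=> zx; rewrite /w eqxx; case: ifPn => // xz.
have -> : x = z1 by apply/eqP; rewrite eq_le xz.
by rewrite /E1 ex2_z1 E1_z1.
Qed.
Let wE2' x : z1 <= x <= x2 -> w reg2 x = M x.
Proof.
move=> /andP[zx xx]; rewrite /w reg2_neq1 xx; case: ifPn => // xz.
have -> : x = z1 by apply/eqP; rewrite eq_le xz.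
by rewrite M_z1.
Qed.
Let wE2'' x : x2 <= x -> w reg2 x = x.
Proof.
move=> xx; rewrite /w reg2_neq1 ifF; last first.
  by apply/negbTE; rewrite -ltNge (lt_le_trans z1x2).
case: ifPn => // xx'; have -> : x = x2 by apply/eqP; rewrite eq_le xx'.
exact: M_x2.
Qed.

(* monotonicity of [s] is the slope bound for the constant function [0] *)
Let snd i x y : x <= y -> s i x <= s i y.
Proof.
suff H : slope_le (fun=> 0) (fun x => - s i x) 1 0 (fun=> True).
  by move=> xy; have := H x y I I xy; rewrite !mul0r addr0 mulr0; lra.
have c0 (u v : R) : u <= v -> (0 : R) <= 0 + 0 * (v - u) by rewrite mul0r addr0.
have mono (f df : R -> R) (D : R -> Prop) :
    (forall x y z, D x -> D z -> x <= y <= z -> D y) ->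
    (forall x : R, is_derive x 1 f (df x)) -> (forall x, D x -> 0 <= df x) ->
    slope_le (fun=> 0) (fun x => - f x) 1 0 D.
  move=> cD fd d0 u v Du Dv uv; rewrite !mul0r addr0 mulr0.
  have : f u <= f v.
    by apply: (derive_ge0_nd (fun z _ => fd z)) => // z uzv; apply: d0; exact: cD uzv.
  lra.
have cle a : forall x y z : R, x <= a -> z <= a -> x <= y <= z -> y <= a.
  by move=> u v t _ ta /andP[_ vt]; exact: le_trans ta.
case: (regP i) => ->; apply: (slope_le_glue (a := z1)) => //.
- apply: (@slope_leS _ _ _ _ _ _ (fun x => x <= z1)); first by move=> ? [].
  apply: (@slope_le_eq _ _ (fun x => - dE1 x)); first by move=> ? /sE1->.
  apply: (mono dE1 ddE1); [exact: cle| |exact: ddE1_ge0].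
  by move=> u; exact: ex2_derive.
- apply: (@slope_le_cst _ _ _ _ _ _ (- 1)) => //.
  by move=> u [_ /sE1' ->].
- apply: (@slope_leS _ _ _ _ _ _ (fun x => x <= z1)); first by move=> ? [].
  apply: (@slope_le_eq _ _ (fun x => - dE2 x)); first by move=> ? /sE2->.
  apply: (mono dE2 ddE2); [exact: cle| |exact: ddE2_ge0].
  by move=> u; exact: ex2_derive.
- apply: (slope_le_glue (a := x2)) => //; first by split=> //; exact: ltW.
  + apply: (@slope_leS _ _ _ _ _ _ (fun x => z1 <= x <= x2)).
      by move=> u [[_ ->] ->].
    apply: (@slope_le_eq _ _ (fun x => - dM x)); first by move=> u /sE2'->.
    apply: (mono _ ddM) => // u v t /andP[zu ux] /andP[zt tx] /andP[uv vt].
    by rewrite (le_trans zu)// (le_trans vt).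
  + apply: (@slope_le_cst _ _ _ _ _ _ (- 1)) => //.
    by move=> u [_ /sE2'' ->].
Qed.

Let s_ge0 i x : 0 <= s i x.
Proof.
have [xz|/ltW zx] := leP x z1.
  by case: (regP i) => ->; rewrite ?sE1 ?sE2// ?dE1_ge0 ?dE2_ge0.
rewrite (le_trans _ (snd i zx))//.
by case: (regP i) => ->; rewrite ?sE1 ?sE2// ?dE1_ge0 ?dE2_ge0.
Qed.

Let w_ge0 i x : 0 <= w i x.
Proof.
have h z : z <= z1 -> 0 <= w i z.
  by move=> zz; rewrite /w zz; case: ifP => _; rewrite ?E1_ge0 ?E2_ge0.
have [xz|/ltW zx] := leP x z1; first exact: h.
apply: (le_trans (h z1 (lexx _))).
by apply: (derive_ge0_nd (fun z _ => wd i z)) => // z _; exact: s_ge0.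
Qed.

Let s1' i x : b i <= x -> s i x = 1.
Proof. by case: (regP i) => ->; rewrite /b ?eqxx ?reg2_neq1; [exact: sE1'|exact: sE2'']. Qed.

Let kE1 x : x <= z1 -> kgen lambda rho w reg1 x = 2^-1 * s1 ^+ 2 * ddE1 x.
Proof. by move=> xz; rewrite /kgen /other eqxx /w eqxx reg2_neq1 xz ddE1E. Qed.

Let kE2 x : x <= z1 -> kgen lambda rho w reg2 x = 2^-1 * s2 ^+ 2 * ddE2 x.
Proof. by move=> xz; rewrite /kgen /other reg2_neq1 /w eqxx reg2_neq1 xz ddE2E. Qed.

Let kE2' x : z1 <= x <= x2 -> kgen lambda rho w reg2 x = 2^-1 * s2 ^+ 2 * ddM x.
Proof.
move=> xzx; rewrite /kgen /other reg2_neq1 wE2'// wE1' ?ddME//.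
by case/andP: xzx.
Qed.

Let wlip2 x y : x <= y -> w reg2 y - w reg2 x <= y - x.
Proof.
move=> xy; have [c _ ->] := mvt_is_derive xy (fun z _ => wd reg2 z).
rewrite ler_piMl ?subr_ge0//.
rewrite -(@s1' reg2 (Num.max c (b reg2))) ?le_max ?lexx ?orbT//.
by apply: snd; rewrite le_max lexx.
Qed.

(** Below a boundary this is convexity of the corresponding piece. For regime 1 above [z1] it equals
    [(rho + l1) * x - l1 * w reg2 x], which is nondecreasing because [w reg2] grows with slope at
    most 1, so nonnegativity at [z1] propagates; for regime 2 above [x2] it is [rho * x]. *)
Let kg i x : 0 <= kgen lambda rho w i x.
Proof.
have s10 : 0 <= 2^-1 * s1 ^+ 2 by rewrite mulr_ge0// sqr_ge0.
have s20 : 0 <= 2^-1 * s2 ^+ 2 by rewrite mulr_ge0// sqr_ge0.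
have h1 z : z <= z1 -> 0 <= kgen lambda rho w reg1 z.
  by move=> zz; rewrite kE1// mulr_ge0 ?ddE1_ge0.
case: (regP i) => ->.
  have [xz|/ltW zx] := leP x z1; first exact: h1.
  have := h1 z1 (lexx _); rewrite /kgen /other eqxx !wE1'// => h.
  have := wlip2 zx; rewrite -subr_ge0 -(pmulr_rge0 _ l1_gt0).
  have : 0 <= rho * (x - z1) by rewrite mulr_ge0 ?subr_ge0// ltW.
  rewrite -/l1 in h *; move: h; nra.
have [xz|/ltW zx] := leP x z1; first by rewrite kE2// mulr_ge0 ?ddE2_ge0.
have [xx|/ltW xx] := leP x x2.
  by rewrite kE2' ?zx// mulr_ge0 ?ddM_ge0 ?zx.
rewrite /kgen /other reg2_neq1 wE1'// wE2''// mulrDl addrK.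
by rewrite mulr_ge0 ?(ltW rho_gt0)// (le_trans _ zx)// ltW.
Qed.

Let K i := 2 * (sigma i ^+ 2)^-1.
Let K0 i : 0 <= K i. Proof. by rewrite mulr_ge0// invr_ge0 sqr_ge0. Qed.
Let Khalf i x : x = K i * (2^-1 * sigma i ^+ 2 * x).
Proof. by rewrite /K; field; rewrite gt_eqF. Qed.

Lemma verification_two_regimes : exists w s,
  verification sigma lambda rho (fun i => if i == reg1 then z1 else x2) w s.
Proof.
exists w, s.
have K0' i : 0 <= 2 * (sigma i ^+ 2)^-1 := K0 i.
have L0 i : 0 <= rho + lambda i by rewrite addr_ge0// ltW.
have sle1 i x : s i x <= 1.
  rewrite -(@s1' i (Num.max x (b i))) ?le_max ?lexx ?orbT//.
  by apply: snd; rewrite le_max lexx.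
have wnd i x y : x <= y -> w i x <= w i y.
  by move=> xy; apply: (derive_ge0_nd (fun z _ => wd i z)) => // z _; exact: s_ge0.
have wlip i x y : x <= y -> w i y - w i x <= y - x.
  move=> xy; have [c _ ->] := mvt_is_derive xy (fun z _ => wd i z).
  by rewrite ler_piMl// subr_ge0.
have kL := kgen_lip lambda_gt0 rho_gt0 wnd wlip.
have kL1 i x y : x <= y -> kgen lambda rho w i y <= kgen lambda rho w i x + (rho + lambda i) * (y - x).
  by move=> xy; have [] := kL i x y xy.
have kL2 i x y : x <= y -> - kgen lambda rho w i y <= - kgen lambda rho w i x + (rho + lambda i) * (y - x).
  by move=> xy; have [] := kL i x y xy; lra.
have cle a : forall x y z : R, x <= a -> z <= a -> x <= y <= z -> y <= a.
  by move=> u v t _ ta /andP[_ vt]; exact: le_trans ta.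
have cbt (u v t : R) : z1 <= u <= x2 -> z1 <= t <= x2 -> u <= v <= t -> z1 <= v <= x2.
  by move=> /andP[zu _] /andP[_ tx] /andP[uv vt]; rewrite (le_trans zu)// (le_trans vt).
have dN (f : R -> R) (u d : R) : is_derive u 1 f d -> is_derive u 1 (fun x => - f x) (- d).
  exact: is_deriveN.
apply: verification_of_slopes => //.
- by move=> i; case: ifP => // _; exact: lt_trans z1x2.
- by move=> i; case: (regP i) => ->; rewrite ?eqxx ?reg2_neq1 ?wE1' ?wE2''.
- move=> i; case: (regP i) => ->.
  + apply: (slope_le_glue (K0' _) (L0 _) (a := z1)) => //; first exact: kL1.
    * apply: (@slope_leS _ _ _ _ _ _ (fun x => x <= z1)); first by move=> ? [].
      apply: (@slope_le_eq _ _ dE1); first by move=> ? /sE1->.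
      apply: (slope_le_smooth (ddf := ddE1) (K0' _) (@cle z1) _ _ (@kL1 _) (L0 _)).
        by move=> u _; exact: ex2_derive.
      by move=> u uz; rewrite kE1// -Khalf.
    * by apply: (@slope_le_cst _ _ _ _ _ _ 1) => // u [_ /sE1' ->].
  + apply: (slope_le_glue (K0' _) (L0 _) (a := z1)) => //; first exact: kL1.
      apply: (@slope_leS _ _ _ _ _ _ (fun x => x <= z1)); first by move=> ? [].
      apply: (@slope_le_eq _ _ dE2); first by move=> ? /sE2->.
      apply: (slope_le_smooth (ddf := ddE2) (K0' _) (@cle z1) _ _ (@kL1 _) (L0 _)).
        by move=> u _; exact: ex2_derive.
      by move=> u uz; rewrite kE2// -Khalf.
    apply: (slope_le_glue (K0' _) (L0 _) (a := x2)); last first.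
    * by apply: (@slope_le_cst _ _ _ _ _ _ 1) => // u [_ /sE2'' ->].
    * apply: (@slope_leS _ _ _ _ _ _ (fun x => z1 <= x <= x2)).
        by move=> u [[_ ->] ->].
      apply: (@slope_le_eq _ _ dM); first by move=> u /sE2'->.
      apply: (slope_le_smooth (ddf := ddM) (K0' _) cbt _ _ (@kL1 _) (L0 _)) => //.
      by move=> u uz; rewrite kE2'// -Khalf.
    * exact: kL1.
    * by split=> //; exact: ltW.
- move=> i; case: (regP i) => ->; rewrite ?eqxx ?reg2_neq1.
  + apply: (@slope_le_eq _ _ (fun x => - dE1 x)); first by move=> ? /sE1->.
    apply: (slope_le_smooth (ddf := fun x => - ddE1 x) (K0' _) (@cle z1) _ _ (@kL2 _) (L0 _)).
    * by move=> u _; apply: dN; exact: ex2_derive.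
    * by move=> u uz; rewrite kE1// mulrN -Khalf.
  + apply: (slope_le_glue (K0' _) (L0 _) (a := z1)); [exact: ltW|exact: kL2| |].
    * apply: (@slope_leS _ _ _ _ _ _ (fun x => x <= z1)); first by move=> ? [].
      apply: (@slope_le_eq _ _ (fun x => - dE2 x)); first by move=> ? /sE2->.
      apply: (slope_le_smooth (ddf := fun x => - ddE2 x) (K0' _) (@cle z1) _ _ (@kL2 _) (L0 _)).
        by move=> u _; apply: dN; exact: ex2_derive.
      by move=> u uz; rewrite kE2// mulrN -Khalf.
    * apply: (@slope_leS _ _ _ _ _ _ (fun x => z1 <= x <= x2)).
        by move=> u [-> ->].
      apply: (@slope_le_eq _ _ (fun x => - dM x)); first by move=> u /sE2'->.
      apply: (slope_le_smooth (ddf := fun x => - ddM x) (K0' _) cbt _ _ (@kL2 _) (L0 _)).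
        by move=> u uz; apply: dN; exact: dM_derive.
      by move=> u uz; rewrite kE2'// mulrN -Khalf.
Qed.

End TwoRegimes.

(** * The value function for a common volatility *)

Section EqualVolatilities.
Context {R : realType}.
Variables (sigma lambda : 'I_2 -> R) (rho v : R).
Hypotheses (v_gt0 : 0 < v) (sigmaE : forall i, sigma i = v).
Hypotheses (lambda_gt0 : forall i, 0 < lambda i) (rho_gt0 : 0 < rho).

Let b0 := v / Num.sqrt (2 * rho).
Let a := Num.sqrt (2 * rho) / v.

Let sq0 : 0 < Num.sqrt (2 * rho).
Proof. by rewrite sqrtr_gt0 mulr_gt0. Qed.

Let b0_gt0 : 0 < b0. Proof. exact: divr_gt0. Qed.
Let a_gt0 : 0 < a. Proof. exact: divr_gt0. Qed.
Let ab : a * b0 = 1. Proof. by rewrite /a /b0; field; rewrite !gt_eqF. Qed.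
Let a2 : 2 * (v ^+ 2)^-1 * rho = a ^+ 2.
Proof.
rewrite /a expr_div_n sqr_sqrtr; last by rewrite mulr_ge0// ltW.
by field; rewrite gt_eqF.
Qed.

Let e x := expR (a * (x - b0)).
Let E x := b0 * e x.

Let e_derive (x : R) : is_derive x 1 e (a * e x).
Proof. exact: is_derive_expR_affine. Qed.

Let E_derive (x : R) : is_derive x 1 E (e x).
Proof.
have d := e_derive x; have -> : E = b0 \*: e by [].
by apply: is_derive_eq; rewrite /GRing.scale/= mulrA (mulrC b0) ab mul1r.
Qed.

Let eb0 : e b0 = 1. Proof. by rewrite /e subrr mulr0 expR0. Qed.

Let w (_ : 'I_2) x := if x <= b0 then E x else x.
Let s (_ : 'I_2) x := if x <= b0 then e x else 1.

Let sE i x : b0 <= x -> s i x = 1.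
Proof.
move=> bx; rewrite /s; case: ifPn => // xb.
by have -> : x = b0 by apply/eqP; rewrite eq_le xb.
Qed.

Let wd i (x : R) : is_derive x 1 (w i) (s i x).
Proof.
apply: (@is_derive_glue _ E id).
- by rewrite /E eb0 mulr1.
- by move=> xb; rewrite /s xb; exact: E_derive.
- by move=> bx; rewrite sE//; exact: is_derive_id.
Qed.

Let kE i x : kgen lambda rho w i x = rho * w i x.
Proof. by rewrite /kgen /w; ring. Qed.

(** With one volatility both regimes have the same value, the coupling cancels from [kgen], and the
    classical perpetual problem remains: the exponent solves [half v^2 a^2 = rho], and [a * b0 = 1]
    is smooth fit. *)
Lemma verification_equal_volatilities : exists w s,
  verification sigma lambda rho (fun=> v / Num.sqrt (2 * rho)) w s.
Proof.
exists w, s.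
have s0 i x : 0 <= s i x by rewrite /s; case: ifP => // _; exact: expR_ge0.
have ele1 x : x <= b0 -> e x <= 1.
  by move=> xb; rewrite -eb0 ler_expR ler_wpM2l ?(ltW a_gt0)// lerD2r.
have sle1 i x : s i x <= 1 by rewrite /s; case: ifP => // /ele1.
have snd i x y : x <= y -> s i x <= s i y.
  move=> xy; have [yb|/ltW bY] := leP y b0; last by rewrite (sE i bY).
  rewrite /s yb (le_trans xy yb) ler_expR ler_wpM2l ?(ltW a_gt0)//.
  by rewrite lerD2r.
have w0 i x : 0 <= w i x.
  rewrite /w; case: ifPn => [_|]; first by rewrite mulr_ge0 ?expR_ge0// ltW.
  by rewrite -ltNge => /ltW; apply: le_trans; exact: ltW.
have wnd i x y : x <= y -> w i x <= w i y.
  by move=> xy; apply: (derive_ge0_nd (fun z _ => wd i z)) => // z _; exact: s0.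
have wlip i x y : x <= y -> w i y - w i x <= y - x.
  move=> xy; have [c _ ->] := mvt_is_derive xy (fun z _ => wd i z).
  by rewrite ler_piMl// subr_ge0.
have kL := kgen_lip lambda_gt0 rho_gt0 wnd wlip.
have L0 i : 0 <= rho + lambda i by rewrite addr_ge0// ltW.
have K0 i : 0 <= 2 * (sigma i ^+ 2)^-1 by rewrite mulr_ge0// invr_ge0 sqr_ge0.
have kg i x : 0 <= kgen lambda rho w i x by rewrite kE mulr_ge0// ltW.
have cle (x y z : R) : x <= b0 -> z <= b0 -> x <= y <= z -> y <= b0.
  by move=> _ zb /andP[_ yz]; exact: le_trans zb.
have ddE i x : x <= b0 -> a * e x = 2 * (sigma i ^+ 2)^-1 * kgen lambda rho w i x.
  move=> xb; rewrite kE mulrA sigmaE a2 /w xb /E expr2.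
  have -> : a * a * (b0 * e x) = a * (a * b0) * e x by ring.
  by rewrite ab mulr1.
apply: verification_of_slopes => //.
- by move=> i; rewrite /w lexx /E eb0 mulr1.
- move=> i; apply: (slope_le_glue (a := b0)) => //.
  + by move=> x y xy; have [] := kL i x y xy.
  + apply: (@slope_leS _ _ _ _ _ _ (fun x => x <= b0)); first by move=> ? [].
    apply: (@slope_le_eq _ _ e); first by move=> x xb; rewrite /s xb.
    apply: (slope_le_smooth (ddf := fun x => a * e x)) => //.
      by move=> x xb; exact: ddE.
    by move=> x y xy; have [] := kL i x y xy.
  + by apply: (@slope_le_cst _ _ _ _ _ _ 1) => // u [_ /(sE i) ->].
- move=> i.
  apply: (@slope_le_eq _ _ (fun x => - e x)); first by move=> x xb; rewrite /s xb.
  apply: (slope_le_smooth (ddf := fun x => - (a * e x))) => //.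
  + by move=> x _; exact: is_deriveN.
  + by move=> x xb; rewrite (ddE i)// mulrN.
  + by move=> x y xy; have [] := kL i x y xy; lra.
Qed.

End EqualVolatilities.

(** * Integrals of non-measurable functions and conditional kernels *)

Section IntegralMonotonicity.
Context d (T : measurableType d) (R : realType).
Variable mu : {measure set T -> \bar R}.
Implicit Types (f g : T -> \bar R) (D : set T).
Local Open Scope ereal_scope.
Import HBNNSimple.

(* The integral is a supremum over simple minorants, so monotonicity holds
   without any measurability assumption. *)
Lemma ge0_ae_le_integralT f g : (forall x, 0 <= f x) -> (forall x, 0 <= g x) ->
  {ae mu, forall x, f x <= g x} -> \int[mu]_x f x <= \int[mu]_x g x.
Proof.
move=> f0 g0 [N [mN N0 fgN]].
rewrite !ge0_integralTE//; apply: ge_ereal_sup => _ [h hf <-].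
have mNC : measurable (~` N) by exact: measurableC.
pose h' := mul_nnsfun h (indic_nnsfun R mNC).
have h'E x : h' x = (h x * \1_(~` N) x)%R by [].
have h'g x : (h' x)%:E <= g x.
  rewrite h'E indicE; have [xN|xN] := boolP (x \in ~` N); last by rewrite mulr0.
  rewrite mulr1 (le_trans (hf x))//; apply: contrapT => /fgN Nx.
  by move: xN; rewrite inE.
have -> : sintegral mu h = sintegral mu h'.
  rewrite -!integralT_nnsfun; apply: ge0_ae_eq_integral => //.
  - exact/measurable_EFinP.
  - exact/measurable_EFinP.
  - by move=> x _; rewrite lee_fin.
  - by move=> x _; rewrite lee_fin.
  - exists N; split => // x /= /not_implyP[_]; apply: contra_notP => xN.
    by rewrite /= mindicE mem_set// mulr1.
by apply: ereal_sup_ubound; exists h'.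
Qed.

(** Positive parts are ordered the same way and negative parts the opposite way, so the nonnegative
    case applies to both. *)
Lemma ae_le_integral D f g : {ae mu, forall x, D x -> f x <= g x} ->
  \int[mu]_(x in D) f x <= \int[mu]_(x in D) g x.
Proof.
move=> fg; rewrite !(integral_mkcond D).
have {}fg : {ae mu, forall x, (f \_ D) x <= (g \_ D) x}.
  by apply: filterS fg => x fgx; rewrite !patchE; case: ifPn => // /[!inE]/fgx.
rewrite integralE [leRHS]integralE; apply: leeB.
  apply: ge0_ae_le_integralT => //; apply: filterS fg => x fgx.
  by rewrite !funeposE; rewrite ge_max le_max fgx/= le_max lexx orbT.
apply: ge0_ae_le_integralT => //; apply: filterS fg => x fgx.
by rewrite !funenegE; rewrite ge_max le_max leeN2 fgx/= le_max lexx orbT.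
Qed.

Lemma ae_eq_integral_nonmeas D f g : {ae mu, forall x, D x -> f x = g x} ->
  \int[mu]_(x in D) f x = \int[mu]_(x in D) g x.
Proof.
move=> fg; apply/eqP; rewrite eq_le; apply/andP.
by split; apply: ae_le_integral; apply: filterS fg => x + Dx => /(_ Dx) ->.
Qed.

Lemma le_integral_nonmeas D f g : (forall x, D x -> f x <= g x) ->
  \int[mu]_(x in D) f x <= \int[mu]_(x in D) g x.
Proof. by move=> fg; apply: ae_le_integral; exact: aeW. Qed.

Lemma ge0_integral_mrestr D (mD : measurable D) f : measurable_fun setT f ->
  (forall x, 0 <= f x) ->
  \int[mrestr mu mD]_x f x = \int[mu]_(x in D) f x.
Proof.
move=> mf f0; have mDC : measurable (~` D) by exact: measurableC.
rewrite -(setUv D) (ge0_integral_setU _ mD mDC)//; last 2 first.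
- exact: measurable_funTS.
- by rewrite disj_set2E setICr.
rewrite [X in _ + X](_ : _ = 0) ?adde0; last first.
  apply: null_set_integral => //.
  - exact: measurable_funTS.
  - by rewrite /= /mrestr setICl measure0.
apply: eq_measure_integral => A mA AD.
by rewrite /= /mrestr setIidl.
Qed.

End IntegralMonotonicity.

Section ImageMeasure.
Context d d' (T : measurableType d) (T' : measurableType d') (R : realType).
Variables (mu : {finite_measure set T -> \bar R}) (phi : T -> T').
Hypothesis mphi : measurable_fun setT phi.
Local Open Scope ereal_scope.

(** The measurability proof is an argument so that the measure structures below can be attached to
    the pushforward under this name. *)
Definition image_measure of measurable_fun setT phi : set T' -> \bar R :=
  pushforward mu phi.
Local Notation im := (image_measure mphi).

Let mI A : measurable A -> measurable (phi @^-1` A).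
Proof. by move=> mA; rewrite -[X in measurable X]setTI; exact: mphi. Qed.

Let im0 : im set0 = 0.
Proof. by rewrite /image_measure /pushforward preimage_set0 measure0. Qed.

Let im_ge0 A : 0 <= im A. Proof. exact: measure_ge0. Qed.

Let im_sigma : semi_sigma_additive im.
Proof.
move=> F mF tF mUF; rewrite /image_measure /pushforward preimage_bigcup.
apply: measure_semi_sigma_additive.
- by move=> n; exact: mI.
- apply/trivIsetP => /= i j _ _ ij; rewrite -preimage_setI.
  by move/trivIsetP : tF => /(_ _ _ _ _ ij) ->//; rewrite preimage_set0.
- by rewrite -preimage_bigcup; exact: mI.
Qed.

HB.instance Definition _ := isMeasure.Build _ _ _ im im0 im_ge0 im_sigma.

Let im_fin : fin_num_fun im.
Proof.
by move=> A mA; rewrite /image_measure /pushforward fin_num_measure//; exact: mI.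
Qed.

HB.instance Definition _ := Measure_isFinite.Build _ _ _ im im_fin.

Lemma ge0_integral_image (f : T' -> \bar R) : measurable_fun setT f ->
  (forall x, 0 <= f x) -> \int[im]_x f x = \int[mu]_x f (phi x).
Proof.
move=> mf f0; rewrite -(preimage_setT phi).
by rewrite -(ge0_integral_pushforward mphi).
Qed.

End ImageMeasure.

Section ConditionalKernel.
Context d d1 d2 (T : measurableType d) (T1 : measurableType d1)
  (T2 : measurableType d2) (R : realType).
Variables (mu : {finite_measure set T -> \bar R}) (nu : probability T2 R).
Variables (phi1 : T -> T1) (phi2 : T -> T2).
Hypotheses (m1 : measurable_fun setT phi1) (m2 : measurable_fun setT phi2).
Variables (D E : set T) (p : {nonneg R}).
Hypotheses (mD : measurable D) (mE : measurable E).
Hypothesis kernelE : forall A U, measurable A -> measurable U ->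
  (mu (phi1 @^-1` A `&` phi2 @^-1` U `&` D) =
   p%:num%:E * mu (phi1 @^-1` A `&` E) * nu U)%E.
Local Open Scope ereal_scope.

(** [kernelE] identifies two measures on rectangles, and uniqueness of the product measure extends
    this to the whole product. In the application [phi1] carries the past, [phi2] the Brownian
    increment, [D] the regimes at both ends of a step and [E] the one at its start. *)
Lemma ge0_integral_kernel (G : T1 * T2 -> \bar R) : measurable_fun setT G ->
  (forall z, 0 <= G z) ->
  \int[mu]_(w in D) G (phi1 w, phi2 w) =
  p%:num%:E * \int[mu]_(w in E) \int[nu]_b G (phi1 w, b).
Proof.
move=> mG G0.
have m12 : measurable_fun setT (fun w => (phi1 w, phi2 w)).
  exact: measurable_fun_pair.
have mI A : measurable A -> measurable (phi1 @^-1` A).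
  by move=> mA; rewrite -[X in measurable X]setTI; exact: m1.
transitivity (\int[image_measure (mrestr mu mD) m12]_z G z).
  by rewrite ge0_integral_image// ge0_integral_mrestr//; exact: measurableT_comp.
transitivity (\int[image_measure (mrestr mu mE) m1 \x mscale p nu]_z G z).
  apply: eq_measure_integral => A mA _.
  apply/esym/product_measure_unique => // U V mU mV.
  rewrite /image_measure /pushforward /mrestr /= /mscale /= muleCA muleA.
  by rewrite -kernelE.
rewrite fubini_tonelli1//=.
transitivity (\int[image_measure (mrestr mu mE) m1]_x (p%:num%:E * \int[nu]_y G (x, y))).
  apply: eq_integral => x _; rewrite /fubini_F ge0_integral_mscale//.
  exact: measurableT_comp.
have mF : measurable_fun setT (fun x => \int[nu]_y G (x, y)).
  exact: measurable_fun_fubini_tonelli_F.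
have F0 x : 0 <= \int[nu]_y G (x, y) by exact: integral_ge0.
rewrite ge0_integralZl//; congr (_ * _).
by rewrite ge0_integral_image// ge0_integral_mrestr//; exact: (measurableT_comp mF).
Qed.

End ConditionalKernel.

(** * Gaussian moments *)

Section Density.
Context d (T : measurableType d) (R : realType).
Variables (mu nu : {measure set T -> \bar R}) (g : T -> R).
Hypotheses (g0 : forall x, 0 <= g x) (mg : measurable_fun setT g).
Hypothesis nuE : forall A, measurable A -> (nu A = \int[mu]_(x in A) (g x)%:E)%E.
Local Open Scope ereal_scope.
Import HBNNSimple.

Let density_indic (h : {nnsfun T >-> R}) r :
  \int[nu]_x (r * \1_(h @^-1` [set r]) x)%:E =
  \int[mu]_x ((r * \1_(h @^-1` [set r]) x)%:E * (g x)%:E).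
Proof.
rewrite integralZl_indic_nnsfun// integral_indic// setIT nuE//.
have [r0|r0] := leP 0%R r; last first.
  rewrite preimage_nnfun0// integral_set0 mule0.
  apply/esym/integral0_eq => x _.
  by rewrite indicE in_set0 mulr0 mul0e.
under [RHS]eq_integral do rewrite EFinM -muleA.
rewrite ge0_integralZl//; last 2 first.
- apply: emeasurable_funM; last exact/measurable_EFinP.
  by apply/measurable_EFinP; exact: measurable_indic.
- by move=> x _; rewrite mule_ge0// lee_fin.
congr (_ * _); rewrite integral_mkcond; apply: eq_integral => x _.
by rewrite patchE indicE; case: ifP => _; rewrite ?mul1e ?mul0e.
Qed.

Let density_nnsfun (h : {nnsfun T >-> R}) :
  \int[nu]_x (h x)%:E = \int[mu]_x ((h x)%:E * (g x)%:E).
Proof.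
under [LHS]eq_integral do rewrite fimfunE -fsumEFin//.
rewrite ge0_integral_fsum//; last 2 first.
- by move=> r; exact/measurable_EFinP/measurableT_comp.
- by move=> n x _; rewrite EFinM nnfun_muleindic_ge0.
under [RHS]eq_integral.
  move=> x _; rewrite fimfunE -fsumEFin// ge0_mule_fsuml; last first.
    by move=> r; rewrite EFinM nnfun_muleindic_ge0.
  over.
rewrite [RHS]ge0_integral_fsum//; last 2 first.
- move=> r; apply: emeasurable_funM; last exact/measurable_EFinP.
  exact/measurable_EFinP/measurableT_comp.
- move=> n x _; rewrite mule_ge0 ?lee_fin//.
  by rewrite -lee_fin EFinM nnfun_muleindic_ge0.
by apply: eq_fsbigr => r _; exact: density_indic.
Qed.

Lemma ge0_integral_density (f : T -> \bar R) : measurable_fun setT f ->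
  (forall x, 0 <= f x) -> \int[nu]_x f x = \int[mu]_x (f x * (g x)%:E).
Proof.
move=> mf f0; pose f_ := nnsfun_approx measurableT mf.
transitivity (limn (fun n => \int[nu]_x (f_ n x)%:E)).
  rewrite -monotone_convergence//=.
  - by apply: eq_integral => x _; apply/esym/cvg_lim => //; exact: cvg_nnsfun_approx.
  - by move=> n; exact/measurable_EFinP.
  - by move=> n x _; rewrite lee_fin.
  - by move=> x _ m n mn; rewrite lee_fin; exact/lefP/nd_nnsfun_approx.
transitivity (limn (fun n => \int[mu]_x ((f_ n x)%:E * (g x)%:E))).
  by congr (limn _); apply/funext => n; exact: density_nnsfun.
rewrite -monotone_convergence//=.
- apply: eq_integral => x _; apply/cvg_lim => //.
  by apply: cvgeMr => //; exact: cvg_nnsfun_approx.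
- move=> n; apply: emeasurable_funM; exact/measurable_EFinP.
- by move=> n x _; rewrite mule_ge0// lee_fin.
- move=> x _ m n mn; rewrite lee_wpmul2r ?lee_fin//.
  exact/lefP/nd_nnsfun_approx.
Qed.

End Density.

Section GaussianMoments.
Context {R : realType}.
Variable s : R.
Hypothesis s_gt0 : 0 < s.
Local Notation mu := (@lebesgue_measure R).
Local Notation phi := (normal_pdf 0 s).
Local Notation N := (normal_prob 0 s).

Let s_neq0 : s != 0. Proof. by rewrite gt_eqF. Qed.

Lemma is_derive_normal_pdf (x : R) :
  is_derive x 1 phi (- (x / s ^+ 2) * phi x).
Proof.
rewrite normal_pdfE// /normal_fun.
have -> : (fun x0 : R => normal_peak s * expR (- (x0 - 0) ^+ 2 / (s ^+ 2 *+ 2))) =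
  normal_peak s \*: (expR \o (- (s ^+ 2 *+ 2)^-1 \*: ((id : R -> R) ^+ 2))).
  apply/funext => y; rewrite !fctE /GRing.scale/= subr0; congr (_ * expR _).
  by rewrite /GRing.scale/= mulrC mulrN mulNr.
apply: is_derive_eq; rewrite subr0 /GRing.scale/= /GRing.scale/= ?fctE.
have -> : - (s ^+ 2 *+ 2)^-1 * x ^+ 2 = - x ^+ 2 / (s ^+ 2 *+ 2) by rewrite mulNr mulrC mulNr.
by field.
Qed.

Lemma continuous_is_derive (g dg : R -> R) :
  (forall x : R, is_derive x 1 g (dg x)) -> continuous g.
Proof.
by move=> gd x; apply/differentiable_continuous/derivable1_diffP; case: (gd x).
Qed.

Let cphi : continuous phi. Proof. exact: continuous_is_derive is_derive_normal_pdf. Qed.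

Lemma within_continuousT (g : R -> R) (A : set R) :
  continuous g -> {within A, continuous g}.
Proof. by move=> cg; apply: continuous_subspaceT. Qed.

(* Stein's identity on a symmetric interval. *)
Lemma gauss_by_parts (g dg : R -> R) (a : R) : 0 < a ->
  (forall x : R, is_derive x 1 g (dg x)) -> continuous dg ->
  (\int[mu]_(x in `[(- a)%R, a]) (x * g x * phi x - s ^+ 2 * dg x * phi x)%:E =
   (s ^+ 2 * (g (- a) - g a) * phi a)%:E)%E.
Proof.
move=> a0 gd cdg.
have cg := continuous_is_derive gd.
pose F x := - s ^+ 2 * g x * phi x.
have Fd (x : R) : is_derive x 1 F (x * g x * phi x - s ^+ 2 * dg x * phi x).
  have -> : F = (- s ^+ 2) \*: (g * phi).
    by apply/funext => y; rewrite /F !fctE /GRing.scale/= -mulrA.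
  have pd := is_derive_normal_pdf x.
  by apply: is_derive_eq; rewrite /GRing.scale/= /GRing.scale/=; field.
have cF := continuous_is_derive Fd.
have ca : - a < a by rewrite gtrN.
rewrite (@continuous_FTC2 _ _ F (- a) a)//.
- rewrite -EFinB /F (_ : phi (- a) = phi a); last first.
    by rewrite !normal_pdfE// /normal_fun !subr0 sqrrN.
  by congr EFin; ring.
- apply: within_continuousT => x; apply: cvgB.
    apply: cvgM; last exact: cphi.
    by apply: cvgM; [exact: cvg_id|exact: cg].
  apply: cvgM; last exact: cphi.
  by apply: cvgM; [exact: cvg_cst|exact: cdg].
- split; first by move=> x _; case: (Fd x).
  + by apply: cvg_at_right_filter; exact: cF.
  + by apply: cvg_at_left_filter; exact: cF.
- by move=> x _; rewrite derive1E; case: (Fd x).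
Qed.

Let I (n : nat) : set R := `[(- n.+1%:R)%R, n.+1%:R%R].

Let ndI : nondecreasing_seq I.
Proof.
move=> m n mn; rewrite subsetEset => x; rewrite /I /= !in_itv/= => /andP[mx xm].
by rewrite (le_trans _ mx) ?(le_trans xm) ?lerN2 ?ler_nat.
Qed.

Let bigcupI : \bigcup_n I n = setT.
Proof.
apply/seteqP; split => // x _.
have [n xn] : exists n : nat, `|x| <= n%:R.
  by exists (Num.truncn `|x|).+1; rewrite ltW// Num.Theory.truncnS_gt.
exists n => //; rewrite /I/= in_itv/= -ler_norml (le_trans xn)//.
by rewrite ler_nat.
Qed.

Let cvgI (f : R -> \bar R) : measurable_fun setT f -> (forall x, 0 <= f x)%E ->
  (\int[mu]_(x in I n) f x @[n --> \oo] --> \int[mu]_x f x)%E.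
Proof.
move=> mf f0; rewrite -bigcupI; apply: ge0_nondecreasing_set_cvg_integral.
- exact: ndI.
- by move=> i; exact: measurable_itv.
- by move=> i; exact: measurable_funTS.
- by move=> i x _; exact: f0.
Qed.

Let intI (f : R -> R) n : continuous f -> mu.-integrable (I n) (EFin \o f).
Proof.
move=> cf; apply: continuous_compact_integrable; first exact: segment_compact.
exact: within_continuousT.
Qed.

Let mphi : measurable_fun setT phi. Proof. exact: measurable_normal_pdf. Qed.

Let NE (f : R -> \bar R) : measurable_fun setT f -> (forall x, 0 <= f x)%E ->
  (\int[N]_x f x = \int[mu]_x (f x * (phi x)%:E))%E.
Proof. by move=> mf f0; apply: ge0_integral_density => // x; exact: normal_pdf_ge0. Qed.

(** Stein's identity rearranged so that the choice of [g] expresses the moment [p] through [q]; the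
    boundary term stays explicit, to be sent to 0 or discarded by its sign. *)
Let by_parts_I (p q g dg : R -> R) n :
  (forall x : R, is_derive x 1 g (dg x)) -> continuous dg ->
  continuous p -> continuous q ->
  (forall x, x * g x - s ^+ 2 * dg x = p x - q x) ->
  (\int[mu]_(x in I n) (p x * phi x)%:E =
   \int[mu]_(x in I n) (q x * phi x)%:E
   + (s ^+ 2 * (g (- n.+1%:R) - g n.+1%:R) * phi n.+1%:R)%:E)%E.
Proof.
move=> gd cdg cp cq gpq.
have a0 : 0 < n.+1%:R :> R by [].
have cpp : continuous (fun x => p x * phi x).
  by move=> x; apply: cvgM; [exact: cp|exact: cphi].
have cqp : continuous (fun x => q x * phi x).
  by move=> x; apply: cvgM; [exact: cq|exact: cphi].
have <- : (\int[mu]_(x in I n) ((p x * phi x)%:E - (q x * phi x)%:E) =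
    (s ^+ 2 * (g (- n.+1%:R) - g n.+1%:R) * phi n.+1%:R)%:E)%E.
  rewrite -(gauss_by_parts a0 gd cdg); apply: eq_integral => x _.
  rewrite -EFinB; congr EFin.
  have e (z : R) : z * g z * phi z - s ^+ 2 * dg z * phi z = p z * phi z - q z * phi z.
    by rewrite -!mulrBl gpq.
  exact/esym/e.
rewrite integralB; [|exact: measurable_itv|exact: intI|exact: intI].
rewrite addeC subeK// integrable_fin_num//; [exact: measurable_itv|exact: intI].
Qed.

Let phi_decay : (n.+1%:R * phi n.+1%:R) @[n --> \oo] --> (0 : R).
Proof.
apply: (@squeeze_cvgr _ _ _ _ (fun=> 0) (fun n : nat => normal_peak s * (2 * s ^+ 2) / n.+1%:R)).
- near=> n; rewrite mulr_ge0 ?normal_pdf_ge0//=.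
  set x : R := n.+1%:R.
  have x0 : 0 < x by [].
  rewrite normal_pdfE// /normal_fun subr0 mulNr expRN.
  set u := x ^+ 2 / (s ^+ 2 *+ 2).
  have u0 : 0 < u by rewrite divr_gt0 ?exprn_gt0// pmulrn_rgt0// exprn_gt0.
  have h : (expR u)^-1 <= u^-1.
    rewrite lef_pV2 ?posrE ?expR_gt0// (le_trans _ (expR_ge1Dx u))//.
    by rewrite lerDr.
  apply: (@le_trans _ _ (x * (normal_peak s * u^-1))).
    by rewrite ler_wpM2l ?(ltW x0)// ler_wpM2l// normal_peak_ge0.
  rewrite le_eqVlt; apply/orP; left; apply/eqP.
  by rewrite /u; field; rewrite ?gt_eqF//.
- exact: cvg_cst.
- rewrite -[X in _ --> X](mulr0 (normal_peak s * (2 * s ^+ 2))).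
  apply: cvgM; first exact: cvg_cst.
  exact: cvg_harmonic.
Unshelve. all: by end_near. Qed.

(** Stein's identity with [g x = x + 2 * m], for which [x * g x - s ^+ 2] is
    [(x + m) ^+ 2 - (s ^+ 2 + m ^+ 2)]. The case [m = 0] gives the variance and, by polarization
    with [m = 1], the mean follows from nonnegative integrands only. *)
Let gauss_shifted (m : R) : (\int[N]_x ((x + m) ^+ 2)%:E = (s ^+ 2 + m ^+ 2)%:E)%E.
Proof.
have mx2 : measurable_fun setT (fun x : R => (x + m) ^+ 2).
  by apply: measurable_funX; exact: measurable_funD.
have sm0 : 0 <= s ^+ 2 + m ^+ 2 by rewrite addr_ge0// sqr_ge0.
rewrite NE; last 2 first.
- exact/measurable_EFinP.
- by move=> x; rewrite lee_fin sqr_ge0.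
under eq_integral do rewrite -EFinM.
have h1 : (\int[mu]_(x in I n) ((x + m) ^+ 2 * phi x)%:E @[n --> \oo] -->
    \int[mu]_x ((x + m) ^+ 2 * phi x)%:E)%E.
  apply: cvgI; first by apply/measurable_EFinP; exact: measurable_funM.
  by move=> x; rewrite lee_fin mulr_ge0 ?sqr_ge0// normal_pdf_ge0.
have h2 : (\int[mu]_(x in I n) ((s ^+ 2 + m ^+ 2) * phi x)%:E @[n --> \oo] -->
    (s ^+ 2 + m ^+ 2)%:E)%E.
  rewrite [X in _ --> X](_ : _ = \int[mu]_x ((s ^+ 2 + m ^+ 2) * phi x)%:E)%E; last first.
    under eq_integral do rewrite EFinM.
    rewrite ge0_integralZl//; last 2 first.
    - exact/measurable_EFinP.
    - by move=> x _; rewrite lee_fin normal_pdf_ge0.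
    by rewrite integral_normal_pdf mule1.
  apply: cvgI; first by apply/measurable_EFinP; exact: measurable_funM.
  by move=> x; rewrite lee_fin mulr_ge0 ?sqr_ge0// normal_pdf_ge0.
have h3 : (\int[mu]_(x in I n) ((x + m) ^+ 2 * phi x)%:E @[n --> \oo] -->
    (s ^+ 2 + m ^+ 2)%:E)%E.
  rewrite (_ : (fun n => _) = (fun n => \int[mu]_(x in I n) ((s ^+ 2 + m ^+ 2) * phi x)%:E +
     (- (2 * s ^+ 2) * (n.+1%:R * phi n.+1%:R))%:E)%E); last first.
    apply/funext => n.
    have gd (x : R) : is_derive x 1 (id + cst (2 * m)) (1 : R).
      by apply: is_derive_eq; rewrite addr0.
    have cm : continuous (fun x : R => (x + m) ^+ 2).
      move=> x; apply: (@continuous_comp _ _ _ (fun x => x + m) (fun x => x ^+ 2)).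
        by apply: cvgD; [exact: cvg_id|exact: cvg_cst].
      exact: exprn_continuous.
    have gpq (x : R) : x * (id + cst (2 * m)) x - s ^+ 2 * 1 = (x + m) ^+ 2 - (s ^+ 2 + m ^+ 2).
      by rewrite fctE/=; ring.
    have cc (c : R) : continuous (fun _ : R => c) by move=> x; exact: cvg_cst.
    rewrite (by_parts_I n gd (cc 1) cm (cc _) gpq).
    by congr (_ + _%:E)%E; rewrite !fctE/=; ring.
  rewrite -[X in _ --> X]adde0; apply: cvgeD => //.
  apply: cvg_EFin; first by near=> n.
  rewrite -[X in _ --> X](mulr0 (- (2 * s ^+ 2))).
  by apply: cvgM; [exact: cvg_cst|exact: phi_decay].
exact: (cvg_unique _ h1 h3).
Unshelve. all: by end_near. Qed.

Lemma gauss_second_moment : (\int[N]_x (x ^+ 2)%:E = (s ^+ 2)%:E)%E.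
Proof.
have := gauss_shifted 0; rewrite expr0n addr0 => <-.
by apply: eq_integral => x _; rewrite addr0.
Qed.

(** An upper bound suffices for the Taylor remainder and spares the limit of the boundary term: for
    [g x = x ^+ 3] that term is nonpositive on every symmetric interval. *)
Lemma gauss_fourth_moment : (\int[N]_x (x ^+ 4)%:E <= (3 * s ^+ 4)%:E)%E.
Proof.
have mx k : measurable_fun setT (fun x : R => x ^+ k) by exact: measurable_funX.
rewrite NE; last 2 first.
- exact/measurable_EFinP.
- by move=> x; rewrite lee_fin exprn_even_ge0.
have h1 : (\int[mu]_(x in I n) (x ^+ 4 * phi x)%:E @[n --> \oo] -->
    \int[mu]_x (x ^+ 4 * phi x)%:E)%E.
  apply: cvgI; first by apply/measurable_EFinP; exact: measurable_funM.
  by move=> x; rewrite lee_fin mulr_ge0 ?exprn_even_ge0// normal_pdf_ge0.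
under eq_integral do rewrite -EFinM.
rewrite -(cvg_lim _ h1)//; apply: lime_le.
  by apply/cvg_ex; exists (\int[mu]_x (x ^+ 4 * phi x)%:E)%E; exact: h1.
near=> n.
have gd (x : R) : is_derive x 1 ((id : R -> R) ^+ 3) (3 * x ^+ 2).
  by apply: is_derive_eq; rewrite /GRing.scale/= mulr1.
have cX (c : R) k : continuous (fun x : R => c * x ^+ k).
  by move=> x; apply: cvgM; [exact: cvg_cst|exact: exprn_continuous].
have cX4 : continuous (fun x : R => x ^+ 4) by exact: exprn_continuous.
have gpq (x : R) : x * ((id : R -> R) ^+ 3) x - s ^+ 2 * (3 * x ^+ 2) =
    x ^+ 4 - 3 * s ^+ 2 * x ^+ 2.
  by rewrite exprfctE/=; ring.
rewrite (by_parts_I n gd (cX _ _) cX4 (cX _ _) gpq).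
rewrite (_ : 3 * s ^+ 4 = 3 * s ^+ 2 * s ^+ 2); last by ring.
apply: (@le_trans _ _ (\int[mu]_(x in I n) (3 * s ^+ 2 * x ^+ 2 * phi x)%:E + 0)%E).
  rewrite leeD2l// lee_fin !exprfctE/= mulr_le0_ge0 ?normal_pdf_ge0//.
  rewrite mulr_ge0_le0 ?sqr_ge0// subr_le0 (@le_trans _ _ 0)//.
  by rewrite exprNn -signr_odd/= expr1 mulN1r oppr_le0 exprn_ge0.
rewrite adde0 EFinM -gauss_second_moment NE; last 2 first.
- exact/measurable_EFinP.
- by move=> x; rewrite lee_fin sqr_ge0.
have s20 : 0 <= 3 * s ^+ 2 by rewrite mulr_ge0// sqr_ge0.
rewrite -ge0_integralZl//; last 2 first.
- by apply: emeasurable_funM; exact/measurable_EFinP.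
- by move=> x _; rewrite mule_ge0// lee_fin ?sqr_ge0// normal_pdf_ge0.
have e (x : R) : 0 <= 3 * s ^+ 2 * x ^+ 2 * phi x.
  apply: mulr_ge0; last exact: normal_pdf_ge0.
  by apply: mulr_ge0 => //; exact: sqr_ge0.
rewrite [leLHS]integral_mkcond; apply: le_integral_nonmeas => x _.
rewrite patchE -!EFinM mulrA; case: ifPn => _ //.
by rewrite lee_fin; exact: e.
Unshelve. all: by end_near. Qed.

Let integrable_shifted m : N.-integrable setT (fun x => ((x + m) ^+ 2)%:E).
Proof.
apply/integrableP; split.
  by apply/measurable_EFinP; apply: measurable_funX; exact: measurable_funD.
under eq_integral do rewrite gee0_abs ?lee_fin ?sqr_ge0//.
by rewrite gauss_shifted ltry.
Qed.

Lemma gauss_integrable2 : N.-integrable setT (fun x => (x ^+ 2)%:E).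
Proof.
have := integrable_shifted 0; apply: eq_integrable => // x _.
by rewrite addr0.
Qed.

Lemma gauss_integrable4 : N.-integrable setT (fun x => (x ^+ 4)%:E).
Proof.
apply/integrableP; split; first by apply/measurable_EFinP; exact: measurable_funX.
under eq_integral do rewrite gee0_abs ?lee_fin ?exprn_even_ge0//.
by rewrite (le_lt_trans gauss_fourth_moment)// ltry.
Qed.

Let icst (c : R) : N.-integrable setT (fun=> c%:E).
Proof. exact: finite_measure_integrable_cst. Qed.

Let Ncst (c : R) : (\int[N]_x c%:E = c%:E)%E.
Proof. by rewrite integral_cst//= [X in (_ * X)%E]probability_setT mule1. Qed.

Let gauss_idE (x : R) : (x%:E = 2^-1%:E * (((x + 1) ^+ 2)%:E - (x ^+ 2)%:E - 1%:E))%E.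
Proof. by rewrite -!EFinB -EFinM; congr EFin; field. Qed.

Let integrable_diff : N.-integrable setT
  (fun x => ((x + 1) ^+ 2)%:E - (x ^+ 2)%:E - 1%:E)%E.
Proof.
apply: integrableB => //; apply: integrableB => //.
exact: gauss_integrable2.
Qed.

Lemma gauss_integrable1 : N.-integrable setT (fun x => x%:E).
Proof.
have := integrableZl measurableT 2^-1 integrable_diff.
by apply: eq_integrable => // x _; rewrite -gauss_idE.
Qed.

Lemma gauss_mean : (\int[N]_x x%:E = 0)%E.
Proof.
under eq_integral do rewrite gauss_idE.
rewrite integralZl//.
rewrite integralB//; last first.
  by apply: integrableB => //; exact: gauss_integrable2.
rewrite integralB//; last exact: gauss_integrable2.
rewrite gauss_shifted gauss_second_moment Ncst -!EFinB (_ : s ^+ 2 + 1 ^+ 2 - s ^+ 2 - 1 = 0) ?mule0//.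
by ring.
Qed.

Section Taylor.
Variables (H : R -> R) (a c : R).

Let Q (e f b : R) := (a%:E + c%:E * b%:E + e%:E * (b ^+ 2)%:E + f%:E * (b ^+ 4)%:E)%E.

Let integral_Q e f : (\int[N]_b Q e f b =
  (a + e * s ^+ 2)%:E + f%:E * \int[N]_b (b ^+ 4)%:E)%E.
Proof.
have i1 := integrableZl measurableT c gauss_integrable1.
have i2 := integrableZl measurableT e gauss_integrable2.
have i4 := integrableZl measurableT f gauss_integrable4.
rewrite /Q integralD//; last by apply: integrableD => //; apply: integrableD.
rewrite integralZl//; last exact: gauss_integrable4.
congr (_ + _)%E; rewrite integralD//; last exact: integrableD.
rewrite integralD// Ncst integralZl//; last exact: gauss_integrable1.
rewrite integralZl//; last exact: gauss_integrable2.
rewrite gauss_mean mule0 adde0 gauss_second_moment.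
by rewrite -EFinM -EFinD.
Qed.

(** This is [(s - |b|) ^+ 2 >= 0], weighted so that both terms have Gaussian expectation of order
    [s ^+ 3]. *)
Let cubic (b : R) : `|b| ^+ 3 <= (s * b ^+ 2 + b ^+ 4 / s) / 2.
Proof.
rewrite -(real_normK (num_real b)) (_ : b ^+ 4 = `|b| ^+ 4); last first.
  by rewrite -normrX ger0_norm// exprn_even_ge0.
set u := `|b|; have u0 : 0 <= u by exact: normr_ge0.
rewrite -subr_ge0 (_ : _ - _ = (u ^+ 2 / s) * (s - u) ^+ 2 / 2); last by field.
apply: mulr_ge0 => //; apply: mulr_ge0; last exact: sqr_ge0.
by apply: mulr_ge0; [exact: sqr_ge0|rewrite invr_ge0 ltW].
Qed.

Let fourth : exists2 m4 : R, 0 <= m4 <= 3 * s ^+ 4 &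
  (\int[N]_b (b ^+ 4)%:E = m4%:E)%E.
Proof.
have := integrable_fin_num measurableT gauss_integrable4.
have := gauss_fourth_moment.
have : (0 <= \int[N]_b (b ^+ 4)%:E)%E.
  by apply: integral_ge0 => x _; rewrite lee_fin exprn_even_ge0.
case: (\int[N]_b _)%E => [m4| |]//; rewrite !lee_fin => m0 m3 _.
by exists m4 => //; rewrite m0.
Qed.

(** The factor 2 of the error is 1/2 from the second moment plus 3/2 from the fourth, after [cubic];
    the linear term has mean zero. *)
Lemma gauss_taylor_le e C : 0 <= C ->
  (forall b, H b <= a + c * b + e * b ^+ 2 + C * `|b| ^+ 3) ->
  (\int[N]_b (H b)%:E <= (a + e * s ^+ 2 + 2 * C * s ^+ 3)%:E)%E.
Proof.
move=> C0 Hle.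
apply: (@le_trans _ _ (\int[N]_b Q (e + C * s / 2) (C / (2 * s)) b)%E).
  have h (b : R) : H b <= a + c * b + (e + C * s / 2) * b ^+ 2 + C / (2 * s) * b ^+ 4.
    apply: (le_trans (Hle b)).
    have := ler_wpM2l C0 (cubic b).
    have -> : C * ((s * b ^+ 2 + b ^+ 4 / s) / 2) = C * s / 2 * b ^+ 2 + C / (2 * s) * b ^+ 4.
      by field.
    by rewrite mulrDl; lra.
  apply: le_integral_nonmeas => b _; rewrite /Q -!EFinM -!EFinD lee_fin.
  exact: h.
rewrite integral_Q; have [m4 /andP[m40 m43] ->] := fourth.
rewrite -EFinM -EFinD lee_fin.
have : C / (2 * s) * m4 <= C / (2 * s) * (3 * s ^+ 4).
  by rewrite ler_wpM2l// divr_ge0// mulr_ge0// ltW.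
have -> : C / (2 * s) * (3 * s ^+ 4) = 3 / 2 * C * s ^+ 3 by field.
have -> : (e + C * s / 2) * s ^+ 2 = e * s ^+ 2 + C / 2 * s ^+ 3 by field.
lra.
Qed.

Lemma gauss_taylor_ge e C : 0 <= C ->
  (forall b, a + c * b + e * b ^+ 2 - C * `|b| ^+ 3 <= H b) ->
  ((a + e * s ^+ 2 - 2 * C * s ^+ 3)%:E <= \int[N]_b (H b)%:E)%E.
Proof.
move=> C0 Hge.
apply: (@le_trans _ _ (\int[N]_b Q (e - C * s / 2) (- (C / (2 * s))) b)%E); last first.
  have h (b : R) : a + c * b + (e - C * s / 2) * b ^+ 2 - C / (2 * s) * b ^+ 4 <= H b.
    apply: le_trans (Hge b).
    have := ler_wpM2l C0 (cubic b).
    have -> : C * ((s * b ^+ 2 + b ^+ 4 / s) / 2) = C * s / 2 * b ^+ 2 + C / (2 * s) * b ^+ 4.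
      by field.
    by rewrite mulrBl; lra.
  apply: le_integral_nonmeas => b _; rewrite /Q -!EFinM -!EFinD lee_fin mulNr.
  exact: h.
rewrite integral_Q; have [m4 /andP[m40 m43] ->] := fourth.
rewrite -EFinM -EFinD lee_fin.
have : C / (2 * s) * m4 <= C / (2 * s) * (3 * s ^+ 4).
  by rewrite ler_wpM2l// divr_ge0// mulr_ge0// ltW.
have -> : C / (2 * s) * (3 * s ^+ 4) = 3 / 2 * C * s ^+ 3 by field.
have -> : (e - C * s / 2) * s ^+ 2 = e * s ^+ 2 - C / 2 * s ^+ 3 by field.
lra.
Qed.

End Taylor.

End GaussianMoments.

(** * The filtration, the chain and the Brownian increments *)

Section Generator.
Context {R : realType}.
Variable lambda : 'I_2 -> R.
Hypothesis lambda_gt0 : forall i, 0 < lambda i.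

Let L := lambda reg1 + lambda reg2.
Let L_gt0 : 0 < L. Proof. exact: addr_gt0. Qed.

(** The eigenvalues are 0 and [- L]; hence all positive powers are multiples of the generator and
    its exponential is explicit. *)
Lemma generator_sq : generator lambda *m generator lambda = - L *: generator lambda.
Proof.
apply/matrixP => i j; rewrite !mxE big_ord_recl big_ord1 !mxE /=.
have -> : lift ord0 ord0 = reg2 by apply/val_inj.
by case: (regP i) => ->; case: (regP j) => ->; rewrite /L /=; ring.
Qed.

Lemma generator_exp h k :
  (h *: generator lambda) ^+ k.+1 = (- L * h) ^+ k *: (h *: generator lambda).
Proof.
elim: k => [|k IH]; first by rewrite expr1 expr0 scale1r.
rewrite exprS IH -[LHS]/(_ *m _) -scalemxAr -scalemxAl -scalemxAr generator_sq.
by rewrite !scalerA exprS; congr (_ *: _); ring.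
Qed.

Definition jump_prob (i : 'I_2) (h : R) : R :=
  lambda i / L * (1 - expR (- L * h)).

Lemma expmx_generator h i j : expmx (h *: generator lambda) i j =
  if i == j then 1 - jump_prob i h else jump_prob i h.
Proof.
have L0 : L != 0 by rewrite gt_eqF.
pose c := - (generator lambda i j / L).
pose x := - L * h.
have -> : expmx (h *: generator lambda) i j = ((i == j)%:R - c) + c * expR x.
  rewrite /expmx.
  (* Every term is [c] times that of the series of [expR x], except that the identity matrix at
     [k = 0] needs the correction [(i == j) - c]. *)
  have -> : (fun k => ((h *: generator lambda) ^+ k) i j / k`!%:R) =
      (fun k => ((i == j)%:R - c) * (k == 0)%:R + c * exp_coeff x k).
    apply/funext => -[|k].
      have -> : (h *: generator lambda) ^+ 0 = 1%:M by [].
      by rewrite mxE /exp_coeff /= expr0 fact0; field.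
    rewrite generator_exp -/x !mxE /= mulr0 add0r /exp_coeff /=.
    have -> : (if i == j then - lambda i else lambda i) = - L * c.
      by rewrite /c mxE; field.
    have -> : x ^+ k.+1 = x ^+ k * x by rewrite exprSr.
    by rewrite [RHS]mulrA; congr (_ * _); rewrite /x; ring.
  apply: cvg_lim => //.
  have -> : series (fun k => ((i == j)%:R - c) * (k == 0)%:R + c * exp_coeff x k) =
    (fun n => ((i == j)%:R - c) * (0 < n)%:R + c * series (exp_coeff x) n).
    apply/funext => n; rewrite /series /= big_split /= -!mulr_sumr; congr (_ * _ + _).
    case: n => [|n]; first by rewrite big_nil.
    by rewrite big_nat_recl//= big1 ?addr0.
  apply: cvgD.
    apply: cvg_near_cst; near=> n.
    by rewrite (_ : (0 < n)%N) ?mulr1//; near: n; exists 1%N.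
  apply: cvgM; first exact: cvg_cst.
  by rewrite /expR; exact: (@is_cvg_series_exp_coeff R x).
rewrite /c mxE /jump_prob -/x; case: ifP => _ /=; field; exact: L0.
Unshelve. all: by end_near. Qed.

Lemma jump_prob_ge0 i h : 0 <= h -> 0 <= jump_prob i h.
Proof.
move=> h0; apply: mulr_ge0; first by rewrite divr_ge0// ltW.
rewrite subr_ge0 -expR0 ler_expR.
by rewrite mulNr oppr_le0 mulr_ge0// ltW.
Qed.

Lemma jump_prob_le i h : jump_prob i h <= lambda i * h.
Proof.
rewrite /jump_prob -mulrA; apply: ler_wpM2l; first exact: ltW.
rewrite ler_pdivrMl//.
have := expR_ge1Dx (- L * h).
by rewrite mulNr; move: (expR (- (L * h))) (L * h) => E u; lra.
Qed.

Lemma jump_prob_le1 i h : 0 <= h -> jump_prob i h <= 1.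
Proof.
move=> h0; rewrite /jump_prob -[leRHS]mulr1; apply: ler_pM.
- by rewrite divr_ge0// ltW.
- by rewrite subr_ge0 -expR0 ler_expR mulNr oppr_le0 mulr_ge0// ltW.
- rewrite ler_pdivrMr// mul1r /L.
  by case: (regP i) => ->; rewrite ?lerDl ?lerDr ltW.
- by rewrite lerBlDr lerDl expR_ge0.
Qed.

(** With [u = L * h], this is [expR (- u) <= (1 + u)^-1 <= 1 - u + u ^+ 2]. *)
Lemma jump_prob_ge i h : 0 <= h -> lambda i * h - lambda i * L * h ^+ 2 <= jump_prob i h.
Proof.
move=> h0; rewrite /jump_prob.
have Lh : 0 <= L * h by rewrite mulr_ge0// ltW.
have e : expR (- L * h) <= 1 - L * h + (L * h) ^+ 2.
  rewrite mulNr expRN.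
  have := expR_ge1Dx (L * h).
  set u := L * h in Lh *; move=> eu.
  have u1 : 0 < 1 + u by rewrite ltr_wpDr.
  apply: (@le_trans _ _ (1 + u)^-1); first by rewrite lef_pV2 ?posrE ?expR_gt0.
  rewrite -[leLHS]mulr1 ler_pdivrMl//.
  have : 0 <= u ^+ 3 by rewrite exprn_ge0.
  by nra.
have -> : lambda i * h - lambda i * L * h ^+ 2 = lambda i / L * (L * h - (L * h) ^+ 2).
  by field; rewrite gt_eqF.
apply: ler_wpM2l; first by rewrite divr_ge0// ltW.
by move: e; move: (expR _) (L * h) => E u; lra.
Qed.

End Generator.

(** * The augmented filtration and the one-step kernel *)

Section Filtration.
Context {R : realType} {d : measure_display} {Omega : measurableType d}.
Variable P : probability Omega R.
Hypothesis complete_P : measure_is_complete P.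
Variables (B : R -> Omega -> R) (eps : R -> Omega -> 'I_2).
Hypothesis mB : forall t : R, 0 <= t -> measurable_fun setT (B t).
Hypothesis meps : forall (t : R) j, 0 <= t -> measurable [set w | eps t w = j].

Local Notation F := (augmented_filtration P B eps).

Definition filtration_generators (t : R) : set (set Omega) :=
  events_of B `[0, t] `|` chain_events_of eps `[0, t]
  `|` [set N | P.-negligible N].

(* [Omega] equipped with the sigma-algebra at time [t], so that being
   F_t-measurable is [measurable_fun [set: filtered t]]. *)
Definition filtered (t : R) := g_sigma_algebraType (filtration_generators t).

Lemma filtrationE t A : F t A = measurable (A : set (filtered t)).
Proof. by []. Qed.

Lemma sub_filtration (t : R) (C : set (set Omega)) : sigma_algebra setT C ->
  (forall r U, 0 <= r <= t -> measurable U -> C (B r @^-1` U)) ->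
  (forall r j, 0 <= r <= t -> C [set w | eps r w = j]) ->
  P.-negligible `<=` C -> F t `<=` C.
Proof.
move=> sC CB Ce CN; apply: smallest_sub => // A [[[r rt [U mU ->]]|[r rt [j ->]]]|].
- by apply: CB => //; move: rt; rewrite /= in_itv.
- by apply: Ce; move: rt; rewrite /= in_itv.
- exact: CN.
Qed.

Lemma filtration_measurable t A : F t A -> measurable A.
Proof.
apply: sub_filtration A.
- exact: sigma_algebra_measurable.
- move=> r U /andP[r0 _] mU; rewrite -[X in measurable X]setTI.
  by apply: mB.
- by move=> r j /andP[r0 _]; exact: meps.
- exact: complete_P.
Qed.

Lemma filtration_le s t : s <= t -> F s `<=` F t.
Proof.
move=> st; apply: sub_filtration.
- exact: smallest_sigma_algebra.
- move=> r U /andP[r0 rs] mU; apply: sub_sigma_algebra; left; left.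
  by exists r; [rewrite /= in_itv/= r0 (le_trans rs)|exists U].
- move=> r j /andP[r0 rs]; apply: sub_sigma_algebra; left; right.
  by exists r; [rewrite /= in_itv/= r0 (le_trans rs)|exists j].
- by move=> N nN; apply: sub_sigma_algebra; right.
Qed.

Lemma filtration_B r t U : 0 <= r <= t -> measurable U -> F t (B r @^-1` U).
Proof.
move=> rt mU; apply: sub_sigma_algebra; left; left.
by exists r; [rewrite /= in_itv|exists U].
Qed.

Lemma filtration_eps r t j : 0 <= r <= t -> F t [set w | eps r w = j].
Proof.
move=> rt; apply: sub_sigma_algebra; left; right.
by exists r; [rewrite /= in_itv|exists j].
Qed.

Lemma filtration_negligible t N : P.-negligible N -> F t N.
Proof. by move=> nN; apply: sub_sigma_algebra; right. Qed.

Lemma measurable_filtered t d' (T : measurableType d') (f : Omega -> T) :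
  measurable_fun [set: filtered t] f -> measurable_fun [set: Omega] f.
Proof.
move=> mf _ U mU; apply: (@filtration_measurable t).
exact: (mf measurableT U mU).
Qed.

Lemma measurable_filtered_le s t d' (T : measurableType d') (f : Omega -> T) :
  s <= t -> measurable_fun [set: filtered s] f -> measurable_fun [set: filtered t] f.
Proof.
move=> st mf _ U mU; apply: (filtration_le st).
exact: (mf measurableT U mU).
Qed.

Lemma measurable_filtered_B r t : 0 <= r <= t ->
  measurable_fun [set: filtered t] (B r).
Proof. by move=> rt _ U mU; rewrite setTI; exact: filtration_B. Qed.

Lemma measurable_filtered_eps r t (f : 'I_2 -> R) : 0 <= r <= t ->
  measurable_fun [set: filtered t] (fun w => f (eps r w)).
Proof.
move=> rt.
have mi j : measurable ([set w | eps r w = j] : set (filtered t)).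
  exact: filtration_eps.
have -> : (fun w => f (eps r w)) =
  (fun w => f reg1 * \1_([set w | eps r w = reg1]) w + f reg2 * \1_([set w | eps r w = reg2]) w).
  apply/funext => w; rewrite !indicE.
  case: (regP (eps r w)) => e; rewrite e.
    by rewrite mem_set// memNset ?mulr1 ?mulr0 ?addr0//= e.
  by rewrite memNset ?mem_set ?mulr1 ?mulr0 ?add0r//= e.
apply: measurable_funD; apply: measurable_funM => //; exact: measurable_indic.
Qed.

Section OneStepKernel.
Variable lambda : 'I_2 -> R.
Hypothesis lambda_gt0 : forall i, 0 < lambda i.
Hypothesis brownian_B : brownian_motion P B.
Hypothesis chain_eps : markov_chain P eps (generator lambda).
Hypothesis independent_B_eps : independent_processes P B eps.

Definition transition (h : R) (i j : 'I_2) : R :=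
  if i == j then 1 - jump_prob lambda i h else jump_prob lambda i h.

Let brownian_generated s t U : 0 <= s <= t -> measurable U ->
  <<s events_of B `[0, +oo[ >> [set w | U (B t w - B s w)].
Proof.
move=> /andP[s0 st] mU.
have t0 := le_trans s0 st.
pose O := g_sigma_algebraType (events_of B `[0, +oo[).
have mBr r : 0 <= r -> measurable_fun [set: O] (B r).
  move=> r0 _ V mV; rewrite setTI; apply: sub_sigma_algebra.
  by exists r; [rewrite /= in_itv/= r0|exists V].
have mf : measurable_fun [set: O] (fun w => B t w - B s w).
  by apply: measurable_funB; exact: mBr.
by have := mf measurableT U mU; rewrite setTI.
Qed.

Let sub_events s : <<s events_of B `[0, s] >> `<=` <<s events_of B `[0, +oo[ >>.
Proof.
apply: smallest_sub; first exact: smallest_sigma_algebra.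
move=> A [r rs AU]; apply: sub_sigma_algebra; exists r => //.
by move: rs; rewrite /= !in_itv/= => /andP[->].
Qed.

Let sub_chain_events s : <<s chain_events_of eps `[0, s] >> `<=`
  <<s chain_events_of eps `[0, +oo[ >>.
Proof.
apply: smallest_sub; first exact: smallest_sigma_algebra.
move=> A [r rs AU]; apply: sub_sigma_algebra; exists r => //.
by move: rs; rewrite /= !in_itv/= => /andP[->].
Qed.

Let null_or_conull (M : set Omega) :=
  measurable M /\ (P M = 0%E \/ P (~` M) = 0%E).

Let setI_conull (A M : set Omega) : measurable A -> measurable M ->
  P (~` M) = 0%E -> P (A `&` M) = P A.
Proof.
move=> mA mM M0; rewrite [RHS](_ : _ = P (A `&` M `|` A `&` ~` M)); last first.
  by rewrite -setIUr setUv setIT.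
rewrite measureU//; [|exact: measurableI|apply: measurableI => //; exact: measurableC|]; last first.
  by rewrite setIACA setICr setI0.
rewrite [X in (_ + X)%E](_ : _ = 0%E) ?adde0//.
apply/eqP; rewrite -measure_le0 -M0 le_measure ?inE//; last exact: measurableC.
by apply: measurableI => //; exact: measurableC.
Qed.

Let pi_system s : set (set Omega) := [set A | exists AB AE M,
  [/\ <<s events_of B `[0, s] >> AB, <<s chain_events_of eps `[0, s] >> AE,
      null_or_conull M & A = AB `&` AE `&` M]].

Let pi_system_setI s : setI_closed (pi_system s).
Proof.
move=> _ _ [A [E [M [hA hE [mM hM] ->]]]] [A' [E' [M' [hA' hE' [mM' hM'] ->]]]].
exists (A `&` A'), (E `&` E'), (M `&` M'); split.
- exact: (@measurableI _ (g_sigma_algebraType (events_of B `[0, s]))).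
- exact: (@measurableI _ (g_sigma_algebraType (chain_events_of eps `[0, s]))).
- split; first exact: measurableI.
  case: hM => hM; first by left; apply: subset_measure0 hM => //; exact: measurableI.
  case: hM' => hM'; first by left; apply: subset_measure0 hM' => //; exact: measurableI.
  right; rewrite setCI; apply/eqP; rewrite -measure_le0.
  apply: (le_trans (measureU2 _ _ _)) => //; try exact: measurableC.
  by move/eqP: hM; rewrite -measure_le0 => hM0; move/eqP: hM'; rewrite -measure_le0 => hM0'; rewrite -[leRHS]adde0; apply: leeD.
- by rewrite (setIACA (A `&` E)) (setIACA A).
Qed.

Let measurable_events s A : <<s events_of B `[0, s] >> A -> measurable A.
Proof.
apply: smallest_sub A; first exact: sigma_algebra_measurable.
move=> A [r]; rewrite /= in_itv/= => /andP[r0 _] [U mU ->].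
by rewrite -[X in measurable X]setTI; exact: mB.
Qed.

Let measurable_chain_events s A : <<s chain_events_of eps `[0, s] >> A -> measurable A.
Proof.
apply: smallest_sub A; first exact: sigma_algebra_measurable.
by move=> A [r]; rewrite /= in_itv/= => /andP[r0 _] [j ->]; exact: meps.
Qed.

Let sub_pi_system s : F s `<=` <<s pi_system s >>.
Proof.
have T1 := @measurableT _ (g_sigma_algebraType (events_of B `[0, s])).
have T2 := @measurableT _ (g_sigma_algebraType (chain_events_of eps `[0, s])).
have T3 : null_or_conull setT by split => //; right; rewrite setCT measure0.
apply: sub_filtration.
- exact: smallest_sigma_algebra.
- move=> r U rs mU; apply: sub_sigma_algebra; exists (B r @^-1` U), setT, setT.
  split => //; last by rewrite !setIT.
  by apply: sub_sigma_algebra; exists r; [rewrite /= in_itv|exists U].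
- move=> r j rs; apply: sub_sigma_algebra; exists setT, [set w | eps r w = j], setT.
  split => //; last by rewrite setTI setIT.
  by apply: sub_sigma_algebra; exists r; [rewrite /= in_itv|exists j].
- move=> N nN; apply: sub_sigma_algebra; exists setT, setT, N.
  split => //; last by rewrite setTI setTI.
  by split; [exact: complete_P|left; apply: measure_negligible => //; exact: complete_P].
Qed.

(** Dynkin's argument in the event [A]. On the generating intersections, independence of the two
    processes separates the factors; independence of increments and the Markov property then treat
    one factor each. *)
Lemma one_step_kernel s t i j A U : 0 <= s -> s < t -> F s A -> measurable U ->
  (P (A `&` [set w | U (B t w - B s w)%R] `&`
      ([set w | eps s w = i] `&` [set w | eps t w = j])) =
   (transition (t - s) i j)%:E * P (A `&` [set w | eps s w = i]) *
   normal_prob 0 (Num.sqrt (t - s)) U)%E.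
Proof.
move=> s0 st FA mU.
have t0 : 0 <= t by rewrite (le_trans s0)// ltW.
have [_ _ _ B4 B5] := brownian_B; have [_ _ _ E4] := chain_eps.
set I := [set w | U _]; set Ei := [set w | eps s w = i]; set Ej := [set w | eps t w = j].
have mI : measurable I.
  have mf : measurable_fun [set: Omega] (fun w => B t w - B s w).
    by apply: measurable_funB; exact: mB.
  by rewrite -[X in measurable X]setTI; exact: mf.
have mEi : measurable Ei by exact: meps.
have mEj : measurable Ej by exact: meps.
have PI : P I = normal_prob 0 (Num.sqrt (t - s)) U by rewrite -B4// s0.
rewrite -PI.
pose D : set (set Omega) := [set A | measurable A /\
  (P (A `&` I `&` (Ei `&` Ej)) = (transition (t - s) i j)%:E * P (A `&` Ei) * P I)%E].
suff : F s `<=` D by move=> /(_ _ FA)[].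
have base AB AE : <<s events_of B `[0, s] >> AB -> <<s chain_events_of eps `[0, s] >> AE ->
    D (AB `&` AE).
  move=> hAB hAE; have mAB := measurable_events hAB; have mAE := measurable_chain_events hAE.
  split; first exact: measurableI.
  have hI : <<s events_of B `[0, +oo[ >> (AB `&` I).
    apply: (@measurableI _ (g_sigma_algebraType (events_of B `[0, +oo[))).
      exact: sub_events hAB.
    by apply: brownian_generated => //; rewrite s0 ltW.
  have hE r k : 0 <= r -> <<s chain_events_of eps `[0, +oo[ >> [set w | eps r w = k].
    by move=> r0; apply: sub_sigma_algebra; exists r; [rewrite /= in_itv/= r0|exists k].
  have hEE : <<s chain_events_of eps `[0, +oo[ >> (AE `&` Ei).
    apply: (@measurableI _ (g_sigma_algebraType (chain_events_of eps `[0, +oo[))).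
      exact: sub_chain_events hAE.
    exact: hE.
  have hEEE : <<s chain_events_of eps `[0, +oo[ >> (AE `&` Ei `&` Ej).
    apply: (@measurableI _ (g_sigma_algebraType (chain_events_of eps `[0, +oo[))) => //.
    exact: hE.
  rewrite (_ : AB `&` AE `&` I `&` (Ei `&` Ej) = (AB `&` I) `&` (AE `&` Ei `&` Ej)); last first.
    by rewrite (setIAC AB AE I) !setIA.
  have st' : 0 <= s < t by rewrite s0.
  rewrite independent_B_eps// (B5 s t st' AB I hAB); last by exists U.
  rewrite E4//; last by rewrite s0 ltW.
  rewrite -(setIA AB AE Ei) (independent_B_eps (sub_events hAB) hEE).
  rewrite expmx_generator// /transition.
  set p := (if _ then _ else _)%:E; rewrite [RHS]muleC [RHS]muleCA [RHS]muleC [LHS]muleA.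
  by congr (_ * _)%E; rewrite [RHS]muleCA muleAC muleA muleAC.
have piD : pi_system s `<=` D.
  move=> _ [AB [AE [M [hAB hAE [mM hM] ->]]]].
  have [mA eA] := base _ _ hAB hAE; split; first exact: measurableI.
  case: hM => hM.
    have z X : measurable X -> X `<=` M -> P X = 0%E by move=> mX XM; exact: subset_measure0 hM.
    rewrite z; [|by apply: measurableI; apply: measurableI => //; exact: measurableI|].
      rewrite z ?mule0 ?mul0e//; first by apply: measurableI => //; exact: measurableI.
      by move=> w [[]].
    by move=> w [[[]]].
  rewrite (_ : _ `&` (Ei `&` Ej) = AB `&` AE `&` I `&` (Ei `&` Ej) `&` M); last first.
    by rewrite -!(setIAC _ M).
  have m1 : measurable (AB `&` AE `&` I `&` (Ei `&` Ej)).
    by apply: measurableI; exact: measurableI.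
  by rewrite (setIAC _ M Ei) (setI_conull m1 mM hM) eA setI_conull//; exact: measurableI.
have dD : dynkin D.
  split.
  - have := base setT setT; rewrite setTI; apply.
      exact: (@measurableT _ (g_sigma_algebraType (events_of B `[0, s]))).
    exact: (@measurableT _ (g_sigma_algebraType (chain_events_of eps `[0, s]))).
  - move=> X [mX eX]; split; first exact: measurableC.
    have := base setT setT; rewrite setTI => /(_ _ _)[].
    + exact: (@measurableT _ (g_sigma_algebraType (events_of B `[0, s]))).
    + exact: (@measurableT _ (g_sigma_algebraType (chain_events_of eps `[0, s]))).
    move=> _; rewrite !setTI => eT.
    have cE (Y Z : set Omega) : measurable Y -> measurable Z ->
        (P (~` Y `&` Z) = P Z - P (Y `&` Z))%E.
      move=> mY mZ; rewrite setIC -setDE measureD//; last first.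
        by rewrite ltey_eq fin_num_measure.
      by rewrite setIC.
    rewrite -setIA cE//; last by apply: measurableI => //; exact: measurableI.
    rewrite (setIA X I) eX eT cE//.
    have f1 := fin_num_measure P _ mEi.
    have f2 := fin_num_measure P _ (measurableI _ _ mX mEi).
    have f3 := fin_num_measure P _ mI.
    rewrite -(fineK f1) -(fineK f2) -(fineK f3).
    move: (fine (P Ei)) (fine (P (X `&` Ei))) (fine (P I)) => a b q.
    move: (transition _ _ _) => p.
    have e : p * a * q - p * b * q = p * (a - b) * q by ring.
    by apply: (congr1 EFin e).
  - move=> X tX DX; split; first by apply: bigcup_measurable => k _; have [] := DX k.
    have mX k : measurable (X k) by have [] := DX k.
    rewrite -setIA !setI_bigcupl.
    rewrite measure_bigcup//; last 2 first.
    + by move=> k _; apply: measurableI => //; apply: measurableI => //; exact: measurableI.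
    + exact: trivIset_setIr.
    rewrite measure_bigcup//; last 2 first.
    + by move=> k _; exact: measurableI.
    + exact: trivIset_setIr.
    have tr0 : (0 <= (transition (t - s) i j)%:E)%E.
      have ts0 : 0 <= t - s by rewrite subr_ge0 ltW.
      rewrite lee_fin /transition; case: ifP => _; last exact: jump_prob_ge0.
      by rewrite subr_ge0 jump_prob_le1.
    have fI : P I = (fine (P I))%:E by rewrite fineK// fin_num_measure.
    rewrite [RHS]muleAC {1}fI -EFinM -nneseriesZl//.
    apply: eq_eseriesr => k _; have [_ +] := DX k.
    rewrite -(setIA (X k)) => e; apply: (etrans e).
    by rewrite [LHS]muleAC EFinM -fI.
move=> X /sub_pi_system; rewrite -setI_closed_g_dynkin_g_sigma_algebra//.
by apply: smallest_sub.
Qed.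

End OneStepKernel.
End Filtration.

Lemma sum_regimes (V : nmodType) (f : 'I_2 -> V) : \sum_i f i = f reg1 + f reg2.
Proof.
by rewrite big_ord_recl big_ord1; congr (_ + f _); exact/val_inj.
Qed.

Section Regimes.
Context d (T : measurableType d) (R : realType) (e : T -> 'I_2).
Hypothesis me : forall j, measurable [set w | e w = j].

Lemma measurable_regimes d' (T' : measurableType d') (f : 'I_2 -> T -> T') :
  (forall j, measurable_fun setT (f j)) -> measurable_fun setT (fun w => f (e w) w).
Proof.
move=> mf _ U mU; rewrite setTI.
rewrite (_ : _ @^-1` U = ([set w | e w = reg1] `&` f reg1 @^-1` U) `|`
                         ([set w | e w = reg2] `&` f reg2 @^-1` U)).
  by apply: measurableU; apply: measurableI => //; rewrite -[X in measurable X]setTI; exact: mf.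
apply/seteqP; split => w /=; last by case=> -[->].
by case: (regP (e w)) => -> ?; [left|right].
Qed.

Lemma ge0_integral_regimes (mu : {measure set T -> \bar R}) (D : set T) (f : 'I_2 -> T -> \bar R) :
  measurable D -> (forall j, measurable_fun setT (f j)) -> (forall j w, (0 <= f j w)%E) ->
  (\int[mu]_(w in D) f (e w) w =
   \int[mu]_(w in D `&` [set w | e w = reg1]) f reg1 w +
   \int[mu]_(w in D `&` [set w | e w = reg2]) f reg2 w)%E.
Proof.
move=> mD mf f0.
have mi j : measurable (D `&` [set w | e w = j]) by exact: measurableI.
rewrite [in LHS](_ : D = D `&` [set w | e w = reg1] `|` D `&` [set w | e w = reg2]); last first.
  apply/seteqP; split => w /=; last by case=> -[].
  by case: (regP (e w)) => ->; auto.
rewrite ge0_integral_setU//; last 2 first.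
- exact/measurable_funTS/measurable_regimes.
- by apply/disj_set2P/seteqP; split => // w /= [[_ ->] [_]].
by congr (_ + _)%E; apply: eq_integral => w /[!inE] -[_ /= ->].
Qed.

End Regimes.

(** * Conditional expectations over one step *)

Section Increments.
Context {R : realType} {d : measure_display} {Omega : measurableType d}.
Variable P : probability Omega R.
Hypothesis complete_P : measure_is_complete P.
Variables (B : R -> Omega -> R) (eps : R -> Omega -> 'I_2) (lambda : 'I_2 -> R).
Hypothesis lambda_gt0 : forall i, 0 < lambda i.
Hypothesis brownian_B : brownian_motion P B.
Hypothesis chain_eps : markov_chain P eps (generator lambda).
Hypothesis independent_B_eps : independent_processes P B eps.
Local Notation F := (augmented_filtration P B eps).
Local Notation filtered t := (filtered P B eps t).

Let mB t : 0 <= t -> measurable_fun setT (B t).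
Proof. by have [+ _ _ _ _] := brownian_B; exact. Qed.

Let meps t j : 0 <= t -> measurable [set w | eps t w = j].
Proof. by have [+ _ _ _] := chain_eps; exact. Qed.

Let L := lambda reg1 + lambda reg2.

Lemma transition_ge0 h i j : 0 <= h -> 0 <= transition lambda h i j.
Proof.
move=> h0; rewrite /transition; case: ifP => _; last exact: jump_prob_ge0.
by rewrite subr_ge0 jump_prob_le1.
Qed.

Lemma lambda_le i : lambda i <= L.
Proof. by case: (regP i) => ->; rewrite ?lerDl ?lerDr ltW. Qed.

Let setT_chain t : F t setT.
Proof. exact: (@measurableT _ (filtered t)). Qed.

Lemma measurable_switch s t : 0 <= s -> 0 <= t ->
  measurable [set w | eps s w != eps t w].
Proof.
move=> s0 t0; rewrite (_ : [set _ | _] =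
  ([set w | eps s w = reg1] `&` [set w | eps t w = reg2]) `|`
  ([set w | eps s w = reg2] `&` [set w | eps t w = reg1])).
  by apply: measurableU; apply: measurableI; exact: meps.
apply/seteqP; split => w /=.
  case: (regP (eps s w)) => e; case: (regP (eps t w)) => e'; rewrite e e' ?eqxx//; auto.
by case=> -[-> ->].
Qed.

Lemma prob_switch s t : 0 <= s <= t ->
  (P [set w | eps s w != eps t w] <= (L * (t - s))%:E)%E.
Proof.
move=> /andP[s0 st]; have t0 := le_trans s0 st.
have [<-|sltt] := eqVneq s t.
  rewrite [X in P X](_ : _ = set0) ?measure0 ?subrr ?mulr0//.
  by apply/seteqP; split => // w /=; rewrite eqxx.
have {}sltt : s < t by rewrite lt_neqAle sltt.
have pw i : (P ([set w | eps s w = i] `&` [set w | eps t w = other i]) <=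
    (L * (t - s))%:E * P [set w | eps s w = i])%E.
  have := one_step_kernel complete_P mB meps lambda_gt0 brownian_B chain_eps
    independent_B_eps i (other i) s0 sltt (@setT_chain s) (@measurableT _ R).
  rewrite (_ : [set w | [set: R] _] = setT)// !setTI => ->.
  rewrite [X in (_ * X)%E]probability_setT mule1 lee_wpmul2r//.
  rewrite lee_fin /transition; have -> : (i == other i) = false by case: (regP i) => ->.
  apply: (le_trans (jump_prob_le lambda_gt0 _ _)).
  by rewrite ler_wpM2r ?lambda_le// subr_ge0 ltW.
rewrite (_ : [set _ | _] =
  ([set w | eps s w = reg1] `&` [set w | eps t w = reg2]) `|`
  ([set w | eps s w = reg2] `&` [set w | eps t w = reg1])); last first.
  apply/seteqP; split => w /=; last by case=> -[-> ->].
  case: (regP (eps s w)) => e; case: (regP (eps t w)) => e'; rewrite e e' ?eqxx//; auto.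
apply: (le_trans (measureU2 _ _ _)); try by apply: measurableI; exact: meps.
apply: (le_trans (leeD (pw reg1) (pw reg2))).
have dis : [disjoint [set w | eps s w = reg1] & [set w | eps s w = reg2]].
  by apply/disj_setPS => w /= [->].
rewrite -muleDr//; last by rewrite ge0_adde_def// inE.
have Ls : (0 <= (L * (t - s))%:E)%E.
  by rewrite lee_fin mulr_ge0 ?subr_ge0 1?ltW// /L addr_gt0.
rewrite -[leRHS]mule1; apply: lee_wpmul2l => //.
rewrite -measureU//; last 3 first.
- exact: meps.
- exact: meps.
- exact/disj_set2P.
by apply: probability_le1; apply: measurableU; exact: meps.
Qed.

Section OneIncrement.
Variables s t : R.
Hypotheses (s0 : 0 <= s) (st : s < t).

Let h := t - s.
Let N := normal_prob 0 (Num.sqrt h).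
Let h0 : 0 <= h. Proof. by rewrite subr_ge0 ltW. Qed.
Let sh0 : 0 < Num.sqrt h. Proof. by rewrite sqrtr_gt0 subr_gt0. Qed.
Let sh2 : Num.sqrt h ^+ 2 = h. Proof. by rewrite sqr_sqrtr. Qed.
Let t0 : 0 <= t. Proof. by rewrite (le_trans s0)// ltW. Qed.

Let m1 : measurable_fun [set: Omega] (id : Omega -> filtered s).
Proof. by move=> _ U mU; rewrite setTI; exact: (filtration_measurable complete_P mB meps mU). Qed.

Let m2 : measurable_fun [set: Omega] (fun w => B t w - B s w).
Proof. by apply: measurable_funB; exact: mB. Qed.

(** Taking [phi1] to be the identity of [Omega] into [filtered s] lets [G] depend on the whole past
    up to [s] as well as on the next increment. *)
Lemma ge0_integral_transition i j (G : filtered s * R -> \bar R) :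
  measurable_fun setT G -> (forall z, (0 <= G z)%E) ->
  (\int[P]_(w in [set w | eps s w = i] `&` [set w | eps t w = j]) G (w, B t w - B s w)%R =
   (transition lambda h i j)%:E *
     \int[P]_(w in [set w | eps s w = i]) \int[N]_b G (w, b))%E.
Proof.
move=> mG G0.
have mi := @meps s i s0; have mj := @meps t j t0.
have tr0 : 0 <= transition lambda h i j by exact: transition_ge0.
apply: (ge0_integral_kernel (phi1 := (id : Omega -> filtered s)) (nu := N)
  (p := NngNum tr0) m1 m2 (measurableI _ _ mi mj) mi _ mG G0).
move=> A U mA mU; rewrite !preimage_id.
exact: (one_step_kernel complete_P mB meps lambda_gt0 brownian_B chain_eps
  independent_B_eps i j s0 st mA mU).
Qed.

Lemma measurable_increment d' (T : measurableType d') (G : filtered s * R -> T) :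
  measurable_fun setT G -> measurable_fun [set: Omega] (fun w => G (w, B t w - B s w)).
Proof. by move=> mG; apply: (measurableT_comp mG); exact: measurable_fun_pair. Qed.

Lemma ge0_integral_step (G : 'I_2 -> filtered s * R -> \bar R) :
  (forall j, measurable_fun setT (G j)) -> (forall j z, (0 <= G j z)%E) ->
  (\int[P]_w G (eps t w) (w, B t w - B s w)%R =
   \int[P]_w \sum_j (transition lambda h (eps s w) j)%:E * \int[N]_b G j (w, b))%E.
Proof.
move=> mG G0.
have mi i := @meps s i s0; have mj j := @meps t j t0.
have tr0 i j : (0 <= (transition lambda h i j)%:E)%E by rewrite lee_fin transition_ge0.
have mH j : measurable_fun [set: Omega] (fun w => \int[N]_b G j (w, b))%E.
  apply: (@measurable_filtered _ _ _ P complete_P B eps mB meps s).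
  exact: (@measurable_fun_fubini_tonelli_F _ _ (filtered s) _ R N (G j) (mG j) (G0 j)).
have H0 j w : (0 <= \int[N]_b G j (w, b))%E by exact: integral_ge0.
have mTH i j : measurable_fun [set: Omega]
    (fun w => (transition lambda h i j)%:E * \int[N]_b G j (w, b))%E.
  exact: emeasurable_funM.
rewrite (ge0_integral_regimes mj P measurableT (f := fun j w => G j (w, B t w - B s w)%R))//; last first.
  by move=> j; exact: measurable_increment.
rewrite (ge0_integral_regimes mi P measurableT
  (f := fun i w => \sum_j (transition lambda h i j)%:E * \int[N]_b G j (w, b))%E)//; last 2 first.
- by move=> i; exact: emeasurable_sum.
- by move=> i w; apply: sume_ge0 => j _; exact: mule_ge0.
have step j : (\int[P]_(w in [set w | eps t w = j]) G j (w, B t w - B s w)%R =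
   (transition lambda h reg1 j)%:E * \int[P]_(w in [set w | eps s w = reg1]) \int[N]_b G j (w, b) +
   (transition lambda h reg2 j)%:E * \int[P]_(w in [set w | eps s w = reg2]) \int[N]_b G j (w, b))%E.
  rewrite (ge0_integral_regimes mi P (mj j) (f := fun _ w => G j (w, B t w - B s w)%R))//; last first.
    by move=> _; exact: measurable_increment.
  by rewrite ![[set w | eps t w = j] `&` _]setIC !ge0_integral_transition.
have sum2 i : (\int[P]_(w in [set w | eps s w = i])
      \sum_j (transition lambda h i j)%:E * \int[N]_b G j (w, b) =
    \sum_j (transition lambda h i j)%:E *
      \int[P]_(w in [set w | eps s w = i]) \int[N]_b G j (w, b))%E.
  rewrite ge0_integral_sum//; last 2 first.
  - by move=> j; exact: measurable_funTS.
  - by move=> j w _; exact: mule_ge0.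
  apply: eq_bigr => j _; rewrite ge0_integralZl//; exact: measurable_funTS.
rewrite !setTI !step !sum2 !sum_regimes.
by rewrite addeACA.
Qed.

Lemma ge0_integral_increment (G : filtered s * R -> \bar R) :
  measurable_fun setT G -> (forall z, (0 <= G z)%E) ->
  (\int[P]_w G (w, B t w - B s w)%R = \int[P]_w \int[N]_b G (w, b))%E.
Proof.
move=> mG G0; rewrite (ge0_integral_step (G := fun=> G))//.
apply: eq_integral => w _; rewrite -ge0_sume_distrl; last first.
  by move=> j _; rewrite lee_fin transition_ge0.
rewrite sumEFin (_ : \sum_j _ = 1) ?mul1e//.
rewrite sum_regimes /transition.
by case: (regP (eps s w)) => ->; rewrite /=; ring.
Qed.

(** The kernel identity is available for nonnegative integrands, so it is applied to the positive
    and the negative part; centring makes their Gaussian integrals agree for each past. *)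
Lemma increment_centered (G : filtered s * R -> R) : measurable_fun setT G ->
  (forall w, N.-integrable setT (fun b => (G (w, b))%:E)) ->
  (forall w, (\int[N]_b (G (w, b))%:E = 0)%E) ->
  P.-integrable setT (fun w => (G (w, B t w - B s w))%:E) ->
  (\int[P]_w (G (w, B t w - B s w))%:E = 0)%E.
Proof.
move=> mG iG G0 iP.
have mEG : measurable_fun setT (EFin \o G) by exact/measurable_EFinP.
have e1 := ge0_integral_increment (measurable_funepos mEG) (funepos_ge0 _).
have e2 := ge0_integral_increment (measurable_funeneg mEG) (funeneg_ge0 _).
rewrite integralE.
have ipos := integrable_pos_fin_num measurableT iP.
have ineg := integrable_neg_fin_num measurableT iP.
have -> : (\int[P]_x ((fun w => (G (w, B t w - B s w))%:E)^\+ x) =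
   \int[P]_x ((fun w => (G (w, B t w - B s w))%:E)^\- x))%E.
  transitivity (\int[P]_w (EFin \o G)^\+ (w, (B t w - B s w)%R))%E.
    by apply: eq_integral => w _; rewrite !funeposE.
  transitivity (\int[P]_w (EFin \o G)^\- (w, (B t w - B s w)%R))%E; last first.
    by apply: eq_integral => w _; rewrite !funenegE.
  rewrite e1 e2; apply: eq_integral => w _.
  have p1 := integrable_pos_fin_num measurableT (iG w).
  have p2 := integrable_neg_fin_num measurableT (iG w).
  have := G0 w; rewrite integralE => /eqP; rewrite sube_eq ?add0e//.
    move/eqP => e; apply: etrans (etrans e _); apply: eq_integral => b _.
      by rewrite !funeposE.
    by rewrite !funenegE.
by rewrite subee.
Qed.

Lemma integrable_increment (G : filtered s * R -> R) (K : R) : measurable_fun setT G ->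
  (\int[P]_w \int[N]_b (`|G (w, b)|)%:E < +oo)%E ->
  P.-integrable setT (fun w => (G (w, B t w - B s w))%:E).
Proof.
move=> mG h1; apply/integrableP; split.
  by apply/measurable_EFinP; exact: measurable_increment.
rewrite [ltLHS](@ge0_integral_increment (fun z => (`|G z|)%:E))//.
by apply/measurable_EFinP; exact: measurableT_comp.
Qed.

Let integrable_sqB : N.-integrable setT (fun b => (b ^+ 2 - h)%:E).
Proof.
have icst : N.-integrable setT (fun=> h%:E) by exact: finite_measure_integrable_cst.
have := integrableB measurableT (gauss_integrable2 sh0) icst.
by apply: eq_integrable => // b _; rewrite EFinB.
Qed.

Section Weighted.
Variable z : Omega -> R.
Hypothesis mz : measurable_fun [set: filtered s] z.
Hypothesis iz : P.-integrable setT (EFin \o z).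

Let mz1 : measurable_fun [set: filtered s * R] (fun x : filtered s * R => z x.1).
Proof. exact: (measurableT_comp mz measurable_fst). Qed.

Let izabs : (\int[P]_w (`|z w|)%:E < +oo)%E.
Proof. by have /integrableP[_] := iz. Qed.

Let integrable_weighted (k : R -> R) : measurable_fun setT k ->
  N.-integrable setT (EFin \o k) ->
  P.-integrable setT (fun w => (z w * k (B t w - B s w))%:E).
Proof.
move=> mk ik.
apply: (@integrable_increment (fun x => z x.1 * k x.2)) => //.
  by apply: measurable_funM => //; exact: (measurableT_comp mk measurable_snd).
under eq_integral => w _.
  under eq_integral => b _ do rewrite /= normrM EFinM.
  rewrite ge0_integralZl//; last first.
    by apply/measurable_EFinP; exact: measurableT_comp.
  over.
have /integrableP[_ ik'] := ik.
have fk : (\int[N]_b (`|k b|)%:E)%E \is a fin_num.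
  by rewrite ge0_fin_numE//; exact: integral_ge0.
rewrite ge0_integralZr//; last 2 first.
- apply/measurable_EFinP/measurableT_comp => //.
  exact: (measurable_filtered complete_P mB meps mz).
- exact: integral_ge0.
apply: lte_mul_pinfty => //; first exact: integral_ge0.
by rewrite ge0_fin_numE//; exact: integral_ge0.
Qed.

Lemma increment_mean :
  P.-integrable setT (fun w => (z w * (B t w - B s w))%:E) /\
  (\int[P]_w (z w * (B t w - B s w))%:E = 0)%E.
Proof.
have i := integrable_weighted (@measurable_id _ _ setT) (gauss_integrable1 sh0).
split => //.
apply: (@increment_centered (fun x => z x.1 * x.2)) => //.
- by apply: measurable_funM => //; exact: measurable_snd.
- by move=> w; apply: (integrableZl measurableT (z w) (gauss_integrable1 sh0)).
- move=> w /=; under eq_integral do rewrite EFinM.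
  by rewrite integralZl//; [rewrite gauss_mean ?mule0|exact: gauss_integrable1].
Qed.

(** Applies [increment_centered] to [z * (b ^+ 2 - h)], whose Gaussian mean is zero. *)
Lemma increment_variance :
  P.-integrable setT (fun w => (z w * (B t w - B s w) ^+ 2)%:E) /\
  (\int[P]_w (z w * (B t w - B s w) ^+ 2)%:E = h%:E * \int[P]_w (z w)%:E)%E.
Proof.
have i2 : P.-integrable setT (fun w => (z w * (B t w - B s w) ^+ 2)%:E).
  apply: (@integrable_weighted (fun b => b ^+ 2)); last exact: gauss_integrable2.
  exact: measurable_funX.
split => //.
have ig (w : Omega) : N.-integrable setT (fun b => (z w * (b ^+ 2 - h))%:E).
  exact: (integrableZl measurableT (z w) integrable_sqB).
have i3 : P.-integrable setT (fun w => (z w * ((B t w - B s w) ^+ 2 - h))%:E).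
  apply: (@integrable_weighted (fun b => b ^+ 2 - h)).
    by apply: measurable_funB => //; exact: measurable_funX.
  exact: integrable_sqB.
have c0 : (\int[P]_w (z w * ((B t w - B s w) ^+ 2 - h))%:E = 0)%E.
  apply: (@increment_centered (fun x => z x.1 * (x.2 ^+ 2 - h))) => //.
    apply: measurable_funM => //; apply: measurable_funB => //.
    by apply: measurable_funX; exact: measurable_snd.
  move=> w /=; under eq_integral do rewrite EFinM.
  rewrite (integralZl measurableT integrable_sqB).
  under eq_integral do rewrite EFinB.
  rewrite integralB//; last 2 first.
  - exact: gauss_integrable2.
  - exact: finite_measure_integrable_cst.
  rewrite gauss_second_moment// sh2 integral_cst//.
  by rewrite [X in (_ - _ * X)%E]probability_setT mule1 subee// mule0.
rewrite -integralZl//.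
rewrite [LHS](eq_integral (fun w => (z w * ((B t w - B s w) ^+ 2 - h))%:E + h%:E * (z w)%:E)%E); last first.
  move=> w _; rewrite -EFinM -EFinD; congr EFin.
  have e (a x y : R) : a * x = a * (x - y) + y * a by ring.
  exact: e.
rewrite integralD//; last exact: integrableZl.
by rewrite c0 add0e.
Qed.

End Weighted.
End OneIncrement.
End Increments.

(** * The Ito integral over a short step *)

Section HasIntegral.
Context d (T : measurableType d) (R : realType).
Variables (mu : {measure set T -> \bar R}) (D : set T).
Hypothesis mD : measurable D.

(** Integrability and value travel together, so that the linear rules compose without side
    conditions. *)
Definition has_integral (f : T -> R) (m : R) :=
  mu.-integrable D (EFin \o f) /\ (\int[mu]_(x in D) (f x)%:E = m%:E)%E.

Lemma has_integral_eq f g m : (forall x, D x -> f x = g x) ->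
  has_integral f m -> has_integral g m.
Proof.
move=> fg [fi fm]; have {}fg x : x \in D -> f x = g x by rewrite inE; exact: fg.
split; last by rewrite -fm; apply: eq_integral => x xD; rewrite fg.
by apply: eq_integrable fi => // x xD; rewrite /= fg.
Qed.

Lemma has_integral0 : has_integral (fun=> 0) 0.
Proof. by split; [exact: integrable0|rewrite integral0]. Qed.

Lemma has_integralD f g m p : has_integral f m -> has_integral g p ->
  has_integral (fun x => f x + g x) (m + p).
Proof.
move=> [fi fm] [gi gm]; split; first exact: (integrableD mD fi gi).
under eq_integral do rewrite EFinD.
by rewrite integralD// fm gm.
Qed.

Lemma has_integralZ k f m : has_integral f m ->
  has_integral (fun x => k * f x) (k * m).
Proof.
move=> [fi fm]; split; first exact: (integrableZl mD k fi).
under eq_integral do rewrite EFinM.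
by rewrite integralZl// fm.
Qed.

Lemma has_integral_sum (I : finType) (f : I -> T -> R) m :
  (forall i, has_integral (f i) (m i)) ->
  has_integral (fun x => \sum_i f i x) (\sum_i m i).
Proof.
move=> fm; elim: (index_enum I) => [|i s IH].
  rewrite big_nil; apply: has_integral_eq has_integral0 => x _.
  by rewrite big_nil.
rewrite big_cons; apply: has_integral_eq (has_integralD (fm i) IH) => x _.
by rewrite big_cons.
Qed.

End HasIntegral.

Section Overlap.
Context {R : realType}.

(** Lebesgue length of the intersection of []a, b]] and []c, e]]. *)
Definition overlap (a b c e : R) : R := Num.max 0 (Num.min b e - Num.max a c).

Lemma overlapC a b c e : overlap a b c e = overlap c e a b.
Proof. by rewrite /overlap (minC b) (maxC a). Qed.

Lemma has_integral_overlap (a b c e T : R) : 0 <= a -> b <= T ->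
  has_integral (@lebesgue_measure R) `[0, T]
    (fun s => \1_(`]a, b]%classic : set R) s * \1_(`]c, e]%classic : set R) s)
    (overlap a b c e).
Proof.
move=> a0 bT.
have h : has_integral (@lebesgue_measure R) `[0, T]
    (\1_(`]a, b] `&` `]c, e] : set R)) (overlap a b c e).
  have mI : measurable (`]a, b] `&` `]c, e] : set R) by exact: measurableI.
  split.
    apply: measurable_bounded_integrable => //.
      by rewrite [ltLHS]lebesgue_measure_itv; case: ifP; rewrite ?ltry.
    exists 1; split; first exact: num_real.
    move=> r r1 s _; rewrite /= indicE; apply: le_trans (ltW r1).
    by case: (_ \in _); rewrite ?normr1// normr0.
  rewrite integral_indic// setIidl; last first.
    move=> s /= [+ _]; rewrite !in_itv/= => /andP[as_ sb].
    by apply/andP; split; [exact: (ltW (le_lt_trans a0 as_))|exact: le_trans bT].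
  rewrite (_ : _ `&` _ = `]Num.max a c, Num.min b e]%classic); last first.
    apply/seteqP; split => s /=; rewrite !in_itv/= gt_max le_min.
      by move=> [/andP[-> ->] /andP[-> ->]].
    by move=> /andP[/andP[-> ->] /andP[-> ->]].
  rewrite [LHS]lebesgue_measure_itv/= lte_fin /overlap.
  case: ltP => [me|em]; last by rewrite max_l// subr_le0.
  have h : 0 <= Num.min b e - Num.max a c by rewrite subr_ge0 ltW.
  by rewrite (max_r h).
by apply: has_integral_eq h => // s _; rewrite indicI.
Qed.

Lemma has_integral_step_square (I : finType) (z a b : I -> R) T :
  (forall i, 0 <= a i /\ b i <= T) ->
  has_integral (@lebesgue_measure R) `[0, T]
    (fun s => (\sum_i z i * \1_(`]a i, b i]%classic : set R) s) ^+ 2)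
    (\sum_i \sum_j z i * z j * overlap (a i) (b i) (a j) (b j)).
Proof.
move=> ab; have mT : measurable (`[0, T]%classic : set (measurableTypeR R)) by [].
have h i j : has_integral (@lebesgue_measure R) `[0, T]
    (fun s => z i * z j * (\1_(`]a i, b i]%classic : set R) s *
                           \1_(`]a j, b j]%classic : set R) s))
    (z i * z j * overlap (a i) (b i) (a j) (b j)).
  have [a0 bT] := ab i; exact/has_integralZ/has_integral_overlap.
have h2 := has_integral_sum mT (fun i => has_integral_sum mT (h i)).
apply: (has_integral_eq mT _ h2) => s _.
rewrite expr2 mulr_suml; apply: eq_bigr => i _.
rewrite mulr_sumr; apply: eq_bigr => j _.
by rewrite mulrACA.
Qed.

End Overlap.

(** * The Ito isometry for step processes *)

Section Isometry.
Context {R : realType} {d : measure_display} {Omega : measurableType d}.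
Variable P : probability Omega R.
Hypothesis complete_P : measure_is_complete P.
Variables (B : R -> Omega -> R) (eps : R -> Omega -> 'I_2) (lambda : 'I_2 -> R).
Hypothesis lambda_gt0 : forall i, 0 < lambda i.
Hypothesis brownian_B : brownian_motion P B.
Hypothesis chain_eps : markov_chain P eps (generator lambda).
Hypothesis independent_B_eps : independent_processes P B eps.
Local Notation F := (augmented_filtration P B eps).
Local Notation filtered t := (filtered P B eps t).

Let mB t : 0 <= t -> measurable_fun setT (B t).
Proof. by have [+ _ _ _ _] := brownian_B; exact. Qed.

Let meps t j : 0 <= t -> measurable [set w | eps t w = j].
Proof. by have [+ _ _ _] := chain_eps; exact. Qed.

Local Notation mean := (has_integral P setT).

Let has_mean (z : Omega -> R) M : measurable_fun setT z -> (forall w, `|z w| <= M) ->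
  mean z (fine (\int[P]_w (z w)%:E)).
Proof.
move=> mz zM.
have iz : P.-integrable setT (EFin \o z).
  apply: measurable_bounded_integrable => //.
    by rewrite [X in (X < _)%E]probability_setT ltry.
  exists M; split; first exact: num_real.
  by move=> N MN w _; rewrite /= (le_trans (zM w))// ltW.
by split => //; rewrite fineK//; exact: (integrable_fin_num _ iz).
Qed.

Let mean_increment s t (z : Omega -> R) m : 0 <= s -> s < t ->
  measurable_fun [set: filtered s] z -> mean z m ->
  mean (fun w => z w * (B t w - B s w)) 0.
Proof.
move=> s0 st mz [iz _].
by have [] := increment_mean complete_P lambda_gt0 brownian_B chain_eps independent_B_eps s0 st mz iz.
Qed.

Let mean_increment_sq s t (z : Omega -> R) m : 0 <= s -> s < t ->
  measurable_fun [set: filtered s] z -> mean z m ->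
  mean (fun w => z w * (B t w - B s w) ^+ 2) ((t - s) * m).
Proof.
move=> s0 st mz [iz zm].
have [i v] := increment_variance complete_P lambda_gt0 brownian_B chain_eps independent_B_eps s0 st mz iz.
by split => //; rewrite v zm.
Qed.

Let measurable_filtered_increment u v s : 0 <= u <= v -> v <= s ->
  measurable_fun [set: filtered s] (fun w => B v w - B u w).
Proof.
move=> /andP[u0 uv] vs; apply: measurable_funB; apply: measurable_filtered_B.
  by rewrite (le_trans u0 uv).
by rewrite u0 (le_trans uv).
Qed.

(** [z] times the earlier increment is measurable at time [s], hence an integrable weight for the
    later, centred increment. *)
Let mean_disjoint u v s t (z : Omega -> R) M : 0 <= u <= v -> v <= s -> s <= t ->
  measurable_fun [set: filtered s] z -> (forall w, `|z w| <= M) ->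
  mean (fun w => z w * ((B v w - B u w) * (B t w - B s w))) 0.
Proof.
move=> uv vs; rewrite le_eqVlt => /predU1P[<-|st] mz zM.
  by apply: (has_integral_eq measurableT) (has_integral0 P setT) => w _; rewrite subrr !mulr0.
have /andP[u0 uv'] := uv; have s0 : 0 <= s by rewrite (le_trans (le_trans u0 uv')).
have mzO := measurable_filtered complete_P mB meps mz.
have mv := measurable_filtered_increment uv vs.
have [m zvm] : exists m, mean (fun w => z w * (B v w - B u w)) m.
  move: uv'; rewrite le_eqVlt => /predU1P[<-|uv'].
    by exists 0; apply: (has_integral_eq measurableT) (has_integral0 P setT) => w _; rewrite subrr mulr0.
  have c1 : mean (fun=> 1) (fine (\int[P]_w 1%:E)).
    by apply: (@has_mean _ 1) => // w; rewrite normr1.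
  have [i1 _] := mean_increment u0 uv' (@measurable_cst _ _ (filtered u) _ _ _) c1.
  have bz : [bounded z w | w in [set: Omega]].
    exists M; split; first exact: num_real.
    by move=> N MN w _; rewrite /= (le_trans (zM w))// ltW.
  have i2 := integrableMr measurableT mzO bz i1.
  exists (fine (\int[P]_w (z w * (B v w - B u w))%:E)).
  have i3 : P.-integrable setT (EFin \o (fun w => z w * (B v w - B u w))).
    by apply: eq_integrable i2 => // w _; rewrite /= -EFinM mul1r.
  by split => //; rewrite fineK//; exact: (integrable_fin_num _ i3).
have mzv : measurable_fun [set: filtered s] (fun w => z w * (B v w - B u w)).
  exact: measurable_funM.
by apply: (has_integral_eq measurableT) (mean_increment s0 st mzv zvm) => w _; rewrite mulrA.
Qed.

Let mean_same_start s q r (z : Omega -> R) m M : 0 <= s -> s < q -> q <= r ->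
  measurable_fun [set: filtered s] z -> (forall w, `|z w| <= M) -> mean z m ->
  mean (fun w => z w * ((B q w - B s w) * (B r w - B s w))) ((q - s) * m).
Proof.
move=> s0 sq qr mz zM zm.
have mzq : measurable_fun [set: filtered q] z.
  by apply: (measurable_filtered_le _ mz); exact: ltW.
have h1 := mean_increment_sq s0 sq mz zm.
have s0q : 0 <= s <= q by rewrite s0 ltW.
have h2 := mean_disjoint s0q (lexx q) qr mzq zM.
have := has_integralD measurableT h1 h2; rewrite addr0.
by apply: (has_integral_eq measurableT) => w _; ring.
Qed.

(** The earlier interval is cut at [c]: the part before [c] is uncorrelated with the second
    increment, and the rest starts together with it, so the shorter of the two decides the
    covariance. *)
Let mean_product_le a b c e (x y : Omega -> R) M m : 0 <= a -> a <= c -> a < b -> c < e ->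
  measurable_fun [set: filtered a] x -> measurable_fun [set: filtered c] y ->
  (forall w, `|x w * y w| <= M) -> mean (fun w => x w * y w) m ->
  mean (fun w => x w * (B b w - B a w) * (y w * (B e w - B c w)))
       (overlap a b c e * m).
Proof.
move=> a0 ac ab ce mx my xyM xym.
have c0 := le_trans a0 ac.
have mxy : measurable_fun [set: filtered c] (fun w => x w * y w).
  by apply: measurable_funM => //; exact: (measurable_filtered_le ac mx).
have [bc|cb] := leP b c.
  have -> : overlap a b c e = 0.
    by rewrite /overlap max_l// subr_le0 ge_min le_max bc orbT.
  rewrite mul0r; have a0b : 0 <= a <= b by rewrite a0 ltW.
  apply: (has_integral_eq measurableT) (mean_disjoint a0b bc (ltW ce) mxy xyM) => w _.
  by ring.
have a0c : 0 <= a <= c by rewrite a0.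
have h1 := mean_disjoint a0c (lexx c) (ltW ce) mxy xyM.
have -> : overlap a b c e = Num.min b e - c.
  by rewrite /overlap (max_r ac) max_r// subr_ge0 le_min !ltW.
have h2 : mean (fun w => x w * y w * ((B b w - B c w) * (B e w - B c w)))
    ((Num.min b e - c) * m).
  have [be|eb] := leP b e.
    exact: mean_same_start c0 cb be mxy xyM xym.
  apply: (has_integral_eq measurableT) (mean_same_start c0 ce (ltW eb) mxy xyM xym) => w _.
  by rewrite [in RHS](mulrC (B b w - _)).
have := has_integralD measurableT h1 h2; rewrite add0r.
by apply: (has_integral_eq measurableT) => w _; ring.
Qed.

Section Families.
Variables (I : finType) (z : I -> Omega -> R) (a b : I -> R) (M T : R).
Hypotheses (a0 : forall i, 0 <= a i) (ab : forall i, a i <= b i)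
  (bT : forall i, b i <= T).
Hypothesis mzO : forall i, measurable_fun setT (z i).
Hypothesis mz : forall i, a i < b i -> measurable_fun [set: filtered (a i)] (z i).
Hypothesis zM : forall i w, `|z i w| <= M.

Let m i j := fine (\int[P]_w (z i w * z j w)%:E).

Let zzM i j w : `|z i w * z j w| <= M * M.
Proof. by rewrite normrM ler_pM. Qed.

Let mean_zz i j : mean (fun w => z i w * z j w) (m i j).
Proof. by apply: (@has_mean _ (M * M)) => //; exact: measurable_funM. Qed.

Let mC i j : m i j = m j i.
Proof. by rewrite /m; congr fine; apply: eq_integral => w _; rewrite mulrC. Qed.

Let mean_product i j :
  mean (fun w => z i w * (B (b i) w - B (a i) w) * (z j w * (B (b j) w - B (a j) w)))
       (overlap (a i) (b i) (a j) (b j) * m i j).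
Proof.
have degenerate k l : a k = b k -> overlap (a k) (b k) (a l) (b l) = 0.
  move=> <-; rewrite /overlap max_l// subr_le0.
  by rewrite ge_min !le_max lexx.
have [abi|abi] := eqVneq (a i) (b i).
  rewrite degenerate// mul0r.
  by apply: (has_integral_eq measurableT) (has_integral0 P setT) => w _; rewrite abi subrr mulr0 mul0r.
have [abj|abj] := eqVneq (a j) (b j).
  rewrite overlapC degenerate// mul0r.
  by apply: (has_integral_eq measurableT) (has_integral0 P setT) => w _; rewrite abj subrr !mulr0.
have lti : a i < b i by rewrite lt_neqAle abi ab.
have ltj : a j < b j by rewrite lt_neqAle abj ab.
have [aij|aji] := leP (a i) (a j).
  by apply: mean_product_le (@zzM i j) (@mean_zz i j) => //; exact: mz.
rewrite overlapC mC.
apply: (has_integral_eq measurableT) (mean_product_le (a0 j) (ltW aji) ltj lti (mz ltj) (mz lti) (@zzM j i) (mean_zz j i)) => w _.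
by rewrite mulrC.
Qed.

(** The intervals may overlap, so a difference of two step integrals on unrelated grids is a single
    family, with no common refinement. Adaptedness of [z i] is asked only for nondegenerate
    intervals: truncating times at a horizon moves the starting points of the empty ones. *)
Lemma step_integral_isometry :
  mean (fun w => (\sum_i z i w * (B (b i) w - B (a i) w)) ^+ 2)
    (\sum_i \sum_j overlap (a i) (b i) (a j) (b j) * m i j) /\
  (\int[P]_w ((\sum_i z i w * (B (b i) w - B (a i) w)) ^+ 2)%:E =
   \int[P]_w \int[lebesgue_measure]_(s in `[0%R, T])
     ((\sum_i z i w * \1_(`]a i, b i]%classic : set R) s) ^+ 2)%:E)%E.
Proof.
have h : mean (fun w => (\sum_i z i w * (B (b i) w - B (a i) w)) ^+ 2)
    (\sum_i \sum_j overlap (a i) (b i) (a j) (b j) * m i j).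
  apply: (has_integral_eq measurableT) (has_integral_sum measurableT (fun i => has_integral_sum measurableT (mean_product i))) => w _.
  rewrite expr2 mulr_suml; apply: eq_bigr => i _.
  by rewrite mulr_sumr.
split => //; have [_ ->] := h.
have [_ e] : mean (fun w => \sum_i \sum_j z i w * z j w * overlap (a i) (b i) (a j) (b j))
    (\sum_i \sum_j overlap (a i) (b i) (a j) (b j) * m i j).
  apply: (has_integral_sum measurableT) => i.
  apply: (has_integral_sum measurableT) => j.
  apply: (has_integral_eq measurableT) (has_integralZ measurableT _ (mean_zz i j)) => w _.
  by rewrite mulrC.
rewrite -e; apply: eq_integral => w _.
have [] := @has_integral_step_square R I (z ^~ w) a b T.
  by move=> i; split; [exact: a0|exact: bT].
by move=> _ ->.
Qed.

End Families.
End Isometry.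

Lemma tonelli_restr d1 d2 (T1 : measurableType d1) (T2 : measurableType d2) (R : realType)
  (m1 : {sigma_finite_measure set T1 -> \bar R})
  (m2 : {sigma_finite_measure set T2 -> \bar R}) (D : set T2) (f : T1 * T2 -> \bar R) :
  measurable D -> measurable_fun setT f -> (forall z, 0 <= f z)%E ->
  measurable_fun setT (fun x => \int[m2]_(y in D) f (x, y))%E /\
  (\int[m1]_x \int[m2]_(y in D) f (x, y) = \int[m2]_(y in D) \int[m1]_x f (x, y))%E.
Proof.
move=> mD mf f0; pose g := f \_ (setT `*` D).
have mTD : measurable (setT `*` D : set (T1 * T2)) by exact: measurableX.
have mg : measurable_fun setT g.
  by apply/(measurable_restrictT _ mTD); exact: measurable_funTS.
have g0 z : (0 <= g z)%E by rewrite /g patchE; case: ifP.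
have gE x y : g (x, y) = ((fun y => f (x, y)) \_ D) y.
  rewrite /g !patchE; congr (if _ then _ else _).
  by apply/idP/idP; rewrite !inE => //= -[].
have gE' x : (\int[m2]_(y in D) f (x, y) = \int[m2]_y g (x, y))%E.
  by rewrite integral_mkcond; apply: eq_integral => y _; rewrite gE.
under eq_fun do rewrite gE'.
split; first exact: measurable_fun_fubini_tonelli_F.
rewrite fubini_tonelli//= [RHS]integral_mkcond; apply: eq_integral => y _.
rewrite patchE; case: ifPn => yD.
  by apply: eq_integral => x _; rewrite gE patchE yD.
by rewrite integral0_eq// => x _; rewrite gE patchE (negbTE yD).
Qed.

Lemma ge0_integral_twiceD d (T : measurableType d) (R : realType)
  (mu : {measure set T -> \bar R}) (f g : T -> \bar R) :
  measurable_fun setT f -> measurable_fun setT g ->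
  (forall x, 0 <= f x)%E -> (forall x, 0 <= g x)%E ->
  (2%:E * \int[mu]_x f x + 2%:E * \int[mu]_x g x = \int[mu]_x (2%:E * f x + 2%:E * g x))%E.
Proof.
move=> mf mg f0 g0; rewrite ge0_integralD//; last 4 first.
- by move=> x _; exact: mule_ge0.
- exact: measurable_funeM.
- by move=> x _; exact: mule_ge0.
- exact: measurable_funeM.
by rewrite !ge0_integralZl//= lee_fin.
Qed.

Lemma integral_sqrD_le d (T : measurableType d) (R : realType)
  (mu : {measure set T -> \bar R}) (D : set T) (f g : T -> R) :
  measurable D -> measurable_fun D f -> measurable_fun D g ->
  (\int[mu]_(x in D) ((f x + g x) ^+ 2)%:E <=
   2%:E * \int[mu]_(x in D) (f x ^+ 2)%:E + 2%:E * \int[mu]_(x in D) (g x ^+ 2)%:E)%E.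
Proof.
move=> mD mf mg.
have mf2 : measurable_fun D (fun x => (f x ^+ 2)%:E) by apply/measurable_EFinP; exact: measurable_funX.
have mg2 : measurable_fun D (fun x => (g x ^+ 2)%:E) by apply/measurable_EFinP; exact: measurable_funX.
have f0 x : (0 <= (f x ^+ 2)%:E)%E by rewrite lee_fin sqr_ge0.
have g0 x : (0 <= (g x ^+ 2)%:E)%E by rewrite lee_fin sqr_ge0.
rewrite -!ge0_integralZl//=; try by rewrite lee_fin.
rewrite -ge0_integralD//=; last 4 first.
- by move=> x _; exact: mule_ge0.
- exact: measurable_funeM.
- by move=> x _; exact: mule_ge0.
- exact: measurable_funeM.
apply: le_integral_nonmeas => x _; rewrite -!EFinM -EFinD lee_fin.
have e (u v : R) : (u + v) ^+ 2 <= 2 * u ^+ 2 + 2 * v ^+ 2.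
  by have := sqr_ge0 (u - v); rewrite sqrrB sqrrD; lra.
exact: e.
Qed.

Section GridStep.
Context {R : realType}.
Variable (g : nat -> R).
Hypothesis g_nd : forall k, g k <= g k.+1.

Lemma grid_le k l : (k <= l)%N -> g k <= g l.
Proof.
move=> /subnK <-; elim: (l - k)%N => // m IH.
by rewrite addSn (le_trans IH).
Qed.

Lemma grid_cell n s : g 0 < s -> s <= g n -> exists2 k, (k < n)%N & g k < s <= g k.+1.
Proof.
move=> gs; elim: n => [|n IH] sg; first by move: (lt_le_trans gs sg); rewrite ltxx.
have [/IH [k kn ks]|ns] := leP s (g n); first by exists k => //; rewrite ltnS ltnW.
by exists n => //; rewrite ns.
Qed.

Lemma grid_step n (c : nat -> R) k s : (k < n)%N -> g k < s <= g k.+1 ->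
  \sum_(j < n) c j * \1_(`]g j, g j.+1]%classic : set R) s = c k.
Proof.
move=> kn /andP[ks sk].
rewrite (bigD1 (Ordinal kn))//= big1 ?addr0.
  by rewrite indicE mem_set ?mulr1//= in_itv/= ks.
move=> j jk; rewrite indicE memNset ?mulr0//= in_itv/= => /andP[js sj].
have [jk'|kj|jk'] := ltngtP j k.
- by move: (le_lt_trans (grid_le jk') ks); rewrite ltNge sj.
- by move: (le_lt_trans (grid_le kj) js); rewrite ltNge sk.
- by move/eqP: jk; apply; exact/val_inj.
Qed.

End GridStep.

(** * Grid approximation of the Ito integral *)

Section ItoGrid.
Context {R : realType} {d : measure_display} {Omega : measurableType d}.
Variable P : probability Omega R.
Hypothesis complete_P : measure_is_complete P.
Variables (B : R -> Omega -> R) (eps : R -> Omega -> 'I_2) (lambda : 'I_2 -> R).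
Hypothesis lambda_gt0 : forall i, 0 < lambda i.
Hypothesis brownian_B : brownian_motion P B.
Hypothesis chain_eps : markov_chain P eps (generator lambda).
Hypothesis independent_B_eps : independent_processes P B eps.
Local Notation F := (augmented_filtration P B eps).
Local Notation filtered t := (filtered P B eps t).

Let mB t : 0 <= t -> measurable_fun setT (B t).
Proof. by have [+ _ _ _ _] := brownian_B; exact. Qed.

Let meps t j : 0 <= t -> measurable [set w | eps t w = j].
Proof. by have [+ _ _ _] := chain_eps; exact. Qed.

Let L := lambda reg1 + lambda reg2.

(** Tonelli's theorem needs the regime to be jointly measurable in sample point and time, while
    [eps] is measurable at fixed times. [J] is the upper limit of the sets in which the regime is
    sampled at the right end of each cell of length [1 / (n + 1)]; right-continuity makes it exact
    almost surely. *)
Lemma joint_version : exists J : set (Omega * R), measurable J /\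
  {ae P, forall w, forall s, 0 <= s -> (J (w, s) <-> eps s w = reg2)}.
Proof.
pose E (n : nat) : set (Omega * R) := \bigcup_k
  ([set w | eps (k.+1%:R / n.+1%:R) w = reg2] `*` `[k%:R / n.+1%:R, k.+1%:R / n.+1%:R[).
have mE n : measurable (E n).
  apply: bigcup_measurable => k _; apply: measurableX => //.
  by apply: meps; rewrite divr_ge0.
exists (\bigcap_n \bigcup_m E (n + m)%N); split.
  by apply: bigcap_measurable => [|n _]; [exists 0%N|exact: bigcup_measurable].
have [_ rc _ _] := chain_eps.
apply: filterS rc => w rc s s0.
have [r r0 sr] : exists2 r, 0 < r & forall q, s < q < s + r -> eps q w = eps s w.
  have := rc s s0; rewrite /at_right near_withinE => /nbhs_ballP[r /= r0 h].
  exists r => // q /andP[sq qr]; apply: h => //=.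
  by rewrite /ball/= distrC gtr0_norm ?subr_gt0// ltrBlDl.
have near_E n : n.+1%:R^-1 < r -> E n (w, s) <-> eps s w = reg2.
  move=> nr.
  have cell k : s \in `[k%:R / n.+1%:R, k.+1%:R / n.+1%:R[ ->
      eps (k.+1%:R / n.+1%:R) w = eps s w.
    rewrite in_itv/= => /andP[ks sk]; apply: sr; rewrite sk/=.
    by rewrite (le_lt_trans (_ : _ <= s + n.+1%:R^-1)) ?ltrD2l// -natr1 mulrDl mul1r lerD2r.
  split; first by move=> [k _ [/= e sk]]; rewrite -(cell k).
  move=> e; pose k := Num.trunc (s * n.+1%:R).
  have /andP[k1 k2] : k%:R <= s * n.+1%:R < k.+1%:R.
    by apply: truncn_itv; rewrite mulr_ge0.
  have sk : s \in `[k%:R / n.+1%:R, k.+1%:R / n.+1%:R[.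
    by rewrite in_itv/= ler_pdivrMr// k1 ltr_pdivlMr.
  by exists k => //; split => //=; rewrite cell.
have [N _ Nr] := near_infty_natSinv_lt (PosNum r0).
split.
  move=> /(_ N I)[m _] h.
  by have /near_E[e _] := Nr (N + m)%N (leq_addr _ _); exact: e.
move=> e n _; exists N => //.
by have /near_E[_] := Nr (n + N)%N (leq_addl _ _); exact.
Qed.

Section Approximation.
Variables (sigma : 'I_2 -> R) (Z : R -> Omega -> R).
Hypothesis ito_Z : is_ito_integral P F B (fun t w => sigma (eps t w)) Z.
Variables (g : nat -> R) (n : nat) (T delta : R).
Hypotheses (g0 : g 0 = 0) (gn : g n = T) (g_nd : forall k, g k <= g k.+1).
Hypothesis gd : forall k, (k < n)%N -> g k.+1 - g k <= delta.

Let D2 := (sigma reg1 - sigma reg2) ^+ 2.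

Let g_ge0 k : 0 <= g k. Proof. by rewrite -g0 grid_le. Qed.

Let gT k : (k <= n)%N -> g k <= T. Proof. by move=> kn; rewrite -gn grid_le. Qed.

Let T0 : 0 <= T. Proof. by rewrite -gn. Qed.

Let step (s : R) (w : Omega) : R :=
  \sum_(k < n) sigma (eps (g k) w) * \1_(`]g k, g k.+1]%classic : set R) s.

Let msigma t : 0 <= t -> measurable_fun setT (fun w => sigma (eps t w)).
Proof.
move=> t0; apply: (@measurable_filtered _ _ _ P complete_P B eps mB meps t).
by apply: measurable_filtered_eps; rewrite lexx t0.
Qed.

Lemma square_jump s t : 0 <= s <= t ->
  (\int[P]_w ((sigma (eps t w) - sigma (eps s w)) ^+ 2)%:E <= (D2 * L * (t - s))%:E)%E.
Proof.
move=> st; have /andP[s0 st'] := st; have t0 := le_trans s0 st'.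
have mS := measurable_switch chain_eps s0 t0.
apply: (@le_trans _ _ (\int[P]_w (D2%:E * (\1_[set w | eps s w != eps t w] w)%:E))%E).
  apply: le_integral_nonmeas => w _; rewrite -EFinM lee_fin indicE.
  have [e|e] := eqVneq (eps s w) (eps t w).
    by rewrite e subrr expr0n/= mulr_ge0 ?sqr_ge0.
  rewrite mem_set//= mulr1 /D2; move: e.
  case: (regP (eps s w)) => ->; case: (regP (eps t w)) => ->; rewrite ?eqxx// => _.
  by rewrite -sqrrN opprB.
rewrite integralZl//; last exact: integrable_indic.
rewrite integral_indic// setIT -mulrA (EFinM D2); apply: lee_wpmul2l.
  by rewrite lee_fin sqr_ge0.
exact: (prob_switch complete_P lambda_gt0 brownian_B chain_eps independent_B_eps).
Qed.

Let joint_measurable_interval (a b : R) : measurable_fun [set: Omega * R]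
  (fun z => \1_(`]a, b]%classic : set R) z.2 : R).
Proof.
apply: (measurableT_comp (f := (\1_(`]a, b]%classic : set R) : R -> R))) => //.
Qed.

Let joint_measurable_step : measurable_fun [set: Omega * R] (fun z => step z.2 z.1).
Proof.
apply: measurable_sum => k; apply: measurable_funM.
  exact: (measurableT_comp (msigma (g_ge0 k)) measurable_fst).
exact: joint_measurable_interval.
Qed.

(** The simple processes in the definition of the integral are compared with the grid step process
    through the isometry. Their distance to the integrand vanishes in the limit; the factor 4 comes
    from twice bounding the square of a sum. *)
Lemma ito_grid : (\int[P]_w ((Z T w - \sum_(k < n) sigma (eps (g k) w) * (B (g k.+1) w - B (g k) w)) ^+ 2)%:E
  <= (4 * (D2 * L * delta * T))%:E)%E.
Proof.
have [aZ _ /(_ T T0)[S [SH SZ]]] := ito_Z.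
have [J [mJ JE]] := joint_version.
pose H (z : Omega * R) : R := sigma reg1 + (sigma reg2 - sigma reg1) * \1_J z.
have mH : measurable_fun setT H.
  by apply: measurable_funD => //; apply: measurable_funM.
have HE : {ae P, forall w, forall s, 0 <= s -> H (w, s) = sigma (eps s w)}.
  apply: filterS JE => w JE s s0; rewrite /H indicE; have [h1 h2] := JE s s0.
  case: (regP (eps s w)) => e; rewrite e.
    by rewrite memNset ?mulr0 ?addr0// => /h1; rewrite e.
  by rewrite (mem_set (h2 e)) mulr1 addrC subrK.
have err : (\int[P]_w \int[lebesgue_measure]_(s in `[0%R, T]) ((H (w, s) - step s w) ^+ 2)%:E
   <= (D2 * L * delta * T)%:E)%E.
  have mHs : measurable_fun setT (fun z : Omega * R => H z - step z.2 z.1).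
    exact: (measurable_funB mH joint_measurable_step).
  have mf : measurable_fun setT (fun z : Omega * R => ((H z - step z.2 z.1) ^+ 2)%:E).
    by apply/measurable_EFinP; exact: measurable_funX.
  have mT : measurable (`[0, T]%classic : set (measurableTypeR R)) by [].
  have f0 (z : Omega * R) : (0 <= ((H z - step z.2 z.1) ^+ 2)%:E)%E.
    by rewrite lee_fin sqr_ge0.
  have [_ ->] := tonelli_restr P (@lebesgue_measure R) mT mf f0.
  apply: (@le_trans _ _ (\int[lebesgue_measure]_(s in `[0%R, T]) (D2 * L * delta)%:E)%E).
    (* Cells are open on the left, so time 0 lies in none of them and is discarded. *)
    apply: ae_le_integral; exists [set 0]; split => //; first exact: lebesgue_measure_set1.
    move=> s /= /not_implyP[sT]; apply: contra_notP => /eqP s_neq0.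
    move: sT; rewrite in_itv/= => /andP[s0 sT].
    have s_gt0 : g 0 < s by rewrite g0 lt_neqAle eq_sym s_neq0.
    have sgn : s <= g n by rewrite gn.
    have [k kn ks] := grid_cell s_gt0 sgn.
    have := ks => /andP[/ltW ks1 ks2].
    apply: (@le_trans _ _ (D2 * L * (s - g k))%:E); last first.
      have L0 : 0 <= L by rewrite ltW// addr_gt0.
      rewrite lee_fin ler_wpM2l//; first exact: mulr_ge0 (sqr_ge0 _) L0.
      by rewrite (le_trans _ (gd kn))// lerD2r.
    have gks : 0 <= g k <= s by rewrite g_ge0.
    apply: le_trans (square_jump gks).
    apply: ae_le_integral; apply: filterS HE => w HE _.
    have -> : step s w = sigma (eps (g k) w).
      exact: (grid_step g_nd (fun k => sigma (eps (g k) w)) kn ks).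
    by rewrite HE.
  rewrite integral_cst//= [X in (_ * X)%E](_ : _ = T%:E) -?EFinM//.
  rewrite [LHS]lebesgue_measure_itv/= lte_fin oppr0 adde0.
  by case: ltP => // T0'; congr EFin; apply/le_anti; rewrite T0 T0'.
have bound m : (\int[P]_w ((Z T w - \sum_(k < n) sigma (eps (g k) w) * (B (g k.+1) w - B (g k) w)) ^+ 2)%:E
  <= 2%:E * (\int[P]_w ((simple_integral B (S m) T w - Z T w) ^+ 2)%:E) +
     (4%:E * (\int[P]_w \int[lebesgue_measure]_(s in `[0%R, T])
           ((simple_value (S m) s w - sigma (eps s w)) ^+ 2)%:E) +
     (4 * (D2 * L * delta * T))%:E))%E.
  set p := sp_size (S m).
  have mcoef k : (k < p)%N -> measurable_fun [set: filtered (sp_time (S m) k)] (sp_coef (S m) k).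
    by move=> kp _ U mU; rewrite setTI; exact: (@sp_coef_adapted _ _ _ _ (S m) k kp U mU).
  have mcoefO k : (k < p)%N -> measurable_fun [set: Omega] (sp_coef (S m) k).
    by move=> kp; exact: (measurable_filtered complete_P mB meps (mcoef k kp)).
  have time0 k : 0 <= sp_time (S m) k.
    by apply: (le_trans (sp_time_ge0 (S m))); apply: grid_le => //; exact: sp_time_nd.
  have [M0 HM0] := sp_coef_bounded (S m).
  (* The simple integral minus the grid sum as one step integral: the grid coefficients enter with a
     minus sign, and the times of the simple process are truncated at [T]. *)
  pose z (i : 'I_p + 'I_n) (w : Omega) : R := match i with
    inl k => sp_coef (S m) k w | inr k => - sigma (eps (g k) w) end.
  pose a (i : 'I_p + 'I_n) : R := match i with
    inl k => Num.min T (sp_time (S m) k) | inr k => g k end.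
  pose b (i : 'I_p + 'I_n) : R := match i with
    inl k => Num.min T (sp_time (S m) k.+1) | inr k => g k.+1 end.
  pose M := Num.max M0 (Num.max `|sigma reg1| `|sigma reg2|).
  have a0 i : 0 <= a i by case: i => k //=; rewrite le_min T0 time0.
  have ab i : a i <= b i.
    case: i => k //=; rewrite le_min ge_min lexx/= ge_min.
    by rewrite (sp_time_nd (S m)) orbT.
  have bT i : b i <= T by case: i => k /=; [rewrite ge_min lexx|exact: gT].
  have mzO i : measurable_fun [set: Omega] (z i).
    by case: i => k /=; [exact: mcoefO|apply: measurableT_comp => //; exact: msigma].
  have mz i : a i < b i -> measurable_fun [set: filtered (a i)] (z i).
    case: i => k /=; last first.
      move=> _; apply: measurableT_comp => //; apply: measurable_filtered_eps.
      by rewrite lexx g_ge0.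
    case: (leP T (sp_time (S m) k)) => [Tk|kT].
      by rewrite lt_min ltxx.
    by move=> _; exact: mcoef.
  have zM i w : `|z i w| <= M.
    case: i => k /=; first by rewrite le_max HM0.
    by rewrite normrN !le_max; case: (regP (eps (g k) w)) => ->; rewrite lexx !orbT.
  have [_ iso] := step_integral_isometry complete_P lambda_gt0 brownian_B chain_eps independent_B_eps
    a0 ab bT mzO mz zM.
  have e1 w : \sum_i z i w * (B (b i) w - B (a i) w) =
      simple_integral B (S m) T w - \sum_(k < n) sigma (eps (g k) w) * (B (g k.+1) w - B (g k) w).
    rewrite big_sumType /=; congr (_ + _).
    by rewrite -sumrN; apply: eq_bigr => k _; rewrite mulNr.
  have e2 w s : s \in `[0, T] -> \sum_i z i w * \1_(`]a i, b i]%classic : set R) s =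
      simple_value (S m) s w - step s w.
    rewrite in_itv/= => /andP[s0 sT].
    rewrite big_sumType /=; congr (_ + _); last first.
      by rewrite -sumrN; apply: eq_bigr => k _; rewrite mulNr.
    apply: eq_bigr => k _; congr (_ * _); rewrite !indicE; congr (_%:R); congr nat_of_bool.
    have Ts : (T < s) = false by rewrite ltNge sT.
    by apply/idP/idP; rewrite !inE/= !in_itv/= gt_min le_min sT Ts.
  have mI : measurable_fun [set: Omega] (simple_integral B (S m) T).
    apply: measurable_sum => k; apply: measurable_funM; first exact: mcoefO.
    by apply: measurable_funB; apply: mB; rewrite le_min T0 time0.
  have mZ : measurable_fun [set: Omega] (Z T).
    apply: (@measurable_filtered _ _ _ P complete_P B eps mB meps T).
    by move=> _ U mU; rewrite setTI; exact: aZ.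
  have mG : measurable_fun [set: Omega]
      (fun w => \sum_(k < n) sigma (eps (g k) w) * (B (g k.+1) w - B (g k) w)).
    apply: measurable_sum => k; apply: measurable_funM; first exact: msigma.
    by apply: measurable_funB; exact: mB.
  have l1 := @integral_sqrD_le _ _ _ P setT (fun w => Z T w - simple_integral B (S m) T w)
    (fun w => simple_integral B (S m) T w - \sum_(k < n) sigma (eps (g k) w) * (B (g k.+1) w - B (g k) w))
    measurableT (measurable_funB mZ mI) (measurable_funB mI mG).
  apply: (@le_trans _ _ _ _ _ (le_trans _ l1)).
    by apply: le_integral_nonmeas => w _; rewrite addrA subrK.
  apply: leeD.
    apply: lee_wpmul2l => //; apply: le_integral_nonmeas => w _.
    by rewrite -sqrrN opprB.
  under eq_integral do rewrite -e1.
  rewrite iso.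
  have mS : measurable_fun setT (fun y : Omega * R => simple_value (S m) y.2 y.1).
    apply: measurable_sum => k; apply: measurable_funM.
      exact: (measurableT_comp (mcoefO k (ltn_ord k)) measurable_fst).
    exact: joint_measurable_interval.
  have mT : measurable (`[0, T]%classic : set (measurableTypeR R)) by [].
  have section_measurable (f : Omega * R -> R) w : measurable_fun setT f ->
      measurable_fun (`[0, T]%classic : set (measurableTypeR R)) (fun s => f (w, s)).
    by move=> mf; apply: measurable_funTS; exact: measurableT_comp.
  have msq (f : Omega * R -> R) : measurable_fun setT f ->
      measurable_fun setT (fun y => (f y ^+ 2)%:E).
    by move=> mf; apply/measurable_EFinP; exact: measurable_funX.
  have mSH := measurable_funB mS mH.
  have mHs := measurable_funB mH joint_measurable_step.
  have sq0 (f : Omega * R -> R) y : (0 <= (f y ^+ 2)%:E)%E by rewrite lee_fin sqr_ge0.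
  have [mi1 _] := tonelli_restr P (@lebesgue_measure R) mT (msq _ mSH) (sq0 _).
  have [mi2 _] := tonelli_restr P (@lebesgue_measure R) mT (msq _ mHs) (sq0 _).
  have i10 w : (0 <= \int[lebesgue_measure]_(s in `[0%R, T])
      ((simple_value (S m) s w - H (w, s)) ^+ 2)%:E)%E.
    by apply: integral_ge0 => s _; rewrite lee_fin sqr_ge0.
  have i20 w : (0 <= \int[lebesgue_measure]_(s in `[0%R, T]) ((H (w, s) - step s w) ^+ 2)%:E)%E.
    by apply: integral_ge0 => s _; rewrite lee_fin sqr_ge0.
  apply: (@le_trans _ _ (2%:E * (2%:E * (\int[P]_w \int[lebesgue_measure]_(s in `[0%R, T])
      ((simple_value (S m) s w - H (w, s)) ^+ 2)%:E) +
      2%:E * \int[P]_w \int[lebesgue_measure]_(s in `[0%R, T]) ((H (w, s) - step s w) ^+ 2)%:E))%E).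
    apply: lee_wpmul2l => //.
    rewrite (ge0_integral_twiceD P mi1 mi2 i10 i20).
    apply: le_integral_nonmeas => w _.
    have l2 := integral_sqrD_le lebesgue_measure mT (section_measurable _ w mSH)
      (section_measurable _ w mHs).
    apply: le_trans l2; apply: le_integral_nonmeas => s sT.
    by rewrite e2 ?inE// addrA subrK.
  rewrite muleDr//; last first.
    by rewrite ge0_adde_def// inE mule_ge0// integral_ge0.
  rewrite !muleA -!EFinM (_ : 2 * 2 = 4 :> R)//; last by ring.
  apply: leeD.
    apply: lee_wpmul2l => //; apply: ae_le_integral; apply: filterS HE => w HE _.
    by apply: le_integral_nonmeas => s /=; rewrite in_itv/= => /andP[s0 _]; rewrite HE.
  by rewrite EFinM; apply: lee_wpmul2l.
have lim : ((fun m => 2%:E * (\int[P]_w ((simple_integral B (S m) T w - Z T w) ^+ 2)%:E) +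
     (4%:E * (\int[P]_w \int[lebesgue_measure]_(s in `[0%R, T])
           ((simple_value (S m) s w - sigma (eps s w)) ^+ 2)%:E) +
     (4 * (D2 * L * delta * T))%:E)) @ \oo --> 2%:E * 0 + (4%:E * 0 + (4 * (D2 * L * delta * T))%:E))%E.
  apply: cvgeD; first by rewrite !mule0 add0e.
    exact: cvgeZl.
  apply: cvgeD; first by rewrite mule0.
    exact: cvgeZl.
  exact: cvg_cst.
rewrite !mule0 !add0e in lim.
by apply: (cvge_ge _ lim); apply: nearW.
Qed.

End Approximation.

End ItoGrid.

Lemma integral_leD d (T : measurableType d) (R : realType)
  (mu : {measure set T -> \bar R}) (D : set T) (f g h : T -> R) :
  measurable D -> measurable_fun D g -> measurable_fun D h ->
  (forall x, D x -> 0 <= g x) -> (forall x, D x -> 0 <= h x) ->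
  (forall x, D x -> f x <= g x + h x) ->
  (\int[mu]_(x in D) (f x)%:E <= \int[mu]_(x in D) (g x)%:E + \int[mu]_(x in D) (h x)%:E)%E.
Proof.
move=> mD mg mh g0 h0 fgh; rewrite -ge0_integralD//=.
- by apply: le_integral_nonmeas => x Dx; rewrite -EFinD lee_fin fgh.
- exact/measurable_EFinP.
- exact/measurable_EFinP.
Qed.

Lemma ge0_integralZ d (T : measurableType d) (R : realType)
  (mu : {measure set T -> \bar R}) (D : set T) (k : R) (f : T -> R) :
  measurable D -> measurable_fun D f -> 0 <= k -> (forall x, D x -> 0 <= f x) ->
  (\int[mu]_(x in D) (k * f x)%:E = k%:E * \int[mu]_(x in D) (f x)%:E)%E.
Proof.
move=> mD mf k0 f0; under eq_integral do rewrite EFinM.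
by rewrite ge0_integralZl//; exact/measurable_EFinP.
Qed.

(** Young's inequality with a free weight [k], chosen later according to the scale of [u]; it
    converts second-moment bounds into first-moment bounds. *)
Lemma norm_le_square (R : realFieldType) (k u : R) : 0 < k ->
  `|u| <= k / 2 + (2 * k)^-1 * u ^+ 2.
Proof.
move=> k0; rewrite -(real_normK (num_real u)).
have -> : k / 2 + (2 * k)^-1 * `|u| ^+ 2 = (2 * k)^-1 * (k ^+ 2 + `|u| ^+ 2).
  by field; rewrite gt_eqF.
rewrite ler_pdivlMl ?mulr_gt0//.
by have := sqr_ge0 (k - `|u|); rewrite sqrrB; lra.
Qed.

Lemma integral_young d (T : measurableType d) (R : realType) (P : probability T R)
  (k a : R) (u : T -> R) : 0 < k -> measurable_fun setT u ->
  (\int[P]_x (u x ^+ 2)%:E <= a%:E)%E ->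
  (\int[P]_x (k / 2 + (2 * k)^-1 * u x ^+ 2)%:E <= (k / 2 + (2 * k)^-1 * a)%:E)%E.
Proof.
move=> k0 mu ua; have k2 : 0 <= (2 * k)^-1 by rewrite invr_ge0 mulr_ge0// ltW.
have mu2 : measurable_fun setT (fun x => u x ^+ 2) by exact: measurable_funX.
apply: le_trans (integral_leD P measurableT (g := fun=> k / 2)
  (h := fun x => (2 * k)^-1 * u x ^+ 2) _ _ _ _ _) _ => //.
- exact: measurable_funM.
- by move=> x _; rewrite divr_ge0// ltW.
- by move=> x _; rewrite mulr_ge0// sqr_ge0.
rewrite integral_cst// [X in (_ * X)%E]probability_setT mule1 EFinD leeD2l//.
rewrite ge0_integralZ//; last by move=> x _; exact: sqr_ge0.
by rewrite EFinM lee_wpmul2l.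
Qed.

Section TwoPieceGrid.
Context {R : realType}.
Variables (t h : R) (n : nat).
Hypotheses (t0 : 0 <= t) (h0 : 0 <= h) (n0 : (0 < n)%N).

(** [n] cells on [[0, t]] followed by [n] cells on [[t, t + h]]: both times are nodes, so the grid
    sums up to [t] and up to [t + h] share their first half. *)
Definition two_piece_grid (k : nat) : R :=
  if (k <= n)%N then t * (k%:R / n%:R) else t + h * ((k - n)%:R / n%:R).

Let n_neq0 : n%:R != 0 :> R. Proof. by rewrite pnatr_eq0 -lt0n. Qed.

Lemma two_piece_grid0 : two_piece_grid 0 = 0.
Proof. by rewrite /two_piece_grid leq0n mul0r mulr0. Qed.

Lemma two_piece_grid_shift k : two_piece_grid (n + k) = t + h * (k%:R / n%:R).
Proof.
rewrite /two_piece_grid; case: k => [|k]; last by rewrite addnS ltnNge leq_addr/= -addnS addKn.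
by rewrite addn0 leqnn divff// mulr1 mul0r mulr0 addr0.
Qed.

Lemma two_piece_grid_mid : two_piece_grid n = t.
Proof. by rewrite -[n in LHS]addn0 two_piece_grid_shift mul0r mulr0 addr0. Qed.

Lemma two_piece_grid_end : two_piece_grid (n + n) = t + h.
Proof. by rewrite two_piece_grid_shift divff// mulr1. Qed.

Lemma two_piece_grid_diff k :
  two_piece_grid k.+1 - two_piece_grid k = (if (k < n)%N then t else h) / n%:R.
Proof.
have [kn|nk] := ltnP k n.
  by rewrite /two_piece_grid kn ltnW// -mulrBr -mulrBl -natrB// subSnn mul1r.
rewrite -(subnKC nk) -addnS !two_piece_grid_shift.
by rewrite addrAC opprD addrA subrr add0r addrC -mulrBr -mulrBl -natrB// subSnn mul1r.
Qed.

Lemma two_piece_grid_nd k : two_piece_grid k <= two_piece_grid k.+1.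
Proof. by rewrite -subr_ge0 two_piece_grid_diff divr_ge0//; case: ifP. Qed.

Lemma two_piece_grid_mesh k : two_piece_grid k.+1 - two_piece_grid k <= (t + h) / n%:R.
Proof.
rewrite two_piece_grid_diff ler_wpM2r ?invr_ge0//.
by case: ifP; rewrite ?lerDl ?lerDr.
Qed.

End TwoPieceGrid.

(** * Error of freezing the volatility over a short step *)

Section ItoStep.
Context {R : realType} {d : measure_display} {Omega : measurableType d}.
Variable P : probability Omega R.
Hypothesis complete_P : measure_is_complete P.
Variables (B : R -> Omega -> R) (eps : R -> Omega -> 'I_2) (lambda : 'I_2 -> R).
Hypothesis lambda_gt0 : forall i, 0 < lambda i.
Hypothesis brownian_B : brownian_motion P B.
Hypothesis chain_eps : markov_chain P eps (generator lambda).
Hypothesis independent_B_eps : independent_processes P B eps.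
Local Notation F := (augmented_filtration P B eps).
Local Notation filtered t := (filtered P B eps t).

Let mB t : 0 <= t -> measurable_fun setT (B t).
Proof. by have [+ _ _ _ _] := brownian_B; exact. Qed.

Let meps t j : 0 <= t -> measurable [set w | eps t w = j].
Proof. by have [+ _ _ _] := chain_eps; exact. Qed.

Let L := lambda reg1 + lambda reg2.
Let L_ge0 : 0 <= L. Proof. by rewrite ltW// addr_gt0. Qed.

Variables (sigma : 'I_2 -> R) (Z : R -> Omega -> R).
Hypothesis ito_Z : is_ito_integral P F B (fun t w => sigma (eps t w)) Z.

Let D2 := (sigma reg1 - sigma reg2) ^+ 2.
Let D2_ge0 : 0 <= D2. Proof. exact: sqr_ge0. Qed.

Let msigma t : 0 <= t -> measurable_fun setT (fun w => sigma (eps t w)).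
Proof.
move=> t0; apply: (@measurable_filtered _ _ _ P complete_P B eps mB meps t).
by apply: measurable_filtered_eps; rewrite lexx t0.
Qed.

Let mZ t : 0 <= t -> measurable_fun [set: Omega] (Z t).
Proof.
move=> t0; have [aZ _ _] := ito_Z.
apply: (@measurable_filtered _ _ _ P complete_P B eps mB meps t).
by move=> _ U mU; rewrite setTI; exact: aZ.
Qed.

(** If the regime at some grid point differs from the initial one, two consecutive grid points
    already differ; the bounds for these switches telescope in time. *)
Lemma prob_switch_grid (g : nat -> R) n : 0 <= g 0%N -> (forall k, g k <= g k.+1) ->
  measurable [set w | exists2 k, (k <= n)%N & eps (g k) w != eps (g 0%N) w] /\
  (P [set w | exists2 k, (k <= n)%N & eps (g k) w != eps (g 0%N) w] <= (L * (g n - g 0%N))%:E)%E.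
Proof.
move=> g0 g_nd; have g_ge0 k : 0 <= g k by rewrite (le_trans g0)// grid_le.
elim: n => [|n [mn Pn]].
  have -> : [set w | exists2 k, (k <= 0)%N & eps (g k) w != eps (g 0%N) w] = set0.
    by apply/seteqP; split => // w [k]; rewrite leqn0 => /eqP ->; rewrite eqxx.
  by rewrite measure0 subrr mulr0.
have mS k l := measurable_switch chain_eps (g_ge0 k) (g_ge0 l).
have m1 : measurable [set w | exists2 k, (k <= n.+1)%N & eps (g k) w != eps (g 0%N) w].
  rewrite (_ : [set _ | _] = [set w | exists2 k, (k <= n)%N & eps (g k) w != eps (g 0%N) w] `|`
     [set w | eps (g n.+1) w != eps (g 0%N) w]); first exact: measurableU.
  apply/seteqP; split => w.
    move=> [k]; rewrite leq_eqVlt ltnS => /predU1P[->|kn] h; first by right.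
    by left; exists k.
  by case=> [[k kn h]|h]; [exists k => //; exact: leqW|exists n.+1].
split => //.
apply: (@le_trans _ _ (P ([set w | exists2 k, (k <= n)%N & eps (g k) w != eps (g 0%N) w] `|`
     [set w | eps (g n) w != eps (g n.+1) w]))).
  apply: le_measure; rewrite ?inE//; first exact: measurableU.
  move=> w [k]; rewrite leq_eqVlt ltnS => /predU1P[->|kn] h; last by left; exists k.
  have [e|e] := eqVneq (eps (g n) w) (eps (g n.+1) w); last by right.
  by left; exists n => //; rewrite e.
apply: (le_trans (measureU2 _ _ _)) => //.
have gn : 0 <= g n <= g n.+1 by rewrite g_ge0 g_nd.
have Ps := prob_switch complete_P lambda_gt0 brownian_B chain_eps independent_B_eps gn.
apply: (le_trans (leeD Pn Ps)); rewrite -EFinD lee_fin -mulrDr.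
by rewrite addrC addrA subrK.
Qed.

Let joint_measurable_interval (a b : R) : measurable_fun [set: Omega * R]
  (fun z => \1_(`]a, b]%classic : set R) z.2 : R).
Proof. exact: (measurableT_comp (f := (\1_(`]a, b]%classic : set R) : R -> R))). Qed.

Section OneStep.
Variables (t h : R).
Hypotheses (t0 : 0 <= t) (h0 : 0 < h).

(** The isometry turns the left side into a time integral over an interval of length [h]; its
    integrand is itself at most of order [h], because the chain has to jump for the two volatilities
    to differ. *)
Lemma frozen_coefficient_square (g : nat -> R) n : g 0 = t -> g n = t + h -> (forall k, g k <= g k.+1) ->
  (\int[P]_w ((\sum_(k < n) (sigma (eps (g k) w) - sigma (eps t w)) * (B (g k.+1) w - B (g k) w)) ^+ 2)%:E
   <= (D2 * L * h ^+ 2)%:E)%E.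
Proof.
move=> g0 gn g_nd.
have gt k : t <= g k by rewrite -g0 grid_le.
have g_ge0 k : 0 <= g k by rewrite (le_trans t0).
pose z (k : 'I_n) w := sigma (eps (g k) w) - sigma (eps t w).
pose M := `|sigma reg1| + `|sigma reg2|.
have mzO k : measurable_fun [set: Omega] (z k) by apply: measurable_funB; exact: msigma.
have mz (k : 'I_n) : g k < g k.+1 -> measurable_fun [set: filtered (g k)] (z k).
  move=> _; apply: measurable_funB; apply: measurable_filtered_eps.
    by rewrite lexx g_ge0.
  by rewrite t0 gt.
have zM k w : `|z k w| <= 2 * M.
  apply: (le_trans (ler_normB _ _)); rewrite mulr_natl mulr2n lerD// /M.
    by case: (regP (eps (g k) w)) => ->; rewrite ?lerDl ?lerDr.
  by case: (regP (eps t w)) => ->; rewrite ?lerDl ?lerDr.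
have gT (k : 'I_n) : g k.+1 <= t + h by rewrite -gn grid_le.
have [_ ->] := step_integral_isometry complete_P lambda_gt0 brownian_B chain_eps independent_B_eps
  (fun k : 'I_n => g_ge0 k) (fun k => g_nd k) gT mzO mz zM.
have mT : measurable (`[0, t + h]%classic : set (measurableTypeR R)) by [].
pose f (y : Omega * R) := \sum_(k < n) z k y.1 * \1_(`]g k, g k.+1]%classic : set R) y.2.
have mf : measurable_fun setT (fun y => (f y ^+ 2)%:E).
  apply/measurable_EFinP/measurable_funX; apply: measurable_sum => k; apply: measurable_funM.
    exact: (measurableT_comp (mzO k) measurable_fst).
  exact: joint_measurable_interval.
have f0 y : (0 <= (f y ^+ 2)%:E)%E by rewrite lee_fin sqr_ge0.
have [_] := tonelli_restr P (@lebesgue_measure R) mT mf f0.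
rewrite /f/= => ->.
apply: (@le_trans _ _ (\int[lebesgue_measure]_(s in `[0%R, (t + h)%R])
    ((D2 * L * h) * \1_(`]t, (t + h)]%classic : set R) s)%:E)%E).
  apply: le_integral_nonmeas => s /=; rewrite in_itv/= => /andP[s0 sth].
  rewrite indicE; have [st|ts] := leP s t.
    rewrite memNset ?mulr0/=; last by rewrite in_itv/= ltNge st.
    rewrite integral0_eq// => w _; rewrite big1 ?expr0n// => k _.
    by rewrite indicE memNset ?mulr0//= in_itv/= ltNge (le_trans st).
  rewrite mem_set ?mulr1/=; last by rewrite in_itv/= ts.
  have g0s : g 0 < s by rewrite g0.
  have sgn : s <= g n by rewrite gn.
  have [k kn ks] := grid_cell g0s sgn.
  have := ks => /andP[/ltW ks1 ks2].
  have tgk : 0 <= t <= g k by rewrite t0 gt.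
  apply: (@le_trans _ _ (D2 * L * (g k - t))%:E); last first.
    rewrite lee_fin; apply: ler_wpM2l; first exact: mulr_ge0 D2_ge0 L_ge0.
    by rewrite lerBlDl (le_trans ks1).
  apply: le_trans (square_jump complete_P lambda_gt0 brownian_B chain_eps independent_B_eps sigma tgk).
  apply: le_integral_nonmeas => w _.
  have -> : \sum_(j < n) z j w * \1_(`]g j, g j.+1]%classic : set R) s =
      sigma (eps (g k) w) - sigma (eps t w).
    exact: (grid_step g_nd (fun k => sigma (eps (g k) w) - sigma (eps t w)) kn ks).
  by [].
rewrite ge0_integralZ//; last first.
  exact: mulr_ge0 (mulr_ge0 D2_ge0 L_ge0) (ltW h0).
rewrite integral_indic// setIidl; last first.
  by move=> s /=; rewrite !in_itv/= => /andP[/ltW ts ->]; rewrite (le_trans t0).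
rewrite [X in (_ * X)%E](_ : _ = h%:E); last first.
  by rewrite [LHS]lebesgue_measure_itv/= lte_fin ltrDl h0 -EFinD; congr EFin; ring.
by rewrite -EFinM lee_fin expr2 mulrA.
Qed.

Let Dn (g : nat -> R) n w :=
  \sum_(k < n) (sigma (eps (g k) w) - sigma (eps t w)) * (B (g k.+1) w - B (g k) w).

(* The frozen coefficient is exact unless the chain jumps, which has
   probability O(h); this is what improves the rate h to h^(3/2). *)
Let frozen_coefficient (g : nat -> R) n : g 0 = t -> g n = t + h -> (forall k, g k <= g k.+1) ->
  (\int[P]_w (`|Dn g n w|)%:E <= (L * (1 + D2) / 2 * (h * Num.sqrt h))%:E)%E.
Proof.
move=> g0 gn g_nd.
have gt k : t <= g k by rewrite -g0 grid_le.
have g_ge0 k : 0 <= g k by rewrite (le_trans t0).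
have q0 : 0 < Num.sqrt h by rewrite sqrtr_gt0.
have q2 : Num.sqrt h ^+ 2 = h by rewrite sqr_sqrtr// ltW.
set q := Num.sqrt h in q0 q2 *.
have mDn : measurable_fun setT (Dn g n).
  apply: measurable_sum => k; apply: measurable_funM.
    by apply: measurable_funB; exact: msigma.
  by apply: measurable_funB; exact: mB.
have g00 : 0 <= g 0 by rewrite g0.
have [mA PA] := prob_switch_grid n g00 g_nd.
set A := [set w | _] in mA PA.
have DE w : ~ A w -> Dn g n w = 0.
  move=> nA; rewrite /Dn big1// => k _; rewrite -g0.
  have -> : eps (g k) w = eps (g 0) w; last by rewrite subrr mul0r.
  by apply/eqP/negPn/negP => e; apply: nA; exists k => //; exact: ltnW.
have q2V : 0 <= (2 * q)^-1 by rewrite invr_ge0 mulr_ge0// ltW.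
apply: le_trans (integral_leD P measurableT (g := fun w => q / 2 * \1_A w)
  (h := fun w => (2 * q)^-1 * Dn g n w ^+ 2) _ _ _ _ _) _.
- exact: measurable_funM.
- by apply: measurable_funM => //; exact: measurable_funX.
- by move=> w _; rewrite mulr_ge0// divr_ge0// ltW.
- by move=> w _; rewrite mulr_ge0// sqr_ge0.
- move=> w _; rewrite indicE; have [wA|wA] := boolP (w \in A).
    by rewrite mulr1; exact: norm_le_square.
  rewrite DE ?normr0; last by move=> /mem_set; apply/negP.
  by rewrite mulr0 expr0n mulr0 addr0.
rewrite ge0_integralZ//; last by rewrite divr_ge0// ltW.
rewrite ge0_integralZ//; last 2 first.
- exact: measurable_funX.
- by move=> w _; exact: sqr_ge0.
rewrite integral_indic// setIT.
have h1 : ((q / 2)%:E * P A <= (q / 2)%:E * (L * h)%:E)%E.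
  apply: lee_wpmul2l; first by rewrite lee_fin divr_ge0// ltW.
  by apply: (le_trans PA); rewrite g0 gn lee_fin addrAC subrr add0r.
have h2 := lee_wpmul2l (_ : 0 <= ((2 * q)^-1)%:E)%E (frozen_coefficient_square g0 gn g_nd).
apply: (le_trans (leeD h1 (h2 _))) => //.
rewrite -!EFinM -EFinD lee_fin -q2.
by rewrite le_eqVlt; apply/orP; left; apply/eqP; field; rewrite gt_eqF.
Qed.

Lemma ito_step_error : (\int[P]_w (`|Z (t + h) w - Z t w - sigma (eps t w) * (B (t + h) w - B t w)|)%:E
  <= (L * (1 + D2) / 2 * (h * Num.sqrt h))%:E)%E.
Proof.
apply/lee_addgt0Pr => e e0.
(* Young's weight: both grid errors have second moment at most [K / n], so together they contribute
   at most [k + K / (k * n)], which is below [2 * k = e] once [n] exceeds [K / k ^+ 2]. *)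
pose k := e / 2; have k0 : 0 < k by rewrite divr_gt0.
have th0 : 0 <= t + h by rewrite addr_ge0// ltW.
pose K := 4 * (D2 * L * (t + h) * (t + h)).
have D2L := mulr_ge0 D2_ge0 L_ge0.
have K0 : 0 <= K by exact: mulr_ge0 (ler0n _ 4) (mulr_ge0 (mulr_ge0 D2L th0) th0).
have Kk0 : 0 <= K / k ^+ 2 by rewrite divr_ge0// sqr_ge0.
pose n := Num.bound (K / k ^+ 2).
have Kn : K / k ^+ 2 < n%:R by exact: archi_boundP.
have n0 : (0 < n)%N by rewrite -(ltr_nat R) (le_lt_trans _ Kn).
have n0' : 0 < n%:R :> R by rewrite ltr0n.
pose g := two_piece_grid t h n.
have g_nd j := two_piece_grid_nd t0 (ltW h0) n0 j.
have g_mesh j := two_piece_grid_mesh t0 (ltW h0) n0 j.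
have g_end := two_piece_grid_end t h n0.
have g_mid := two_piece_grid_mid t h n0.
have u2 := ito_grid complete_P lambda_gt0 brownian_B chain_eps independent_B_eps ito_Z
  (two_piece_grid0 t h n) g_end g_nd (fun j _ => g_mesh j).
have v2 := ito_grid complete_P lambda_gt0 brownian_B chain_eps independent_B_eps ito_Z
  (two_piece_grid0 t h n) g_mid g_nd (fun j _ => g_mesh j).
pose I m w := \sum_(j < m) sigma (eps (g j) w) * (B (g j.+1) w - B (g j) w).
rewrite -/g -/D2 -/L in u2 v2.
have g_ge0 j : 0 <= g j by rewrite -(two_piece_grid0 t h n) grid_le.
have mI m : measurable_fun setT (I m).
  apply: measurable_sum => j; apply: measurable_funM; first exact: msigma.
  by apply: measurable_funB; exact: mB.
have mu : measurable_fun setT (fun w => Z (t + h) w - I (n + n)%N w).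
  by apply: measurable_funB => //; exact: mZ.
have mv : measurable_fun setT (fun w => Z t w - I n w).
  by apply: measurable_funB => //; exact: mZ.
pose g' j := g (n + j)%N.
have g'_ge0 j : 0 <= g' j by exact: g_ge0.
have mDn : measurable_fun setT (Dn g' n).
  apply: measurable_sum => j; apply: measurable_funM.
    by apply: measurable_funB; exact: msigma.
  by apply: measurable_funB; exact: mB.
have g'0 : g' 0%N = t by rewrite /g' addn0.
have g'n : g' n = t + h by [].
have g'_nd j : g' j <= g' j.+1 by rewrite /g' addnS.
have dec w : Z (t + h) w - Z t w - sigma (eps t w) * (B (t + h) w - B t w) =
    (Z (t + h) w - I (n + n)%N w) - (Z t w - I n w) + Dn g' n w.
  have -> : B (t + h) w - B t w = \sum_(j < n) (B (g' j.+1) w - B (g' j) w).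
    by rewrite -(big_mkord xpredT (fun j => B (g' j.+1) w - B (g' j) w)) telescope_sumr// g'n g'0.
  rewrite /I big_split_ord/= /Dn.
  under [X in _ = _ + X]eq_bigr do rewrite mulrBl.
  rewrite mulr_sumr sumrB.
  have -> : \sum_(i < n) sigma (eps (g (n + i)%N) w) * (B (g (n + i).+1) w - B (g (n + i)%N) w) =
     \sum_(i < n) sigma (eps (g' i) w) * (B (g' i.+1) w - B (g' i) w).
    by apply: eq_bigr => j _; rewrite /g' addnS.
  by move: (\sum_(_ < _) _) (\sum_(_ < _) _) (\sum_(_ < _) _) => x y v; ring.
have b1 := integral_young k0 mu u2.
have b2 := integral_young k0 mv v2.
have b3 := frozen_coefficient g'0 g'n g'_nd.
have sq0 (x : R) : 0 <= k / 2 + (2 * k)^-1 * x ^+ 2.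
  exact: le_trans (normr_ge0 x) (norm_le_square x k0).
have msq (x : Omega -> R) : measurable_fun setT x ->
    measurable_fun setT (fun w => k / 2 + (2 * k)^-1 * x w ^+ 2).
  by move=> mx; apply: measurable_funD => //; apply: measurable_funM => //; exact: measurable_funX.
apply: le_trans (integral_leD P measurableT
  (g := fun w => (k / 2 + (2 * k)^-1 * (Z (t + h) w - I (n + n)%N w) ^+ 2) +
                 (k / 2 + (2 * k)^-1 * (Z t w - I n w) ^+ 2))
  (h := fun w => `|Dn g' n w|) _ _ _ _ _) _.
- by apply: measurable_funD; exact: msq.
- exact: measurableT_comp.
- by move=> w _; rewrite addr_ge0.
- by [].
- move=> w _; rewrite dec; apply: (le_trans (ler_normD _ _)); rewrite lerD2r.
  by apply: (le_trans (ler_normB _ _)); apply: lerD; exact: norm_le_square.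
rewrite addeC; apply: leeD => //.
apply: le_trans (integral_leD P measurableT (msq _ mu) (msq _ mv) _ _ _) _ => //.
apply: (le_trans (leeD b1 b2)); rewrite -EFinD lee_fin.
have Kkn : K / (k * n%:R) <= k.
  rewrite ler_pdivrMr ?mulr_gt0// mulrA -expr2 -ler_pdivrMl ?exprn_gt0//.
  by rewrite mulrC ltW.
have ke : k + k = e by rewrite /k; field.
rewrite -ke.
apply: (@le_trans _ _ (k + K / (k * n%:R))); last by rewrite lerD2l.
have -> : k + K / (k * n%:R) = (k / 2 + (2 * k)^-1 * (4 * (D2 * L * ((t + h) / n%:R) * (t + h)))) +
    (k / 2 + (2 * k)^-1 * (4 * (D2 * L * ((t + h) / n%:R) * (t + h)))).
  by rewrite /K; field; rewrite !gt_eqF.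
rewrite lerD2l lerD2l; apply: ler_wpM2l; first by rewrite invr_ge0 mulr_ge0// ltW.
apply: ler_wpM2l => //; apply: ler_wpM2l.
  by apply: mulr_ge0 => //; rewrite divr_ge0.
by rewrite lerDl ltW.
Qed.

End OneStep.
End ItoStep.

(** * The one-step operator *)

Lemma expRN_discount (R : realType) (u : R) : 0 <= u ->
  1 - u ^+ 2 <= expR (- u) * (1 + u) <= 1.
Proof.
move=> u0; apply/andP; split; last first.
  rewrite expRN ler_pdivrMl ?expR_gt0// mulr1; exact: expR_ge1Dx.
have -> : 1 - u ^+ 2 = (1 + - u) * (1 + u) by ring.
by apply: ler_wpM2r; [rewrite addr_ge0|exact: expR_ge1Dx].
Qed.

Section OneStepOperator.
Context {R : realType}.
Variables (sigma lambda : 'I_2 -> R) (rho : R).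
Hypotheses (sigma_gt0 : forall i, 0 < sigma i) (lambda_gt0 : forall i, 0 < lambda i).
Hypothesis rho_gt0 : 0 < rho.
Variables (b : 'I_2 -> R) (w s : 'I_2 -> R -> R).
Hypothesis vf : verification sigma lambda rho b w s.

Let L := lambda reg1 + lambda reg2.
Let W := w reg1 0 + w reg2 0.

Lemma verification_value_bound i x : w i x <= w i 0 + Num.max 0 x.
Proof.
have [x0|/ltW x0] := leP x 0; first by rewrite addr0; exact: (vf_nd vf).
by have := vf_lip vf i x0; rewrite subr0; lra.
Qed.

(** Every component lies between [max 0 x] and [max 0 x + W], so a change of regime costs a bounded
    amount although the value itself is unbounded. *)
Lemma verification_value_diff i j x : `|w i x - w j x| <= W.
Proof.
have lo k : Num.max 0 x <= w k x by rewrite ge_max (vf_ge0 vf) (vf_ge vf).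
have up k : w k 0 <= W by case: (regP k) => ->; rewrite /W ?lerDl ?lerDr (vf_ge0 vf).
have := verification_value_bound i x; have := verification_value_bound j x.
have := lo i; have := lo j; have := up i; have := up j.
move: (Num.max 0 x) => m; rewrite ler_norml; lra.
Qed.

Lemma verification_value_lip i x y : `|w i y - w i x| <= `|y - x|.
Proof.
have [xy|yx] := leP x y.
  by rewrite !ger0_norm ?subr_ge0//; [exact: (vf_lip vf)|exact: (vf_nd vf)].
rewrite distrC [leRHS]distrC !ger0_norm ?subr_ge0 ?(ltW yx)//.
  by apply: (vf_lip vf); exact: ltW.
by apply: (vf_nd vf); exact: ltW.
Qed.

Lemma verification_value_measurable i : measurable_fun setT (w i).
Proof. by apply: nondecreasing_measurable => // x y xy; exact: (vf_nd vf). Qed.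

Definition one_step (i : 'I_2) (x h : R) : \bar R :=
  (\sum_j (transition lambda h i j)%:E *
    \int[normal_prob 0 (Num.sqrt h)]_z (w j (x + sigma i * z))%:E)%E.

Lemma one_stepE i x h : one_step i x h =
  ((1 - jump_prob lambda i h)%:E * \int[normal_prob 0 (Num.sqrt h)]_z (w i (x + sigma i * z))%:E +
   (jump_prob lambda i h)%:E * \int[normal_prob 0 (Num.sqrt h)]_z (w (other i) (x + sigma i * z))%:E)%E.
Proof.
rewrite /one_step sum_regimes /transition.
by case: (regP i) => -> //=; rewrite addeC.
Qed.

Section Bounds.
Variables (i : 'I_2) (h : R).
Hypotheses (h0 : 0 < h) (h1 : h <= 1).
Let q := Num.sqrt h.
Let q0 : 0 < q. Proof. by rewrite sqrtr_gt0. Qed.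
Let q2 : q ^+ 2 = h. Proof. by rewrite sqr_sqrtr// ltW. Qed.
Let q1 : q <= 1. Proof. by rewrite -[1]sqrtr1 ler_sqrt. Qed.
Let p := jump_prob lambda i h.
Let p0 : 0 <= p. Proof. exact: jump_prob_ge0 (ltW h0). Qed.
Let p1 : p <= 1. Proof. exact: jump_prob_le1 (ltW h0). Qed.

Let ph : p <= lambda i * h. Proof. exact: jump_prob_le. Qed.

Let ph' : lambda i * h - lambda i * L * h ^+ 2 <= p.
Proof. exact: jump_prob_ge (ltW h0). Qed.

(** After a regime change the Lipschitz bound is enough: its error of order [q] is multiplied by a
    switching probability of order [q ^+ 2]. *)
Let switched_le j x :
  (\int[normal_prob 0 q]_z (w j (x + sigma i * z))%:E <= (w j x + sigma i * q)%:E)%E.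
Proof.
have H (z : R) : w j (x + sigma i * z) <=
    (w j x + sigma i * q / 2) + 0 * z + sigma i / (2 * q) * z ^+ 2 + 0 * `|z| ^+ 3.
  have := verification_value_lip j x (x + sigma i * z); rewrite ler_norml => /andP[_].
  rewrite addrAC subrr add0r normrM gtr0_norm// => l.
  have := norm_le_square z q0 => /(ler_wpM2l (ltW (sigma_gt0 i))) l2.
  rewrite !mul0r !addr0 (_ : _ + _ + _ = w j x + sigma i * (q / 2 + (2 * q)^-1 * z ^+ 2)).
    by rewrite -lerBlDl; exact: le_trans l2.
  by field; rewrite gt_eqF.
apply: (le_trans (gauss_taylor_le q0 (lexx 0) H)); rewrite lee_fin le_eqVlt; apply/orP; left; apply/eqP.
by field; rewrite gt_eqF.
Qed.

Let switched_ge j x :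
  ((w j x - sigma i * q)%:E <= \int[normal_prob 0 q]_z (w j (x + sigma i * z))%:E)%E.
Proof.
have H (z : R) : (w j x - sigma i * q / 2) + 0 * z + (- (sigma i / (2 * q))) * z ^+ 2 - 0 * `|z| ^+ 3
    <= w j (x + sigma i * z).
  have := verification_value_lip j x (x + sigma i * z); rewrite ler_norml => /andP[+ _].
  rewrite addrAC subrr add0r normrM gtr0_norm// => l.
  have := norm_le_square z q0 => /(ler_wpM2l (ltW (sigma_gt0 i))) l2.
  rewrite !mul0r addr0 subr0 (_ : _ + _ = w j x - sigma i * (q / 2 + (2 * q)^-1 * z ^+ 2)).
    by rewrite lerBlDl -lerBlDr; apply: le_trans l2; rewrite -lerN2 opprB.
  by field; rewrite gt_eqF.
apply: le_trans (gauss_taylor_ge q0 (lexx 0) H); rewrite lee_fin le_eqVlt; apply/orP; left; apply/eqP.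
by field; rewrite gt_eqF.
Qed.

Let W0 : 0 <= W. Proof. by rewrite addr_ge0// (vf_ge0 vf). Qed.
Let L0 : 0 <= L. Proof. by rewrite ltW// addr_gt0. Qed.

(* The compensated jump [p (w_j - w_i)] matches the coupling term of [kgen]. *)
Let kgen_jump x : `|p * (w (other i) x - w i x) + kgen lambda rho w i x * h - rho * h * w i x|
  <= L * L * W * q ^+ 3.
Proof.
rewrite /kgen; have -> : p * (w (other i) x - w i x) +
    ((rho + lambda i) * w i x - lambda i * w (other i) x) * h - rho * h * w i x =
    - ((lambda i * h - p) * (w (other i) x - w i x)) by ring.
rewrite normrN normrM.
have e1 : `|lambda i * h - p| <= L * L * q ^+ 3.
  rewrite ger0_norm ?subr_ge0//; apply: (@le_trans _ _ (lambda i * L * h ^+ 2)).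
    by move: ph'; lra.
  apply: ler_pM.
  - by rewrite mulr_ge0// ltW.
  - exact: sqr_ge0.
  - by apply: ler_wpM2r => //; exact: lambda_le.
  - by rewrite -q2 -exprM; apply: ler_wiXn2l => //; exact: ltW.
rewrite (mulrAC (L * L)); apply: ler_pM => //.
exact: verification_value_diff.
Qed.

(** The Gaussian second moment turns the quadratic Taylor term into [kgen * h], which together with
    the compensated jump is nearly [rho * h * w i x]. The undiscounted expectation is thus at most
    [(1 + rho * h) * w i x] up to a term of order [q ^+ 3], and discounting removes the growth. *)
Lemma one_step_le_aux C x : 0 <= C ->
  (forall y z, w i (y + z) <= w i y + s i y * z + (sigma i ^+ 2)^-1 * kgen lambda rho w i y * z ^+ 2
                   + C * `|z| ^+ 3) ->
  ((expR (- (rho * h)))%:E * one_step i x h <=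
   (w i x + (2 * (C * sigma i ^+ 3) + L * sigma i + L * L * W) * q ^+ 3)%:E)%E.
Proof.
move=> C0 HC; rewrite one_stepE -/p -/q.
have s3 : 0 <= C * sigma i ^+ 3 by rewrite mulr_ge0// exprn_ge0// ltW.
have H (z : R) : w i (x + sigma i * z) <= w i x + (s i x * sigma i) * z +
    kgen lambda rho w i x * z ^+ 2 + (C * sigma i ^+ 3) * `|z| ^+ 3.
  apply: (le_trans (HC x (sigma i * z))).
  rewrite normrM (gtr0_norm (sigma_gt0 i)) le_eqVlt; apply/orP; left; apply/eqP.
  by field; rewrite gt_eqF.
have i1 := gauss_taylor_le q0 s3 H.
have i2 := switched_le (other i) x.
have p1' : (0 <= (1 - p)%:E)%E by rewrite lee_fin subr_ge0.
have p0' : (0 <= p%:E)%E by rewrite lee_fin.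
have h2 : (0 <= (expR (- (rho * h)))%:E)%E by rewrite lee_fin expR_ge0.
have := leeD (lee_wpmul2l p1' i1) (lee_wpmul2l p0' i2).
move=> /(lee_wpmul2l h2) h3; apply: (le_trans h3).
rewrite -?EFinM -?EFinD -?EFinM lee_fin.
have /andP[_ eD] := expRN_discount (ltW (mulr_gt0 rho_gt0 h0)).
have e1 : expR (- (rho * h)) <= 1 by rewrite -expR0 ler_expR oppr_le0 mulr_ge0// ltW.
have e0 := expR_ge0 (- (rho * h)).
have := kgen_jump x; rewrite ler_norml => /andP[_ kj].
have pq : p * (sigma i * q) <= L * sigma i * q ^+ 3.
  rewrite (_ : L * sigma i * q ^+ 3 = L * q ^+ 2 * (sigma i * q)); last by ring.
  apply: ler_wpM2r; first by rewrite mulr_ge0// ltW.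
  rewrite q2; apply: (le_trans ph); apply: ler_wpM2r; first exact: ltW.
  exact: lambda_le.
have k0 := vf_kgen vf i x.
have q30 : 0 <= q ^+ 3 by rewrite exprn_ge0// ltW.
set T := (X in _ * X <= _).
have T1 : T <= (1 + rho * h) * w i x +
    (2 * (C * sigma i ^+ 3) + L * sigma i + L * L * W) * q ^+ 3.
  rewrite /T q2.
  have pk := mulr_ge0 p0 (mulr_ge0 k0 (ltW h0)).
  have pc := mulr_ge0 p0 (mulr_ge0 (mulr_ge0 (ler0n _ 2) s3) q30).
  move: pk pc kj pq.
  by move: (kgen _ _ _ _ _) (w (other i) x) (q ^+ 3) (C * _) (L * L * W) (L * sigma i) => *; lra.
apply: (le_trans (ler_wpM2l e0 T1)).
rewrite mulrDr; apply: lerD.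
  by rewrite mulrA -[leRHS]mul1r; apply: ler_wpM2r => //; exact: (vf_ge0 vf).
rewrite -[leRHS]mul1r; apply: ler_wpM2r => //.
by rewrite mulr_ge0// !addr_ge0// !mulr_ge0// ltW.
Qed.

(** Mirror image of the upper bound with two extra losses: discounting loses
    [(rho * h) ^+ 2 * w i x], and [p] times the quadratic term has to be subtracted. Below the
    boundary [w i x] and [kgen] are bounded by multiples of [b i], which gives the last two
    constants. *)
Lemma one_step_ge_aux C e x : 0 < e -> 0 <= C -> x <= b i - e ->
  (forall z, w i x + s i x * z + (sigma i ^+ 2)^-1 * kgen lambda rho w i x * z ^+ 2
      - C * `|z| ^+ 3 <= w i (x + z)) ->
  ((w i x - (2 * (C * sigma i ^+ 3) + L * sigma i + L * L * W + rho ^+ 2 * b i +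
      L * ((rho + L) * b i)) * q ^+ 3)%:E <=
    (expR (- (rho * h)))%:E * one_step i x h)%E.
Proof.
move=> e_gt0 C0 xb HC; rewrite one_stepE -/p -/q.
have s3 : 0 <= C * sigma i ^+ 3 by rewrite mulr_ge0// exprn_ge0// ltW.
have H (z : R) : w i x + (s i x * sigma i) * z +
    kgen lambda rho w i x * z ^+ 2 - (C * sigma i ^+ 3) * `|z| ^+ 3 <= w i (x + sigma i * z).
  apply: le_trans (HC (sigma i * z)).
  rewrite normrM (gtr0_norm (sigma_gt0 i)) le_eqVlt; apply/orP; left; apply/eqP.
  by field; rewrite gt_eqF.
have i1 := gauss_taylor_ge q0 s3 H.
have i2 := switched_ge (other i) x.
have p1' : (0 <= (1 - p)%:E)%E by rewrite lee_fin subr_ge0.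
have p0' : (0 <= p%:E)%E by rewrite lee_fin.
have h2 : (0 <= (expR (- (rho * h)))%:E)%E by rewrite lee_fin expR_ge0.
have := leeD (lee_wpmul2l p1' i1) (lee_wpmul2l p0' i2).
move=> /(lee_wpmul2l h2) h3; apply: le_trans h3.
rewrite -?EFinM -?EFinD -?EFinM lee_fin.
have u0 := mulr_gt0 rho_gt0 h0.
have /andP[eD _] := expRN_discount (ltW u0).
have e1 : expR (- (rho * h)) <= 1 by rewrite -expR0 ler_expR oppr_le0 ltW.
have e0 := expR_ge0 (- (rho * h)).
have := kgen_jump x; rewrite ler_norml => /andP[kj _].
have q30 : 0 <= q ^+ 3 by rewrite exprn_ge0// ltW.
have b0 := vf_b vf i.
have wx0 := vf_ge0 vf i x.
have wb : w i x <= b i.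
  by rewrite -[leRHS](vf_eq vf (lexx (b i))); apply: (vf_nd vf); lra.
have pq : p * (sigma i * q) <= L * sigma i * q ^+ 3.
  rewrite (_ : L * sigma i * q ^+ 3 = L * q ^+ 2 * (sigma i * q)); last by ring.
  apply: ler_wpM2r; first by rewrite mulr_ge0// ltW.
  rewrite q2; apply: (le_trans ph); apply: ler_wpM2r; first exact: ltW.
  exact: lambda_le.
have h2q : h ^+ 2 <= q ^+ 3.
  by rewrite -q2 -exprM; apply: ler_wiXn2l => //; exact: ltW.
have k0 := vf_kgen vf i x.
have kb : kgen lambda rho w i x <= (rho + L) * b i.
  rewrite /kgen; apply: (@le_trans _ _ ((rho + lambda i) * w i x)).
    by rewrite gerBl mulr_ge0 ?(vf_ge0 vf)// ltW.
  apply: ler_pM => //; first by rewrite addr_ge0// ltW.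
  by rewrite lerD2l lambda_le.
have pk : p * (kgen lambda rho w i x * h) <= L * ((rho + L) * b i) * q ^+ 3.
  apply: (@le_trans _ _ (lambda i * h * ((rho + L) * b i * h))).
    apply: ler_pM => //; first by rewrite mulr_ge0// ltW.
    by apply: ler_wpM2r => //; exact: ltW.
  rewrite (_ : lambda i * h * ((rho + L) * b i * h) = lambda i * ((rho + L) * b i) * h ^+ 2); last by ring.
  apply: ler_pM => //.
  - by rewrite !mulr_ge0// ?addr_ge0// ltW.
  - exact: sqr_ge0.
  - by apply: ler_wpM2r; [rewrite mulr_ge0 ?addr_ge0// ltW|exact: lambda_le].
set T := (X in _ <= _ * X).
set K := 2 * (C * sigma i ^+ 3) + L * sigma i + L * L * W.
have K0 : 0 <= K.
  by rewrite /K addr_ge0 ?addr_ge0 ?mulr_ge0// ltW.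
have T1 : (1 + rho * h) * w i x - (K + L * ((rho + L) * b i)) * q ^+ 3 <= T.
  rewrite /T /K q2.
  have pc := mulr_ge0 p0 (mulr_ge0 (mulr_ge0 (ler0n _ 2) s3) q30).
  move: pk pc kj pq.
  by move: (kgen _ _ _ _ _) (w (other i) x) (q ^+ 3) (C * _) (L * L * W) (L * sigma i) (L * (_ * _)) => *; lra.
apply: le_trans (ler_wpM2l e0 T1).
have r2 : rho ^+ 2 * h ^+ 2 * w i x <= rho ^+ 2 * b i * q ^+ 3.
  rewrite -(mulrA (rho ^+ 2)) -(mulrA (rho ^+ 2) (b i)); apply: ler_wpM2l; first exact: sqr_ge0.
  by rewrite [leRHS]mulrC; apply: ler_pM => //; exact: sqr_ge0.
have r1 : (1 - rho ^+ 2 * h ^+ 2) * w i x <= expR (- (rho * h)) * ((1 + rho * h) * w i x).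
  by rewrite mulrA; apply: ler_wpM2r => //; rewrite -exprMn.
have r3 : expR (- (rho * h)) * ((K + L * ((rho + L) * b i)) * q ^+ 3) <= (K + L * ((rho + L) * b i)) * q ^+ 3.
  rewrite -[leRHS]mul1r; apply: ler_wpM2r => //.
  by rewrite mulr_ge0// addr_ge0// !mulr_ge0// ?addr_ge0// ltW.
rewrite mulrBr; apply: le_trans (lerB r1 r3).
rewrite mulrBl mul1r (_ : w i x - (K + rho ^+ 2 * b i + L * ((rho + L) * b i)) * q ^+ 3 =
  w i x - rho ^+ 2 * b i * q ^+ 3 - (K + L * ((rho + L) * b i)) * q ^+ 3); last by ring.
by rewrite lerD2r lerD2l lerN2.
Qed.

End Bounds.

Lemma one_step_le : exists2 C, 0 <= C & forall i x h, 0 < h -> h <= 1 ->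
  ((expR (- (rho * h)))%:E * one_step i x h <= (w i x + C * (h * Num.sqrt h))%:E)%E.
Proof.
have [C C0 HC] := vf_upper vf.
pose K i := 2 * (C * sigma i ^+ 3) + L * sigma i + L * L * W.
have W0 : 0 <= W by rewrite addr_ge0// (vf_ge0 vf).
have L0 : 0 <= L by rewrite ltW// addr_gt0.
have K0 i : 0 <= K i.
  by rewrite /K addr_ge0 ?addr_ge0 ?mulr_ge0 ?exprn_ge0// ltW.
exists (K reg1 + K reg2); first by rewrite addr_ge0.
move=> i x h h0 h1; apply: (le_trans (one_step_le_aux h0 h1 x C0 (HC i))).
have -> : h * Num.sqrt h = Num.sqrt h ^+ 3.
  by rewrite [RHS]exprSr sqr_sqrtr// ltW.
rewrite lee_fin lerD2l; apply: ler_wpM2r; first by rewrite exprn_ge0.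
by rewrite -/(K i); case: (regP i) => ->; rewrite ?lerDl ?lerDr.
Qed.

Lemma one_step_ge e : 0 < e -> exists2 C, 0 <= C & forall i x h, 0 < h -> h <= 1 ->
  x <= b i - e ->
  ((w i x - C * (h * Num.sqrt h))%:E <= (expR (- (rho * h)))%:E * one_step i x h)%E.
Proof.
move=> e0; have [C C0 HC] := vf_lower vf e0.
pose K i := 2 * (C * sigma i ^+ 3) + L * sigma i + L * L * W + rho ^+ 2 * b i + L * ((rho + L) * b i).
have W0 : 0 <= W by rewrite addr_ge0// (vf_ge0 vf).
have L0 : 0 <= L by rewrite ltW// addr_gt0.
have K0 i : 0 <= K i.
  have b0 := ltW (vf_b vf i); have s0 := ltW (sigma_gt0 i); have r0 := ltW rho_gt0.
  have rL := addr_ge0 r0 L0.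
  rewrite /K; apply: addr_ge0; last by rewrite !mulr_ge0.
  apply: addr_ge0; last by rewrite mulr_ge0// sqr_ge0.
  by rewrite addr_ge0 ?addr_ge0 ?mulr_ge0 ?exprn_ge0.
exists (K reg1 + K reg2); first by rewrite addr_ge0.
move=> i x h h0 h1 xb; apply: le_trans (one_step_ge_aux h0 h1 e0 C0 xb (fun z => HC i x z xb)).
have -> : h * Num.sqrt h = Num.sqrt h ^+ 3.
  by rewrite [RHS]exprSr sqr_sqrtr// ltW.
rewrite lee_fin lerD2l lerN2; apply: ler_wpM2r; first by rewrite exprn_ge0.
by rewrite -/(K i); case: (regP i) => ->; rewrite ?lerDl ?lerDr.
Qed.

End OneStepOperator.

Lemma measurable_one_step (R : realType) (sigma lambda : 'I_2 -> R) (rho : R)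
  (b : 'I_2 -> R) (v sl : 'I_2 -> R -> R) : verification sigma lambda rho b v sl ->
  forall i h, measurable_fun setT (fun y => one_step sigma lambda v i y h).
Proof.
move=> vf i h; apply: emeasurable_sum => j; apply: measurable_funeM.
pose f (yz : R * R) := (v j (yz.1 + sigma i * yz.2))%:E.
have mf : measurable_fun setT f.
  apply/measurable_EFinP; apply: (measurableT_comp (verification_value_measurable vf j)).
  apply: measurable_funD; first exact: measurable_fst.
  by apply: measurable_funM => //; exact: measurable_snd.
have f0 yz : (0 <= f yz)%E by rewrite lee_fin (vf_ge0 vf).
exact: (measurable_fun_fubini_tonelli_F (m2 := normal_prob 0 (Num.sqrt h)) f mf f0).
Qed.

(** * Approximate supermartingale inequalities for the discounted value *)

Section Price.
Context {R : realType} {d : measure_display} {Omega : measurableType d}.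
Variable P : probability Omega R.
Hypothesis complete_P : measure_is_complete P.
Variables (B : R -> Omega -> R) (eps : R -> Omega -> 'I_2) (lambda : 'I_2 -> R).
Hypothesis lambda_gt0 : forall i, 0 < lambda i.
Hypothesis brownian_B : brownian_motion P B.
Hypothesis chain_eps : markov_chain P eps (generator lambda).
Hypothesis independent_B_eps : independent_processes P B eps.
Local Notation F := (augmented_filtration P B eps).
Local Notation filtered t := (filtered P B eps t).

Let mB t : 0 <= t -> measurable_fun setT (B t).
Proof. by have [+ _ _ _ _] := brownian_B; exact. Qed.

Let meps t j : 0 <= t -> measurable [set w | eps t w = j].
Proof. by have [+ _ _ _] := chain_eps; exact. Qed.

Variables (sigma : 'I_2 -> R) (rho : R) (b : 'I_2 -> R) (v sl : 'I_2 -> R -> R).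
Hypotheses (sigma_gt0 : forall i, 0 < sigma i) (rho_gt0 : 0 < rho).
Hypothesis vf : verification sigma lambda rho b v sl.
Variables (x th : R) (X : R -> Omega -> R).
Hypothesis price_X : price_process P F B eps sigma x X.

Let L := lambda reg1 + lambda reg2.
Let D2 := (sigma reg1 - sigma reg2) ^+ 2.
Let err := L * (1 + D2) / 2.

Lemma measurable_price t : 0 <= t -> measurable_fun [set: filtered t] (X t).
Proof.
move=> t0; have [aX _ _] := price_X.
have m : measurable_fun [set: filtered t] (fun w => X t w - x).
  by move=> _ U mU; rewrite setTI; exact: aX.
have -> : X t = (fun w => (X t w - x) + x) by apply/funext => w; rewrite subrK.
exact: measurable_funD.
Qed.

Lemma price_initial : {ae P, forall w, X 0 w = x}.
Proof.
have g : (\int[P]_w ((X 0 w - x) ^+ 2)%:E <= 0)%E.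
  have h k : (k < 0)%N -> (0 : R) - 0 <= 0 by [].
  (* On the empty grid with horizon 0 the estimate says that [X 0 - x] has second moment 0. *)
  have := ito_grid complete_P lambda_gt0 brownian_B chain_eps independent_B_eps price_X
    (erefl ((fun _ : nat => 0 : R) 0%N)) (erefl ((fun _ : nat => 0 : R) 0%N)) (fun=> lexx _) h.
  rewrite !mulr0 => g; apply: le_trans g.
  by apply: le_integral_nonmeas => w _; rewrite big_ord0 subr0.
have m0 : measurable_fun [set: Omega] (fun w => ((X 0 w - x) ^+ 2)%:E).
  apply/measurable_EFinP/measurable_funX/measurable_funB => //.
  exact: (measurable_filtered complete_P mB meps (measurable_price (lexx 0))).
have g0 : (\int[P]_w `|((X 0 w - x) ^+ 2)%:E| = 0)%E.
  apply/eqP; rewrite eq_le integral_ge0// andbT; apply: le_trans g.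
  by apply: le_integral_nonmeas => w _; rewrite gee0_abs// lee_fin sqr_ge0.
move/(ae_eq_integral_abs P measurableT m0): g0; apply: filterS => w /(_ I)/eqP.
by rewrite eqe sqrf_eq0 subr_eq0 => /eqP.
Qed.

Lemma measurable_regimes_filtered t d' (T : measurableType d') (f : 'I_2 -> Omega -> T) :
  0 <= t -> (forall j, measurable_fun [set: filtered t] (f j)) ->
  measurable_fun [set: filtered t] (fun w => f (eps t w) w).
Proof.
move=> t0 mf; apply: (@measurable_regimes _ (filtered t) (eps t)) => // j.
by apply: filtration_eps; rewrite lexx t0.
Qed.

Definition value (t : R) (w : Omega) : R := v (eps t w) (X t w - th).

Lemma value_ge0 t w : 0 <= value t w.
Proof. exact: (vf_ge0 vf). Qed.

Lemma measurable_value t : 0 <= t -> measurable_fun [set: filtered t] (value t).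
Proof.
move=> t0; apply: (measurable_regimes_filtered (f := fun j w => v j (X t w - th))) => // j.
apply: (measurableT_comp (verification_value_measurable vf j)).
by apply: measurable_funB => //; exact: measurable_price.
Qed.

Section OneStep.
Variables (t h : R) (Y : Omega -> R) (K : R).
Hypotheses (t0 : 0 <= t) (h0 : 0 < h) (h1 : h <= 1).
Hypothesis mY : measurable_fun [set: filtered t] Y.
Hypotheses (Y0 : forall w, 0 <= Y w) (YK : forall w, Y w <= K).

Let th0 : 0 <= t + h. Proof. by rewrite addr_ge0// ltW. Qed.
Let mO (f : Omega -> R) : measurable_fun [set: filtered t] f -> measurable_fun [set: Omega] f.
Proof. by move=> mf; exact: (measurable_filtered complete_P mB meps mf). Qed.
Let disc := expR (- (rho * h)).
Let disc0 : 0 <= disc. Proof. exact: expR_ge0. Qed.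
Let disc1 : disc <= 1. Proof. by rewrite -expR0 ler_expR oppr_le0 mulr_ge0// ltW. Qed.

Let frozen w := v (eps (t + h) w) (X t w - th + sigma (eps t w) * (B (t + h) w - B t w)).

Let Q w := `|X (t + h) w - x - (X t w - x) - sigma (eps t w) * (B (t + h) w - B t w)|.

Let mQ : measurable_fun setT Q.
Proof.
have mX r : 0 <= r -> measurable_fun [set: Omega] (X r).
  by move=> r0; exact: (measurable_filtered complete_P mB meps (measurable_price r0)).
apply: measurableT_comp => //; apply: measurable_funB.
  by apply: measurable_funB; apply: measurable_funB => //; exact: mX.
apply: measurable_funM; first by apply: mO; apply: measurable_filtered_eps; rewrite lexx t0.
by apply: measurable_funB; exact: mB.
Qed.

Let Q0 w : 0 <= Q w. Proof. exact: normr_ge0. Qed.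

Let K0 : 0 <= K. Proof. exact: le_trans (Y0 point) (YK point). Qed.

Let QE : (\int[P]_w (K * Q w)%:E <= (K * (err * (h * Num.sqrt h)))%:E)%E.
Proof.
rewrite ge0_integralZ// EFinM; apply: lee_wpmul2l => //.
exact: (ito_step_error complete_P lambda_gt0 brownian_B chain_eps independent_B_eps price_X t0 h0).
Qed.

Let value_frozen w : `|value (t + h) w - frozen w| <= Q w.
Proof.
apply: (le_trans (verification_value_lip vf _ _ _)).
by rewrite le_eqVlt; apply/orP; left; apply/eqP; congr `|_|; ring.
Qed.

Let measurable_frozen : measurable_fun setT frozen.
Proof.
have mj j : measurable [set w | eps (t + h) w = j] by exact: meps.
apply: (measurable_regimes mj (f := fun j w => v j (X t w - th + sigma (eps t w) * (B (t + h) w - B t w)))) => j.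
 apply: (measurableT_comp (verification_value_measurable vf j)).
apply: measurable_funD.
  by apply: measurable_funB => //; apply: mO; exact: measurable_price.
apply: measurable_funM.
  by apply: mO; apply: measurable_filtered_eps; rewrite lexx t0.
by apply: measurable_funB; exact: mB.
Qed.

(** [Y] and [X t] are known at time [t], so [ge0_integral_step] integrates out the Brownian
    increment and the final regime, which leaves [one_step]. *)
Let frozen_step : (\int[P]_w (disc * Y w * frozen w)%:E =
  \int[P]_w ((Y w)%:E * ((expR (- (rho * h)))%:E * one_step sigma lambda v (eps t w) (X t w - th) h)))%E.
Proof.
have tth : t < t + h by rewrite ltrDl.
have hE : t + h - t = h by rewrite addrAC subrr add0r.
pose G j (z : filtered t * R) := (disc * Y z.1 * v j (X t z.1 - th + sigma (eps t z.1) * z.2))%:E.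
have mG j : measurable_fun setT (G j).
  apply/measurable_EFinP; apply: measurable_funM.
    by apply: measurable_funM => //; exact: (measurableT_comp mY measurable_fst).
  apply: (measurableT_comp (verification_value_measurable vf j)).
  apply: measurable_funD.
    apply: measurable_funB => //.
    exact: (measurableT_comp (measurable_price t0) measurable_fst).
  apply: measurable_funM; last exact: measurable_snd.
  have ms : measurable_fun [set: filtered t] (fun w => sigma (eps t w)).
    by apply: measurable_filtered_eps; rewrite lexx t0.
  exact: (measurableT_comp ms measurable_fst).
have G0 j z : (0 <= G j z)%E.
  by rewrite lee_fin !mulr_ge0// (vf_ge0 vf).
have := ge0_integral_step complete_P lambda_gt0 brownian_B chain_eps independent_B_eps
  t0 tth mG G0; rewrite hE => e.
apply: (etrans e); apply: eq_integral => w _.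
have tr0 j : (0 <= (transition lambda h (eps t w) j)%:E)%E.
  by rewrite lee_fin; apply: transition_ge0 => //; exact: ltW.
have I0 j : (0 <= \int[normal_prob 0 (Num.sqrt h)]_z (v j (X t w - th + sigma (eps t w) * z))%:E)%E.
  by apply: integral_ge0 => z _; rewrite lee_fin (vf_ge0 vf).
rewrite /one_step ge0_sume_distrr; last by move=> j _; exact: mule_ge0.
rewrite ge0_sume_distrr; last by move=> j _; rewrite !mule_ge0// lee_fin.
apply: eq_bigr => j _; rewrite /G /=.
under eq_integral do rewrite EFinM.
rewrite ge0_integralZl//=.
- rewrite -/disc EFinM -(muleA disc%:E) [LHS]muleCA [RHS]muleCA; congr (_ * _)%E.
  exact: muleCA.
- apply/measurable_EFinP; apply: (measurableT_comp (verification_value_measurable vf j)).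
  by apply: measurable_funD => //; exact: measurable_funM.
- by move=> z _; rewrite lee_fin (vf_ge0 vf).
- by rewrite lee_fin mulr_ge0.
Qed.

Let measurable_frozen_weight : measurable_fun setT (fun w => disc * Y w * frozen w).
Proof.
apply: measurable_funM => //; apply: measurable_funM => //; exact: mO.
Qed.

Let frozen0 w : 0 <= frozen w. Proof. exact: (vf_ge0 vf). Qed.

Let K_const (C : R) : (\int[P]_w (C%:E) = C%:E)%E.
Proof. by rewrite integral_cst// [X in (_ * X)%E]probability_setT mule1. Qed.

Let Yvalue0 w : 0 <= Y w * value t w.
Proof. by rewrite mulr_ge0// value_ge0. Qed.

Let mYvalue : measurable_fun setT (fun w => Y w * value t w).
Proof. by apply: mO; apply: measurable_funM => //; exact: measurable_value. Qed.

Let weight_step_le w (C : R) : 0 <= C ->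
  ((expR (- (rho * h)))%:E * one_step sigma lambda v (eps t w) (X t w - th) h <= (value t w + C)%:E)%E ->
  ((Y w)%:E * ((expR (- (rho * h)))%:E * one_step sigma lambda v (eps t w) (X t w - th) h)
     <= (Y w * value t w + K * C)%:E)%E.
Proof.
move=> C0 /(lee_wpmul2l (_ : (0 <= (Y w)%:E)%E)) h'; apply: (le_trans (h' _)).
  by rewrite lee_fin.
by rewrite -EFinM lee_fin mulrDr lerD2l ler_wpM2r.
Qed.

Lemma value_step_le C : 0 <= C ->
  (forall i y, ((expR (- (rho * h)))%:E * one_step sigma lambda v i y h <= (v i y + C * (h * Num.sqrt h))%:E)%E) ->
  (\int[P]_w (Y w * (expR (- (rho * h)) * value (t + h) w))%:E <=
   \int[P]_w (Y w * value t w)%:E + ((C + err) * K * (h * Num.sqrt h))%:E)%E.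
Proof.
move=> C0 HC.
have hq0 : 0 <= h * Num.sqrt h by rewrite mulr_ge0// ltW.
apply: le_trans (integral_leD P measurableT measurable_frozen_weight
  (measurable_funM (@measurable_cst _ _ _ _ _ K) mQ) _ _ _) _.
- by move=> w _; rewrite !mulr_ge0.
- by move=> w _; rewrite mulr_ge0.
- move=> w _; rewrite mulrCA mulrA.
  have := value_frozen w; rewrite ler_norml => /andP[_]; rewrite lerBlDl addrC => vq.
  apply: (le_trans (ler_wpM2l (mulr_ge0 disc0 (Y0 w)) vq)).
  rewrite mulrDr lerD2l; apply: ler_wpM2r => //.
  by rewrite -[leRHS]mul1r; apply: ler_pM.
rewrite frozen_step.
apply: (@le_trans _ _ (\int[P]_w (Y w * value t w + K * (C * (h * Num.sqrt h)))%:E +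
   (K * (err * (h * Num.sqrt h)))%:E)%E).
  apply: leeD => //; apply: le_integral_nonmeas => w _.
  by apply: weight_step_le; [exact: mulr_ge0|exact: HC].
apply: (le_trans (leeD (integral_leD P measurableT mYvalue
  (@measurable_cst _ _ _ _ _ (K * (C * (h * Num.sqrt h)))) _ _ _) (lexx _))) => //.
  by move=> w _; exact: mulr_ge0 K0 (mulr_ge0 C0 hq0).
rewrite K_const -addeA -EFinD leeD2l// lee_fin le_eqVlt; apply/orP; left; apply/eqP; ring.
Qed.

(** The lower one-step bound is available only below the boundary, so the weight [Y] has to vanish
    wherever the process has come within [e] of it. *)
Lemma value_step_ge C e : 0 <= C -> (forall w, Y w != 0 -> X t w - th <= b (eps t w) - e) ->
  (forall i y, y <= b i - e ->
     ((v i y - C * (h * Num.sqrt h))%:E <= (expR (- (rho * h)))%:E * one_step sigma lambda v i y h)%E) ->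
  (\int[P]_w (Y w * value t w)%:E <=
   \int[P]_w (Y w * (expR (- (rho * h)) * value (t + h) w))%:E + ((C + err) * K * (h * Num.sqrt h))%:E)%E.
Proof.
move=> C0 Ybelow HC.
have hq0 : 0 <= h * Num.sqrt h by rewrite mulr_ge0// ltW.
have one0 i y : (0 <= (expR (- (rho * h)))%:E * one_step sigma lambda v i y h)%E.
  rewrite mule_ge0 ?lee_fin ?expR_ge0//; apply: sume_ge0 => j _; rewrite mule_ge0//.
    by rewrite lee_fin; apply: transition_ge0 => //; exact: ltW.
  by apply: integral_ge0 => z _; rewrite lee_fin (vf_ge0 vf).
have KC0 := mulr_ge0 K0 (mulr_ge0 C0 hq0).
pose G w := ((Y w)%:E * ((expR (- (rho * h)))%:E * one_step sigma lambda v (eps t w) (X t w - th) h))%E.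
have mG : measurable_fun setT G.
  apply: emeasurable_funM; first by apply/measurable_EFinP; exact: mO.
  apply: measurable_funeM.
  apply: (measurable_filtered complete_P mB meps (t := t)).
  apply: (measurable_regimes_filtered (f := fun i w => one_step sigma lambda v i (X t w - th) h)) => // i.
  apply: (measurableT_comp (measurable_one_step vf i h)).
  by apply: measurable_funB => //; exact: measurable_price.
apply: (@le_trans _ _ (\int[P]_w (G w + (K * (C * (h * Num.sqrt h)))%:E)%E)%E).
  apply: le_integral_nonmeas => w _.
  have [Yw|Yw] := eqVneq (Y w) 0.
    by rewrite /G Yw mul0r mul0e add0e lee_fin.
  have := HC (eps t w) _ (Ybelow w Yw).
  move=> h'.
  have -> : Y w * value t w = Y w * (v (eps t w) (X t w - th) - C * (h * Num.sqrt h)) +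
      Y w * (C * (h * Num.sqrt h)) by rewrite -mulrDr subrK.
  rewrite EFinD; apply: leeD; last by rewrite lee_fin ler_wpM2r// mulr_ge0.
  by rewrite EFinM; apply: lee_wpmul2l; rewrite ?lee_fin.
rewrite ge0_integralD//; last by move=> w _; rewrite /G mule_ge0// lee_fin.
rewrite K_const /G -frozen_step.
have l : (\int[P]_w (disc * Y w * frozen w)%:E <=
    \int[P]_w (Y w * (expR (- (rho * h)) * value (t + h) w))%:E + \int[P]_w (K * Q w)%:E)%E.
  apply: integral_leD => //.
  - apply: measurable_funM; first exact: mO.
    apply: measurable_funM => //.
    exact: (measurable_filtered complete_P mB meps (measurable_value th0)).
  - exact: measurable_funM.
  - by move=> w _; rewrite mulr_ge0// mulr_ge0// value_ge0.
  - by move=> w _; rewrite mulr_ge0.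
  - move=> w _; rewrite [leRHS]addrC -lerBlDr mulrCA mulrA -mulrBr.
    have := value_frozen w; rewrite ler_norml => /andP[+ _]; rewrite lerNl opprB => vq.
    apply: (le_trans (ler_wpM2l (mulr_ge0 disc0 (Y0 w)) vq)).
    apply: ler_wpM2r => //; rewrite -[leRHS]mul1r; exact: ler_pM.
apply: (le_trans (leeD l (lexx _))).
rewrite -addeA leeD2l//; apply: (le_trans (leeD QE (lexx _))).
by rewrite -EFinD lee_fin le_eqVlt; apply/orP; left; apply/eqP; ring.
Qed.

End OneStep.

Section Discrete.
Variables (h K : R) (Y : nat -> Omega -> R).
Hypotheses (h0 : 0 < h) (h1 : h <= 1).
Hypothesis mY : forall k, measurable_fun [set: filtered (k%:R * h)] (Y k).
Hypotheses (Y0 : forall k w, 0 <= Y k w) (YK : forall k w, Y k w <= K).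
Hypothesis Y_ni : forall k w, Y k.+1 w <= Y k w.

Definition discounted (k : nat) (w : Omega) : R :=
  expR (- (rho * (k%:R * h))) * value (k%:R * h) w.

(* Summation by parts: the stopped or controlled reward, with [Y] the part
   that is still alive. *)
Definition liquidated (n : nat) (w : Omega) : R :=
  \sum_(k < n) discounted k.+1 w * (Y k w - Y k.+1 w).

Let t0 k : 0 <= k%:R * h. Proof. by rewrite mulr_ge0// ltW. Qed.

Lemma discounted_ge0 k w : 0 <= discounted k w.
Proof. by rewrite mulr_ge0 ?expR_ge0// value_ge0. Qed.

Lemma liquidated_ge0 n w : 0 <= liquidated n w.
Proof. by apply: sumr_ge0 => k _; rewrite mulr_ge0 ?discounted_ge0// subr_ge0. Qed.

Let mdisc k : measurable_fun [set: Omega] (discounted k).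
Proof.
apply: measurable_funM => //.
exact: (measurable_filtered complete_P mB meps (measurable_value (t0 k))).
Qed.

Let mYO k : measurable_fun [set: Omega] (Y k).
Proof. exact: (measurable_filtered complete_P mB meps (@mY k)). Qed.

Lemma measurable_liquidated n : measurable_fun [set: Omega] (liquidated n).
Proof.
apply: measurable_sum => k; apply: measurable_funM => //.
exact: measurable_funB.
Qed.

Let liquidatedD n (k : nat) :
  (\int[P]_w (liquidated n w + discounted k w * Y n w)%:E =
   \int[P]_w (liquidated n w)%:E + \int[P]_w (discounted k w * Y n w)%:E)%E.
Proof.
under eq_integral do rewrite EFinD.
rewrite ge0_integralD//=.
- by move=> w _; rewrite lee_fin liquidated_ge0.
- by apply/measurable_EFinP; exact: measurable_liquidated.
- by move=> w _; rewrite lee_fin mulr_ge0// discounted_ge0.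
- by apply/measurable_EFinP; exact: measurable_funM.
Qed.

Let liquidatedS n : (\int[P]_w (liquidated n.+1 w + discounted n.+1 w * Y n.+1 w)%:E =
  \int[P]_w (liquidated n w)%:E + \int[P]_w (discounted n.+1 w * Y n w)%:E)%E.
Proof.
rewrite -liquidatedD; apply: eq_integral => w _; congr EFin.
rewrite /liquidated big_ord_recr/= -addrA; congr (_ + _).
by rewrite -mulrDr subrK.
Qed.

(** The discount up to time [k * h] is absorbed into the weight, so that the one-step lemmas only
    see the discount of a single step. *)
Let weight k w := expR (- (rho * (k%:R * h))) * Y k w.

Let mweight k : measurable_fun [set: filtered (k%:R * h)] (weight k).
Proof. exact: measurable_funM. Qed.

Let weight0 k w : 0 <= weight k w.
Proof. by rewrite mulr_ge0 ?expR_ge0. Qed.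

Let weightK k w : weight k w <= K.
Proof.
apply: le_trans (YK k w); rewrite -[leRHS]mul1r; apply: ler_wpM2r => //.
by rewrite -[leRHS]expR0 ler_expR oppr_le0; exact: mulr_ge0 (ltW rho_gt0) (t0 k).
Qed.

Let error_nS n (c : R) : ((n.+1%:R * c)%:E = (n%:R * c)%:E + c%:E)%E.
Proof. by rewrite -natr1 mulrDl mul1r EFinD. Qed.

Let weight_value k w : weight k w * value (k%:R * h) w = discounted k w * Y k w.
Proof. by rewrite mulrAC. Qed.

Let weight_step k w : weight k w * (expR (- (rho * h)) * value (k%:R * h + h) w) =
  discounted k.+1 w * Y k w.
Proof.
have e : k.+1%:R * h = k%:R * h + h by rewrite -natr1 mulrDl mul1r.
rewrite /discounted e mulrDr opprD expRD /weight; ring.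
Qed.

(** Induction on [n]: the surviving weight [Y n] is carried one step ahead at the price of one error
    term, and [liquidatedS] then splits it into the part sold and the part still alive. *)
Lemma liquidated_le C n : 0 <= C ->
  (forall i y, ((expR (- (rho * h)))%:E * one_step sigma lambda v i y h <= (v i y + C * (h * Num.sqrt h))%:E)%E) ->
  (\int[P]_w (liquidated n w + discounted n w * Y n w)%:E <=
   \int[P]_w (discounted 0 w * Y 0 w)%:E + (n%:R * ((C + err) * K * (h * Num.sqrt h)))%:E)%E.
Proof.
move=> C0 HC; elim: n => [|n IH].
  rewrite mul0r adde0; apply: le_integral_nonmeas => w _.
  by rewrite /liquidated big_ord0 add0r.
have step : (\int[P]_w (discounted n.+1 w * Y n w)%:E <=
    \int[P]_w (discounted n w * Y n w)%:E + ((C + err) * K * (h * Num.sqrt h))%:E)%E.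
  have := value_step_le (t0 n) h0 (@mweight n) (@weight0 n) (@weightK n) C0 HC.
  under eq_integral do rewrite weight_step.
  by under [X in (_ <= X + _)%E -> _]eq_integral do rewrite weight_value.
have chain (A D E I e1 e2 : \bar R) :
    (E <= D + e1 -> A + D <= I + e2 -> A + E <= I + (e2 + e1))%E.
  move=> h1' h2'; apply: (le_trans (leeD2l A h1')).
  by rewrite !addeA; exact: leeD2r.
rewrite liquidatedS error_nS; apply: chain step _.
by rewrite -liquidatedD.
Qed.

Lemma liquidated_ge C e n : 0 <= C ->
  (forall k w, Y k w != 0 -> X (k%:R * h) w - th <= b (eps (k%:R * h) w) - e) ->
  (forall i y, y <= b i - e ->
     ((v i y - C * (h * Num.sqrt h))%:E <= (expR (- (rho * h)))%:E * one_step sigma lambda v i y h)%E) ->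
  (\int[P]_w (discounted 0 w * Y 0 w)%:E <=
   \int[P]_w (liquidated n w + discounted n w * Y n w)%:E + (n%:R * ((C + err) * K * (h * Num.sqrt h)))%:E)%E.
Proof.
move=> C0 Yb HC; elim: n => [|n IH].
  rewrite mul0r adde0; apply: le_integral_nonmeas => w _.
  by rewrite /liquidated big_ord0 add0r.
apply: (le_trans IH); rewrite liquidatedS error_nS addeA addeAC leeD2r//.
rewrite liquidatedD -addeA leeD2l//.
have wb w : weight n w != 0 -> X (n%:R * h) w - th <= b (eps (n%:R * h) w) - e.
  by move=> wn; apply: Yb; apply: contra wn => /eqP Yn; rewrite /weight Yn mulr0.
have := value_step_ge (t0 n) h0 (@mweight n) (@weight0 n) (@weightK n) C0 wb HC.
under [X in (_ <= X + _)%E -> _]eq_integral do rewrite weight_step.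
by under [X in (X <= _)%E -> _]eq_integral do rewrite weight_value.
Qed.

End Discrete.

Lemma initial_value (i : 'I_2) (K : R) : 0 <= K ->
  (\int[P]_w (value 0 w * (K * \1_(start eps i) w))%:E = (K * v i (x - th))%:E * P (start eps i))%E.
Proof.
move=> K0; have mi : measurable (start eps i) by exact: meps.
rewrite -[start eps i in RHS]setIT -integral_indic// -ge0_integralZl//; last by rewrite lee_fin mulr_ge0// (vf_ge0 vf).
  apply: ae_eq_integral_nonmeas; apply: filterS price_initial => w X0 _.
  rewrite -EFinM; congr EFin; rewrite /value X0 indicE.
  have [wi|wi] := boolP (w \in start eps i); last by rewrite !mulr0.
  by move: wi; rewrite inE /start/= => ->; rewrite !mulr1 mulrC.
by apply/measurable_EFinP; exact: measurable_indic.
Qed.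

End Price.

(** * Controls and Stieltjes integrals *)

Lemma limn_einf_le (R : realType) (u v : (\bar R)^nat) :
  (forall n, u n <= v n)%E -> (limn_einf u <= limn_einf v)%E.
Proof.
move=> uv; rewrite !limn_einf_lim; apply: lee_lim; [exact: is_cvg_einfs..|].
apply: nearW => n; apply: le_ereal_inf_tmp => _ [m mn <-].
by apply: le_trans (uv m); apply: ereal_inf_lbound; exists m.
Qed.

Lemma within_half_line_eps_delta (R : realType) (G : R -> R) (t e : R) :
  {within `[0, +oo[, continuous G} -> 0 <= t -> 0 < e ->
  exists2 del, 0 < del & forall s, 0 <= s -> `|t - s| < del -> `|G t - G s| < e.
Proof.
move=> /subspace_continuousP cG t0 e0.
have tD : `[0, +oo[%classic t by rewrite /= in_itv/= t0.
have /cvgrPdist_lt/(_ e e0) := cG t tD.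
rewrite near_withinE => /nbhs_ballP[del /= del0 H]; exists del => // s s0 ts.
by apply: H => //=; rewrite in_itv/= s0.
Qed.

Lemma grid_step_co (R : realType) (g : nat -> R) (g_nd : forall k, g k <= g k.+1)
  n (c : nat -> R) k s : (k < n)%N -> g k <= s < g k.+1 ->
  \sum_(j < n) c j * \1_(`[g j, g j.+1[%classic : set R) s = c k.
Proof.
move=> kn /andP[ks sk].
rewrite (bigD1 (Ordinal kn))//= big1 ?addr0.
  by rewrite indicE mem_set ?mulr1//= in_itv/= ks.
move=> j jk; rewrite indicE memNset ?mulr0//= in_itv/= => /andP[js sj].
have [jk'|kj|jk'] := ltngtP j k.
- by move: (lt_le_trans sj (grid_le g_nd jk')); rewrite ltNge ks.
- by move: (lt_le_trans sk (grid_le g_nd kj)); rewrite ltNge js.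
- by move/eqP: jk; apply; exact/val_inj.
Qed.

Section Stieltjes.
Context {R : realType} {d : measure_display} {Omega : measurableType d}.
Variables (nu : control R Omega) (w : Omega).
Local Notation mu := (lebesgue_stieltjes_measure (ctl_right nu w)).

Lemma ctl_right_neg t : t < 0 -> ctl_right nu w t = 0.
Proof.
move=> t0; apply/le_anti/andP; split.
  by rewrite -(ctl_zero nu w); exact: ctl_right_le.
apply: lb_le_inf; first exact: ctl_right_neq0.
exact: ctl_right_lb.
Qed.

Lemma le_ctl_right t : 0 <= t -> nu t w <= ctl_right nu w t.
Proof.
move=> t0; apply: lb_le_inf; first exact: ctl_right_neq0.
by move=> _ [s [s0 ts] <-]; apply: ctl_nd => //; exact: ltW.
Qed.

Lemma stieltjes_ocitv (a b : R) : a <= b ->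
  mu `]a, b]%classic = (ctl_right nu w b - ctl_right nu w a)%:E.
Proof.
move=> ab; rewrite /lebesgue_stieltjes_measure/= /measure_extension/=.
rewrite measurable_mu_extE/=; last exact: is_ocitv.
by rewrite wlength_itv_bnd.
Qed.

(** The interval starts at -1, where [ctl_right] vanishes, so that a jump of the control at time 0
    is included for positive [b]. It is exhausted by half-open intervals whose masses tend to
    [nu b w], not to [ctl_right nu w b], because [nu] is left-continuous. *)
Lemma stieltjes_below (b : R) : 0 <= b -> mu `]-1, b[%classic = (nu b w)%:E.
Proof.
move=> b0; pose c n : R := b - n.+1%:R^-1.
have c1 n : -1 <= c n.
  have : n.+1%:R^-1 <= 1 :> R by rewrite invf_le1// ler1n.
  by rewrite /c; move: (n.+1%:R^-1) b0 => r; lra.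
have U : \bigcup_n `]-1, c n]%classic = `]-1, b[%classic :> set R.
  by rewrite itv_bnd_open_bigcup.
have h1 : (mu \o (fun n => `]-1, c n]%classic : set R)) @ \oo --> mu `]-1, b[%classic.
  rewrite -U; apply: nondecreasing_cvg_mu.
  - by move=> n; exact: measurable_itv.
  - by apply: bigcup_measurable => n _; exact: measurable_itv.
  - move=> m n mn; apply/subsetPset => r/=; rewrite !in_itv/= => /andP[->/=].
    by move/le_trans; apply; rewrite /c lerB// lef_pV2 ?ler_nat ?posrE.
have h2 : (mu \o (fun n => `]-1, c n]%classic : set R)) @ \oo --> (nu b w)%:E.
  have -> : mu \o (fun n => `]-1, c n]%classic : set R) = (fun n => (ctl_right nu w (c n))%:E).
    have R1 : ctl_right nu w (-1) = 0 by apply: ctl_right_neg; rewrite ltrN10.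
    by apply/funext => n /=; rewrite stieltjes_ocitv// R1 subr0.
  apply/cvg_EFin; first exact: nearW.
  (* Left-continuity holds only at positive times; for [b = 0] all the points [c n] are negative and
     carry the value 0. *)
  move: b0; rewrite le_eqVlt => /predU1P[b0|b_gt0].
    apply: cvg_near_cst; apply: nearW => n; rewrite /= -b0 ctl_zero.
    by apply: ctl_right_neg; rewrite /c -b0 sub0r oppr_lt0 invr_gt0.
  have cb : c n @[n --> \oo] --> b.
    rewrite -[X in _ --> X]subr0; apply: cvgB; first exact: cvg_cst.
    exact: cvg_harmonic.
  have cltb n : c n < b by rewrite /c ltrBlDr ltrDl invr_gt0.
  have ccv : c n @[n --> \oo] --> b^'-.
    move=> A nA; have hA : \forall n \near \oo, c n < b -> A (c n) by exact: (cb _ nA).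
    by apply: filterS hA => n H; exact: H.
  have lc : nu (c n) w @[n --> \oo] --> nu b w.
    exact: (cvg_comp _ _ ccv (@ctl_lc _ _ _ nu w b b_gt0)).
  apply: squeeze_cvgr lc (cvg_cst _).
  near=> n; apply/andP; split.
    by apply: le_ctl_right; apply: ltW; near: n; exact: (cvgr_gt b cb).
  by apply: ctl_right_le => //; exact: ltW.
by apply: cvg_unique h1 h2.
Unshelve. all: by end_near. Qed.

Lemma stieltjes_itvco (a b : R) : 0 <= a -> a <= b ->
  mu `[a, b[%classic = (nu b w - nu a w)%:E.
Proof.
move=> a0 ab.
have -> : `[a, b[%classic = `]-1, b[%classic `\` `]-1, a[%classic :> set R.
  apply/seteqP; split => r /=; rewrite !in_itv/=.
    move=> /andP[ar ->]; rewrite (lt_le_trans (ltrN10 R))/=; last exact: le_trans ar.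
    by split => //; rewrite ltNge ar.
  by move=> [/andP[-> ->] /=] /negP; rewrite -leNgt => ->.
rewrite measureD//=.
- rewrite setIidr; last first.
    by move=> r /=; rewrite !in_itv/= => /andP[-> /lt_le_trans]; exact.
  by rewrite !stieltjes_below// (le_trans a0).
- by rewrite [ltLHS]stieltjes_below ?ltry// (le_trans a0).
Qed.

(** The sums are integrals of step functions that converge pointwise by continuity of [G], so
    Fatou's lemma applies. Right endpoints are used because [liquidated] sells at the end of a
    cell. *)
Lemma stieltjes_integral_fatou (G : R -> R) (h : nat -> R) (n : nat -> nat) :
  (forall t, 0 <= G t) -> {within `[0, +oo[, continuous G} ->
  (forall m, 0 < h m) -> h @ \oo --> 0 -> (fun m => (n m)%:R * h m) @ \oo --> +oo ->
  (\int[mu]_(t in `[0%R, +oo[) (G t)%:E <=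
   limn_einf (fun m => (\sum_(k < n m) G (k.+1%:R * h m) * (nu (k.+1%:R * h m) w - nu (k%:R * h m) w))%:E))%E.
Proof.
move=> G0 cG h0 hcv ncv.
pose cell m k : set R := `[k%:R * h m, k.+1%:R * h m[%classic.
pose g m (t : R) := \sum_(k < n m) G (k.+1%:R * h m) * \1_(cell m k) t.
have gG t : 0 <= t -> g m t @[m --> \oo] --> G t.
  move=> t0; apply/cvgrPdist_lt => e e0.
  have [del del0 Gdel] := within_half_line_eps_delta cG t0 e0.
  near=> m.
  pose k := Num.trunc (t / h m).
  have /andP[k1 k2] : k%:R <= t / h m < k.+1%:R.
    by apply: truncn_itv; rewrite divr_ge0// ltW.
  have kt : k%:R * h m <= t by rewrite -ler_pdivlMr.
  have tk : t < k.+1%:R * h m by rewrite -ltr_pdivrMr.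
  have kn : (k < n m)%N.
    rewrite -(ltr_nat R) (le_lt_trans k1)// ltr_pdivrMr//.
    near: m; exact: (cvgryPgt _).1.
  have -> : g m t = G (k.+1%:R * h m).
    apply: (grid_step_co (g := fun k => k%:R * h m) _ (fun k => G (k.+1%:R * h m)) kn).
      by move=> j; rewrite ler_pM2r// ler_nat.
    by rewrite kt.
  apply: Gdel; first by rewrite mulr_ge0// ltW.
  rewrite distrC ger0_norm ?subr_ge0 ?ltW// ltrBlDr.
  have : h m < del by near: m; exact: (cvgr_lt 0 hcv).
  by rewrite -natr1 mulrDl mul1r; move: kt; move: (k%:R * h m) (h m) => a q; lra.
have mcell m k : measurable (cell m k : set (measurableTypeR R)) by exact: measurable_itv.
have gE m : (\int[mu]_(t in `[0%R, +oo[) (g m t)%:E =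
  (\sum_(k < n m) G (k.+1%:R * h m) * (nu (k.+1%:R * h m) w - nu (k%:R * h m) w))%:E)%E.
  under eq_integral do rewrite -sumEFin.
  rewrite ge0_integral_sum//; last 2 first.
  - by move=> k; apply/measurable_EFinP; apply: measurable_funM.
  - by move=> k t _; rewrite lee_fin mulr_ge0.
  rewrite -sumEFin; apply: eq_bigr => k _.
  rewrite ge0_integralZ//.
  rewrite integral_indic// EFinM; congr (_ * _)%E.
  rewrite setIidl; last first.
    move=> t; rewrite /cell/= !in_itv/= => /andP[kt _]; rewrite andbT.
    by apply: le_trans kt; rewrite mulr_ge0// ltW.
  apply: stieltjes_itvco; first by rewrite mulr_ge0// ltW.
  by rewrite ler_pM2r// ler_nat.
under [X in (_ <= limn_einf X)%E]eq_fun do rewrite -gE.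
apply: le_trans (fatou _ _ _ _) => //.
- apply: le_integral_nonmeas => t /=; rewrite in_itv/= andbT => t0.
  have cE : (fun m => (g m t)%:E) @ \oo --> (G t)%:E.
    by apply: cvg_EFin; [exact: nearW|exact: gG].
  by rewrite (cvg_limn_einf_sup cE).1.
- move=> m; apply/measurable_EFinP; by apply: measurable_sum => k; apply: measurable_funM.
- by move=> m t _; rewrite lee_fin; apply: sumr_ge0 => k _; rewrite mulr_ge0.
Unshelve. all: by end_near. Qed.

End Stieltjes.

Section ExponentialDiscount.
Context {R : realType}.
Variable rho : R.
Hypothesis rho_gt0 : 0 < rho.
Local Notation leb := (@lebesgue_measure R).

Lemma continuous_discount : continuous (fun t : R => expR (- (rho * t))).
Proof.
move=> t; apply: continuous_comp; last exact: continuous_expR.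
by apply: continuousN; apply: continuousM; [exact: cst_continuous|exact: cvg_id].
Qed.

Lemma exponential_tail (t : R) :
  (\int[leb]_(s in `[t, +oo[) (rho * expR (- (rho * s)))%:E = (expR (- (rho * t)))%:E)%E.
Proof.
have cE := continuous_discount.
have cr : continuous (fun s : R => rho * expR (- (rho * s))).
  by move=> s; apply: (@cvgM _ _ _ _ (fun=> rho)); [exact: cvg_cst|exact: cE].
have dF (s : R) : is_derive s 1 (fun s => - expR (- (rho * s))) (rho * expR (- (rho * s))).
  apply: is_derive_eq; rewrite /GRing.scale/=; ring.
rewrite (@ge0_continuous_FTC2y _ _ (fun s => - expR (- (rho * s))) _ 0)//.
- by rewrite EFinN oppeK add0e.
- by move=> s _; rewrite mulr_ge0 ?expR_ge0// ltW.
- exact: continuous_subspaceT.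
- rewrite -oppr0; apply: cvgN.
  rewrite (_ : (fun x => expR (- (rho * x))) = (fun z => expR (- z)) \o (fun z => rho * z))//.
  apply: (@cvg_comp _ _ _ _ _ _ (pinfty_nbhs R)); last exact: cvgr_expR.
  exact: gt0_cvgMry.
- by apply: cvgN; apply/cvg_at_right_filter; exact: cE.
- by move=> s _; rewrite derive1E; exact: derive_val.
Qed.

(* Integration by parts for a control, through Tonelli's theorem applied to
   [rho * exp (- rho s)] on [{0 <= t < s}]. *)
Lemma stieltjes_discount d (Omega : measurableType d) (nu : control R Omega) w :
  (\int[lebesgue_stieltjes_measure (ctl_right nu w)]_(t in `[0%R, +oo[) (expR (- (rho * t)))%:E =
   \int[leb]_(s in `[0%R, +oo[) (rho * expR (- (rho * s)) * nu s w)%:E)%E.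
Proof.
pose mu := lebesgue_stieltjes_measure (ctl_right nu w).
pose A : set (R * R) := [set z | 0 <= z.1 /\ z.1 < z.2].
have mA : measurable (A : set (measurableTypeR R * measurableTypeR R)).
  have m1 : measurable_fun [set: measurableTypeR R * measurableTypeR R] fst by exact: measurable_fst.
  have m2 : measurable_fun [set: measurableTypeR R * measurableTypeR R] snd by exact: measurable_snd.
  rewrite (_ : A = (fst @^-1` `[0, +oo[%classic) `&` ((fun z => z.2 - z.1) @^-1` `]0, +oo[%classic)).
    apply: measurableI; rewrite -[X in measurable X]setTI.
      by apply: m1 => //; exact: measurable_itv.
    by apply: (measurable_funB m2 m1) => //; exact: measurable_itv.
  by apply/seteqP; split => z /=; rewrite !in_itv/= !andbT subr_gt0.
pose f (z : measurableTypeR R * measurableTypeR R) := (rho * expR (- (rho * z.2)) * \1_A z)%:E.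
have f0 z : (0 <= f z)%E by rewrite lee_fin !mulr_ge0 ?expR_ge0// ltW.
have mf : measurable_fun setT f.
  apply/measurable_EFinP; apply: measurable_funM; last exact: measurable_indic.
  apply: measurable_funM => //.
  apply: (measurableT_comp (f := fun s : R => expR (- (rho * s)))); last exact: measurable_snd.
  by apply: continuous_measurable_fun; exact: continuous_discount.
have mI : measurable (`[0, +oo[%classic : set (measurableTypeR R)) by exact: measurable_itv.
have [_ e] := tonelli_restr mu leb mI mf f0.
move=> {mA mf f0}.
have me : measurable_fun [set: measurableTypeR R] (fun s : R => (rho * expR (- (rho * s)))%:E).
  apply/measurable_EFinP; apply: measurable_funM => //.
  by apply: continuous_measurable_fun; exact: continuous_discount.
transitivity (\int[mu]_t \int[leb]_(s in `[0%R, +oo[) f (t, s))%E.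
  move=> {e}; rewrite [LHS]integral_mkcond; apply: eq_integral => t _; rewrite patchE.
  case: ifPn => tI; last first.
    rewrite integral0_eq// => s _; rewrite /f indicE memNset ?mulr0// => -[/= t0 _].
    by move: tI; rewrite notin_setE/= in_itv/= t0.
  move: tI; rewrite inE/= in_itv/= andbT => t0.
  rewrite -exponential_tail -integral_itv_obnd_cbnd; last exact: measurable_funTS.
  rewrite [LHS]integral_mkcond [RHS]integral_mkcond; apply: eq_integral => s _.
  rewrite !patchE; have [ts|st] := ltP t s.
    rewrite !mem_set/= ?in_itv/= ?ts ?(le_trans t0 (ltW ts))//.
    by rewrite /f/= indicE mem_set ?mulr1//; split.
  rewrite (memNset (A := `]t, +oo[%classic)); last by rewrite /= in_itv/= ltNge st.
  case: ifP => // _; rewrite /f/= indicE memNset ?mulr0// => -[_ /=].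
  by rewrite ltNge st.
rewrite {}e; apply: eq_integral => s; rewrite inE/= in_itv/= andbT => s0.
have fE t : f (t, s) = (rho * expR (- (rho * s)) * \1_(`[0, s[%classic : set (measurableTypeR R)) t)%:E.
  rewrite /f/= !indicE; congr (_ * _%:R)%:E; congr nat_of_bool.
  apply/idP/idP; rewrite !inE/= in_itv/=; first by move=> [-> ->].
  by move=> /andP[].
under eq_integral do rewrite fE.
rewrite ge0_integralZ//; last by rewrite mulr_ge0 ?expR_ge0// ltW.
rewrite integral_indic// setIT [X in (_ * X)%E]stieltjes_itvco//.
by rewrite ctl_zero subr0 -EFinM.
Qed.

End ExponentialDiscount.

(** * Upper bounds *)

Lemma measurable_fun_limn_einf (R : realType) d (Omega : measurableType d)
    (f : nat -> Omega -> \bar R) :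
  (forall m, measurable_fun setT (f m)) ->
  measurable_fun setT (fun w => limn_einf (f^~ w)).
Proof.
move=> mf; under eq_fun do rewrite limn_einf_lim.
apply: (emeasurable_fun_cvg (fun m w => einfs (f^~ w) m)).
  by move=> m; exact: measurable_fun_einfs.
by move=> w _; exact: is_cvg_einfs.
Qed.

Section FineGrid.
Context {R : realType}.

(* [n] steps of length [h] reach the horizon [n h = m + 1], while their
   accumulated error [n h^(3/2)] is [1 / (m + 1)]. *)
Definition mesh (m : nat) : R := (m.+1%:R ^+ 4)^-1.
Definition steps (m : nat) : nat := (m.+1 ^ 5)%N.

Lemma mesh_gt0 m : 0 < mesh m. Proof. by rewrite invr_gt0 exprn_gt0. Qed.

Lemma mesh_le1 m : mesh m <= 1.
Proof. by rewrite invf_le1 ?exprn_gt0// exprn_ege1// ler1n. Qed.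

Lemma steps_error m (K : R) :
  (steps m)%:R * (K * (mesh m * Num.sqrt (mesh m))) = K * (m.+1%:R)^-1.
Proof.
have -> : Num.sqrt (mesh m) = (m.+1%:R ^+ 2)^-1.
  rewrite (_ : mesh m = ((m.+1%:R ^+ 2)^-1) ^+ 2); last by rewrite exprVn -exprM.
  by rewrite sqrtr_sqr ger0_norm// invr_ge0 exprn_ge0.
rewrite /mesh /steps natrX; have := ltr0Sn R m; move: (m.+1%:R) => q q0.
by field; rewrite gt_eqF.
Qed.

Lemma steps_mesh m : (steps m)%:R * mesh m = m.+1%:R.
Proof. rewrite /mesh /steps natrX; have := ltr0Sn R m; move: (m.+1%:R) => q q0.
by field; rewrite gt_eqF. Qed.

Lemma mesh_cvg : mesh @ \oo --> 0.
Proof.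
apply: (squeeze_cvgr (f := fun=> 0) (h := harmonic)); last 2 first.
- exact: cvg_cst.
- exact: cvg_harmonic.
apply: nearW => m; rewrite ltW ?mesh_gt0//= lef_pV2 ?posrE ?exprn_gt0//.
by apply: ler_eXnr => //; rewrite ler1n.
Qed.

Lemma horizon_cvg : (fun m => (steps m)%:R * mesh m) @ \oo --> +oo.
Proof.
under eq_fun do rewrite steps_mesh.
apply/cvgryPge => A; near=> m.
rewrite (le_trans (ler_norm A))// (le_trans (ltW (archi_boundP (normr_ge0 A))))//.
rewrite ler_nat ltnW// ltnS; near: m; exact: nbhs_infty_ge.
Unshelve. all: by end_near. Qed.

End FineGrid.

Section UpperBound.
Context {R : realType} {d : measure_display} {Omega : measurableType d}.
Variable P : probability Omega R.
Hypothesis complete_P : measure_is_complete P.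
Variables (B : R -> Omega -> R) (eps : R -> Omega -> 'I_2) (lambda : 'I_2 -> R).
Hypothesis lambda_gt0 : forall i, 0 < lambda i.
Hypothesis brownian_B : brownian_motion P B.
Hypothesis chain_eps : markov_chain P eps (generator lambda).
Hypothesis independent_B_eps : independent_processes P B eps.
Local Notation F := (augmented_filtration P B eps).
Local Notation filtered t := (filtered P B eps t).

Let mB t : 0 <= t -> measurable_fun setT (B t).
Proof. by have [+ _ _ _ _] := brownian_B; exact. Qed.

Let meps t j : 0 <= t -> measurable [set w | eps t w = j].
Proof. by have [+ _ _ _] := chain_eps; exact. Qed.

Variables (sigma : 'I_2 -> R) (rho : R) (b : 'I_2 -> R) (v sl : 'I_2 -> R -> R).
Hypotheses (sigma_gt0 : forall i, 0 < sigma i) (rho_gt0 : 0 < rho).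
Hypothesis vf : verification sigma lambda rho b v sl.
Variables (x th : R) (X : R -> Omega -> R).
Hypothesis price_X : price_process P F B eps sigma x X.

Lemma price_continuous : {ae P, forall w, {within `[0, +oo[, continuous (fun t : R => X t w)}}.
Proof.
have [_ cX _] := price_X; apply: filterS cX => w cX.
have -> : (fun t => X t w) = (fun t => (X t w - x) + x).
  by apply/funext => t; rewrite subrK.
by move=> t; apply: cvgD; [exact: cX|exact: cvg_cst].
Qed.

Definition reward (t : R) (w : Omega) : R := expR (- (rho * t)) * Num.max 0 (X t w - th).

Lemma reward_ge0 t w : 0 <= reward t w.
Proof. by rewrite mulr_ge0 ?expR_ge0// le_max lexx. Qed.

Lemma reward_continuous w : {within `[0, +oo[, continuous (fun t : R => X t w)} ->
  {within `[0, +oo[, continuous (fun t : R => reward t w)}.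
Proof.
move=> cX t; apply: cvgM.
  by apply: (continuous_subspaceT (f := fun t : R => expR (- (rho * t)))); exact: continuous_discount.
apply: (@max_fun_continuous _ (subspace (`[0, +oo[%classic : set R)) R (fun=> 0) (fun t => X t w - th)).
  by move=> s; exact: cvg_cst.
by move=> s; apply: cvgB; [exact: cX|exact: cvg_cst].
Qed.

Lemma reward_le_discounted h k w : reward (k%:R * h) w <= discounted eps rho v th X h k w.
Proof.
apply: ler_wpM2l; first exact: expR_ge0.
by rewrite ge_max (vf_ge0 vf) (vf_ge vf).
Qed.

Section Control.
Variables (nu : control R Omega) (y : R) (i : 'I_2).
Hypotheses (y0 : 0 <= y) (nu_adm : admissible P F y nu).

Local Notation h := (@mesh R).
Local Notation n := steps.

(** The stock not yet sold. The truncation at 0 is there because admissibility holds only almost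
    surely, while the discrete inequality asks for a nonnegative weight everywhere. *)
Let alive (m k : nat) (w : Omega) : R := \1_(start eps i) w * Num.max 0 (y - nu (k%:R * h m) w).

Let t0 m k : 0 <= k%:R * h m. Proof. by rewrite mulr_ge0// ltW// mesh_gt0. Qed.

Let alive_ge0 m k w : 0 <= alive m k w.
Proof. by rewrite mulr_ge0// le_max lexx. Qed.

Let alive_le m k w : alive m k w <= y.
Proof.
rewrite -[leRHS]mul1r; apply: ler_pM => //; first by rewrite le_max lexx.
by rewrite ge_max y0 gerBl; exact: ctl_ge0.
Qed.

Let alive_ni m k w : alive m k.+1 w <= alive m k w.
Proof.
apply: ler_wpM2l => //; rewrite ge_max !le_max lexx /= lerB ?orbT//.
by apply: ctl_nd => //; rewrite ler_pM2r ?mesh_gt0// ler_nat.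
Qed.

Let measurable_alive m k : measurable_fun [set: filtered (k%:R * h m)] (alive m k).
Proof.
apply: measurable_funM.
  apply: measurable_indic; apply: filtration_eps.
  by rewrite lexx t0.
apply: measurable_maxr => //; apply: measurable_funB => //.
have [adp _] := nu_adm.
by move=> _ V mV; rewrite setTI; exact: adp.
Qed.

Let U (w : Omega) : \bar R :=
  limn_einf (fun m => (liquidated eps rho v th X (h m) (alive m) (n m) w)%:E).

Let mliq m : measurable_fun [set: Omega] (fun w => (liquidated eps rho v th X (h m) (alive m) (n m) w)%:E).
Proof.
apply/measurable_EFinP.
exact: (measurable_liquidated complete_P brownian_B chain_eps vf th price_X (mesh_gt0 m) (@measurable_alive m)).
Qed.

Let liq0 m w : (0 <= (liquidated eps rho v th X (h m) (alive m) (n m) w)%:E)%E.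
Proof. by rewrite lee_fin; exact: (liquidated_ge0 eps vf th X (h m) (alive_ni m)). Qed.

Let liq_bound : exists2 K, 0 <= K & forall m,
  (\int[P]_w (liquidated eps rho v th X (h m) (alive m) (n m) w)%:E <=
   (y * v i (x - th))%:E * P (start eps i) + (K * (m.+1%:R)^-1)%:E)%E.
Proof.
have [C C0 HC] := one_step_le sigma_gt0 lambda_gt0 rho_gt0 vf.
pose e := (lambda reg1 + lambda reg2) * (1 + (sigma reg1 - sigma reg2) ^+ 2) / 2.
have e0 : 0 <= e by rewrite divr_ge0// mulr_ge0 ?addr_ge0 ?sqr_ge0// ltW.
exists ((C + e) * y); first by rewrite mulr_ge0// addr_ge0.
move=> m; rewrite -steps_error.
have := liquidated_le complete_P lambda_gt0 brownian_B chain_eps independent_B_eps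
  rho_gt0 vf th price_X (mesh_gt0 m) (@measurable_alive m) (alive_ge0 m) (alive_le m)
  (alive_ni m) (n m) C0 (fun j z => HC j z (h m) (mesh_gt0 m) (mesh_le1 m)).
rewrite -/e => l; apply: (le_trans (le_trans _ l)).
  apply: le_integral_nonmeas => w _; rewrite lee_fin lerDl mulr_ge0//.
  exact: (discounted_ge0 eps vf).
rewrite leeD2r//.
have := initial_value complete_P lambda_gt0 brownian_B chain_eps independent_B_eps vf th price_X i y0.
move=> <-; apply: le_integral_nonmeas => w _; rewrite lee_fin.
rewrite /discounted mul0r mulr0 oppr0 expR0 mul1r /alive mul0r ctl_zero subr0 max_r//.
by rewrite (mulrC y).
Qed.

(** The bound is phrased through a measurable majorant [U], since measurability in [w] of the path
    integral is not at hand. [U] is the lower limit of the discrete rewards, and Fatou's lemma is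
    used twice: along each path and for the expectation. *)
Lemma control_reward : exists U : Omega -> \bar R,
  [/\ measurable_fun setT U, forall w, (0 <= U w)%E,
      {ae P, forall w, start eps i w ->
        (\int[lebesgue_stieltjes_measure (ctl_right nu w)]_(t in `[0%R, +oo[) (reward t w)%:E <= U w)%E} &
      (\int[P]_w U w <= (y * v i (x - th))%:E * P (start eps i))%E].
Proof.
exists U; split.
- exact: (measurable_fun_limn_einf (f := fun m w => (liquidated eps rho v th X (h m) (alive m) (n m) w)%:E)).
- move=> w; rewrite -(cvg_limn_einf_sup (cvg_cst (0 : \bar R))).1.
  exact: limn_einf_le.
- have [_ adm] := nu_adm.
  apply: filterS2 price_continuous adm => w cX nuy wi.
  have := stieltjes_integral_fatou nu w (fun t => reward_ge0 t w) (reward_continuous cX)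
    (@mesh_gt0 R) mesh_cvg horizon_cvg; move=> fat; apply: (le_trans fat).
  apply: limn_einf_le => m; rewrite lee_fin; apply: ler_sum => k _.
  have alE j : alive m j w = y - nu (j%:R * h m) w.
    by rewrite /alive indicE mem_set// mul1r max_r//; exact: nuy.
  rewrite !alE; apply: ler_pM.
  + exact: reward_ge0.
  + by rewrite subr_ge0; apply: ctl_nd => //; rewrite ler_pM2r ?mesh_gt0// ler_nat.
  + exact: reward_le_discounted.
  + by rewrite le_eqVlt; apply/orP; left; apply/eqP; ring.
- apply: (le_trans (fatou P measurableT mliq (fun m w _ => liq0 m w))).
  have [K K0 HK] := liq_bound.
  apply: (le_trans (limn_einf_le HK)).
  have c : (fun m => (y * v i (x - th))%:E * P (start eps i) + (K * (m.+1%:R)^-1)%:E)%E @ \oo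
      --> ((y * v i (x - th))%:E * P (start eps i) + 0)%E.
    apply: cvgeD; first by rewrite fin_num_adde_defl.
      exact: cvg_cst.
    apply: cvg_EFin; first exact: nearW.
    rewrite -[X in _ --> X](mulr0 K); apply: cvgM; first exact: cvg_cst.
    exact: cvg_harmonic.
  by rewrite (cvg_limn_einf_sup c).1 adde0.
Qed.

End Control.
End UpperBound.

Lemma stieltjes_half_line (R : realType) d (Omega : measurableType d)
    (nu : control R Omega) (w : Omega) (a m : R) :
  0 <= a -> (forall t, a < t -> nu t w - nu a w = m) ->
  lebesgue_stieltjes_measure (ctl_right nu w) `[a, +oo[%classic = m%:E.
Proof.
move=> a0 H; set mu := lebesgue_stieltjes_measure _.
have aN n : a < a + (n + 1)%:R by rewrite ltrDl ltr0n addn1.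
have c1 : (fun n => mu `[a, a + (n + 1)%:R[%classic) @ \oo --> mu `[a, +oo[%classic.
  rewrite [X in _ --> mu X](itv_bndy_bigcup_BLeft_shift true a 1).
  apply: nondecreasing_cvg_mu.
  - by move=> n; exact: measurable_itv.
  - by apply: bigcup_measurable => n _; exact: measurable_itv.
  - move=> p q pq; apply/subsetPset => r/=; rewrite !in_itv/= => /andP[->/=].
    by move/lt_le_trans; apply; rewrite lerD2l ler_nat leq_add2r.
apply: cvg_unique c1 _; first exact: ereal_hausdorff.
rewrite (_ : (fun n => _) = (fun=> m%:E)); first exact: cvg_cst.
by apply/funext => n; rewrite /mu stieltjes_itvco ?H// ltW.
Qed.

Lemma stieltjes_integral_null (R : realType) d (Omega : measurableType d)
    (nu : control R Omega) (w : Omega) (h : R -> R) :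
  (forall t, 0 <= t -> nu t w = 0) -> stieltjes_integral nu w h = 0%E.
Proof.
move=> nu0; have m0 : lebesgue_stieltjes_measure (ctl_right nu w) `[0, +oo[%classic = 0%E.
  by apply: stieltjes_half_line => // t t0; rewrite !nu0 ?subrr// ltW.
rewrite /stieltjes_integral.
transitivity (\int[lebesgue_stieltjes_measure (ctl_right nu w)]_(t in `[0%R, +oo[) 0%E)%E; last exact: integral0.
apply: ae_eq_integral_nonmeas; exists `[0, +oo[%classic; split => //.
by move=> t /= /not_implyP[].
Qed.

(** * Payoffs along a single path *)

Section PathPayoff.
Context {R : realType} {d : measure_display} {Omega : measurableType d}.
Variable rho : R.
Hypothesis rho_gt0 : 0 < rho.
Local Notation leb := (@lebesgue_measure R).

Section BoundedControl.
Variables (nu : control R Omega) (w : Omega) (y : R).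
Hypothesis nuy : forall t, 0 <= t -> nu t w <= y.
Local Notation mu := (lebesgue_stieltjes_measure (ctl_right nu w)).

Let y0 : 0 <= y. Proof. by rewrite -(ctl_zero nu w) nuy. Qed.

Let measurable_nu : measurable_fun (`[0, +oo[%classic : set (measurableTypeR R)) (fun t : R => nu t w).
Proof.
have mn : measurable_fun [set: measurableTypeR R] (fun t : R => nu (Num.max 0 t) w).
  apply: nondecreasing_measurable => // s t st; apply: ctl_nd; first by rewrite le_max lexx.
  by rewrite ge_max le_max lexx/= le_max st orbT.
apply: eq_measurable_fun (measurable_funTS mn) => t; rewrite inE/= in_itv/= andbT => t0.
by rewrite max_r.
Qed.

Let measurable_e : measurable_fun (`[0, +oo[%classic : set (measurableTypeR R)) (fun t : R => expR (- (rho * t))).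
Proof. by apply: measurable_funTS; apply: continuous_measurable_fun; exact: continuous_discount. Qed.

(** Integration by parts for a cost linear in the remaining stock, obtained from a sum of
    nonnegative integrals; the discounted mass [E] is at most [y], hence finite and free to be
    subtracted. *)
Lemma linear_cost (a : R) : 0 <= a -> exists E : R,
  [/\ 0 <= E, (\int[mu]_(t in `[0%R, +oo[) (expR (- (rho * t)))%:E = E%:E)%E &
   (\int[leb]_(t in `[0%R, +oo[) (expR (- (rho * t)) * (a * (y - nu t w)))%:E
    = (rho^-1 * (a * y) - rho^-1 * a * E)%:E)%E].
Proof.
move=> a0; have ri : 0 <= rho^-1 by rewrite invr_ge0 ltW.
have mI : measurable (`[0, +oo[%classic : set (measurableTypeR R)) by exact: measurable_itv.
have e0 t : 0 <= expR (- (rho * t)) by exact: expR_ge0.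
have re0 t : 0 <= rho * expR (- (rho * t)) by rewrite mulr_ge0// ltW.
have ra0 : 0 <= rho^-1 * a by exact: mulr_ge0.
have ray0 : 0 <= rho^-1 * (a * y) by rewrite !mulr_ge0.
have me : measurable_fun (`[0, +oo[%classic : set (measurableTypeR R)) (fun t : R => rho * expR (- (rho * t))).
  exact: measurable_funM.
have menu : measurable_fun (`[0, +oo[%classic : set (measurableTypeR R)) (fun t : R => rho * expR (- (rho * t)) * nu t w).
  exact: measurable_funM.
have md : measurable_fun (`[0, +oo[%classic : set (measurableTypeR R)) (fun t : R => expR (- (rho * t)) * (a * (y - nu t w))).
  apply: measurable_funM => //; apply: measurable_funM => //; exact: measurable_funB.
have enu0 t : `[0, +oo[%classic t -> 0 <= rho * expR (- (rho * t)) * nu t w.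
  by rewrite /= in_itv/= andbT => t0; rewrite mulr_ge0// ctl_ge0.
have enuy t : `[0, +oo[%classic t -> rho * expR (- (rho * t)) * nu t w <= y * (rho * expR (- (rho * t))).
  rewrite /= in_itv/= andbT => t0; rewrite (mulrC y); apply: ler_wpM2l => //; exact: nuy.
have d0 t : `[0, +oo[%classic t -> 0 <= expR (- (rho * t)) * (a * (y - nu t w)).
  by rewrite /= in_itv/= andbT => t0; rewrite mulr_ge0// mulr_ge0// subr_ge0 nuy.
have const (k : R) : 0 <= k -> (\int[leb]_(t in `[0%R, +oo[) (k * (rho * expR (- (rho * t))))%:E = k%:E)%E.
  move=> k0; rewrite (ge0_integralZ leb mI me k0 (fun t _ => re0 t)) exponential_tail//.
  by rewrite mulr0 oppr0 expR0 mule1.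
rewrite (stieltjes_discount rho_gt0 nu w).
have sum : (\int[leb]_(t in `[0%R, +oo[) (expR (- (rho * t)) * (a * (y - nu t w)))%:E +
    (rho^-1 * a)%:E * \int[leb]_(t in `[0%R, +oo[) (rho * expR (- (rho * t)) * nu t w)%:E =
    (rho^-1 * (a * y))%:E)%E.
  rewrite -(ge0_integralZ leb mI menu ra0 enu0) -(const _ ray0).
  rewrite -(ge0_integralD leb mI); last 4 first.
  - by move=> t /d0.
  - exact/measurable_EFinP.
  - by move=> t /enu0 z; rewrite lee_fin; exact: mulr_ge0.
  - by apply/measurable_EFinP; exact: measurable_funM.
  apply: eq_integral => t _; rewrite -EFinD; congr EFin.
  by field; rewrite gt_eqF.
have E0 : (0 <= \int[leb]_(t in `[0%R, +oo[) (rho * expR (- (rho * t)) * nu t w)%:E)%E.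
  by apply: integral_ge0 => t /enu0.
have Ey : (\int[leb]_(t in `[0%R, +oo[) (rho * expR (- (rho * t)) * nu t w)%:E <= y%:E)%E.
  by rewrite -[leRHS](const _ y0); apply: le_integral_nonmeas => t /enuy.
clear - sum E0 Ey; move: (integral _ _ _) sum E0 Ey => I.
move: (integral _ _ _) => [E| |]// + E0 Ey; rewrite -EFinM.
by move=> /(congr1 (fun z => z - (rho^-1 * a * E)%:E)%E); rewrite addeK// => ->; exists E.
Qed.

Lemma path_payoff_le (f : R -> R) (X : R -> R) (c th : R) :
  c = th + rho^-1 * (f y / y) -> 0 < y -> 0 <= f y ->
  (forall z, 0 <= z <= y -> f y / y * z <= f z) ->
  {within `[0, +oo[, continuous X} ->
  (stieltjes_integral nu w (fun t => expR (- (rho * t)) * (X t - c))%R -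
   \int[leb]_(t in `[0%R, +oo[) (expR (- (rho * t)) * f (y - nu t w))%:E <=
   \int[mu]_(t in `[0%R, +oo[) (expR (- (rho * t)) * Num.max 0 (X t - th))%:E - (rho^-1 * f y)%:E)%E.
Proof.
move=> cE y_gt0 fy0 fz cX; set a := f y / y in cE fz.
have a0 : 0 <= a by rewrite divr_ge0// ltW.
have [E [E0 EE lin]] := linear_cost a0.
have mI : measurable (`[0, +oo[%classic : set (measurableTypeR R)) by exact: measurable_itv.
have e0 t : 0 <= expR (- (rho * t)) by exact: expR_ge0.
set G := (\int[mu]_(t in _) (_ * Num.max 0 _)%:E)%E.
have G0 : (0 <= G)%E.
  by apply: integral_ge0 => t _; rewrite lee_fin mulr_ge0// le_max lexx.
(* An infinite right-hand side leaves nothing to prove; otherwise both parts of the Stieltjes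
   integrand are integrable and may be split. *)
have [Ginf|Gfin] := eqVneq G +oo%E; first by rewrite Ginf leey.
have mX : measurable_fun (`[0, +oo[%classic : set (measurableTypeR R)) X.
  exact: subspace_continuous_measurable_fun.
have mG : measurable_fun (`[0, +oo[%classic : set (measurableTypeR R)) (fun t => expR (- (rho * t)) * Num.max 0 (X t - th)).
  apply: measurable_funM => //; apply: measurable_maxr => //; exact: measurable_funB.
have iG : mu.-integrable `[0%R, +oo[ (EFin \o (fun t => expR (- (rho * t)) * Num.max 0 (X t - th))).
  apply/integrableP; split; first exact/measurable_EFinP.
  under eq_integral do rewrite gee0_abs ?lee_fin ?(mulr_ge0 (e0 _))// ?le_max ?lexx//.
  by rewrite ltey.
have iE : mu.-integrable `[0%R, +oo[ (fun t : R => (expR (- (rho * t)))%:E).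
  apply/integrableP; split; first exact/measurable_EFinP.
  under eq_integral do rewrite gee0_abs ?lee_fin//.
  by rewrite EE ltry.
have S : (stieltjes_integral nu w (fun t => expR (- (rho * t)) * (X t - c))%R <= G - (rho^-1 * a * E)%:E)%E.
  rewrite EFinM -EE -integralZl// -integralB//; last exact: integrableZl.
  apply: le_integral_nonmeas => t _; rewrite -EFinM -EFinB lee_fin.
  rewrite (mulrC (rho^-1 * a)) -mulrBr; apply: ler_wpM2l => //.
  by rewrite cE opprD addrA lerB// le_max lexx orbT.
have J : ((rho^-1 * f y - rho^-1 * a * E)%:E <= \int[leb]_(t in `[0%R, +oo[) (expR (- (rho * t)) * f (y - nu t w))%:E)%E.
  have -> : f y = a * y by rewrite divfK// gt_eqF.
  rewrite -lin; apply: le_integral_nonmeas => t /=; rewrite in_itv/= andbT => t0.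
  rewrite lee_fin; apply: ler_wpM2l => //; apply: fz.
  by rewrite subr_ge0 nuy//= gerBl ctl_ge0.
apply: (le_trans (leeB S J)).
clear - Gfin G0; clearbody G; case: G G0 Gfin => [g| |]// _ _.
by rewrite -!EFinB lee_fin opprB addrA subrK.
Qed.

End BoundedControl.

Section JumpPath.
Variables (y : R) (tau : Omega -> \bar R).
Hypotheses (y0 : 0 <= y) (tau0 : forall w, (0 <= tau w)%E).
Variable w : Omega.
Local Notation nu := (jump_control y0 tau0).
Local Notation mu := (lebesgue_stieltjes_measure (ctl_right nu w)).

(** The Stieltjes measure of the path is the point mass [y] at [tau w]: the interval below and the
    half-lines strictly above carry no mass, so [h] may be replaced by its value there. *)
Lemma jump_path_integral (h : R -> R) : tau w \is a fin_num ->
  stieltjes_integral nu w h = (y * h (fine (tau w)))%:E.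
Proof.
move=> tf; set r := fine (tau w).
have tE : tau w = r%:E by rewrite /r fineK.
have r0 : 0 <= r by rewrite -lee_fin -tE.
have nuE t : nu t w = if t <= r then 0 else y by rewrite /= /jump_path tE lee_fin.
have m1 : mu `[0, r[%classic = 0%E by rewrite stieltjes_itvco// !nuE lexx r0 subr0.
have m2 : mu `[r, +oo[%classic = y%:E.
  by apply: stieltjes_half_line => // t rt; rewrite !nuE lexx leNgt rt subr0.
have m3 n : mu `[r + n.+1%:R^-1, +oo[%classic = 0%E.
  apply: stieltjes_half_line; first by rewrite addr_ge0.
  have rn : r < r + n.+1%:R^-1 by rewrite ltrDl invr_gt0.
  by move=> t rt; rewrite !nuE !leNgt (lt_trans rn rt) rn subrr.
have m0 : mu `[0, +oo[%classic = y%:E.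
  rewrite (_ : `[0, +oo[%classic = `[r, +oo[%classic `|` `[0, r[%classic); last first.
    apply/seteqP; split => t /=; rewrite !in_itv/= !andbT.
      by move=> t0; have [rt|tr] := leP r t; [left|right; rewrite t0].
    by move=> [/(le_trans r0)|/andP[]].
  by rewrite measureU0//; exact: measurable_itv.
rewrite /stieltjes_integral.
transitivity (\int[mu]_(t in `[0%R, +oo[) (h r)%:E)%E; last first.
  by rewrite integral_cst// [X in (_ * X)%E]m0 -EFinM mulrC.
apply: ae_eq_integral_nonmeas.
have n1 : mu.-negligible `[0, r[%classic by exists `[0, r[%classic; split => //; exact: measurable_itv.
have n2 : mu.-negligible (\bigcup_n `[r + n.+1%:R^-1, +oo[%classic).
  apply: negligible_bigcup => n.
  by apply/negligibleP; [exact: measurable_itv|exact: m3].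
apply: negligibleS (negligibleU n1 n2) => t /= /not_implyP[]; rewrite in_itv/= andbT => t0 ht.
have [tr|rt|tr] := ltgtP t r; last by rewrite tr in ht.
  by left; rewrite /= in_itv/= t0.
right; exists (Num.truncn (t - r)^-1) => //=; rewrite in_itv/= andbT.
rewrite -lerBrDl invf_ple ?posrE ?subr_gt0//.
by rewrite ltW// truncnS_gt.
Qed.

Lemma jump_path_integral_never (h : R -> R) : tau w = +oo%E ->
  stieltjes_integral nu w h = 0%E.
Proof.
by move=> tE; apply: stieltjes_integral_null => t _; rewrite /= /jump_path tE leey.
Qed.

(** The remaining stock takes only the values 0 and [y], where the chord agrees with [f], so the
    linear cost formula is exact. *)
Lemma jump_path_payoff (f : R -> R) (X : R -> R) (c th : R) :
  c = th + rho^-1 * (f y / y) -> 0 < y -> 0 <= f y -> f 0 = 0 ->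
  (stieltjes_integral nu w (fun t => expR (- (rho * t)) * (X t - c))%R -
   \int[leb]_(t in `[0%R, +oo[) (expR (- (rho * t)) * f (y - nu t w))%:E)%E =
  (y * (if tau w is r%:E then expR (- (rho * r)) * (X r - th) else 0) - rho^-1 * f y)%:E.
Proof.
move=> cE y_gt0 fy0 f0.
have nuy t : 0 <= t -> nu t w <= y by move=> _; rewrite /= /jump_path; case: ifP.
have a0 : 0 <= f y / y by rewrite divr_ge0.
have [E [E0 EE lin]] := linear_cost nuy a0.
have fE t : f (y - nu t w) = f y / y * (y - nu t w).
  rewrite /= /jump_path; case: ifP => _; first by rewrite subr0 divfK// gt_eqF.
  by rewrite subrr mulr0.
under [X in (_ - X)%E]eq_integral do rewrite fE.
rewrite lin -/(stieltjes_integral nu w (fun t => expR (- (rho * t)))) in EE *.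
have : (0 <= tau w)%E by [].
case tE : (tau w) => [r| |]// _.
  rewrite !jump_path_integral ?tE//= in EE *; case: EE => <-.
  by rewrite -EFinB; congr EFin; rewrite cE; field; rewrite !gt_eqF.
rewrite !jump_path_integral_never// in EE *; case: EE => <-.
by rewrite -EFinB; congr EFin; field; rewrite !gt_eqF.
Qed.

End JumpPath.
End PathPayoff.

Lemma countType_bigcup_measurable d (T : sigmaRingType d) (I : countType) (D : set I)
    (A : I -> set T) :
  (forall i, D i -> measurable (A i)) -> measurable (\bigcup_(i in D) A i).
Proof.
move=> mA; rewrite bigcup_mkcond; apply: countable_bigcupT_measurable => [|i]; first exact: countableP.
by case: ifPn => [/set_mem/mA|].
Qed.

Section ConditionalExpectation.
Context {R : realType} {d : measure_display} {Omega : measurableType d}.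
Variables (P : probability Omega R) (A : set Omega).
Hypotheses (mA : measurable A) (PA : (0 < P A)%E).

Let PA_fin : P A \is a fin_num.
Proof. by rewrite ge0_fin_numE// (le_lt_trans (probability_le1 P mA))// ltry. Qed.

Let normalize (k : \bar R) : (k * P A * (fine (P A))^-1%:E = k)%E.
Proof.
have a0 : 0 < fine (P A) by rewrite fine_gt0// PA/= -ge0_fin_numE.
rewrite -[X in (k * X)%E](fineK PA_fin); move: (fine (P A)) a0 => a a0.
by rewrite -muleA -EFinM divff ?mule1// gt_eqF.
Qed.

Lemma cond_expectation_le Z (k : \bar R) :
  (\int[P]_(w in A) Z w <= k * P A)%E -> (cond_expectation P A Z <= k)%E.
Proof.
move=> h; rewrite -[leRHS]normalize /cond_expectation; apply: lee_wpmul2r => //.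
by rewrite lee_fin invr_ge0 fine_ge0.
Qed.

Lemma cond_expectation_ge Z (k : \bar R) :
  (k * P A <= \int[P]_(w in A) Z w)%E -> (k <= cond_expectation P A Z)%E.
Proof.
move=> h; rewrite -[leLHS]normalize /cond_expectation; apply: lee_wpmul2r => //.
by rewrite lee_fin invr_ge0 fine_ge0.
Qed.

End ConditionalExpectation.

Section UpperBounds.
Context {R : realType} {d : measure_display} {Omega : measurableType d}.
Variable P : probability Omega R.
Hypothesis complete_P : measure_is_complete P.
Variables (B : R -> Omega -> R) (eps : R -> Omega -> 'I_2) (lambda : 'I_2 -> R).
Hypothesis lambda_gt0 : forall i, 0 < lambda i.
Hypothesis brownian_B : brownian_motion P B.
Hypothesis chain_eps : markov_chain P eps (generator lambda).
Hypothesis independent_B_eps : independent_processes P B eps.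
Local Notation F := (augmented_filtration P B eps).
Local Notation filtered t := (filtered P B eps t).

Let mB t : 0 <= t -> measurable_fun setT (B t).
Proof. by have [+ _ _ _ _] := brownian_B; exact. Qed.

Let meps t j : 0 <= t -> measurable [set w | eps t w = j].
Proof. by have [+ _ _ _] := chain_eps; exact. Qed.

Variables (sigma : 'I_2 -> R) (rho : R) (b : 'I_2 -> R) (v sl : 'I_2 -> R -> R).
Hypotheses (sigma_gt0 : forall i, 0 < sigma i) (rho_gt0 : 0 < rho).
Hypothesis vf : verification sigma lambda rho b v sl.
Variables (x th : R) (X : R -> Omega -> R).
Hypothesis price_X : price_process P F B eps sigma x X.

(** A left-continuous jump control looks at [t <= tau]; the complementary event is a countable union
    of the events [tau <= q] over rational [q < t]. *)
Lemma stopping_time_before (tau : Omega -> \bar R) t : stopping_time F tau -> 0 <= t ->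
  F t [set w | (t%:E <= tau w)%E].
Proof.
move=> [tau0 tauF] t0.
have -> : [set w | (t%:E <= tau w)%E] = ~` \bigcup_(q in [set q : rat | 0 <= (ratr q : R) < t]) [set w | (tau w <= (ratr q : R)%:E)%E].
  apply/seteqP; split => w /=.
    move=> tw [q /= /andP[_ qt]]; rewrite leNgt => /negP; apply.
    by rewrite (lt_le_trans _ tw)// lte_fin.
  move=> H; rewrite leNgt; apply/negP => wt; apply: H.
  have := tau0 w; case E : (tau w) wt => [r| |]// rt; rewrite lee_fin => r0.
  have [q] := rat_in_itvoo rt; rewrite in_itv/= => /andP[rq qt].
  by exists q => /=; [rewrite qt andbT (le_trans r0)// ltW|rewrite E lee_fin ltW].
rewrite filtrationE; apply: measurableC; apply: countType_bigcup_measurable => q /= /andP[q0 qt].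
by apply: (filtration_le (ltW qt)); exact: tauF.
Qed.

Lemma adapted_jump_control (tau : Omega -> \bar R) (tau0 : forall w, (0 <= tau w)%E) y (y0 : 0 <= y) :
  stopping_time F tau -> adapted F (jump_control y0 tau0).
Proof.
move=> st t t0 U mU.
have mj : measurable_fun [set: filtered t] (jump_path y tau t).
  apply: measurable_fun_ifT => //; apply: (measurable_fun_bool true); rewrite setTI.
  exact: stopping_time_before.
by have := mj measurableT U mU; rewrite setTI.
Qed.

Lemma payoff_le (f : R -> R) (c y : R) (i : 'I_2) (nu : control R Omega) :
  (0 < P (start eps i))%E -> c = th + rho^-1 * (f y / y) -> 0 < y -> 0 <= f y ->
  (forall z, 0 <= z <= y -> f y / y * z <= f z) -> admissible P F y nu ->
  (payoff P eps (fun=> X) rho c f x y i nu <= (y * v i (x - th) - rho^-1 * f y)%:E)%E.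
Proof.
move=> P0 cE y_gt0 fy0 fz nu_adm; apply: cond_expectation_le => //; first exact: meps.
have [U [mU U0 HU IU]] := control_reward complete_P lambda_gt0 brownian_B chain_eps independent_B_eps
  sigma_gt0 rho_gt0 vf th price_X i (ltW y_gt0) nu_adm.
have mi : measurable (start eps i) by exact: meps.
have iU : P.-integrable (start eps i) U.
  apply/integrableP; split; first exact: measurable_funTS.
  under eq_integral do rewrite gee0_abs//.
  apply: (@le_lt_trans _ _ (\int[P]_w U w)%E); first exact: ge0_subset_integral.
  by apply: (le_lt_trans IU); rewrite lte_mul_pinfty ?lee_fin ?mulr_ge0 ?(vf_ge0 vf) ?(ltW y_gt0)// (le_lt_trans (probability_le1 P mi))// ltry.
apply: (@le_trans _ _ (\int[P]_(w in start eps i) (U w - (rho^-1 * f y)%:E))%E).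
  have [_ adm] := nu_adm.
  apply: ae_le_integral; apply: filterS3 HU adm (price_continuous price_X) => w HUw nuy cX wi.
  have nuy' t : 0 <= t -> nu t w <= y by move=> t0; rewrite -subr_ge0 nuy.
  apply: (le_trans (path_payoff_le rho_gt0 nuy' cE y_gt0 fy0 fz cX)).
  by apply: leeB => //; exact: HUw.
rewrite integralB//; last by apply: finite_measure_integrable_cst.
rewrite integral_cst// EFinB muleBl//; last by rewrite ge0_fin_numE ?(le_lt_trans (probability_le1 P mi))// ltry.
by apply: leeB => //; apply: le_trans IU; apply: ge0_subset_integral.
Qed.

(** Stopping at [tau] is the control that sells one unit at [tau], so the bound for controls applies
    with [y = 1]. *)
Lemma stopping_payoff_le (i : 'I_2) (tau : Omega -> \bar R) :
  (0 < P (start eps i))%E -> finite_stopping_time P F eps i tau ->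
  (cond_expectation P (start eps i) (fun w => (expR (- (rho * fine (tau w))) *
                 (X (fine (tau w)) w - th))%:E) <= (v i (x - th))%:E)%E.
Proof.
move=> P0 [st fin]; apply: cond_expectation_le => //; first exact: meps.
have nu_adm : admissible P F 1 (jump_control ler01 st.1).
  split; first exact: adapted_jump_control.
  by apply: aeW => w t t0; rewrite /= /jump_path subr_ge0; case: ifP.
have [U [mU U0 HU IU]] := control_reward complete_P lambda_gt0 brownian_B chain_eps independent_B_eps
  sigma_gt0 rho_gt0 vf th price_X i ler01 nu_adm.
rewrite mul1r in IU; apply: le_trans IU.
apply: (@le_trans _ _ (\int[P]_(w in start eps i) U w)%E); last by apply: ge0_subset_integral => //; exact: meps.
apply: ae_le_integral; apply: filterS2 HU fin => w HUw tw wi.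
apply: le_trans (HUw wi).
have tf : tau w \is a fin_num by rewrite ge0_fin_numE ?tw//; exact: st.1.
have := jump_path_integral ler01 st.1 (fun t => reward rho th X t w) tf.
rewrite /stieltjes_integral mul1r => ->.
rewrite lee_fin; apply: ler_wpM2l; first exact: expR_ge0.
by rewrite le_max lexx orbT.
Qed.

End UpperBounds.

(** * The hitting time *)

Section HittingPath.
Context {R : realType}.
Variables (e : R -> 'I_2) (z : R -> R) (beta : 'I_2 -> R).
Hypothesis e_rc : forall t, 0 <= t -> \forall s \near t^'+, e s = e t.
Hypothesis z_cont : {within `[0, +oo[, continuous z}.

Definition hits : set R := [set t | 0 <= t /\ beta (e t) <= z t].

Let right_constant t : 0 <= t -> exists2 del, 0 < del & forall s, t < s < t + del -> e s = e t.
Proof.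
move=> t0; have := e_rc t0; rewrite near_withinE => /nbhs_ballP[del /= del0 H].
exists del => // s /andP[ts sd]; apply: H => //=.
by rewrite /ball/= distrC gtr0_norm ?subr_gt0// ltrBlDl.
Qed.

(** Hits can approach their infimum only from the right; there the regime is constant, so the
    threshold is fixed and continuity of [z] passes the inequality to the limit. *)
Lemma hits_inf : hits !=set0 -> hits (inf hits).
Proof.
move=> h0; have lb : has_lbound hits by exists 0 => t [].
have i0 : 0 <= inf hits by apply: lb_le_inf => // t [].
split => //; rewrite leNgt; apply/negP => zi.
have [d1 d10 H1] := right_constant i0.
have gap : 0 < beta (e (inf hits)) - z (inf hits) by rewrite subr_gt0.
have [d2 d20 H2] := within_half_line_eps_delta z_cont i0 gap.
have dd : 0 < Num.min d1 d2 by rewrite lt_min d10.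
have [|s [s0 hs] si] := inf_adherent dd (_ : has_inf hits); first by split.
have is_ : inf hits <= s by apply: ge_inf => //; split.
have [E|ne] := eqVneq (inf hits) s; first by move: hs; rewrite -E leNgt zi.
have lt_is : inf hits < s by rewrite lt_neqAle ne.
have [s1 s2] : s < inf hits + d1 /\ s < inf hits + d2.
  by split; apply: (lt_le_trans si); rewrite lerD2l ge_min lexx ?orbT.
move: hs; rewrite H1 ?lt_is// leNgt => /negP; apply.
have : `|z (inf hits) - z s| < beta (e (inf hits)) - z (inf hits).
  by apply: H2 => //; rewrite distrC gtr0_norm ?subr_gt0// ltrBlDl.
rewrite ltr_norml => /andP[+ _]; rewrite ltrNl opprB.
by rewrite ltrBDr subrK.
Qed.

(* A hit strictly before [t] is detected along the rationals: the regime is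
   constant on some [r, q], and [z] comes arbitrarily close to the threshold
   of that regime at rational times. *)
Definition rational_hit (t : R) : Prop := exists j (q : rat), 0 <= (ratr q : R) <= t /\
  forall n, exists r : rat, [/\ 0 <= (ratr r : R) <= ratr q, beta j - n.+1%:R^-1 <= z (ratr r) &
    forall p : rat, (ratr r : R) <= (ratr p : R) <= ratr q -> e (ratr p) = j].

Lemma rational_hits t s : hits s -> s < t -> rational_hit t.
Proof.
move=> [s0 hs] st; have [d1 d10 H1] := right_constant s0.
have sm : s < Num.min t (s + d1) by rewrite lt_min st ltrDl.
have [q] := rat_in_itvoo sm; rewrite in_itv/= lt_min => /and3P[sq qt qd].
exists (e s), q; split; first by rewrite (le_trans s0 (ltW sq)) ltW.
move=> n; have n0 : 0 < n.+1%:R^-1 :> R by rewrite invr_gt0.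
have [d2 d20 H2] := within_half_line_eps_delta z_cont s0 n0.
have sm2 : s < Num.min (ratr q) (s + d2) by rewrite lt_min sq ltrDl.
have [r] := rat_in_itvoo sm2; rewrite in_itv/= lt_min => /and3P[sr rq rd].
have r0 : 0 <= ratr r :> R by rewrite (le_trans s0 (ltW sr)).
exists r; split; first by rewrite r0 ltW.
  have /H2 : `|s - ratr r| < d2 by rewrite distrC gtr0_norm ?subr_gt0// ltrBlDl.
  move=> /(_ r0); rewrite ltr_norml => /andP[_ h].
  by move: (n.+1%:R^-1) h hs => k; lra.
by move=> p /andP[rp pq]; apply: H1; rewrite (lt_le_trans sr rp) (le_lt_trans pq).
Qed.

(** The regime is [j] from each near-hit up to [q], first at rational and then, by right-continuity,
    at all times. The set [A] of such starting points contains its infimum, and on the compact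
    interval from there to [q] the maximum of [z] is attained and dominates every approximate
    threshold. *)
Lemma rational_hit_hits t : rational_hit t -> exists2 s, hits s & s <= t.
Proof.
move=> [j [q [/andP[q0 qt] Hq]]].
pose A : set R := [set a | 0 <= a <= ratr q /\ forall p, a <= p <= ratr q -> e p = j].
have eq : e (ratr q) = j.
  by have [r [/andP[_ rq] _ +]] := Hq 0%N; apply; rewrite rq lexx.
have AE a : 0 <= a <= ratr q -> (forall p, a < p <= ratr q -> e p = j) -> A a.
  move=> /andP[a0 aq] H; split; first by rewrite a0.
  move=> p /andP[]; rewrite le_eqVlt => /predU1P[<-{p} _|ap pq]; last by apply: H; rewrite ap.
  move: aq; rewrite le_eqVlt => /predU1P[->//|aq].
  have [d1 d10 H1] := right_constant a0.
  have m1 : a < Num.min (ratr q) (a + d1) by rewrite lt_min aq ltrDl.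
  have [p] := rat_in_itvoo m1; rewrite in_itv/= lt_min => /and3P[ap pq pd].
  by rewrite -(H1 (ratr p)) ?ap// H// ap ltW.
have Ar n : exists2 a, A a & beta j - n.+1%:R^-1 <= z a.
  have [r [/andP[r0 rq] zr Hr]] := Hq n; exists (ratr r) => //.
  split; first by rewrite r0.
  move=> p /andP[rp]; rewrite le_eqVlt => /predU1P[->//|pq].
  have p0 : 0 <= p by exact: le_trans rp.
  have [d1 d10 H1] := right_constant p0.
  have m1 : p < Num.min (ratr q) (p + d1) by rewrite lt_min pq ltrDl.
  have [p'] := rat_in_itvoo m1; rewrite in_itv/= lt_min => /and3P[pp' pq' pd'].
  by rewrite -(H1 (ratr p')) ?pp'// Hr// (ltW (le_lt_trans rp pp')) ltW.
have A0 : A !=set0 by have [a Aa _] := Ar 0%N; exists a.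
have lbA : has_lbound A by exists 0 => a [/andP[]].
have Ai : A (inf A).
  apply: AE.
    rewrite lb_le_inf//=; last by move=> a [/andP[]].
    by have [a Aa _] := Ar 0%N; rewrite (le_trans (ge_inf lbA Aa))//; case: Aa => /andP[].
  move=> p /andP[ip pq].
  have [a Aa ap] := inf_lt A0 ip.
  by apply: (Aa.2); rewrite (ltW ap).
have [/andP[i0 iq] iE] := Ai.
have zc : {within `[inf A, ratr q], continuous z}.
  apply: continuous_subspaceW z_cont => p /=; rewrite !in_itv/= andbT => /andP[+ _].
  exact: le_trans.
have [c] := EVT_max iq zc; rewrite in_itv/= => /andP[ic cq] cmax.
exists c; last exact: le_trans qt.
split; first exact: le_trans ic.
rewrite iE ?ic//; apply/ler_addgt0Pr => k k0.
have [n nk] : exists n : nat, n.+1%:R^-1 < k.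
  exists (Num.truncn k^-1); rewrite invf_plt ?posrE//; exact: truncnS_gt.
have [a Aa za] := Ar n.
have : z a <= z c.
  apply: cmax; rewrite in_itv/= ge_inf//=; by case: Aa => /andP[].
by move: (n.+1%:R^-1) nk za => u; lra.
Qed.

(** Rational detection needs room to the right of a hit, so a hit at [t] itself is listed
    separately. *)
Lemma rational_hitP t : 0 <= t ->
  (exists2 s, hits s & s <= t) <-> (beta (e t) <= z t \/ rational_hit t).
Proof.
move=> t0; split.
  move=> [s hs]; rewrite le_eqVlt => /predU1P[<-|st]; first by left; case: hs.
  by right; exact: rational_hits st.
by move=> [h|/rational_hit_hits//]; exists t.
Qed.

Lemma hits_attained r : ereal_inf (EFin @` hits) = r%:E -> hits r.
Proof.
have [h0|/set0P] := pselect (hits !=set0); last first.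
  by move=> /negP; rewrite negbK => /eqP ->; rewrite image_set0 ereal_inf0.
rewrite ereal_inf_EFin//; last by exists 0 => t [].
by move=> [<-]; exact: hits_inf.
Qed.

Lemma hits_before t : 0 <= t -> (t%:E < ereal_inf (EFin @` hits))%E -> z t < beta (e t).
Proof.
move=> t0 h; rewrite ltNge; apply/negP => zt; move: h.
by rewrite ltNge => /negP; apply; apply: ereal_inf_lbound; exists t.
Qed.

Lemma hits_inf_le t : 0 <= t ->
  (ereal_inf (EFin @` hits) <= t%:E)%E <-> (beta (e t) <= z t \/ rational_hit t).
Proof.
move=> t0; apply: iff_trans (rational_hitP t0); split; last first.
  by move=> [s hs st]; apply: (@le_trans _ _ s%:E) => //; apply: ereal_inf_lbound; exists s.
case E : (ereal_inf _) => [r| |]//=; last first.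
  move=> _; have : (0 <= ereal_inf (EFin @` hits))%E.
    by apply: le_ereal_inf_tmp => _ [s [s0 _] <-]; rewrite lee_fin.
  by rewrite E.
by rewrite lee_fin => rt; exists r => //; exact: hits_attained.
Qed.

End HittingPath.

Section HittingTime.
Context {R : realType} {d : measure_display} {Omega : measurableType d}.
Variable P : probability Omega R.
Hypothesis complete_P : measure_is_complete P.
Variables (B : R -> Omega -> R) (eps : R -> Omega -> 'I_2) (lambda : 'I_2 -> R).
Hypothesis lambda_gt0 : forall i, 0 < lambda i.
Hypothesis brownian_B : brownian_motion P B.
Hypothesis chain_eps : markov_chain P eps (generator lambda).
Hypothesis independent_B_eps : independent_processes P B eps.
Local Notation F := (augmented_filtration P B eps).
Local Notation filtered t := (filtered P B eps t).

Let mB t : 0 <= t -> measurable_fun setT (B t).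
Proof. by have [+ _ _ _ _] := brownian_B; exact. Qed.

Let meps t j : 0 <= t -> measurable [set w | eps t w = j].
Proof. by have [+ _ _ _] := chain_eps; exact. Qed.

Variables (sigma : 'I_2 -> R) (x : R) (X : R -> Omega -> R).
Hypothesis price_X : price_process P F B eps sigma x X.
Variable beta : 'I_2 -> R.
Local Notation tau := (hitting_time eps (fun=> X) beta x).

Definition regular_path (w : Omega) : Prop :=
  (forall t, 0 <= t -> \forall s \near t^'+, eps s w = eps t w) /\
  {within `[0, +oo[, continuous (fun t : R => X t w)}.

Lemma regular_path_ae : {ae P, forall w, regular_path w}.
Proof.
have [_ rc _ _] := chain_eps.
by apply: filterS2 rc (price_continuous price_X) => w; split.
Qed.

Lemma hitting_time_attained w r : regular_path w -> tau w = r%:E ->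
  0 <= r /\ beta (eps r w) <= X r w.
Proof. by move=> [rc cX]; exact: hits_attained rc cX r. Qed.

Lemma before_hitting_time w t : 0 <= t -> (t%:E < tau w)%E -> X t w < beta (eps t w).
Proof. exact: hits_before. Qed.

(** On regular paths the event is given by countably many conditions on times up to [t]. The other
    paths form a negligible set, all of whose subsets belong to the augmented filtration. *)
Lemma stopping_time_hitting : stopping_time F tau.
Proof.
split=> [w|t t0]; first exact: hitting_time_ge0.
pose A := [set w | beta (eps t w) <= X t w \/ rational_hit (eps^~ w) (X^~ w) beta t].
have [N [mN N0 HN]] := regular_path_ae.
have tA w : regular_path w -> (tau w <= t%:E)%E <-> A w.
  by move=> [rc cX]; exact: hits_inf_le.
have FA : F t A.
  have mX r : 0 <= r <= t -> measurable_fun [set: filtered t] (X r).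
    by move=> /andP[r0 rt]; apply: (measurable_filtered_le rt); exact: (measurable_price price_X r0).
  have -> : A = [set w | beta (eps t w) <= X t w] `|`
    \bigcup_j \bigcup_(q in [set q : rat | 0 <= (ratr q : R) <= t]) \bigcap_n
      \bigcup_(r in [set r : rat | 0 <= (ratr r : R) <= ratr q])
        ([set w | beta j - n.+1%:R^-1 <= X (ratr r) w] `&`
         \bigcap_(p in [set p : rat | (ratr r : R) <= (ratr p : R) <= ratr q]) [set w | eps (ratr p) w = j]).
    rewrite /A; apply/seteqP; split => w /=; (case; first by left).
      move=> [j [q [qt H]]]; right; exists j => //; exists q => // n _.
      by have [r [r0 zr Hr]] := H n; exists r.
    move=> [j _ [q qt H]]; right; exists j, q; split => // n.
    by have [r r0 [zr Hr]] := H n I; exists r.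
  rewrite filtrationE; apply: measurableU.
    rewrite (_ : [set w | _] = (fun w => X t w - beta (eps t w)) @^-1` `[0, +oo[%classic); last first.
      by apply/seteqP; split => w /=; rewrite in_itv/= andbT subr_ge0.
    rewrite -[X in measurable X]setTI; apply: measurable_funB => //.
      by apply: mX; rewrite t0 lexx.
    by apply: measurable_filtered_eps; rewrite t0 lexx.
  apply: countType_bigcup_measurable => j _; apply: countType_bigcup_measurable => q /= /andP[q0 qt].
  apply: bigcap_measurableType => n _; apply: countType_bigcup_measurable => r /= /andP[r0 rq].
  apply: measurableI.
    rewrite (_ : [set w | _] = X (ratr r) @^-1` `[beta j - n.+1%:R^-1, +oo[%classic); last first.
      by apply/seteqP; split => w /=; rewrite in_itv/= andbT.
    rewrite -[X in measurable X]setTI; apply: mX => //.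
    by rewrite r0 (le_trans rq qt).
  rewrite -(setCK (\bigcap_(p in _) _)) setC_bigcap; apply: measurableC.
  apply: countType_bigcup_measurable => p /= /andP[rp pq]; apply: measurableC.
  by apply: filtration_eps; rewrite (le_trans r0 rp) (le_trans pq qt).
have nN (D : set Omega) : D `<=` N -> F t D.
  by move=> DN; apply: filtration_negligible; exists N.
have -> : [set w | (tau w <= t%:E)%E] = (A `\` N) `|` ([set w | (tau w <= t%:E)%E] `&` N).
  apply/seteqP; split => w /=.
    have [Nw|Nw] := pselect (N w); first by right.
    have gw : regular_path w by apply: contrapT => bad; apply: Nw; exact: HN.
    by move=> /(tA w gw); left.
  have gw : ~ N w -> regular_path w by move=> Nw; apply: contrapT => bad; apply: Nw; exact: HN.
  by move=> [[Aw /gw g]|[]//]; apply/(tA w g).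
by rewrite filtrationE; apply: measurableU; [apply: measurableD => //; exact: nN|apply: nN => w []].
Qed.

End HittingTime.

(** * The value is attained *)

Section AlmostSureLimit.
Context {R : realType} {d : measure_display} {Omega : measurableType d}.
Variable P : probability Omega R.
Hypothesis complete_P : measure_is_complete P.

Variables (D_ : nat -> Omega -> R) (D : Omega -> R).
Hypothesis mD : forall m, measurable_fun setT (D_ m).
Hypothesis D_cvg : {ae P, forall w, D_ m w @[m --> \oo] --> D w}.

Lemma ae_limit_measurable : measurable_fun setT D.
Proof.
pose G w := fine (limn_einf (fun m => (D_ m w)%:E)).
have mG : measurable_fun setT G.
  apply: measurableT_comp => //; apply: (measurable_fun_limn_einf (f := fun m w => (D_ m w)%:E)).
  by move=> m; exact/measurable_EFinP.
have [N [mN N0 HN]] := D_cvg.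
have GD w : ~ N w -> G w = D w.
  move=> Nw; have c : D_ m w @[m --> \oo] --> D w by apply: contrapT => bad; apply: Nw; exact: HN.
  have c' : (D_ m w)%:E @[m --> \oo] --> (D w)%:E by apply: cvg_EFin => //; exact: nearW.
  by rewrite /G (cvg_limn_einf_sup c').1.
move=> _ U mU; rewrite setTI.
have -> : D @^-1` U = (G @^-1` U `\` N) `|` (D @^-1` U `&` N).
  apply/seteqP; split => w /=.
    by move=> DU; have [Nw|Nw] := pselect (N w); [right|left; rewrite GD].
  by move=> [[+ Nw]|[]//]; rewrite GD.
apply: measurableU; last by apply: complete_P; exists N; split => // w [].
by apply: measurableD => //; rewrite -[X in measurable X]setTI; exact: mG.
Qed.

(** Truncation at [K] permits dominated convergence and costs at most the mean of [Q m], whose bound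
    tends to [r]. The limit inequality therefore holds up to [r], which is made small afterwards. *)
Lemma limit_lower_bound (Q : nat -> Omega -> R) (K r l : R) (e e' : nat -> R) :
  (forall m w, 0 <= D_ m w) -> 0 <= K ->
  (forall m, measurable_fun setT (Q m)) -> (forall m w, 0 <= Q m w) ->
  (forall m, {ae P, forall w, D_ m w <= K + Q m w}) ->
  (forall m, \int[P]_w (Q m w)%:E <= (e m)%:E)%E -> e @ \oo --> r ->
  (forall m, l%:E <= \int[P]_w (D_ m w)%:E + (e' m)%:E)%E -> e' @ \oo --> (0 : R) ->
  (l%:E <= \int[P]_w (D w)%:E + r%:E)%E.
Proof.
move=> D_0 K0 mQ Q0 DQ Qe er De' e'0.
pose T m w := Num.min (D_ m w) K.
have mT m : measurable_fun setT (T m) by apply: measurable_minr.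
have mDl := ae_limit_measurable.
have mQE m : measurable_fun setT (fun w => (Q m w)%:E) by exact/measurable_EFinP.
have mTE m : measurable_fun setT (fun w => (T m w)%:E) by exact/measurable_EFinP.
have T0 m w : 0 <= T m w by rewrite le_min D_0.
have cT : (\int[P]_w (T m w)%:E @[m --> \oo] --> \int[P]_w (Num.min (D w) K)%:E)%E.
  have iK : P.-integrable setT (fun=> K%:E) by exact: finite_measure_integrable_cst.
  have [] // := @dominated_convergence _ _ _ P setT measurableT (fun m w => (T m w)%:E)
    (fun w => (Num.min (D w) K)%:E) (fun=> K%:E) mTE.
  - by apply/measurable_EFinP; exact: measurable_minr.
  - apply: filterS D_cvg => w Dw _; apply: cvg_EFin; first exact: nearW.
    have mc : continuous (fun z : R => Num.min z K).
      apply: (@min_fun_continuous _ R R (fun z => z) (fun=> K)); first by move=> z; exact: cvg_id.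
      by move=> z; exact: cvg_cst.
    exact: (cvg_comp _ _ Dw (mc (D w))).
  - by apply: aeW => w m _; rewrite gee0_abs lee_fin// ge_min lexx orbT.
have step m : (l%:E <= \int[P]_w (T m w)%:E + (e m + e' m)%:E)%E.
  apply: (le_trans (De' m)); rewrite EFinD addeA leeD2r//.
  apply: (le_trans _ (leeD2l _ (Qe m))); rewrite -ge0_integralD//; [|by move=> w _; rewrite lee_fin|by move=> w _; rewrite lee_fin].
  apply: ae_le_integral; apply: filterS (DQ m) => w DKQ _.
  rewrite -EFinD lee_fin /T; have [DK|KD] := leP (D_ m w) K; last by [].
  by rewrite lerDl.
have lim : (\int[P]_w (T m w)%:E + (e m + e' m)%:E @[m --> \oo]
    --> \int[P]_w (Num.min (D w) K)%:E + r%:E)%E.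
  apply: cvgeD cT _; first by rewrite fin_num_adde_defl.
  apply: cvg_EFin; first exact: nearW.
  by rewrite -[X in _ --> X]addr0; exact: cvgD.
apply: (@le_trans _ _ (\int[P]_w (Num.min (D w) K)%:E + r%:E)%E).
  by apply: (cvge_ge _ lim); exact: nearW.
apply: leeD2r => //; apply: le_integral_nonmeas => w _.
by rewrite lee_fin ge_min lexx.
Qed.

End AlmostSureLimit.

Lemma summation_by_parts_le (R : realDomainType) (dd Y q : nat -> R) (K : R) n :
  (forall k, dd k.+1 * (Y k - Y k.+1) <= K * (Y k - Y k.+1) + q k) ->
  \sum_(k < n) dd k.+1 * (Y k - Y k.+1) <= K * (Y 0%N - Y n) + \sum_(k < n) q k.
Proof.
move=> H; elim: n => [|n IH]; first by rewrite !big_ord0 subrr mulr0 addr0.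
rewrite !big_ord_recr/=; apply: (le_trans (lerD IH (H n))).
rewrite le_eqVlt; apply/orP; left; apply/eqP; ring.
Qed.

(* [rho h] is at most [exp (rho h) - 1], so the sum telescopes. *)
Lemma discounted_mesh_sum (R : realType) (rho h : R) n : 0 < rho -> 0 < h ->
  \sum_(k < n) expR (- (rho * (k.+1%:R * h))) * h <= rho^-1.
Proof.
move=> rho0 h0.
have step k : expR (- (rho * (k.+1%:R * h))) * h <=
    rho^-1 * (expR (- (rho * (k%:R * h))) - expR (- (rho * (k.+1%:R * h)))).
  have -> : expR (- (rho * (k%:R * h))) = expR (- (rho * (k.+1%:R * h))) * expR (rho * h).
    by rewrite -expRD; congr expR; rewrite -natr1; ring.
  rewrite -ler_pdivrMl ?invr_gt0// invrK.
  rewrite -[X in _ <= _ - X]mulr1 -mulrBr mulrCA; apply: ler_wpM2l; first exact: expR_ge0.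
  by rewrite lerBrDr addrC expR_ge1Dx// mulr_ge0// ltW.
have sum m : \sum_(k < m) expR (- (rho * (k.+1%:R * h))) * h <=
    rho^-1 * (1 - expR (- (rho * (m%:R * h)))).
  elim: m => [|m IH]; first by rewrite big_ord0 mul0r mulr0 oppr0 expR0 subrr mulr0.
  rewrite big_ord_recr/=; apply: (le_trans (lerD IH (step m))).
  by rewrite -mulrDr addrA subrK.
apply: (le_trans (sum n)); rewrite -[leRHS]mulr1; apply: ler_wpM2l.
  by rewrite invr_ge0 ltW.
by rewrite gerBl expR_ge0.
Qed.

(** * Lower bound for the expected reward at the hitting time *)

Section LowerBound.
Context {R : realType} {d : measure_display} {Omega : measurableType d}.
Variable P : probability Omega R.
Hypothesis complete_P : measure_is_complete P.
Variables (B : R -> Omega -> R) (eps : R -> Omega -> 'I_2) (lambda : 'I_2 -> R).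
Hypothesis lambda_gt0 : forall i, 0 < lambda i.
Hypothesis brownian_B : brownian_motion P B.
Hypothesis chain_eps : markov_chain P eps (generator lambda).
Hypothesis independent_B_eps : independent_processes P B eps.
Local Notation F := (augmented_filtration P B eps).
Local Notation filtered t := (filtered P B eps t).

Let mB t : 0 <= t -> measurable_fun setT (B t).
Proof. by have [+ _ _ _ _] := brownian_B; exact. Qed.

Let meps t j : 0 <= t -> measurable [set w | eps t w = j].
Proof. by have [+ _ _ _] := chain_eps; exact. Qed.

Variables (sigma : 'I_2 -> R) (rho : R) (b : 'I_2 -> R) (v sl : 'I_2 -> R -> R).
Hypotheses (sigma_gt0 : forall i, 0 < sigma i) (rho_gt0 : 0 < rho).
Hypothesis vf : verification sigma lambda rho b v sl.
Variables (x th : R) (X : R -> Omega -> R).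
Hypothesis price_X : price_process P F B eps sigma x X.

Local Notation beta := (fun j => b j + th).
Local Notation tau := (hitting_time eps (fun=> X) beta x).

(** Paths that never hit contribute 0, in agreement with a control that never sells. *)
Definition hit_reward (w : Omega) : R :=
  if tau w is r%:E then expR (- (rho * r)) * (X r w - th) else 0.

Variable i : 'I_2.
Local Notation start_i := (start eps i).
Local Notation h := (@mesh R).
Local Notation n := steps.

Let msi : measurable start_i. Proof. exact: meps. Qed.

Let t0 m k : 0 <= k%:R * h m. Proof. by rewrite mulr_ge0// ltW// mesh_gt0. Qed.

(** The weight of the stopping rule. The inequality is strict, so that a hit at a mesh time counts
    as stopped and a positive weight means that [X] is strictly below its threshold. *)
Let waiting (m k : nat) (w : Omega) : R :=
  \1_start_i w * \1_[set w | ((k%:R * h m)%:E < tau w)%E] w.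

Let waiting0 m k w : 0 <= waiting m k w.
Proof. exact: mulr_ge0. Qed.

Let waiting1 m k w : waiting m k w <= 1.
Proof. by rewrite /waiting !indicE; do 2 case: (_ \in _); rewrite ?mulr0 ?mul0r ?mulr1. Qed.

Let waiting_ni m k w : waiting m k.+1 w <= waiting m k w.
Proof.
apply: ler_wpM2l => //; rewrite !indicE ler_nat.
have [/set_mem/= kt|] := boolP (w \in [set w | (_ < tau w)%E]); last by [].
rewrite mem_set//=; apply: le_lt_trans kt.
by rewrite lee_fin ler_pM2r ?mesh_gt0// ler_nat.
Qed.

Let measurable_waiting m k : measurable_fun [set: filtered (k%:R * h m)] (waiting m k).
Proof.
apply: measurable_funM; apply: measurable_indic.
  by apply: filtration_eps; rewrite lexx t0.
have -> : [set w | ((k%:R * h m)%:E < tau w)%E] = ~` [set w | (tau w <= (k%:R * h m)%:E)%E].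
  by apply/seteqP; split => w /=; rewrite ltNge => /negP.
apply: measurableC; have [_ st] := stopping_time_hitting chain_eps price_X beta.
by rewrite -filtrationE; exact: st.
Qed.

Let waiting_price m k w : waiting m k w != 0 -> X (k%:R * h m) w - th < b (eps (k%:R * h m) w).
Proof.
rewrite /waiting !indicE; case: (boolP (w \in [set w | (_ < tau w)%E])) => [|_]; last by rewrite mulr0 eqxx.
by move=> /set_mem/= /(before_hitting_time (t0 m k)) h _; rewrite ltrBlDr.
Qed.

Let measurable_waitingO m k : measurable_fun [set: Omega] (waiting m k).
Proof. exact: (measurable_filtered complete_P mB meps (@measurable_waiting m k)). Qed.

(* The discounted value at the first mesh point after the hitting time, or at
   the horizon if that comes first, summed by parts. *)
Let stopped (a : R) (m : nat) (w : Omega) : R :=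
  discounted eps rho v a X (h m) 0 w * (\1_start_i w - waiting m 0 w) +
  (liquidated eps rho v a X (h m) (waiting m) (n m) w +
   discounted eps rho v a X (h m) (n m) w * waiting m (n m) w).

Let waiting_start m k w : waiting m k w <= \1_start_i w.
Proof. by rewrite /waiting !indicE; do 2 case: (_ \in _); rewrite ?mulr0 ?mul0r ?mulr1. Qed.

Let stopped_ge0 a m w : 0 <= stopped a m w.
Proof.
have d0 k := discounted_ge0 eps vf a X (h m) k w.
apply: addr_ge0; first by apply: mulr_ge0 => //; rewrite subr_ge0.
by apply: addr_ge0; [exact: (liquidated_ge0 eps vf)|exact: mulr_ge0].
Qed.

Let measurable_discounted a m k : measurable_fun [set: Omega] (discounted eps rho v a X (h m) k).
Proof.
apply: measurable_funM => //.
exact: (measurable_filtered complete_P mB meps (measurable_value vf a price_X (t0 m k))).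
Qed.

Let measurable_liq a m : measurable_fun [set: Omega] (liquidated eps rho v a X (h m) (waiting m) (n m)).
Proof. exact: (measurable_liquidated complete_P brownian_B chain_eps vf a price_X (mesh_gt0 m) (@measurable_waiting m)). Qed.

Let measurable_stopped a m : measurable_fun [set: Omega] (stopped a m).
Proof.
apply: measurable_funD; first by apply: measurable_funM => //; apply: measurable_funB.
by apply: measurable_funD => //; apply: measurable_funM.
Qed.

Let stopped_le del m w : 0 <= del -> stopped (th + del) m w <= stopped th m w.
Proof.
move=> d0; have dd k : discounted eps rho v (th + del) X (h m) k w <= discounted eps rho v th X (h m) k w.
  apply: ler_wpM2l; first exact: expR_ge0.
  by apply: (vf_nd vf); rewrite lerD2l lerN2 lerDl.
apply: lerD; first by apply: ler_wpM2r => //; rewrite subr_ge0.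
apply: lerD; last exact: ler_wpM2r.
by apply: ler_sum => k _; apply: ler_wpM2r => //; rewrite subr_ge0.
Qed.

(* Raising the cost to [th + del] keeps the process at distance [del] from the
   boundary before the hitting time, as [one_step_ge] requires. *)
Let stopped_lower del : 0 < del -> exists C, forall m,
  (((v i (x - th) - del) * fine (P start_i))%:E <= \int[P]_w (stopped th m w)%:E + (C * (m.+1%:R)^-1)%:E)%E.
Proof.
move=> d0; have [C C0 HC] := one_step_ge sigma_gt0 lambda_gt0 rho_gt0 vf d0.
pose err := (lambda reg1 + lambda reg2) * (1 + (sigma reg1 - sigma reg2) ^+ 2) / 2.
exists ((C + err) * 1) => m; rewrite -steps_error.
have Yb k w : waiting m k w != 0 -> X (k%:R * h m) w - (th + del) <= b (eps (k%:R * h m) w) - del.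
  by move=> /waiting_price; rewrite opprD addrA lerD2r => /ltW.
have := liquidated_ge complete_P lambda_gt0 brownian_B chain_eps independent_B_eps
  rho_gt0 vf price_X (mesh_gt0 m) (@measurable_waiting m) (waiting0 m) (waiting1 m) (waiting_ni m)
  (n m) C0 Yb (fun j z => HC j z (h m) (mesh_gt0 m) (mesh_le1 m)).
rewrite -/err => ge.
have PE : P start_i = (fine (P start_i))%:E.
  by rewrite fineK// ge0_fin_numE// (le_lt_trans (probability_le1 P msi))// ltry.
have init := initial_value complete_P lambda_gt0 brownian_B chain_eps independent_B_eps vf (th + del) price_X i ler01.
pose dd k := discounted eps rho v (th + del) X (h m) k.
have dd_ge0 k w : 0 <= dd k w by exact: (discounted_ge0 eps vf).
have m0 : measurable_fun [set: Omega] (fun w => \1_start_i w - waiting m 0 w) by exact: measurable_funB.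
have mdd k : measurable_fun [set: Omega] (dd k) by exact: measurable_discounted.
have split : (\int[P]_w (value eps v (th + del) X 0 w * (1 * \1_start_i w))%:E <=
    \int[P]_w (dd 0%N w * (\1_start_i w - waiting m 0 w))%:E + \int[P]_w (dd 0%N w * waiting m 0 w)%:E)%E.
  apply: integral_leD => //.
  - exact: measurable_funM (mdd 0%N) m0.
  - exact: measurable_funM (mdd 0%N) _.
  - by move=> w _; apply: mulr_ge0 => //; rewrite subr_ge0.
  - by move=> w _; exact: mulr_ge0.
  - move=> w _; rewrite /dd /discounted mul0r mulr0 oppr0 expR0 !mul1r.
    by rewrite -mulrDr subrK.
apply: (@le_trans _ _ ((1 * v i (x - (th + del)))%:E * P start_i)%E).
  rewrite mul1r [in leRHS]PE -EFinM lee_fin; apply: ler_wpM2r; first exact: fine_ge0.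
  have := verification_value_lip vf i (x - th) (x - (th + del)).
  rewrite (_ : x - (th + del) - (x - th) = - del); last by ring.
  rewrite [`|- _|]normrN (gtr0_norm d0) ler_norml => /andP[+ _].
  by rewrite lerBrDl addrC.
rewrite -init; apply: (le_trans split); apply: (le_trans (leeD2l _ ge)).
rewrite addeA leeD2r// -ge0_integralD//.
- by apply: le_integral_nonmeas => w _; rewrite -EFinD lee_fin; exact/stopped_le/ltW.
- by move=> w _; rewrite lee_fin; apply: mulr_ge0 => //; rewrite subr_ge0.
- by apply/measurable_EFinP; exact: measurable_funM (mdd 0%N) m0.
- by move=> w _; rewrite lee_fin; apply: addr_ge0; [exact: (liquidated_ge0 eps vf)|exact: mulr_ge0].
- by apply/measurable_EFinP; apply: measurable_funD => //; exact: measurable_funM (mdd _) _.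
Qed.

Let V0 := v reg1 0 + v reg2 0.
Let bm := b reg1 + b reg2.
Let s := sigma reg1 + sigma reg2.

Let ito_error (m k : nat) (w : Omega) : R :=
  X (k%:R * h m + h m) w - x - (X (k%:R * h m) w - x) -
  sigma (eps (k%:R * h m) w) * (B (k%:R * h m + h m) w - B (k%:R * h m) w).

(* Before the hitting time [X] is below the boundary, so only its last
   increment can make the value large; truncated at [M], that increment is
   dominated by its square over [M]. *)
Let overshoot (M : R) (m k : nat) (w : Omega) : R :=
  `|ito_error m k w| +
  s ^+ 2 / M * expR (- (rho * (k.+1%:R * h m))) * (B (k%:R * h m + h m) w - B (k%:R * h m) w) ^+ 2.

Let regime (j : 'I_2) : j = reg1 \/ j = reg2.
Proof. by case: j => [[|[|//]]] /= ?; [left|right]; exact/val_inj. Qed.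

Let V0_ge j : v j 0 <= V0.
Proof. by have [->|->] := regime j; rewrite ?lerDl ?lerDr (vf_ge0 vf). Qed.

Let bm_ge j : b j <= bm.
Proof. by have [->|->] := regime j; rewrite ?lerDl ?lerDr ltW// (vf_b vf). Qed.

Let s_ge j : sigma j <= s.
Proof. by have [->|->] := regime j; rewrite ?lerDl ?lerDr ltW. Qed.

Let V0_ge0 : 0 <= V0. Proof. by rewrite addr_ge0// (vf_ge0 vf). Qed.
Let bm_ge0 : 0 <= bm. Proof. by rewrite addr_ge0// ltW// (vf_b vf). Qed.
Let s_ge0 : 0 <= s. Proof. by rewrite addr_ge0// ltW. Qed.

Let overshoot_ge0 M m k w : 0 < M -> 0 <= overshoot M m k w.
Proof.
move=> M0; apply: addr_ge0 => //; apply: mulr_ge0 (sqr_ge0 _).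
by apply: mulr_ge0 (expR_ge0 _); rewrite divr_ge0 ?sqr_ge0// ltW.
Qed.

Let value_le_bound j y z : y <= z -> 0 <= z -> v j y <= V0 + z.
Proof.
move=> yz z0; apply: (le_trans (verification_value_bound vf j y)).
by apply: lerD (V0_ge j) _; rewrite ge_max z0.
Qed.

Let discount_le1 t : 0 <= t -> expR (- (rho * t)) <= 1.
Proof. by move=> t_ge0; rewrite -expR0 ler_expR oppr_le0 mulr_ge0// ltW. Qed.

Let discounted_le_value k m w (z : R) : v (eps (k%:R * h m) w) (X (k%:R * h m) w - th) <= z ->
  discounted eps rho v th X (h m) k w <= z.
Proof.
move=> vz; have z0 : 0 <= z by exact: le_trans (vf_ge0 vf _ _) vz.
apply: (@le_trans _ _ (1 * z)); last by rewrite mul1r.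
apply: ler_pM; [exact: expR_ge0|exact: (vf_ge0 vf)| |exact: vz].
exact: discount_le1.
Qed.

Let am_gm (M u : R) : 0 < M -> s * `|u| <= M + s ^+ 2 / M * u ^+ 2.
Proof.
move=> M0; rewrite -[u ^+ 2]real_normK ?num_real//.
have := normr_ge0 u; move: `|u| s_ge0 => z s0 z0; move: s s0 => q q0.
rewrite -(ler_pM2r M0) mulrDl.
have -> : q ^+ 2 / M * z ^+ 2 * M = (q * z) ^+ 2 by field; rewrite gt_eqF.
have := mulr_ge0 q0 z0; move: (q * z) => y y0.
by nra.
Qed.

(** The discount is bounded by 1 everywhere except on the squared increment, where it is kept so
    that the sum over the cells stays bounded. *)
Let discounted_overshoot M m k w : 0 < M -> waiting m k w != 0 ->
  discounted eps rho v th X (h m) k.+1 w <= V0 + bm + M + overshoot M m k w.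
Proof.
move=> M0 /waiting_price Xb; rewrite /discounted /value /overshoot.
have -> : k.+1%:R * h m = k%:R * h m + h m by rewrite -natr1 mulrDl mul1r.
have errE : X (k%:R * h m + h m) w - th = (X (k%:R * h m) w - th) + ito_error m k w +
  sigma (eps (k%:R * h m) w) * (B (k%:R * h m + h m) w - B (k%:R * h m) w).
  by rewrite /ito_error; ring.
have E0 : 0 <= expR (- (rho * (k%:R * h m + h m))) by exact: expR_ge0.
have E1 : expR (- (rho * (k%:R * h m + h m))) <= 1.
  exact: discount_le1 (addr_ge0 (t0 m k) (ltW (mesh_gt0 m))).
have sB : sigma (eps (k%:R * h m) w) * (B (k%:R * h m + h m) w - B (k%:R * h m) w) <=
    M + s ^+ 2 / M * (B (k%:R * h m + h m) w - B (k%:R * h m) w) ^+ 2.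
  apply: le_trans (am_gm _ M0); apply: (@le_trans _ _ (sigma (eps (k%:R * h m) w) * `|B (k%:R * h m + h m) w - B (k%:R * h m) w|)).
    by apply: ler_wpM2l; [exact: ltW|exact: ler_norm].
  exact: ler_wpM2r.
have Q0 : 0 <= s ^+ 2 / M * (B (k%:R * h m + h m) w - B (k%:R * h m) w) ^+ 2.
  by apply: mulr_ge0 (sqr_ge0 _); rewrite divr_ge0 ?sqr_ge0// ltW.
have := @value_le_bound (eps (k%:R * h m + h m) w) (X (k%:R * h m + h m) w - th)
  (bm + `|ito_error m k w| + (M + s ^+ 2 / M * (B (k%:R * h m + h m) w - B (k%:R * h m) w) ^+ 2)).
have ie0 := normr_ge0 (ito_error m k w).
have ie := ler_norm (ito_error m k w).
have bj := bm_ge (eps (k%:R * h m) w).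
rewrite errE.
move: (X (k%:R * h m) w - th) (ito_error m k w) (v (eps (k%:R * h m + h m) w)) ie0 ie bj Xb sB Q0 E0 E1.
move: (s ^+ 2 / M) => g.
move: (expR _) (sigma _ * _) (b (eps _ w)) (_ ^+ 2) => E S bj Q y ie f ie0 iel bjl yb sB gQ E0 E1 H.
move: V0 bm V0_ge0 bm_ge0 bjl H => V b' v0' b0' bjl H.
set val := f _ in H *.
have {}H : val <= V + (b' + `|ie| + (M + g * Q)).
  apply: H; first lra.
  by rewrite !addr_ge0// ltW.
have gE : g * E * Q = E * (g * Q) by ring.
rewrite gE; apply: (@le_trans _ _ (E * (V + (b' + `|ie| + (M + g * Q))))); first exact: ler_wpM2l.
have A0 : 0 <= V + b' + M + `|ie| by rewrite !addr_ge0// ltW.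
have : E * (V + b' + M + `|ie|) <= V + b' + M + `|ie|.
  by rewrite -[leRHS]mul1r; exact: ler_wpM2r.
by move: (g * Q) => u; nra.
Qed.

(** The weights lost over the cells add up to at most 1, so the constant [K] is counted once; each
    overshoot enters with a coefficient at most 1. *)
Let stopped_dominated M m w : 0 < M -> X 0 w = x ->
  stopped th m w <= V0 + bm + M + Num.max 0 (x - th) + \sum_(k < n m) overshoot M m k w.
Proof.
move=> M0 X0; set K := V0 + bm + M + Num.max 0 (x - th).
have mx0 : 0 <= Num.max 0 (x - th) by rewrite le_max lexx.
have K0 : 0 <= K by exact: addr_ge0 (addr_ge0 (addr_ge0 V0_ge0 bm_ge0) (ltW M0)) mx0.
have zero k : waiting m k w = 0 -> waiting m k.+1 w = 0.
  by move=> wk; apply: le_anti; rewrite waiting0 -wk waiting_ni.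
have d0 : discounted eps rho v th X (h m) 0 w <= K.
  apply: discounted_le_value; rewrite mul0r X0.
  apply: (@le_trans _ _ (V0 + Num.max 0 (x - th))); last by rewrite /K lerD2r -addrA lerDl; exact: addr_ge0 bm_ge0 (ltW M0).
  by apply: value_le_bound => //; rewrite le_max lexx orbT.
have dn : discounted eps rho v th X (h m) (n m) w * waiting m (n m) w <= K * waiting m (n m) w.
  have [->|/waiting_price Xb] := eqVneq (waiting m (n m) w) 0; first by rewrite !mulr0.
  apply: ler_wpM2r => //; apply: discounted_le_value.
  apply: (@le_trans _ _ (V0 + bm)); last exact: ler_wpDr mx0 (ler_wpDr (ltW M0) (lexx _)).
  by apply: value_le_bound => //; rewrite (le_trans (ltW Xb)).
have dk : \sum_(k < n m) discounted eps rho v th X (h m) k.+1 w * (waiting m k w - waiting m k.+1 w) <=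
    K * (waiting m 0 w - waiting m (n m) w) + \sum_(k < n m) overshoot M m k w.
  apply: (summation_by_parts_le (dd := fun k => discounted eps rho v th X (h m) k w)
    (Y := fun k => waiting m k w) (q := fun k => overshoot M m k w)) => k.
  have o0 := overshoot_ge0 m k w M0.
  have [wk|wk] := eqVneq (waiting m k w) 0; first by rewrite wk (zero _ wk) subrr !mulr0 add0r.
  have D0 : 0 <= waiting m k w - waiting m k.+1 w by rewrite subr_ge0.
  have D1 : waiting m k w - waiting m k.+1 w <= 1.
    by apply: le_trans (waiting1 m k w); rewrite gerBl.
  have dK : discounted eps rho v th X (h m) k.+1 w <= K + overshoot M m k w.
    by apply: (le_trans (discounted_overshoot M0 wk)); rewrite lerD2r lerDl.
  apply: (le_trans (ler_wpM2r D0 dK)); rewrite mulrDl lerD2l.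
  by rewrite -[leRHS]mulr1; exact: ler_wpM2l.
have s1 : \1_start_i w <= 1 :> R by rewrite indicE; case: (_ \in _).
rewrite /stopped /liquidated.
have e0 : discounted eps rho v th X (h m) 0 w * (\1_start_i w - waiting m 0 w) <= K * (\1_start_i w - waiting m 0 w).
  by apply: ler_wpM2r => //; rewrite subr_ge0.
apply: (le_trans (lerD e0 (lerD dk dn))).
have : K * \1_start_i w <= K by rewrite -[leRHS]mulr1; exact: ler_wpM2l.
by move: (\sum_(k < n m) overshoot M m k w) (\1_start_i w) => S u; lra.
Qed.

Let ito_errorE : R := (lambda reg1 + lambda reg2) * (1 + (sigma reg1 - sigma reg2) ^+ 2) / 2.

Let measurable_ito_error m k : measurable_fun [set: Omega] (ito_error m k).
Proof.
have mX t : 0 <= t -> measurable_fun [set: Omega] (X t).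
  by move=> t_ge0; exact: (measurable_filtered complete_P mB meps (measurable_price price_X t_ge0)).
have u0 := addr_ge0 (t0 m k) (ltW (mesh_gt0 m)).
apply: measurable_funB.
  by apply: measurable_funB; apply: measurable_funB => //; exact: mX.
apply: measurable_funM; last by apply: measurable_funB; exact: mB.
have me : measurable_fun [set: filtered (k%:R * h m)] (fun w => sigma (eps (k%:R * h m) w)).
  by apply: measurable_filtered_eps; rewrite t0 lexx.
exact: (measurable_filtered complete_P mB meps me).
Qed.

Let measurable_increment m k : measurable_fun [set: Omega] (fun w => (B (k%:R * h m + h m) w - B (k%:R * h m) w) ^+ 2).
Proof.
have u0 := addr_ge0 (t0 m k) (ltW (mesh_gt0 m)).
by apply: measurable_funX; apply: measurable_funB; exact: mB.
Qed.

Let measurable_overshoot M m k : measurable_fun [set: Omega] (overshoot M m k).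
Proof.
apply: measurable_funD.
  by apply: measurableT_comp (measurable_ito_error m k).
by apply: measurable_funM.
Qed.

Let increment_square m k : (\int[P]_w ((B (k%:R * h m + h m) w - B (k%:R * h m) w) ^+ 2)%:E = (h m)%:E)%E.
Proof.
have st : k%:R * h m < k%:R * h m + h m by rewrite ltrDl mesh_gt0.
have i1 : P.-integrable [set: Omega] (EFin \o (fun=> 1 : R)) by exact: finite_measure_integrable_cst.
have m1 : measurable_fun [set: filtered (k%:R * h m)] (fun=> 1 : R) by exact: measurable_cst.
have [_] := increment_variance complete_P lambda_gt0 brownian_B chain_eps independent_B_eps (t0 m k) st m1 i1.
under eq_integral do rewrite mul1r.
move=> ->; rewrite integral_cst// mul1e [X in (_ * X)%E]probability_setT mule1.
by rewrite addrC addKr.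
Qed.

Let overshoot_integral M m k : 0 < M ->
  (\int[P]_w (overshoot M m k w)%:E <=
   (ito_errorE * (h m * Num.sqrt (h m)) + s ^+ 2 / M * (expR (- (rho * (k.+1%:R * h m))) * h m))%:E)%E.
Proof.
move=> M0.
have g0 : 0 <= s ^+ 2 / M * expR (- (rho * (k.+1%:R * h m))).
  by apply: mulr_ge0 (expR_ge0 _); rewrite divr_ge0 ?sqr_ge0// ltW.
apply: (@le_trans _ _ (\int[P]_w (`|ito_error m k w|)%:E + \int[P]_w (s ^+ 2 / M *
    expR (- (rho * (k.+1%:R * h m))) * (B (k%:R * h m + h m) w - B (k%:R * h m) w) ^+ 2)%:E)%E).
  apply: integral_leD => //.
  - by apply: measurableT_comp (measurable_ito_error m k).
  - exact: measurable_funM.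
  - by move=> w _; exact: mulr_ge0 g0 (sqr_ge0 _).
rewrite EFinD; apply: leeD.
  exact: (ito_step_error complete_P lambda_gt0 brownian_B chain_eps independent_B_eps price_X (t0 m k) (mesh_gt0 m)).
rewrite (ge0_integralZ P measurableT (measurable_increment m k) g0 (fun w _ => sqr_ge0 _)).
by rewrite increment_square -EFinM -(mulrA _ _ (h m)).
Qed.

(** The Ito errors sum to a multiple of [1 / (m + 1)] by the choice of mesh. The squared increments
    do not vanish with the mesh, but the bound for their discounted sum carries the small factor
    [1 / M]. *)
Let overshoot_sum M m : 0 < M ->
  (\int[P]_w (\sum_(k < n m) overshoot M m k w)%:E <=
   (ito_errorE * (m.+1%:R)^-1 + s ^+ 2 / M * rho^-1)%:E)%E.
Proof.
move=> M0.
have H p : (\int[P]_w (\sum_(k < p) overshoot M m k w)%:E <=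
   (p%:R * (ito_errorE * (h m * Num.sqrt (h m))) +
    s ^+ 2 / M * \sum_(k < p) expR (- (rho * (k.+1%:R * h m))) * h m)%:E)%E.
  elim: p => [|p IH].
    under eq_integral do rewrite big_ord0.
    by rewrite integral0 big_ord0 mul0r mulr0 addr0.
  apply: (@le_trans _ _ (\int[P]_w (\sum_(k < p) overshoot M m k w)%:E + \int[P]_w (overshoot M m p w)%:E)%E).
    apply: integral_leD => //.
    - by apply: measurable_sum => k; exact: measurable_overshoot.
    - by move=> w _; apply: sumr_ge0 => k _; exact: overshoot_ge0.
    - by move=> w _; exact: overshoot_ge0.
    - by move=> w _; rewrite big_ord_recr.
  apply: (le_trans (leeD IH (overshoot_integral m p M0))).
  rewrite -EFinD lee_fin big_ord_recr/= -natr1 le_eqVlt; apply/orP; left; apply/eqP.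
  by move: (\sum_(k < p) _) (expR _) => S E; ring.
apply: (le_trans (H (n m))); rewrite steps_error lee_fin lerD2l.
apply: ler_wpM2l; first by rewrite divr_ge0 ?sqr_ge0// ltW.
by apply: discounted_mesh_sum => //; exact: mesh_gt0.
Qed.

Let waitingE m k w : start_i w -> waiting m k w = ((k%:R * h m)%:E < tau w)%E%:R.
Proof.
by move=> wi; rewrite /waiting !indicE mem_set// mul1r; congr (_%:R); congr nat_of_bool; apply/idP/idP => [/set_mem//|kt]; exact/mem_set.
Qed.

Let stopped_never m w : start_i w -> tau w = +oo%E ->
  stopped th m w = discounted eps rho v th X (h m) (n m) w.
Proof.
move=> wi tE; have wE k : waiting m k w = 1 by rewrite waitingE// tE ltry.
rewrite /stopped /liquidated !wE indicE mem_set// subrr mulr0 add0r mulr1 big1 ?add0r// => k _.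
by rewrite !wE subrr mulr0.
Qed.

Let stopped_cell m k w r : start_i w -> tau w = r%:E -> (k < n m)%N ->
  k%:R * h m < r <= k.+1%:R * h m ->
  stopped th m w = discounted eps rho v th X (h m) k.+1 w.
Proof.
move=> wi tE kn /andP[kr rk].
have wE j : waiting m j w = (j <= k)%N%:R.
  rewrite waitingE// tE lte_fin; congr (_%:R); congr nat_of_bool; apply/idP/idP => [jr|jk].
    rewrite leqNgt; apply/negP => kj; move: (lt_le_trans jr rk).
    by rewrite ltr_pM2r ?mesh_gt0// ltr_nat ltnS leqNgt kj.
  by apply: le_lt_trans kr; rewrite ler_pM2r ?mesh_gt0// ler_nat.
rewrite /stopped /liquidated !wE indicE mem_set// subrr mulr0 add0r leqNgt kn mulr0 addr0.
rewrite (bigD1 (Ordinal kn))//= big1 ?addr0 ?wE ?leqnn ?ltnn ?subr0 ?mulr1//.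
move=> j jk; rewrite !wE; suff -> : (j < k)%N = (j <= k)%N by rewrite subrr mulr0.
have jk' : (j != k :> nat) by apply: contra jk => /eqP jk; exact/eqP/val_inj.
by rewrite ltn_neqAle jk'.
Qed.

Let stopped_initial m w : start_i w -> tau w = 0%:E ->
  stopped th m w = discounted eps rho v th X (h m) 0 w.
Proof.
move=> wi tE; have wE k : waiting m k w = 0 by rewrite waitingE// tE lte_fin ltNge t0.
rewrite /stopped /liquidated !wE indicE mem_set// subr0 !mulr0 mulr1 addr0 big1 ?addr0// => k _.
by rewrite !wE subrr mulr0.
Qed.

Let value_continuous j : continuous (v j).
Proof.
move=> y; apply/cvgrPdist_lt => e e0; near=> z.
apply: (le_lt_trans (verification_value_lip vf j _ _)).
by near: z; exact: cvgr_dist_lt.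
Unshelve. all: by end_near. Qed.

(** Right-continuity is what the limit calls for, since [stopped] is evaluated at the first mesh
    point not before the hitting time. *)
Let value_right_continuous w r e : regular_path eps X w -> 0 <= r -> 0 < e ->
  exists2 del, 0 < del & forall t, r <= t < r + del ->
  `|expR (- (rho * r)) * value eps v th X r w - expR (- (rho * t)) * value eps v th X t w| < e.
Proof.
move=> [rc cX] r0 e0.
have cv : {within `[0, +oo[, continuous (fun t : R => expR (- (rho * t)) * v (eps r w) (X t w - th))}.
  move=> t; apply: cvgM.
    by apply: (continuous_subspaceT (f := fun t : R => expR (- (rho * t)))); exact: continuous_discount.
  have cXt : (fun t : subspace (`[0, +oo[%classic : set R) => X t w - th) s @[s --> t] --> X t w - th.
    by apply: cvgB; [exact: cX|exact: cvg_cst].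
  exact: (cvg_comp _ _ cXt (@value_continuous (eps r w) (X t w - th))).
have [d1 d10 H1] := within_half_line_eps_delta cv r0 e0.
have := rc r r0; rewrite near_withinE => /nbhs_ballP[d2 /= d20 H2].
exists (Num.min d1 d2); first by rewrite lt_min d10.
move=> t /andP[rt]; rewrite -ltrBlDl lt_min => /andP[td1 td2].
have dist z : t - r < z -> `|r - t| < z by rewrite distrC ger0_norm ?subr_ge0.
have Et : eps t w = eps r w.
  move: rt; rewrite le_eqVlt => /predU1P[<-//|rt].
  by apply: H2 => //; exact: dist.
by rewrite /value Et; apply: H1; [exact: le_trans rt|exact: dist].
Qed.

(** At a finite hitting time the process is in the stopping region, where the value is [X - th]. If
    the boundary is never hit, [X] stays below it, the value is bounded, and the discount at the
    growing horizon sends the limit to 0. *)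
Let stopped_cvg : {ae P, forall w, stopped th m w @[m --> \oo] --> \1_start_i w * hit_reward w}.
Proof.
apply: filterS (regular_path_ae chain_eps price_X) => w reg.
have [wi|wi] := pselect (start_i w); last first.
  have wE m k : waiting m k w = 0 by rewrite /waiting indicE memNset// mul0r.
  apply: cvg_near_cst; apply: nearW => m.
  rewrite /stopped /liquidated indicE memNset// !wE subrr !mulr0 mul0r addr0 add0r big1// => k _.
  by rewrite !wE subrr mulr0.
rewrite indicE mem_set// mul1r /hit_reward; have := hitting_time_ge0 eps (fun=> X) beta x w.
case tE : (tau w) => [r| |]// r0.
  have {}r0 : 0 <= r by rewrite -lee_fin.
  have [_ br] := hitting_time_attained reg tE.
  have vE : X r w - th = value eps v th X r w.
    by rewrite /value (vf_eq vf)// lerBrDr.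
  rewrite vE; have [r_eq0|r_gt0] : r = 0 \/ 0 < r by move: r0; rewrite le_eqVlt => /predU1P[]; [left|right].
    apply: cvg_near_cst; apply: nearW => m.
    by rewrite stopped_initial ?tE ?r_eq0// /discounted mul0r.
  apply/cvgrPdist_lt => e e0.
  have [del del0 H] := value_right_continuous reg r0 e0.
  near=> m.
  have g_nd k : k%:R * h m <= k.+1%:R * h m by rewrite ler_pM2r ?mesh_gt0// ler_nat.
  have rn : r <= (n m)%:R * h m.
    by apply: ltW; near: m; have := @horizon_cvg R => /cvgryPgt; apply.
  have [|k kn /andP[kr rk]] := @grid_cell R (fun k => k%:R * h m) (n m) r _ rn.
    by rewrite mul0r.
  rewrite (stopped_cell wi tE kn) ?kr//; apply: H; rewrite rk/=.
  rewrite -natr1 mulrDl mul1r; apply: ltrD => //.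
  by near: m; have := @mesh_cvg R => /cvgr_lt; apply.
under eq_fun do rewrite stopped_never//.
have K0 : 0 <= (V0 + bm) / rho by apply: divr_ge0 (addr_ge0 V0_ge0 bm_ge0) (ltW rho_gt0).
apply: (squeeze_cvgr (f := fun=> 0) (h := fun m => (V0 + bm) / rho * (m.+1%:R)^-1)); last 2 first.
- exact: cvg_cst.
- rewrite -[X in _ --> X](mulr0 ((V0 + bm) / rho)); apply: cvgM; first exact: cvg_cst.
  exact: cvg_harmonic.
apply: nearW => m; rewrite (discounted_ge0 eps vf)/=.
have Xb : X ((n m)%:R * h m) w - th < b (eps ((n m)%:R * h m) w).
  have tn : (((n m)%:R * h m)%:E < tau w)%E by rewrite tE ltry.
  by rewrite ltrBlDr; exact: before_hitting_time (t0 m (n m)) tn.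
have val : value eps v th X ((n m)%:R * h m) w <= V0 + bm.
  by apply: value_le_bound => //; rewrite (le_trans (ltW Xb)).
have ex : expR (- (rho * ((n m)%:R * h m))) <= rho^-1 * (m.+1%:R)^-1.
  rewrite steps_mesh expRN -invfM lef_pV2 ?posrE ?expR_gt0 ?mulr_gt0//.
  by rewrite (le_trans _ (expR_ge1Dx _))// lerDr.
rewrite /discounted -mulrA mulrC; apply: ler_pM => //; exact: (vf_ge0 vf).
Unshelve. all: by end_near. Qed.

Lemma measurable_hit_reward : measurable_fun setT (fun w => \1_start_i w * hit_reward w).
Proof. exact: (ae_limit_measurable complete_P (measurable_stopped th) stopped_cvg). Qed.

Lemma hit_reward_lower :
  ((v i (x - th))%:E * P start_i <= \int[P]_w (\1_start_i w * hit_reward w)%:E)%E.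
Proof.
have PE : P start_i = (fine (P start_i))%:E.
  by rewrite fineK// ge0_fin_numE// (le_lt_trans (probability_le1 P msi))// ltry.
set p := fine _ in PE; set I := (\int[P]_w _)%E.
have p0 : 0 <= p by exact: fine_ge0.
have p1 : p <= 1 by rewrite -lee_fin -PE; exact: probability_le1.
(* [m] tends to infinity first, with the shift [del] and the truncation level [M] fixed; these are
   removed afterwards. *)
have main del M : 0 < del -> 0 < M -> (((v i (x - th) - del) * p)%:E <= I + (s ^+ 2 / M * rho^-1)%:E)%E.
  move=> del0 M0; have [C HC] := stopped_lower del0.
  apply: (limit_lower_bound (D_ := stopped th) complete_P (measurable_stopped th) stopped_cvg
    (Q := fun m w => \sum_(k < n m) overshoot M m k w) (K := V0 + bm + M + Num.max 0 (x - th))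
    (e := fun m => ito_errorE * (m.+1%:R)^-1 + s ^+ 2 / M * rho^-1) (e' := fun m => C * (m.+1%:R)^-1)).
  - exact: stopped_ge0.
  - by apply: addr_ge0; [exact: addr_ge0 (addr_ge0 V0_ge0 bm_ge0) (ltW M0)|rewrite le_max lexx].
  - by move=> m; apply: measurable_sum => k; exact: measurable_overshoot.
  - by move=> m w; apply: sumr_ge0 => k _; exact: overshoot_ge0.
  - move=> m; have X0 := price_initial complete_P lambda_gt0 brownian_B chain_eps independent_B_eps price_X.
    by apply: filterS X0 => w; exact: stopped_dominated.
  - by move=> m; exact: overshoot_sum.
  - rewrite -[X in _ --> X]add0r; apply: cvgD; last exact: cvg_cst.
    rewrite -[X in _ --> X](mulr0 ito_errorE); apply: cvgM; first exact: cvg_cst.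
    exact: cvg_harmonic.
  - exact: HC.
  - rewrite -[X in _ --> X](mulr0 C); apply: cvgM; first exact: cvg_cst.
    exact: cvg_harmonic.
rewrite PE -EFinM; apply/lee_addgt0Pr => e e0.
have e2 : 0 < e / 2 by rewrite divr_gt0.
(* Large enough for the overshoot to contribute at most [e / 2]; the shift [del = e / 2] accounts
   for the other half. *)
pose M := (s ^+ 2 + 1) * rho^-1 / (e / 2).
have s2 : 0 <= s ^+ 2 by exact: sqr_ge0.
have M0 : 0 < M by rewrite /M divr_gt0// mulr_gt0 ?invr_gt0// ltr_wpDl.
have ME : s ^+ 2 / M * rho^-1 <= e / 2.
  rewrite -(ler_pM2r M0) mulrAC divfK ?gt_eqF// /M mulrCA divff ?gt_eqF// mulr1.
  by apply: ler_wpM2r; rewrite ?invr_ge0 ?(ltW rho_gt0)// lerDl.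
have := main _ _ e2 M0; move: I {main} => [I| |]; last 2 first.
- by move=> _; rewrite addye// leey.
- by rewrite addNye leeNy_eq.
rewrite -!EFinD !lee_fin => H; rewrite (_ : v i (x - th) * p = (v i (x - th) - e / 2) * p + e / 2 * p); last by ring.
have : e / 2 * p <= e / 2 by rewrite -[leRHS]mulr1; apply: ler_wpM2l => //; exact: ltW.
by move: (e / 2 * p) (s ^+ 2 / M * rho^-1) ((_ - _) * p) ME H => u1 u2 u3 ME H H2; lra.
Qed.

End LowerBound.

(** The exponential is split into three equal factors, each at most [(rho * T / 3)^-1]. *)
Lemma discounted_square (R : realType) (rho T : R) : 0 < rho -> 0 < T ->
  expR (- (rho * T)) * T ^+ 2 <= (3 / rho) ^+ 3 * T^-1.
Proof.
move=> rho0 T0; have q0 : 0 < rho * T / 3 by rewrite divr_gt0// mulr_gt0.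
have e3 : expR (- (rho * T)) = expR (- (rho * T / 3)) ^+ 3.
  by rewrite -expRM_natl; congr expR; field.
have le : expR (- (rho * T / 3)) <= (rho * T / 3)^-1.
  rewrite expRN lef_pV2 ?posrE ?expR_gt0//.
  by rewrite (le_trans _ (expR_ge1Dx _))// lerDr.
have le3 : expR (- (rho * T / 3)) ^+ 3 <= ((rho * T / 3)^-1) ^+ 3.
  by rewrite lerXn2r// nnegrE ?expR_ge0// invr_ge0 ltW.
rewrite e3; apply: (le_trans (ler_wpM2r (sqr_ge0 T) le3)).
rewrite le_eqVlt; apply/orP; left; apply/eqP; field.
by rewrite !gt_eqF.
Qed.

(** * Payoff of the hitting rule and its finite truncations *)

Section StoppingRule.
Context {R : realType} {d : measure_display} {Omega : measurableType d}.
Variable P : probability Omega R.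
Hypothesis complete_P : measure_is_complete P.
Variables (B : R -> Omega -> R) (eps : R -> Omega -> 'I_2) (lambda : 'I_2 -> R).
Hypothesis lambda_gt0 : forall i, 0 < lambda i.
Hypothesis brownian_B : brownian_motion P B.
Hypothesis chain_eps : markov_chain P eps (generator lambda).
Hypothesis independent_B_eps : independent_processes P B eps.
Local Notation F := (augmented_filtration P B eps).
Local Notation filtered t := (filtered P B eps t).

Let mB t : 0 <= t -> measurable_fun setT (B t).
Proof. by have [+ _ _ _ _] := brownian_B; exact. Qed.

Let meps t j : 0 <= t -> measurable [set w | eps t w = j].
Proof. by have [+ _ _ _] := chain_eps; exact. Qed.

Variables (sigma : 'I_2 -> R) (rho : R) (b : 'I_2 -> R) (v sl : 'I_2 -> R -> R).
Hypotheses (sigma_gt0 : forall i, 0 < sigma i) (rho_gt0 : 0 < rho).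
Hypothesis vf : verification sigma lambda rho b v sl.
Variables (x th : R) (X : R -> Omega -> R).
Hypothesis price_X : price_process P F B eps sigma x X.

Local Notation beta := (fun j => b j + th).
Local Notation tau := (hitting_time eps (fun=> X) beta x).
Variable i : 'I_2.
Local Notation start_i := (start eps i).
Local Notation hit w := (\1_start_i w * hit_reward eps rho b x th X w).
Hypothesis P0 : (0 < P start_i)%E.

Let msi : measurable start_i. Proof. exact: meps. Qed.

Let mhit : measurable_fun setT (fun w => hit w).
Proof. exact: (measurable_hit_reward complete_P brownian_B chain_eps rho_gt0 vf th price_X i). Qed.

Let stau := stopping_time_hitting chain_eps price_X beta.

Let hit_ge0 : {ae P, forall w, 0 <= hit_reward eps rho b x th X w}.
Proof.
apply: filterS (regular_path_ae chain_eps price_X) => w reg; rewrite /hit_reward.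
case tE : (tau w) => [r| |]//.
have [_ br] := hitting_time_attained reg tE.
apply: mulr_ge0; first exact: expR_ge0.
rewrite subr_ge0; apply: le_trans br; rewrite lerDr.
by rewrite ltW// (vf_b vf).
Qed.

(** The reward is dominated by the majorant [U] of the control that sells one unit at the hitting
    time. *)
Lemma integrable_hit_reward : P.-integrable setT (fun w => (hit w)%:E).
Proof.
have nu_adm : admissible P F 1 (jump_control ler01 stau.1).
  split; first exact: adapted_jump_control.
  by apply: aeW => w t t0; rewrite /= /jump_path subr_ge0; case: ifP.
have [U [mU U0 HU IU]] := control_reward complete_P lambda_gt0 brownian_B chain_eps independent_B_eps
  sigma_gt0 rho_gt0 vf th price_X i ler01 nu_adm.
apply/integrableP; split; first exact/measurable_EFinP.
apply: (@le_lt_trans _ _ (\int[P]_w U w)%E); last first.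
  by apply: (le_lt_trans IU); rewrite lte_mul_pinfty ?lee_fin ?mulr_ge0 ?(vf_ge0 vf)// (le_lt_trans (probability_le1 P msi))// ltry.
apply: ae_le_integral; apply: filterS2 HU hit_ge0 => w HUw h0 _.
have [wi|wi] := pselect (start_i w); last by rewrite indicE memNset// mul0r abse0.
rewrite indicE mem_set// mul1r gee0_abs ?lee_fin//; move: h0; rewrite /hit_reward.
case tE : (tau w) => [r| |]//= _.
apply: le_trans (HUw wi).
have tf : tau w \is a fin_num by rewrite tE.
have := jump_path_integral ler01 stau.1 (fun t => reward rho th X t w) tf.
rewrite /stieltjes_integral mul1r => ->.
rewrite tE lee_fin; apply: ler_wpM2l; first exact: expR_ge0.
by rewrite le_max lexx orbT.
Qed.

Let integral_start (g : Omega -> R) :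
  (\int[P]_(w in start_i) (\1_start_i w * g w)%:E = \int[P]_w (\1_start_i w * g w)%:E)%E.
Proof.
rewrite integral_mkcond; apply: eq_integral => w _; rewrite patchE.
by case: ifPn => // wi; rewrite indicE (negbTE wi) mul0r.
Qed.

Lemma payoff_hitting_ge (f : R -> R) (c y : R) (y_gt0 : 0 < y) :
  c = th + rho^-1 * (f y / y) -> 0 <= f y -> f 0 = 0 ->
  ((y * v i (x - th) - rho^-1 * f y)%:E <=
   payoff P eps (fun=> X) rho c f x y i (hitting_control eps (fun=> X) (ltW y_gt0) beta x))%E.
Proof.
move=> cE fy0 f0; apply: cond_expectation_ge => //.
have E : {in start_i, (fun w => stieltjes_integral (hitting_control eps (fun=> X) (ltW y_gt0) beta x) w
     (fun t => expR (- (rho * t)) * (X t w - c))%R -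
     \int[lebesgue_measure]_(t in `[0%R, +oo[) (expR (- (rho * t)) *
        f (y - hitting_control eps (fun=> X) (ltW y_gt0) beta x t w))%:E)%E =1
   fun w => (y%:E * (hit w)%:E - (rho^-1 * f y)%:E)%E}.
  move=> w wi; rewrite (jump_path_payoff rho_gt0 (ltW y_gt0) _ w (X^~ w) cE y_gt0 fy0 f0).
  by rewrite -EFinM -EFinB; congr (_ * _ - _)%:E; rewrite indicE wi mul1r.
rewrite (eq_integral _ _ E).
have ih := integrable_hit_reward.
have ih' : P.-integrable start_i (fun w => (hit w)%:E) by exact: integrableS ih.
rewrite integralB//; [|exact: integrableZl|exact: finite_measure_integrable_cst].
rewrite integralZl// integral_start integral_cst//.
have PF : P start_i \is a fin_num by rewrite ge0_fin_numE// (le_lt_trans (probability_le1 P msi))// ltry.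
rewrite EFinB muleBl//; apply: leeB => //.
rewrite EFinM -muleA; apply: lee_wpmul2l; first by rewrite lee_fin ltW.
exact: (hit_reward_lower complete_P lambda_gt0 brownian_B chain_eps independent_B_eps sigma_gt0 rho_gt0 vf th price_X i).
Qed.

(** A single application of [ito_step_error] over the whole of [[0, T]] is crude but sufficient,
    since polynomial growth is beaten by the discount. *)
Lemma price_moment : exists C, forall T, 1 <= T ->
  (\int[P]_w (`|X T w - th|)%:E <= (C * T ^+ 2)%:E)%E.
Proof.
pose e := (lambda reg1 + lambda reg2) * (1 + (sigma reg1 - sigma reg2) ^+ 2) / 2.
have e0 : 0 <= e by rewrite divr_ge0// mulr_ge0 ?addr_ge0 ?sqr_ge0// ltW.
pose s := sigma reg1 + sigma reg2.
have s0 : 0 <= s by rewrite addr_ge0// ltW.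
exists (`|x - th| + 1 + s ^+ 2 + e) => T T1.
have T0 : 0 < T by exact: lt_le_trans T1.
have mX t : 0 <= t -> measurable_fun [set: Omega] (X t).
  by move=> t_ge0; exact: (measurable_filtered complete_P mB meps (measurable_price price_X t_ge0)).
pose Z w := X (0 + T) w - x - (X 0 w - x) - sigma (eps 0 w) * (B (0 + T) w - B 0 w).
pose D w := B (0 + T) w - B 0 w.
have mD : measurable_fun setT D by apply: measurable_funB; apply: mB; rewrite ?add0r// ltW.
have mZ : measurable_fun setT Z.
  apply: measurable_funB; first by apply: measurable_funB; apply: measurable_funB => //; apply: mX; rewrite ?add0r// ltW.
  apply: measurable_funM => //.
  have me : measurable_fun [set: filtered 0] (fun w => sigma (eps 0 w)).
    by apply: measurable_filtered_eps; rewrite lexx.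
  exact: (measurable_filtered complete_P mB meps me).
have dom : (\int[P]_w (`|X T w - th|)%:E <=
    \int[P]_w ((`|x - th| + 1 + s ^+ 2 * D w ^+ 2) + `|Z w|)%:E)%E.
  apply: ae_le_integral.
  have := price_initial complete_P lambda_gt0 brownian_B chain_eps independent_B_eps price_X.
  apply: filterS => w X0 _; rewrite lee_fin.
  have -> : X T w - th = (x - th) + sigma (eps 0 w) * D w + Z w by rewrite /Z /D add0r X0; ring.
  apply: (le_trans (ler_normD _ _)); apply: lerD => //.
  apply: (le_trans (ler_normD _ _)); rewrite -addrA lerD2l normrM.
  have sj : `|sigma (eps 0 w)| <= s.
    rewrite gtr0_norm// /s; case: (eps 0 w) => [[|[|//]]] ?.
      by rewrite (_ : Ordinal _ = reg1) ?lerDl ?ltW//; exact/val_inj.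
    by rewrite (_ : Ordinal _ = reg2) ?lerDr ?ltW//; exact/val_inj.
  apply: (le_trans (ler_wpM2r (normr_ge0 _) sj)).
  rewrite -[D w ^+ 2]real_normK ?num_real// -exprMn.
  by move: (s * `|D w|) => q; have := sqr_ge0 (q - 1); have := sqr_ge0 q; nra.
apply: (le_trans dom).
apply: (@le_trans _ _ (\int[P]_w (`|x - th| + 1 + s ^+ 2 * D w ^+ 2)%:E + \int[P]_w (`|Z w|)%:E)%E).
  apply: integral_leD => //.
  - by apply: measurable_funD => //; apply: measurable_funM => //; exact: measurable_funX.
  - exact: measurableT_comp.
  - by move=> w _; rewrite !addr_ge0// mulr_ge0 ?sqr_ge0.
have i2 : (\int[P]_w (`|x - th| + 1 + s ^+ 2 * D w ^+ 2)%:E <= (`|x - th| + 1 + s ^+ 2 * T)%:E)%E.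
  apply: (@le_trans _ _ (\int[P]_w (`|x - th| + 1)%:E + \int[P]_w (s ^+ 2 * D w ^+ 2)%:E)%E).
    apply: integral_leD => //.
    - by apply: measurable_funM => //; exact: measurable_funX.
    - by move=> w _; rewrite mulr_ge0 ?sqr_ge0.
  rewrite integral_cst// [X in (_ * X + _)%E]probability_setT mule1 [leRHS]EFinD; apply: leeD2l.
  rewrite ge0_integralZ//; last 3 first.
  - exact: measurable_funX.
  - exact: sqr_ge0.
  - by move=> w _; exact: sqr_ge0.
  have i1 : P.-integrable [set: Omega] (EFin \o (fun=> 1 : R)) by exact: finite_measure_integrable_cst.
  have m1 : measurable_fun [set: filtered (0 : R)] (fun=> 1 : R) by exact: measurable_cst.
  have st : 0 < 0 + T by rewrite add0r.
  have [_] := increment_variance complete_P lambda_gt0 brownian_B chain_eps independent_B_eps (lexx 0) st m1 i1.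
  under [X in X = _ -> _]eq_integral do rewrite mul1r.
  move=> ->; rewrite integral_cst// mul1e [X in (_ * (_ * X))%E]probability_setT mule1.
  by rewrite subr0 add0r -EFinM.
have i3 := ito_step_error complete_P lambda_gt0 brownian_B chain_eps independent_B_eps price_X (lexx 0) T0.
apply: (le_trans (leeD i2 i3)); rewrite -EFinD lee_fin -/e.
have sT : Num.sqrt T <= T.
  have TT : T <= T ^+ 2 by rewrite expr2 ler_peMl// ltW.
  by have := ler_wsqrtr TT; rewrite sqrtr_sqr gtr0_norm.
have q1 : 1 <= T ^+ 2 by rewrite exprn_ege1.
have q2 : T <= T ^+ 2 by rewrite expr2 ler_peMl// ltW.
have q3 : T * Num.sqrt T <= T ^+ 2 by rewrite expr2; apply: ler_wpM2l => //; exact: ltW.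
rewrite !mulrDl; apply: lerD; last exact: ler_wpM2l.
apply: lerD; last by apply: ler_wpM2l => //; exact: sqr_ge0.
by apply: lerD; [rewrite ler_peMr|rewrite mul1r].
Qed.

Let horizon_hit T : 0 <= T -> measurable_fun setT (fun w => hit w * \1_[set w | (tau w <= T%:E)%E] w).
Proof.
move=> T0; apply: measurable_funM => //; apply: measurable_indic.
by apply: (filtration_measurable complete_P mB meps); exact: stau.2.
Qed.

(** Only almost surely finite times compete in the stopping problem, so the hitting time is
    truncated at [m + 1] instead of being shown finite. On paths not yet stopped the reward at the
    horizon may be negative; its absolute size [E m] tends to 0 in mean. *)
Lemma stopping_value_ge : exists tau_ : nat -> Omega -> \bar R,
  (forall m, finite_stopping_time P F eps i (tau_ m)) /\
  ((v i (x - th))%:E <= ereal_sup (range (fun m => cond_expectation P start_i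
     (fun w => (expR (- (rho * fine (tau_ m w))) * (X (fine (tau_ m w)) w - th))%:E))))%E.
Proof.
pose N m : R := m.+1%:R.
have N1 m : 1 <= N m by rewrite ler1n.
have N0 m : 0 <= N m by [].
pose tau_ m w := mine (tau w) (N m)%:E.
have fin m w : tau_ m w \is a fin_num.
  rewrite ge0_fin_numE; first by rewrite /tau_ gt_min ltry orbT.
  by rewrite /tau_ le_min hitting_time_ge0 lee_fin N0.
exists tau_; split.
  move=> m; split; last by apply: aeW => w _; rewrite -ge0_fin_numE// /tau_ le_min hitting_time_ge0 lee_fin N0.
  split=> [w|t t_ge0]; first by rewrite /tau_ le_min hitting_time_ge0 lee_fin N0.
  have -> : [set w | (tau_ m w <= t%:E)%E] = [set w | (tau w <= t%:E)%E] `|` (if N m <= t then setT else set0).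
    apply/seteqP; split => w /=; rewrite /tau_ ge_min lee_fin.
      by move=> /orP[|Nt]; [left|right; rewrite Nt].
    by move=> [->//|]; case: ifP => // _ _; rewrite orbT.
  rewrite filtrationE; apply: measurableU; first exact: stau.2.
  by case: ifP.
set S := ereal_sup _.
have [C HC] := price_moment.
pose A m w := hit w * \1_[set w | (tau w <= (N m)%:E)%E] w.
pose E m w := expR (- (rho * N m)) * `|X (N m) w - th|.
have mX m : measurable_fun [set: Omega] (X (N m)).
  exact: (measurable_filtered complete_P mB meps (measurable_price price_X (N0 m))).
have mE m : measurable_fun setT (E m).
  apply: measurable_funM => //; apply: measurableT_comp => //; exact: measurable_funB.
have E0 m w : 0 <= E m w by exact: mulr_ge0 (expR_ge0 _) (normr_ge0 _).
have IE m : (\int[P]_w (E m w)%:E <= ((3 / rho) ^+ 3 * C * (N m)^-1)%:E)%E.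
  have C0 : 0 <= C.
    have /le_trans/(_ (HC 1 (lexx 1))) : (0 <= \int[P]_w (`|X 1%R w - th|)%:E)%E by apply: integral_ge0 => w _; rewrite lee_fin.
    by rewrite lee_fin expr1n mulr1.
  rewrite ge0_integralZ ?expR_ge0//; last first.
    by apply: measurableT_comp => //; exact: measurable_funB.
  apply: (le_trans (lee_wpmul2l _ (HC _ (N1 m)))); first by rewrite lee_fin expR_ge0.
  rewrite -EFinM lee_fin mulrCA (mulrC _ C) -mulrA; apply: ler_wpM2l => //.
  by apply: discounted_square => //; exact: lt_le_trans (N1 m).
have iE m : P.-integrable setT (fun w => (E m w)%:E).
  apply/integrableP; split; first exact/measurable_EFinP.
  under eq_integral do rewrite gee0_abs ?lee_fin//.
  by apply: (le_lt_trans (IE m)); rewrite ltry.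
have ih := integrable_hit_reward.
have mA m : measurable_fun setT (fun w => (A m w)%:E) by apply/measurable_EFinP; exact: horizon_hit.
have A_le m w : (`|(A m w)%:E| <= `|(hit w)%:E|)%E.
  rewrite /A /= lee_fin normrM ler_piMr// indicE; case: (_ \in _); rewrite ?normr1 ?normr0//.
have iA m : P.-integrable setT (fun w => (A m w)%:E).
  by apply: (le_integrable _ _ _ ih) => // w _; exact: A_le.
have cA : (\int[P]_w (A m w)%:E @[m --> \oo] --> \int[P]_w (hit w)%:E)%E.
  have [] // := @dominated_convergence _ _ _ P setT measurableT (fun m w => (A m w)%:E)
    (fun w => (hit w)%:E) (fun w => `|(hit w)%:E|%E) mA.
  - exact/measurable_EFinP.
  - apply: aeW => w _; apply: cvg_near_cst; rewrite /A.
    have := hitting_time_ge0 eps (fun=> X) beta x w; case tE : (tau w) => [r| |]// _; last first.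
      by apply: nearW => m; rewrite /hit_reward tE mulr0 mul0r.
    near=> m; rewrite [X in _ * X]indicE mem_set ?mulr1//= tE lee_fin.
    rewrite (le_trans (ler_norm r))// (le_trans (ltW (archi_boundP (normr_ge0 r))))//.
    by rewrite ler_nat ltnW// ltnS; near: m; exact: nbhs_infty_ge.
  - exact: integrable_abse.
  - by apply: aeW => w m _; exact: A_le.
have PF : P start_i \is a fin_num by rewrite ge0_fin_numE// (le_lt_trans (probability_le1 P msi))// ltry.
have key m : (\int[P]_w (A m w)%:E - ((3 / rho) ^+ 3 * C * (N m)^-1)%:E <= S * P start_i)%E.
  apply: (@le_trans _ _ (\int[P]_(w in start_i) (expR (- (rho * fine (tau_ m w))) * (X (fine (tau_ m w)) w - th))%:E)%E); last first.
    rewrite -[leLHS]mule1 -[X in (_ * X)%E](_ : ((fine (P start_i))^-1%:E * P start_i)%E = 1%E); last first.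
      rewrite -[X in (_ * X)%E](fineK PF) -EFinM mulVf// gt_eqF//.
      by rewrite fine_gt0// P0/= -ge0_fin_numE.
    rewrite muleA; apply: lee_wpmul2r => //.
    by apply: ereal_sup_ubound; exists m.
  apply: (@le_trans _ _ (\int[P]_(w in start_i) ((A m w)%:E - (E m w)%:E))%E).
    rewrite integralB//; [|exact: integrableS (iA m)|exact: integrableS (iE m)].
    apply: leeB; last first.
      apply: le_trans (IE m); apply: ge0_subset_integral => //; first exact/measurable_EFinP.
      by move=> w _; rewrite lee_fin.
    rewrite le_eqVlt; apply/orP; left; apply/eqP.
    by rewrite /A; under [LHS]eq_integral do rewrite -mulrA; under [RHS]eq_integral do rewrite -mulrA; rewrite integral_start.
  apply: le_integral_nonmeas => w wi; rewrite -EFinB lee_fin /A /E /tau_ indicE mem_set// mul1r.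
  have := hitting_time_ge0 eps (fun=> X) beta x w; rewrite /hit_reward.
  case tE : (tau w) => [r| |]// _; rewrite indicE.
    have [rN|Nr] := leP r (N m).
      rewrite mem_set /= ?tE ?lee_fin// mulr1 /mine lte_fin.
      rewrite (_ : fine _ = r); last by case: ltgtP rN => // ->.
      by rewrite gerBl mulr_ge0 ?expR_ge0.
    rewrite memNset /= ?tE ?lee_fin -?ltNge//; last by apply/negP; rewrite -ltNge.
    rewrite /mine lte_fin ltNge (ltW Nr)/= mulr0 sub0r -mulrN; apply: ler_wpM2l; first exact: expR_ge0.
    by rewrite lerNl -normrN ler_norm.
  rewrite mul0r sub0r -mulrN min_r ?leey//=; apply: ler_wpM2l; first exact: expR_ge0.
  by rewrite lerNl -normrN ler_norm.
have lower := hit_reward_lower complete_P lambda_gt0 brownian_B chain_eps independent_B_eps sigma_gt0 rho_gt0 vf th price_X i.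
have lim : (\int[P]_w (A m w)%:E - ((3 / rho) ^+ 3 * C * (N m)^-1)%:E @[m --> \oo] --> \int[P]_w (hit w)%:E - 0)%E.
  apply: cvgeB => //; first by rewrite fin_num_adde_defl.
  apply: cvg_EFin; first exact: nearW.
  rewrite -[X in _ --> X](mulr0 ((3 / rho) ^+ 3 * C)); apply: cvgM; first exact: cvg_cst.
  exact: cvg_harmonic.
have : ((v i (x - th))%:E * P start_i <= S * P start_i)%E.
  apply: (le_trans lower); rewrite -[leLHS]sube0; apply: (cvge_le _ lim); exact: nearW.
by rewrite lee_pmul2r.
Unshelve. all: by end_near. Qed.

End StoppingRule.

(** * The control problem *)

Lemma threshold_verification (R : realType) (sigma lambda : 'I_2 -> R) (rho z1 z2 : R) :
  0 < sigma reg1 -> sigma reg1 <= sigma reg2 -> (forall i, 0 < lambda i) -> 0 < rho ->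
  (sigma reg1 < sigma reg2 -> free_boundary_solution sigma lambda rho z1 z2) ->
  exists b w s, verification sigma lambda rho b w s /\
    forall th, threshold sigma rho z1 z2 th = (fun j => b j + th).
Proof.
move=> s1 s12 l0 r0 zs.
have regime (j : 'I_2) : j = reg1 \/ j = reg2.
  by case: j => [[|[|//]]] /= ?; [left|right]; exact/val_inj.
have s0 i : 0 < sigma i by have [->|->] := regime i => //; exact: lt_le_trans s12.
have [lt12|ge12] := ltP (sigma reg1) (sigma reg2).
  have [a3 [a4 [zh [[a30 a34 r3 r4] _ [z10 /andP[z20 _]] e1 e2]]]] := zs lt12.
  have [w [s vf]] := verification_two_regimes s0 l0 r0 a30 a34 r3 r4 z10 z20 e1 e2.
  exists (fun i => if i == reg1 then z1 else z2 + z1), w, s; split=> // th.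
  by apply/funext => j; rewrite /threshold lt12; case: ifP => // _; rewrite addrA.
have sE i : sigma i = sigma reg1.
  by have [->|->] := regime i => //; apply: le_anti; rewrite s12 ge12.
have [w [s vf]] := verification_equal_volatilities s1 sE l0 r0.
exists (fun=> sigma reg1 / Num.sqrt (2 * rho)), w, s; split=> // th.
by apply/funext => j; rewrite /threshold ltNge ge12.
Qed.

(** Concavity between 0, where [f] vanishes, and [y], at the convex weight [z / y]. *)
Lemma concave_running_cost_chord (R : realType) (f : R -> R) (y z : R) :
  concave_running_cost f -> 0 < y <= 1 -> 0 <= z <= y -> f y / y * z <= f z.
Proof.
move=> [_ _ f0 conc _] /andP[y0 y1] /andP[z0 zy].
have tz : 0 <= z / y <= 1 by rewrite divr_ge0 ?(ltW y0)//= ler_pdivrMr// mul1r.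
have h0 : `[0, 1]%classic (0 : R) by rewrite /= in_itv/= lexx ler01.
have hy : `[0, 1]%classic y by rewrite /= in_itv/= y1 ltW.
have := conc y 0 (z / y) hy h0 tz; rewrite f0 !mulr0 !addr0 divfK ?gt_eqF//.
by rewrite (_ : z / y * f y = f y / y * z)//; ring.
Qed.

(** Admissible controls vanish almost surely, so every payoff is 0; the control that never jumps
    shows that the supremum is not over an empty set. *)
Lemma control_value0 (R : realType) d (Omega : measurableType d) (P : probability Omega R)
    (F : R -> set (set Omega)) eps X rho c f x i :
  (forall t, 0 <= t -> F t set0 /\ F t setT) -> f 0 = 0 ->
  control_value P F eps X rho c f x 0 i = 0%E.
Proof.
move=> F0 f0.
have zero nu : admissible P F 0 nu -> payoff P eps X rho c f x 0 i nu = 0%E.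
  move=> [_ nu0]; rewrite /payoff /cond_expectation.
  rewrite (_ : (\int[P]_(w in _) _)%E = 0%E) ?mul0e//.
  transitivity (\int[P]_(w in start eps i) 0%E)%E; last exact: integral0.
  apply: ae_eq_integral_nonmeas; apply: filterS nu0 => w nuw _.
  have {}nuw t : 0 <= t -> nu t w = 0.
    by move=> t0; apply: le_anti; rewrite ctl_ge0// andbT -oppr_ge0 -[leRHS]add0r nuw.
  rewrite stieltjes_integral_null// integral0_eq ?sub0e ?oppe0// => t /=.
  by rewrite in_itv/= andbT => t0; rewrite nuw// subrr f0 mulr0.
have never0 : forall w : Omega, (0 <= +oo :> \bar R)%E by [].
have adm : admissible P F 0 (jump_control (lexx 0) never0).
  have nu0 t w : jump_control (lexx 0) never0 t w = 0 by rewrite /= /jump_path leey.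
  split; last by apply: aeW => w t _; rewrite nu0 subrr.
  move=> t t0 U mU; have [F1 F2] := F0 t t0.
  rewrite (_ : jump_control (lexx 0) never0 t = cst 0); last by apply/funext => w; exact: nu0.
  by rewrite preimage_cst; case: ifP.
rewrite /control_value (_ : [set _ | _ in _] = [set 0%E]) ?ereal_sup1//.
apply/seteqP; split => [_ [nu nuA <-]|_ ->]; first exact: zero.
by exists (jump_control (lexx 0) never0) => //; exact: zero.
Qed.

Theorem theorem4p6 (R : realType) (d : measure_display)
  (Omega : measurableType d) (P : probability Omega R)
  (complete_P : measure_is_complete P)
  (sigma lambda : 'I_2 -> R) (rho c : R)
  (sigma1_gt0 : 0 < sigma reg1) (sigma12 : sigma reg1 <= sigma reg2)
  (lambda_gt0 : forall i, 0 < lambda i) (rho_gt0 : 0 < rho) (c_gt0 : 0 < c)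
  (B : R -> Omega -> R) (brownian_B : brownian_motion P B)
  (eps : R -> Omega -> 'I_2)
  (chain_eps : markov_chain P eps (generator lambda))
  (independent_B_eps : independent_processes P B eps)
  (X : R -> R -> Omega -> R)
  (price_X : forall x : R,
     price_process P (augmented_filtration P B eps) B eps sigma x (X x))
  (f : R -> R) (f_cost : concave_running_cost f)
  (z1 z2 : R)
  (z_sol : sigma reg1 < sigma reg2 ->
     free_boundary_solution sigma lambda rho z1 z2) :
  let F := augmented_filtration P B eps in
  let J := payoff P eps X rho c f in
  let V := control_value P F eps X rho c f in
  let W := candidate P F eps X rho c f in
  forall (x : R) (i : 'I_2), (0 < P (start eps i))%E ->
  [/\ forall (y : R) (y_gt0 : 0 < y), y <= 1 ->
        let nu_star := hitting_control eps X (ltW y_gt0)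
          (threshold sigma rho z1 z2 (theta rho c f y)) x in
        admissible P F y nu_star /\ V x y i = J x y i nu_star,
      W x y i @[y --> 0^'+] --> 0%E
    & forall y : R, 0 <= y <= 1 -> W x y i = V x y i].
Proof.
move=> F J V W x i P0.
have [[f_ge0 _] f_cont f0 _ _] := f_cost.
have s_gt0 (j : 'I_2) : 0 < sigma j.
  case: j => [[|[|//]]] j.
    by rewrite (_ : Ordinal _ = reg1)//; exact/val_inj.
  by rewrite (_ : Ordinal _ = reg2) ?(lt_le_trans sigma1_gt0)//; exact/val_inj.
have [b [v [s [vf thE]]]] := threshold_verification sigma1_gt0 sigma12 lambda_gt0 rho_gt0 z_sol.
pose val y := y * v i (x - theta rho c f y) - rho^-1 * f y.
have thetaE y : c = theta rho c f y + rho^-1 * (f y / y) by rewrite subrK.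
have payoff_ub y nu : 0 < y <= 1 -> admissible P F y nu -> (J x y i nu <= (val y)%:E)%E.
  move=> /andP[y0 y1] adm.
  apply: (payoff_le complete_P lambda_gt0 brownian_B chain_eps independent_B_eps s_gt0 rho_gt0 vf
    (price_X x) P0 (thetaE y) y0 (f_ge0 y) _ adm) => z.
  by apply: concave_running_cost_chord; rewrite ?y0.
have star y (y0 : 0 < y) : y <= 1 ->
    let nu_star := hitting_control eps X (ltW y0) (threshold sigma rho z1 z2 (theta rho c f y)) x in
    admissible P F y nu_star /\ J x y i nu_star = (val y)%:E.
  move=> y1; rewrite thE => nu_star.
  have adm : admissible P F y nu_star.
    split.
      apply: adapted_jump_control.
      exact: (stopping_time_hitting chain_eps (price_X x)).
    apply: aeW => w t _; rewrite /nu_star /= /jump_path; case: ifP => _; last by rewrite subrr.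
    by rewrite subr0 ltW.
  split=> //; apply: le_anti; rewrite payoff_ub ?y0//=.
  exact: (payoff_hitting_ge complete_P lambda_gt0 brownian_B chain_eps independent_B_eps s_gt0 rho_gt0
    vf (price_X x) P0 y0 (thetaE y) (f_ge0 y) f0).
have VE y : 0 < y <= 1 -> V x y i = (val y)%:E.
  move=> /andP[y0 y1]; apply: le_anti; apply/andP; split.
    by apply: ge_ereal_sup => _ [nu adm <-]; apply: payoff_ub; rewrite ?y0.
  by have [adm <-] := star y y0 y1; apply: ereal_sup_ubound; exists (hitting_control eps X (ltW y0) (threshold sigma rho z1 z2 (theta rho c f y)) x).
have stopE y : stopping_value P F eps X rho c f x i y = (v i (x - theta rho c f y))%:E.
  apply: le_anti; apply/andP; split.
    apply: ge_ereal_sup => _ [tau st <-].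
    exact: (stopping_payoff_le complete_P lambda_gt0 brownian_B chain_eps independent_B_eps s_gt0 rho_gt0
      vf _ (price_X x) P0 st).
  have [tau [st ge]] := stopping_value_ge complete_P lambda_gt0 brownian_B chain_eps independent_B_eps
    s_gt0 rho_gt0 vf (theta rho c f y) (price_X x) P0.
  apply: (le_trans ge); apply: ge_ereal_sup => _ [m _ <-].
  by apply: ereal_sup_ubound; exists (tau m).
have posE y : candidate_pos P F eps X rho c f x y i = (val y)%:E.
  by rewrite /candidate_pos stopE -EFinM -EFinB.
have WE y : 0 < y -> W x y i = (val y)%:E.
  by move=> y0; rewrite /W /candidate gt_eqF.
(* [theta] may tend to minus infinity as [y] decreases to 0, since [f y / y] can blow up; but
   [y * theta] equals [y * c - rho^-1 * f y] and does vanish, and the linear growth of [v] makes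
   that enough. *)
have val0 : val y @[y --> 0^'+] --> 0.
  have id0 : y @[y --> 0^'+] --> (0 : R) by exact/cvg_at_right_filter/cvg_id.
  have fcv : f y @[y --> 0^'+] --> 0.
    by have /(continuous_within_itvP _ ltr01)[_ + _] := f_cont; rewrite f0.
  pose K := v i 0 + `|x| + c.
  apply/norm_cvg0P.
  apply: (squeeze_cvgr (f := fun=> 0) (h := fun y => y * K + 2 * rho^-1 * f y)); last 2 first.
  - exact: cvg_cst.
  - rewrite -[X in _ --> X]addr0; apply: cvgD.
      by rewrite -[X in _ --> X](mul0r K); apply: cvgM => //; exact: cvg_cst.
    by rewrite -[X in _ --> X](mulr0 (2 * rho^-1)); apply: cvgM => //; exact: cvg_cst.
  near=> y; have y0 : 0 < y by near: y; exact: nbhs_right_gt.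
  rewrite normr_ge0/=.
  have v0 := vf_ge0 vf i (x - theta rho c f y).
  have vb := verification_value_bound vf i (x - theta rho c f y).
  have yth : y * theta rho c f y = y * c - rho^-1 * f y.
    by rewrite /theta; field; rewrite !gt_eqF.
  have rf : 0 <= rho^-1 * f y by rewrite mulr_ge0// invr_ge0 ltW.
  have bd : y * v i (x - theta rho c f y) <= y * K + rho^-1 * f y.
    apply: (le_trans (ler_wpM2l (ltW y0) vb)).
    rewrite /K; have := ler_norm x; have := normr_ge0 x; have := vf_ge0 vf i 0.
    move: (v i 0) (`|x|) yth rf; move: (theta _ _ _ _) (rho^-1 * f y) => t r v' nx yth rf v'0 nx0 xn.
    have [h|h] := leP 0 (x - t); rewrite ?addr0.
      have : y * (v' + (x - t)) = y * v' + y * x - y * t by ring.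
      have : y * x <= y * nx by rewrite ler_pM2l.
      have := mulr_ge0 (ltW y0) (ltW c_gt0).
      by rewrite yth !mulrDr; lra.
    have := mulr_ge0 (ltW y0) (ltW c_gt0); have := mulr_ge0 (ltW y0) nx0.
    by rewrite !mulrDr; lra.
  rewrite ler_norml; apply/andP; split.
    rewrite lerNl opprB /val; have := mulr_ge0 (ltW y0) v0.
    have : 0 <= y * K by rewrite mulr_ge0 ?(ltW y0)// !addr_ge0 ?(vf_ge0 vf) ?(ltW c_gt0).
    move: (y * K) (y * v _ _) rf bd; rewrite -mulrA; move: (rho^-1 * f y) => r u1 u2; lra.
  rewrite /val -mulrA; move: (y * K) (y * v _ _) (rho^-1 * f y) rf bd => u1 u2 r; lra.
have cvgE g : (forall y, 0 < y -> g y = (val y)%:E) -> g y @[y --> 0^'+] --> 0%E.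
  move=> gE; apply: (@cvg_trans _ ((val y)%:E @[y --> 0^'+])); last first.
    by apply: cvg_EFin => //; exact: nearW.
  apply: near_eq_cvg; near=> y; rewrite gE//; near: y; exact: nbhs_right_gt.
split.
- move=> y y0 y1; have [adm JE] := star y y0 y1.
  by split=> //; rewrite VE ?y0// JE.
- by apply: cvgE.
- move=> y /andP[]; rewrite le_eqVlt => /predU1P[<- _|y0 y1]; last by rewrite WE// VE// y0.
  rewrite /V control_value0//; last first.
    by move=> t _; rewrite /F; split; rewrite filtrationE.
  rewrite /W /candidate eqxx; apply/cvg_lim => //; apply: cvgE => y' _; exact: posE.
Unshelve. all: by end_near. Qed.
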